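(* Let $M$ be a nonempty functionally open subset of $\mathbb R^{\omega_1}$. Then $\mathrm{mpcc}(M)$ is homeomorphic to $M$.
   Context: A subset $U$ of a topological space $X$ is functionally open if $U=f^{-1}((0,1])$ for some continuous $f\colon X\to[0,1]$. For a cardinal $\tau$, $x,y\in\mathbb R^\tau$ and $\lambda\in\mathbb R_{\max}=\mathbb R\cup\{-\infty\}$, $x\oplus y$ denotes the coordinatewise maximum and $\lambda\odot x$ the vector obtained by adding $\lambda$ to every coordinate. A subset $A\subset\mathbb R^\tau$ is max-plus convex if $\alpha\odot a\oplus\beta\odot b\in A$ for all $a,b\in A$ and $\alpha,\beta\in\mathbb R_{\max}$ with $\max(\alpha,\beta)=0$. $\mathrm{mpcc}(\mathbb R^{\omega_1})$ is the set of nonempty compact max-plus convex subsets of $\mathbb R^{\omega_1}$ (Tychonov product topology) with the Vietoris topology, and $\mathrm{mpcc}(M)=\{A\in\mathrm{mpcc}(\mathbb R^{\omega_1}): A\subset M\}$ with the subspace topology. *)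

(* Defs.v *)
From Stdlib Require Import Reals List.
Open Scope R_scope.

Definition continuous {X Y : Type} (tX : (X -> Prop) -> Prop) (tY : (Y -> Prop) -> Prop)
  (f : X -> Y) : Prop :=
  forall V : Y -> Prop, tY V -> tX (fun x => V (f x)).

Definition homeomorphic {X Y : Type} (tX : (X -> Prop) -> Prop) (tY : (Y -> Prop) -> Prop) : Prop :=
  exists (f : X -> Y) (g : Y -> X),
    continuous tX tY f /\ continuous tY tX g /\
    (forall x, g (f x) = x) /\ (forall y, f (g y) = y).

Definition subspace_top {X : Type} (tX : (X -> Prop) -> Prop) (P : X -> Prop)
  : ({x : X | P x} -> Prop) -> Prop :=
  fun V => exists U : X -> Prop, tX U /\ forall p : {x : X | P x}, V p <-> U (proj1_sig p).

Definition generated_top {X : Type} (S : (X -> Prop) -> Prop) : (X -> Prop) -> Prop :=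
  fun W => forall x, W x ->
    exists l : list (X -> Prop),
      (forall B, In B l -> S B) /\ (forall B, In B l -> B x) /\
      (forall y, (forall B, In B l -> B y) -> W y).

Definition compact_set {X : Type} (tX : (X -> Prop) -> Prop) (A : X -> Prop) : Prop :=
  forall (J : Type) (U : J -> X -> Prop),
    (forall j, tX (U j)) ->
    (forall x, A x -> exists j, U j x) ->
    exists l : list J, forall x, A x -> exists j, In j l /\ U j x.

(* Vietoris topology on subsets of X: subbase <U>^+ = {A | A ⊆ U}, <U>^- = {A | A ∩ U ≠ ∅}
   for U open in X. (Its trace on any family of subsets is the Vietoris topology of that family.) *)
Definition vietoris_top {X : Type} (tX : (X -> Prop) -> Prop) : ((X -> Prop) -> Prop) -> Prop :=
  generated_top (fun W : (X -> Prop) -> Prop =>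
    exists U : X -> Prop, tX U /\
      ((forall A, W A <-> (forall x, A x -> U x)) \/
       (forall A, W A <-> (exists x, A x /\ U x)))).

Definition R_top : (R -> Prop) -> Prop :=
  fun U => forall x, U x -> exists eps, eps > 0 /\ forall y, Rabs (y - x) < eps -> U y.

Definition product_top (I : Type) : ((I -> R) -> Prop) -> Prop :=
  fun U => forall x, U x -> exists (F : list I) (eps : R), eps > 0 /\
    forall y, (forall i, In i F -> Rabs (y i - x i) < eps) -> U y.

Definition functionally_open (I : Type) (U : (I -> R) -> Prop) : Prop :=
  exists f : (I -> R) -> R,
    continuous (product_top I) R_top f /\
    (forall x, 0 <= f x <= 1) /\
    (forall x, U x <-> (0 < f x /\ f x <= 1)).

Definition countable (T : Type) : Prop :=
  exists f : T -> nat, forall a b, f a = f b -> a = b.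

Definition is_omega1 (I : Type) (lt : I -> I -> Prop) : Prop :=
  (forall i, ~ lt i i) /\
  (forall i j k, lt i j -> lt j k -> lt i k) /\
  (forall i j, lt i j \/ i = j \/ lt j i) /\
  well_founded lt /\
  ~ countable I /\
  (forall i, countable {j : I | lt j i}).

(* R_max = R ∪ {-∞}, with None = -∞ *)
Definition Rmaxplus := option R.

Definition emax (a b : Rmaxplus) : Rmaxplus :=
  match a, b with
  | None, _ => b
  | _, None => a
  | Some x, Some y => Some (Rmax x y)
  end.

Definition odot (l : Rmaxplus) (t : R) : Rmaxplus :=
  match l with None => None | Some a => Some (a + t) end.

Definition mp_comb {I : Type} (al : Rmaxplus) (a : I -> R) (be : Rmaxplus) (b : I -> R)
  : I -> Rmaxplus := fun i => emax (odot al (a i)) (odot be (b i)).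

Definition maxplus_convex {I : Type} (A : (I -> R) -> Prop) : Prop :=
  forall a b, A a -> A b ->
  forall al be : Rmaxplus, emax al be = Some 0 ->
    exists y, A y /\ forall i, mp_comb al a be b i = Some (y i).

Definition mpcc (I : Type) (M : (I -> R) -> Prop) (A : (I -> R) -> Prop) : Prop :=
  (exists x, A x) /\ compact_set (product_top I) A /\ maxplus_convex A /\
  (forall x, A x -> M x).

(* Main.v *)
Require Import Defs.
From Stdlib Require Import Reals Arith List Lra Lia Classical ClassicalEpsilon.
From Stdlib Require Import FunctionalExtensionality PropExtensionality Cantor.
From Corelib Require Import ssreflect.
From mathcomp Require classical.filter.
Open Scope R_scope.
Set SsrOldRewriteGoalsOrder.
Open Scope general_if_scope.

(** Writing a compact max-plus convex set as [x + ln A] with [x] its greatest point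
    identifies mpcc(M) with pairs [(x, A)], where [A] is a closed set of functions with
    values in (0,1], bounded below, containing 1 and stable under max-times
    combinations, and [x + ln A] lies in [M].  Since [M] depends only on the coordinates
    below some [i0], it suffices to factor out of the space of these [A] first the
    coordinates below [i0] (over [x]), then one coordinate at a time, transfinitely:
    each step is a bundle which becomes trivial after multiplication by R^omega, and
    R^omega_1 provides a factor R^omega for each step.

    The triviality is an infinite shift.  Let the fibres be complete and suppose that a
    point [b] can be recovered up to [O(eta n)] from the finitely many numbers
    [S n m b], by a continuous decoding map [c n].  To [(b, v)], with [v] rapidly
    decreasing in R^omega, associate [u n = S n b + v n - S n b_n], where [b_n] decodes
    the approximate values [S (n - 1) b + v (n - 1)].  Then [u] is again rapidly
    decreasing, and [(b, v)] is recovered from [u] because [b] is the limit of the [b_n].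
    Here [S n m] is the distance to the [m]-th of finitely many continuous sections of
    the bundle, and [c n] is a max-times mixture of these sections. *)

(** Three obstacles shape the construction. Rapid decrease is not an open condition in R^omega and
    its constants are not locally bounded there, while continuity of the shift needs local bounds;
    so every sequence carries majorants, and these pairs again form a copy of R^omega. Without lower
    bounds the fibres are not complete; the bounds are adjoined as further data ranging over
    half-lines, which R^omega absorbs. Finally, the condition that [x + ln A] lies in [M] cuts out
    only a part of the fibre; with one more adjoined half-line datum, a slope, that part becomes a
    closed retract of the fibre, and the shift works in retracts as well.

    In the transfinite product the forward map treats all stages at once, because each stage only
    sees a projection of [A]. The inverse is a recursion along omega_1 in which compactness
    identifies a set with the coherent system of its projections, so initial, successor and limit
    stages are the same. Every stage involves countably many coordinates, hence has a metric, while
    the whole space has none; this is why convergence is tested along arbitrary filters. *)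

Lemma choice_fun {A B : Type} (P : A -> B -> Prop) :
  (forall a, exists b, P a b) -> exists f, forall a, P a (f a).
Proof.
move=> h; exists (fun a => proj1_sig (constructive_indefinite_description _ (h a))) => a.
exact: (proj2_sig (constructive_indefinite_description _ (h a))).
Qed.

(** The default [b0] fills the indices outside [D], so that choices can be made over a list or an
    initial range of indices. *)
Lemma choice_on {A B : Type} (b0 : B) (D : A -> Prop) (P : A -> B -> Prop) :
  (forall a, D a -> exists b, P a b) -> exists f, forall a, D a -> P a (f a).
Proof.
move=> h; apply: (choice_fun (fun a b => D a -> P a b)) => a.
case: (classic (D a)) => [/h [b hb]|hn]; first by exists b.
by exists b0.
Qed.

Ltac rmx := unfold Rmax, Rmin, Rabs in *;
  repeat (match goal with
  | |- context [Rle_dec ?a ?b] => destruct (Rle_dec a b)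
  | |- context [Rcase_abs ?a] => destruct (Rcase_abs a)
  | H : context [Rle_dec ?a ?b] |- _ => destruct (Rle_dec a b)
  | H : context [Rcase_abs ?a] |- _ => destruct (Rcase_abs a)
  end); try lra.

Lemma Rmax_dist a b c d e : Rabs (a - c) <= e -> Rabs (b - d) <= e ->
  Rabs (Rmax a b - Rmax c d) <= e.
Proof. move=> h1 h2; rmx. Qed.

Lemma Rmin_dist a b c d e : Rabs (a - c) <= e -> Rabs (b - d) <= e ->
  Rabs (Rmin a b - Rmin c d) <= e.
Proof. move=> h1 h2; rmx. Qed.

Lemma Rle_eps a b : (forall e, 0 < e -> a <= b + e) -> a <= b.
Proof.
move=> h; apply: Rnot_lt_le => h1; have := h ((a - b) / 2) ltac:(lra); lra.
Qed.

Lemma Rmul_maxk k a b : 0 <= k -> k * Rmax a b = Rmax (k * a) (k * b).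
Proof. move=> h; symmetry; exact: RmaxRmult. Qed.

Lemma Rabs_mulk k a : 0 <= k -> Rabs (k * a) = k * Rabs a.
Proof. by move=> h; rewrite Rabs_mult (Rabs_pos_eq k h). Qed.

Definition clamp (t : R) := Rmax 0 (Rmin 1 t).

Lemma clamp01 t : 0 <= clamp t <= 1.
Proof. rewrite /clamp; rmx. Qed.
Lemma clamp_dist s t e : Rabs (s - t) <= e -> Rabs (clamp s - clamp t) <= e.
Proof. rewrite /clamp => h; rmx. Qed.
Lemma clamp_1 t : 1 <= t -> clamp t = 1.
Proof. rewrite /clamp => h; rmx. Qed.
Lemma clamp_pos t : 0 < clamp t -> 0 < t.
Proof. rewrite /clamp => h; rmx. Qed.

(** * Suprema of sets of reals *)

(** Total by choice; it is meaningful for nonempty sets that are bounded above. *)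
Definition supr (E : R -> Prop) : R := epsilon (inhabits 0) (is_lub E).

Lemma supr_lub E b : (exists x, E x) -> (forall x, E x -> x <= b) -> is_lub E (supr E).
Proof.
move=> h1 h2; apply: epsilon_spec.
have [|m hm] := completeness E _ h1; first by exists b => x; exact: h2.
by exists m.
Qed.

Lemma supr_ub E b x : (forall x, E x -> x <= b) -> E x -> x <= supr E.
Proof.
by move=> h2 h3; have [h _] := supr_lub E b (ex_intro _ x h3) h2; exact: h.
Qed.

Lemma supr_le E b : (exists x, E x) -> (forall x, E x -> x <= b) -> supr E <= b.
Proof. by move=> h1 h2; have [_ h] := supr_lub E b h1 h2; exact: h. Qed.

Lemma supr_approx E b c : (exists x, E x) -> (forall x, E x -> x <= b) -> c < supr E ->
  exists x, E x /\ c < x.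
Proof.
move=> h1 h2 h3; apply: NNPP => h4.
have : supr E <= c; last by lra.
apply: supr_le => // x hx; apply: Rnot_lt_le => h5; apply: h4; by exists x.
Qed.

Definition infr (E : R -> Prop) : R := - supr (fun x => E (- x)).

Lemma infr_lb E b x : (forall x, E x -> b <= x) -> E x -> infr E <= x.
Proof.
move=> h2 h3; rewrite /infr.
have := supr_ub (fun x => E (- x)) (- b) (- x); rewrite Ropp_involutive => h.
have := h _ h3; have : forall y, E (- y) -> y <= - b by move=> y /h2; lra.
by move=> h4 /(_ h4); lra.
Qed.

Lemma infr_ge E b : (exists x, E x) -> (forall x, E x -> b <= x) -> b <= infr E.
Proof.
move=> [x hx] h2; rewrite /infr.
have : supr (fun x => E (- x)) <= - b; last by lra.
apply: supr_le; first by exists (- x); rewrite Ropp_involutive.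
by move=> y /h2; lra.
Qed.

Lemma infr_approx E b c : (exists x, E x) -> (forall x, E x -> b <= x) -> infr E < c ->
  exists x, E x /\ x < c.
Proof.
move=> h1 h2 h3; apply: NNPP => h4.
have : c <= infr E; last by lra.
apply: infr_ge => // x hx; apply: Rnot_lt_le => h5; apply: h4; by exists x.
Qed.

(** * Finite maxima *)

(** The initial value 0 makes it a genuine maximum for nonnegative families, with value 0 on the
    empty list. *)
Definition lmx {A : Type} (f : A -> R) (l : list A) : R :=
  fold_right (fun x r => Rmax (f x) r) 0 l.

Lemma lmx_ge0 {A} (f : A -> R) l : 0 <= lmx f l.
Proof. elim: l => [|x l ih] /=; [lra | exact: Rle_trans ih (Rmax_r _ _)]. Qed.

Lemma lmx_le {A} (f : A -> R) l c : 0 <= c -> (forall x, In x l -> f x <= c) -> lmx f l <= c.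
Proof.
move=> hc; elim: l => [|x l ih] h //=.
by apply: Rmax_lub; [apply: h; left | apply: ih => y hy; apply: h; right].
Qed.

Lemma lmx_lt {A} (f : A -> R) l c : 0 < c -> (forall x, In x l -> f x < c) -> lmx f l < c.
Proof.
move=> hc; elim: l => [|x l ih] h //=.
by apply: Rmax_lub_lt; [apply: h; left | apply: ih => y hy; apply: h; right].
Qed.

Lemma lmx_ub {A} (f : A -> R) l x : In x l -> f x <= lmx f l.
Proof.
elim: l => [|y l ih] //= [->|/ih h]; first exact: Rmax_l.
exact: Rle_trans h (Rmax_r _ _).
Qed.

(** The factor [k] is later a coordinate weight [w i]; carrying it along avoids a division by
    weights that may vanish. *)
Lemma lmx_distk {A} (f g : A -> R) l k e : 0 <= k -> 0 <= e ->
  (forall x, In x l -> k * Rabs (f x - g x) <= e) -> k * Rabs (lmx f l - lmx g l) <= e.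
Proof.
move=> hk he; elim: l => [|x l ih] h /=.
  by rewrite Rminus_diag Rabs_R0; lra.
rewrite -Rabs_mulk // Rmult_minus_distr_l !Rmul_maxk //; apply: Rmax_dist.
  by rewrite -Rmult_minus_distr_l Rabs_mulk //; apply: h; left.
by rewrite -Rmult_minus_distr_l Rabs_mulk //; apply: ih => y hy; apply: h; right.
Qed.

Lemma lmx_dist {A} (f g : A -> R) l e : 0 <= e ->
  (forall x, In x l -> Rabs (f x - g x) <= e) -> Rabs (lmx f l - lmx g l) <= e.
Proof.
move=> he h; have := lmx_distk f g l 1 e; rewrite !Rmult_1_l; apply=> //; first lra.
by move=> x hx; rewrite Rmult_1_l; exact: h.
Qed.

Lemma lmx_ext {A} (f g : A -> R) l : (forall x, In x l -> f x = g x) -> lmx f l = lmx g l.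
Proof.
elim: l => [|x l ih] h //=; rewrite (h x (or_introl eq_refl)).
by rewrite ih // => y hy; apply: h; right.
Qed.

Lemma lmx_map {A B} (f : B -> R) (g : A -> B) l : lmx f (map g l) = lmx (fun x => f (g x)) l.
Proof. by elim: l => [|x l ih] //=; rewrite ih. Qed.

Lemma lmx_app {A} (f : A -> R) l1 l2 : lmx f (l1 ++ l2) = Rmax (lmx f l1) (lmx f l2).
Proof.
elim: l1 => [|x l ih] /=; first by rewrite Rmax_right //; exact: lmx_ge0.
by rewrite ih Rmax_assoc.
Qed.

Lemma lmx_scale {A} (f : A -> R) l k : 0 <= k -> k * lmx f l = lmx (fun x => k * f x) l.
Proof.
move=> hk; elim: l => [|x l ih] /=; first by rewrite Rmult_0_r.
by rewrite Rmul_maxk // ih.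
Qed.

Lemma lmx_max {A} (f g : A -> R) l : Rmax (lmx f l) (lmx g l) = lmx (fun x => Rmax (f x) (g x)) l.
Proof.
elim: l => [|x l ih] /=; first by rewrite Rmax_left; lra.
rewrite -ih; move: (lmx f l) (lmx g l) (f x) (g x) => a b c d; rmx.
Qed.

(** The max-times form of a partition of unity. *)
Lemma lmx_unit {A} (p : A -> R) l a : 0 <= a -> (forall x, In x l -> 0 <= p x <= 1) ->
  (exists x, In x l /\ p x = 1) -> lmx (fun x => p x * a) l = a.
Proof.
move=> ha h [x [h1 h2]]; apply: Rle_antisym.
  by apply: lmx_le => // y hy; have [h3 h4] := h _ hy; nra.
by have := lmx_ub (fun x => p x * a) l x h1; rewrite h2; lra.
Qed.

(** * Convergence along filters *)

Definition filt {N : Type} (F : (N -> Prop) -> Prop) : Prop :=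
  F (fun _ => True) /\ (forall P Q, F P -> F Q -> F (fun m => P m /\ Q m)) /\
  (forall P Q : N -> Prop, (forall m, P m -> Q m) -> F P -> F Q).

Lemma filtT {N} (F : (N -> Prop) -> Prop) (P : N -> Prop) : filt F -> (forall m, P m) -> F P.
Proof. by move=> [h1 [_ h3]] h; exact: (h3 _ _ (fun m _ => h m) h1). Qed.

Lemma filt1 {N} {F : (N -> Prop) -> Prop} {P : N -> Prop} (Q : N -> Prop) : filt F -> F Q -> (forall m, Q m -> P m) -> F P.
Proof. by move=> [h1 [_ h3]] h h4; exact: (h3 _ _ h4 h). Qed.

Lemma filt2 {N} {F : (N -> Prop) -> Prop} {P : N -> Prop} (Q1 Q2 : N -> Prop) : filt F -> F Q1 -> F Q2 ->
  (forall m, Q1 m -> Q2 m -> P m) -> F P.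
Proof.
move=> [h1 [h2 h3]] h4 h5 h6; apply: (h3 (fun m => Q1 m /\ Q2 m) _ _ (h2 _ _ h4 h5)).
by move=> m []; exact: h6.
Qed.

Lemma filt_list {N A} (F : (N -> Prop) -> Prop) (l : list A) (P : A -> N -> Prop) : filt F ->
  (forall x, In x l -> F (P x)) -> F (fun m => forall x, In x l -> P x m).
Proof.
move=> hF; elim: l => [|x l ih] h; first by apply: filtT.
apply: (filt2 _ _ hF (h x (or_introl eq_refl)) (ih (fun y hy => h y (or_intror hy)))).
by move=> m h1 h2 y [<-|hy] //; exact: h2.
Qed.

Definition tends {N : Type} (F : (N -> Prop) -> Prop) (f : N -> R) (l : R) : Prop :=
  forall e, 0 < e -> F (fun m => Rabs (f m - l) <= e).

Section Tends.
Context {N : Type} (F : (N -> Prop) -> Prop) (hF : filt F).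

Lemma tends_const c : tends F (fun _ => c) c.
Proof. by move=> e he; apply: filtT => // m; rewrite Rminus_diag Rabs_R0; lra. Qed.

Lemma tends_ext f g l : (forall m, f m = g m) -> tends F f l -> tends F g l.
Proof. by move=> h h1 e he; apply: (filt1 _ hF (h1 e he)) => m; rewrite h. Qed.

Lemma tends_lip2 (g : R -> R -> R) f1 f2 l1 l2 K : 0 < K ->
  (forall a b c d e, Rabs (a - c) <= e -> Rabs (b - d) <= e -> Rabs (g a b - g c d) <= K * e) ->
  tends F f1 l1 -> tends F f2 l2 -> tends F (fun m => g (f1 m) (f2 m)) (g l1 l2).
Proof.
move=> hK hg h1 h2 e he.
have hp : 0 < e / K by apply: Rdiv_lt_0_compat.
apply: (filt2 _ _ hF (h1 _ hp) (h2 _ hp)) => m h3 h4.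
have := hg _ _ _ _ _ h3 h4; have -> : K * (e / K) = e by field; lra.
by [].
Qed.

Lemma tends_plus f1 f2 l1 l2 : tends F f1 l1 -> tends F f2 l2 ->
  tends F (fun m => f1 m + f2 m) (l1 + l2).
Proof. apply: (tends_lip2 Rplus _ _ _ _ 2); first lra. move=> a b c d e; rmx. Qed.

Lemma tends_minus f1 f2 l1 l2 : tends F f1 l1 -> tends F f2 l2 ->
  tends F (fun m => f1 m - f2 m) (l1 - l2).
Proof. apply: (tends_lip2 Rminus _ _ _ _ 2); first lra. move=> a b c d e; rmx. Qed.

Lemma tends_max f1 f2 l1 l2 : tends F f1 l1 -> tends F f2 l2 ->
  tends F (fun m => Rmax (f1 m) (f2 m)) (Rmax l1 l2).
Proof. apply: (tends_lip2 Rmax _ _ _ _ 1); first lra. move=> a b c d e h1 h2; rewrite Rmult_1_l; exact: Rmax_dist. Qed.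

Lemma tends_min f1 f2 l1 l2 : tends F f1 l1 -> tends F f2 l2 ->
  tends F (fun m => Rmin (f1 m) (f2 m)) (Rmin l1 l2).
Proof. apply: (tends_lip2 Rmin _ _ _ _ 1); first lra. move=> a b c d e h1 h2; rewrite Rmult_1_l; exact: Rmin_dist. Qed.

Lemma tends_cont (g : R -> R) f l : continuity_pt g l -> tends F f l ->
  tends F (fun m => g (f m)) (g l).
Proof.
move=> hg hf e he; have [d [hd h]] := hg e he.
have hd2 : 0 < d / 2 by lra.
apply: (filt1 _ hF (hf _ hd2)) => m h1.
case: (Req_dec (f m) l) => [->|hne]; first by rewrite Rminus_diag Rabs_R0; lra.
apply: Rlt_le; apply: (h (f m)); split; last by rewrite /= /Rdist; lra.
by split => // h2; apply: hne.
Qed.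

Lemma tends_mult f1 f2 l1 l2 : tends F f1 l1 -> tends F f2 l2 ->
  tends F (fun m => f1 m * f2 m) (l1 * l2).
Proof.
move=> h1 h2.
(* Polarization reduces products to squares, which are functions of one variable: 4 a b = (a + b)^2
   - (a - b)^2. *)
have sq : forall f l, tends F f l -> tends F (fun m => f m * f m) (l * l).
  move=> f l; apply: (tends_cont (fun x => x * x)); reg.
have h3 := sq _ _ (tends_plus _ _ _ _ h1 h2); have h4 := sq _ _ (tends_minus _ _ _ _ h1 h2).
have h5 := tends_minus _ _ _ _ h3 h4.
have := tends_cont (fun x => x / 4) _ _ _ h5.
have -> : ((l1 + l2) * (l1 + l2) - (l1 - l2) * (l1 - l2)) / 4 = l1 * l2 by field.
move=> h; apply: tends_ext (h _); last by reg.
by move=> m /=; field.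
Qed.

Lemma tends_inv f l : l <> 0 -> tends F f l -> tends F (fun m => / f m) (/ l).
Proof. move=> h; apply: (tends_cont Rinv). apply: continuity_pt_inv => //; reg. Qed.

Lemma tends_div f1 f2 l1 l2 : l2 <> 0 -> tends F f1 l1 -> tends F f2 l2 ->
  tends F (fun m => f1 m / f2 m) (l1 / l2).
Proof. move=> h h1 h2; apply: tends_mult => //; exact: tends_inv. Qed.

Lemma tends_exp f l : tends F f l -> tends F (fun m => exp (f m)) (exp l).
Proof. apply: tends_cont; apply: derivable_continuous_pt; exact: derivable_pt_exp. Qed.

Lemma tends_ln f l : 0 < l -> tends F f l -> tends F (fun m => ln (f m)) (ln l).
Proof. move=> h; apply: tends_cont; apply: derivable_continuous_pt; exists (/ l); exact: derivable_pt_lim_ln. Qed.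

Lemma tends_lip1 (g : R -> R) f l :
  (forall a b, Rabs (g a - g b) <= Rabs (a - b)) -> tends F f l ->
  tends F (fun m => g (f m)) (g l).
Proof.
move=> hg hf e he; apply: (filt1 _ hF (hf _ he)) => m h; exact: Rle_trans (hg _ _) h.
Qed.

Lemma tends_clamp f l : tends F f l -> tends F (fun m => clamp (f m)) (clamp l).
Proof. by apply: (tends_lip1 clamp) => a b; apply: clamp_dist; lra. Qed.

Lemma tends_abs f l : tends F f l -> tends F (fun m => Rabs (f m)) (Rabs l).
Proof. by apply: (tends_lip1 Rabs) => a b; exact: Rabs_triang_inv2. Qed.

Lemma tends_lmx {A} (f : N -> A -> R) g (l : list A) :
  (forall x, In x l -> tends F (fun m => f m x) (g x)) ->
  tends F (fun m => lmx (f m) l) (lmx g l).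
Proof.
elim: l => [|x l ih] h /=; first exact: tends_const.
apply: tends_max; first by apply: h; left.
by apply: ih => y hy; apply: h; right.
Qed.

Lemma tends_approx f l :
  (forall e, 0 < e -> exists g lg, F (fun m => Rabs (f m - g m) <= e) /\ tends F g lg /\
     Rabs (l - lg) <= e) -> tends F f l.
Proof.
move=> h e he; have h3 : 0 < e / 3 by lra.
have [g [lg [h1 [h2 h4]]]] := h _ h3.
apply: (filt2 _ _ hF h1 (h2 _ h3)) => m h5 h6; rmx.
Qed.

Lemma tends_le_lim f g l l' : ~ F (fun _ => False) -> tends F f l -> tends F g l' ->
  F (fun m => f m <= g m) -> l <= l'.
Proof.
move=> hp h1 h2 h3; apply: Rnot_lt_le => h4; apply: hp.
have h5 : 0 < (l - l') / 3 by lra.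
have h6 : F (fun m => f m > g m).
  by apply: (filt2 _ _ hF (h1 _ h5) (h2 _ h5)) => m a b; rmx.
by apply: (filt2 _ _ hF h3 h6) => m; lra.
Qed.

End Tends.

(** * Convergence spaces and homeomorphisms over a base *)

(** Topologies are encoded by the convergence of families along arbitrary filters;
    [ok] singles out the actual points of the carrier. *)
Record space := Space {
  car :> Type;
  ok : car -> Prop;
  cv : forall N : Type, ((N -> Prop) -> Prop) -> (N -> car) -> car -> Prop }.

Definition cont (X Y : space) (f : X -> Y) : Prop :=
  (forall x, ok X x -> ok Y (f x)) /\
  forall (N : Type) F (xs : N -> X) x0, filt F -> (forall m, ok X (xs m)) -> ok X x0 ->
    cv X N F xs x0 -> cv Y N F (fun m => f (xs m)) (f x0).

(** Homeomorphic over the base [B]. *)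
Definition hov {B : Type} (X Y : space) (p : X -> B) (q : Y -> B) : Prop :=
  exists (f : X -> Y) (g : Y -> X), cont X Y f /\ cont Y X g /\
    (forall x, ok X x -> g (f x) = x) /\ (forall y, ok Y y -> f (g y) = y) /\
    (forall x, ok X x -> q (f x) = p x).

Definition iso (X Y : space) : Prop := hov X Y (fun _ => tt) (fun _ => tt).

Definition prodS (X Y : space) : space :=
  Space (X * Y) (fun z => ok X (fst z) /\ ok Y (snd z))
    (fun N F zs z => cv X N F (fun m => fst (zs m)) (fst z) /\ cv Y N F (fun m => snd (zs m)) (snd z)).

Definition funS (K : Type) (X : space) : space :=
  Space (K -> X) (fun f => forall k, ok X (f k))
    (fun N F fs f => forall k, cv X N F (fun m => fs m k) (f k)).

Definition subS (X : space) (P : X -> Prop) : space :=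
  Space X (fun x => ok X x /\ P x) (fun N F xs x => cv X N F xs x).

Definition Rsp : space := Space R (fun _ => True) (fun N F xs x => tends F xs x).

Definition Rw : space := funS nat Rsp.

Lemma cont_comp (X Y Z : space) f g : cont X Y f -> cont Y Z g -> cont X Z (fun x => g (f x)).
Proof.
move=> [f1 f2] [g1 g2]; split; first by move=> x hx; apply: g1; exact: f1.
move=> N F xs x0 hF h1 h2 h3; apply: g2 => //; last exact: f2.
  by move=> m; apply: f1.
exact: f1.
Qed.

Lemma cont_id X : cont X X (fun x => x).
Proof. by split. Qed.

Lemma hov_refl {B} (X : space) (p : X -> B) : hov X X p p.
Proof. by exists (fun x => x), (fun x => x); do 2 (split; first exact: cont_id). Qed.

Lemma hov_sym {B} (X Y : space) (p : X -> B) (q : Y -> B) : hov X Y p q -> hov Y X q p.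
Proof.
move=> [f [g [hf [hg [h1 [h2 h3]]]]]]; exists g, f; do 4 (split => //).
by move=> y hy; rewrite -h3 ?h2 //; apply: (proj1 hg).
Qed.

Lemma hov_trans {B} (X Y Z : space) (p : X -> B) (q : Y -> B) (r : Z -> B) :
  hov X Y p q -> hov Y Z q r -> hov X Z p r.
Proof.
move=> [f [g [hf [hg [h1 [h2 h3]]]]]] [f' [g' [hf' [hg' [h1' [h2' h3']]]]]].
exists (fun x => f' (f x)), (fun z => g (g' z)).
split; first exact: cont_comp hf hf'.
split; first exact: cont_comp hg' hg.
split; first by move=> x hx; rewrite h1' ?h1 //; apply: (proj1 hf).
split; first by move=> x hx; rewrite h2 ?h2' //; apply: (proj1 hg').
by move=> x hx; rewrite h3' ?h3 //; apply: (proj1 hf).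
Qed.

Lemma cont_prod (X Y X' Y' : space) f g : cont X X' f -> cont Y Y' g ->
  cont (prodS X Y) (prodS X' Y') (fun z => (f (fst z), g (snd z))).
Proof.
move=> [f1 f2] [g1 g2]; split.
  by move=> [x y] [/= /f1 h1 /g1 h2].
move=> N F zs z0 hF h1 h2 [h3 h4]; split => /=.
  by apply: f2 => //; [move=> m; exact: (proj1 (h1 m)) | exact: (proj1 h2)].
by apply: g2 => //; [move=> m; exact: (proj2 (h1 m)) | exact: (proj2 h2)].
Qed.

Lemma hov_prod {B} (X X' Z Z' : space) (p : X -> B) (p' : X' -> B) : hov X X' p p' -> iso Z Z' ->
  hov (prodS X Z) (prodS X' Z') (fun z => p (fst z)) (fun z => p' (fst z)).
Proof.
move=> [f [g [hf [hg [h1 [h2 h3]]]]]] [f' [g' [hf' [hg' [h1' [h2' _]]]]]].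
exists (fun z => (f (fst z), f' (snd z))), (fun z => (g (fst z), g' (snd z))).
split; first exact: cont_prod.
split; first exact: cont_prod.
split; first by move=> [x z] [hx hz] /=; rewrite h1 // h1'.
split; first by move=> [x z] [hx hz] /=; rewrite h2 // h2'.
by move=> [x z] [hx hz] /=; rewrite h3.
Qed.

Lemma hov_assoc {B} (X Y Z : space) (p : X -> B) :
  hov (prodS (prodS X Y) Z) (prodS X (prodS Y Z)) (fun z => p (fst (fst z))) (fun z => p (fst z)).
Proof.
exists (fun z => (fst (fst z), (snd (fst z), snd z))), (fun z => ((fst z, fst (snd z)), snd (snd z))).
split; first by split; [move=> [[x y] z] /= [[]] | move=> N F zs z0 _ _ _ [[]]].
split; first by split; [move=> [x [y z]] /= [? []] | move=> N F zs z0 _ _ _ [? []]].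
split; first by move=> [[x y] z].
split; first by move=> [x [y z]].
by move=> [[x y] z].
Qed.

Lemma iso_reindex K L X (a : K -> L) (b : L -> K) :
  (forall k, b (a k) = k) -> (forall l, a (b l) = l) -> iso (funS K X) (funS L X).
Proof.
move=> h1 h2; exists (fun f l => f (b l)), (fun f k => f (a k)).
split; first by split; [move=> f hf l; exact: hf | move=> N F fs f _ _ _ h l; exact: h].
split; first by split; [move=> f hf l; exact: hf | move=> N F fs f _ _ _ h l; exact: h].
split; first by move=> f _; apply: functional_extensionality => k; rewrite h1.
by split; [move=> f _; apply: functional_extensionality => k; rewrite h2 |].
Qed.

Lemma iso_funS K X Y : iso X Y -> iso (funS K X) (funS K Y).
Proof.
move=> [f [g [hf [hg [h1 [h2 _]]]]]].
exists (fun u k => f (u k)), (fun u k => g (u k)).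
have cc : forall X Y f, cont X Y f -> cont (funS K X) (funS K Y) (fun u k => f (u k)).
  move=> X' Y' f' [c1 c2]; split; first by move=> u hu k; apply: c1.
  by move=> N F us u hF h3 h4 h5 k; apply: c2 => // m; exact: h3.
split; first exact: cc.
split; first exact: cc.
split; first by move=> u hu; apply: functional_extensionality => k; rewrite h1.
by split; [move=> u hu; apply: functional_extensionality => k; rewrite h2 |].
Qed.

Lemma iso_curry K L X : iso (funS K (funS L X)) (funS (K * L) X).
Proof.
exists (fun f kl => f (fst kl) (snd kl)), (fun f k l => f (k, l)).
split; first by split; [move=> f hf l; exact: hf | move=> N F fs f _ _ _ h l; exact: h].
split; first by split; [move=> f hf k l; exact: hf | move=> N F fs f _ _ _ h k l; exact: h].
by split => //; split => // f _; apply: functional_extensionality => -[k l].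
Qed.

Lemma iso_fprod K X Y : iso (funS K (prodS X Y)) (prodS (funS K X) (funS K Y)).
Proof.
exists (fun f => (fun k => fst (f k), fun k => snd (f k))), (fun f k => (fst f k, snd f k)).
split; first by split; [move=> f hf; split => k; apply (hf k) | move=> N F fs f _ _ _ h; split => k; apply (h k)].
split; first by split; [move=> f [h1 h2] k; split; [exact: h1 | exact: h2] | move=> N F fs f _ _ _ [h1 h2] k; split; [exact: h1 | exact: h2]].
split; first by move=> f _; apply: functional_extensionality => k /=; case: (f k).
by split => // -[f g].
Qed.

Lemma iso_sum K L X : iso (prodS (funS K X) (funS L X)) (funS (K + L) X).
Proof.
exists (fun f kl => match kl with inl k => fst f k | inr l => snd f l end),
  (fun f => (fun k => f (inl k), fun l => f (inr l))).
split.
  split; first by move=> [f g] [h1 h2] [k|l]; [exact: h1 | exact: h2].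
  by move=> N F fs f _ _ _ [h1 h2] [k|l]; [exact: h1 | exact: h2].
split; first by split; [move=> f hf; split => k; exact: hf | move=> N F fs f _ _ _ h; split => k; exact: h].
split; first by move=> [f g].
by split => // f _; apply: functional_extensionality => -[].
Qed.

Lemma iso_Rw_nat : iso (funS nat Rw) Rw.
Proof.
apply: hov_trans (iso_curry nat nat Rsp) _.
exact: (iso_reindex _ _ _ Cantor.to_nat Cantor.of_nat Cantor.cancel_of_to Cantor.cancel_to_of).
Qed.

Lemma iso_Rw2 : iso (prodS Rw Rw) Rw.
Proof.
apply: hov_trans (iso_sum nat nat Rsp) _.
pose a (s : nat + nat) := match s with inl n => (2 * n)%nat | inr n => (2 * n + 1)%nat end.
pose b (n : nat) := if Nat.even n then inl (Nat.div2 n) else inr (Nat.div2 n) : nat + nat.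
apply: (iso_reindex _ _ _ a b).
  move=> [n|n]; rewrite /a /b.
    by rewrite Nat.even_mul /= -/(2 * n)%nat Nat.div2_double.
  have -> : Nat.even (2 * n + 1) = false by rewrite Nat.add_1_r Nat.even_succ -Nat.negb_even Nat.even_mul.
  by rewrite Nat.add_1_r Nat.div2_succ_double.
move=> n; rewrite /b; case h : (Nat.even n); rewrite /a.
  by have := Nat.div2_odd n; rewrite -Nat.negb_even h /= ; lia.
by have := Nat.div2_odd n; rewrite -Nat.negb_even h /= ; lia.
Qed.

(** * Rapidly decreasing sequences with majorants *)

Lemma pow2_pos n : 0 < 2 ^ n.
Proof. apply: pow_lt; lra. Qed.

Lemma pow2_ge1 n : 1 <= 2 ^ n.
Proof. apply: pow_R1_Rle; lra. Qed.

Lemma pow2_mono n m : (n <= m)%nat -> 2 ^ n <= 2 ^ m.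
Proof. move=> h; apply: Rle_pow => //; lra. Qed.

Lemma half_pow_small K d : 0 < d -> exists n, forall m, (n <= m)%nat -> K * (/ 2) ^ m <= d.
Proof.
move=> hd; have hK : 0 < d / (Rabs K + 1).
  by apply: Rdiv_lt_0_compat => //; have := Rabs_pos K; lra.
have h2 : Rabs (/ 2) < 1 by rewrite Rabs_pos_eq; lra.
have [n hn] := pow_lt_1_zero (/ 2) h2 _ hK.
exists n => m hm; have := hn m hm.
rewrite Rabs_pos_eq; last by apply: pow_le; lra.
move=> h; have h3 := Rabs_pos K; have h4 := Rle_abs K.
have h5 : 0 <= (/ 2) ^ m by apply: pow_le; lra.
have : (/ 2) ^ m * (Rabs K + 1) <= d.
  have -> : d = d / (Rabs K + 1) * (Rabs K + 1) by field; lra.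
  by apply: Rmult_le_compat_r; lra.
by nra.
Qed.

Fixpoint bmin (f : nat -> R) (n : nat) : R :=
  match n with O => f O | S n => Rmin (bmin f n) (f (S n)) end.

Lemma bmin_le f n k : (k <= n)%nat -> bmin f n <= f k.
Proof.
elim: n => [|n ih] h /=; first by rewrite (_ : k = O); [lra | lia].
case: (Nat.eq_dec k (S n)) => [->|hk]; first exact: Rmin_r.
by apply: Rle_trans (Rmin_l _ _) (ih _); lia.
Qed.

Lemma bmin_attain f n : exists k, (k <= n)%nat /\ bmin f n = f k.
Proof.
elim: n => [|n [k [h1 h2]]] /=; first by exists O.
rewrite /Rmin; case: Rle_dec => h; first by exists k; split => //; lia.
by exists (S n).
Qed.

Lemma tends_bmin {N} (F : (N -> Prop) -> Prop) (fs : N -> nat -> R) f n : filt F ->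
  (forall k, (k <= n)%nat -> tends F (fun m => fs m k) (f k)) -> tends F (fun m => bmin (fs m) n) (bmin f n).
Proof.
move=> hF; elim: n => [|n ih] h /=; first exact: h.
by apply: tends_min => //; [apply: ih => k hk; apply: h; lia | exact: h].
Qed.

Definition nrm (M : nat -> nat) (n : nat) (v : nat -> nat -> R) : R :=
  lmx (fun m => Rabs (v n m)) (seq 0 (M n)).

Lemma nrm_ge0 M n v : 0 <= nrm M n v.
Proof. exact: lmx_ge0. Qed.

Lemma nrm_ub M n v m : (m < M n)%nat -> Rabs (v n m) <= nrm M n v.
Proof. by move=> h; apply: (lmx_ub (fun m => Rabs (v n m))); apply/in_seq; lia. Qed.

Lemma nrm_le M n v c : 0 <= c -> (forall m, (m < M n)%nat -> Rabs (v n m) <= c) -> nrm M n v <= c.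
Proof. by move=> hc h; apply: lmx_le => // m /in_seq [_ hm]; apply: h. Qed.

Lemma nrm_add M n u v d : 0 <= d -> (forall m, (m < M n)%nat -> Rabs (u n m - v n m) <= d) ->
  nrm M n u <= nrm M n v + d.
Proof.
move=> hd h; apply: nrm_le; first by have := nrm_ge0 M n v; lra.
move=> m hm; have h1 := h m hm; have h2 := nrm_ub M n v m hm.
have := Rabs_triang_inv (u n m) (v n m); lra.
Qed.

Lemma tends_nrm {N} (F : (N -> Prop) -> Prop) M n (vs : N -> nat -> nat -> R) v : filt F ->
  (forall m, tends F (fun i => vs i n m) (v n m)) -> tends F (fun i => nrm M n (vs i)) (nrm M n v).
Proof. by move=> hF h; apply: tends_lmx => // m _; exact: tends_abs. Qed.

(** The constraint that [2 ^ (k * n) * nrm M n v] stay below [tau k] is imposed on row [n] only for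
    [k <= n]. So each row meets finitely many constraints, and its bound is positive and continuous
    in [tau]; yet every geometric rate of decay is enforced from some row on. *)
Definition beta (tau : nat -> R) (n : nat) : R := bmin (fun k => tau k / 2 ^ (k * n)) n.

(** Strict inequalities let every constrained entry range over an open interval, so that the pairs
    form a copy of R^omega in [iso_VTS]. *)
Definition good (M : nat -> nat) (tau : nat -> R) (v : nat -> nat -> R) : Prop :=
  (forall k, 0 < tau k) /\ forall n m, (m < M n)%nat -> Rabs (v n m) < beta tau n.

Lemma beta_pos tau n : (forall k, 0 < tau k) -> 0 < beta tau n.
Proof.
move=> h; rewrite /beta; have [k [_ ->]] := bmin_attain (fun k => tau k / 2 ^ (k * n)) n.
by apply: Rdiv_lt_0_compat => //; exact: pow2_pos.
Qed.

Lemma good_nrm M tau v n : good M tau v -> nrm M n v < beta tau n.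
Proof.
move=> [h1 h2]; apply: lmx_lt; first exact: beta_pos.
by move=> m /in_seq [_ hm]; apply: h2.
Qed.

Definition cls1 M v j b := forall n, 2 ^ (j * n) * nrm M n v <= b.

(** Rows [n >= j] are controlled by [tau j]; the finitely many rows before them are controlled by
    [tau 0], at the cost of a factor at most [2 ^ (j * j)]. *)
Definition bd (tau : nat -> R) (j : nat) : R := 2 ^ (j * j) * tau 0%nat + tau j.

Lemma good_lt M tau v n k : good M tau v -> (k <= n)%nat -> 2 ^ (k * n) * nrm M n v < tau k.
Proof.
move=> h hk; have h1 := good_nrm _ _ _ n h.
have h2 := bmin_le (fun k => tau k / 2 ^ (k * n)) n k hk.
have h3 : nrm M n v < tau k / 2 ^ (k * n) by exact: Rlt_le_trans h1 h2.
have hp := pow2_pos (k * n).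
have -> : tau k = 2 ^ (k * n) * (tau k / 2 ^ (k * n)) by field; lra.
exact: Rmult_lt_compat_l.
Qed.

Lemma good_cls M tau v j : good M tau v -> cls1 M v j (bd tau j).
Proof.
move=> h n; rewrite /bd; have [ht _] := h.
have h0 := ht O; have hj := ht j; have hp := pow2_pos (j * j).
case: (le_lt_dec j n) => hn.
  have := good_lt _ _ _ _ _ h hn; have : 0 < 2 ^ (j * j) * tau O by apply: Rmult_lt_0_compat.
  lra.
have h1 := good_lt _ _ _ n _ h (Nat.le_0_l n); rewrite /= Rmult_1_l in h1.
have : 2 ^ (j * n) <= 2 ^ (j * j) by apply: pow2_mono; nia.
move=> h2; have := nrm_ge0 M n v => h3.
have : 2 ^ (j * n) * nrm M n v <= 2 ^ (j * j) * tau O by apply: Rmult_le_compat; try lra; exact: Rlt_le (pow2_pos _).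
lra.
Qed.

(** [sk M k v] is finite when [cls1 M v (S k)]; replacing the majorant [tau k] of [v] by
    [tau k - sk M k v + sk M k u] turns [v] into [u]. *)
Definition sk M k v : R := supr (fun r => r = 0 \/ exists n, (k <= n)%nat /\ r = 2 ^ (k * n) * nrm M n v).

Definition skf M k v (N : nat) : R :=
  lmx (fun n => if le_dec k n then 2 ^ (k * n) * nrm M n v else 0) (seq 0 N).

(** Decay of order [S k] leaves a geometric factor to spare at order [k]; this makes [sk] a uniform
    limit of the finite maxima [skf]. *)
Lemma cls1_up M v k b n : cls1 M v (S k) b -> 2 ^ (k * n) * nrm M n v <= b * (/ 2) ^ n.
Proof.
move=> h; have := h n; rewrite (_ : S k * n = n + k * n)%nat; last by lia.
rewrite pow_add pow_inv => h1; have hp := pow2_pos n.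
apply: (Rmult_le_reg_l (2 ^ n)) => //.
have -> : 2 ^ n * (b * / 2 ^ n) = b by field; lra.
lra.
Qed.

Section Sk.
Context (M : nat -> nat) (k : nat) (v : nat -> nat -> R) (b : R) (hb : cls1 M v (S k) b).

Lemma cls1_b0 : 0 <= b.
Proof. have := hb O; rewrite Nat.mul_0_r /= Rmult_1_l; have := nrm_ge0 M 0 v; lra. Qed.

Lemma sk_bound r : (r = 0 \/ exists n, (k <= n)%nat /\ r = 2 ^ (k * n) * nrm M n v) -> r <= b.
Proof.
have b0 := cls1_b0.
move=> [->|[n [_ ->]]] //; apply: Rle_trans (cls1_up _ _ _ _ n hb) _.
have : (/ 2) ^ n <= 1 by rewrite -(pow1 n); apply: pow_incr; lra.
have : 0 <= (/ 2) ^ n by apply: pow_le; lra.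
nra.
Qed.

Lemma sk_ge0 : 0 <= sk M k v.
Proof. by apply: (supr_ub _ b); [exact: sk_bound | left]. Qed.

Lemma sk_ub n : (k <= n)%nat -> 2 ^ (k * n) * nrm M n v <= sk M k v.
Proof. by move=> hn; apply: (supr_ub _ b); [exact: sk_bound | right; exists n]. Qed.

Lemma skf_le N : skf M k v N <= sk M k v.
Proof.
apply: lmx_le; first exact: sk_ge0.
by move=> n _; case: le_dec => h; [exact: sk_ub | exact: sk_ge0].
Qed.

Lemma sk_le N : sk M k v <= Rmax (skf M k v N) (b * (/ 2) ^ N).
Proof.
have b0 := cls1_b0.
apply: supr_le; first by exists 0; left.
move=> r [->|[n [hk ->]]]; first by apply: Rle_trans (Rmax_l _ _); exact: lmx_ge0.
case: (le_lt_dec N n) => hn.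
  apply: Rle_trans (Rmax_r _ _); apply: Rle_trans (cls1_up _ _ _ _ n hb) _.
  apply: Rmult_le_compat_l => //; rewrite !pow_inv; apply: Rinv_le_contravar; first exact: pow2_pos.
  exact: pow2_mono.
apply: Rle_trans (Rmax_l _ _).
have := lmx_ub (fun n => if le_dec k n then 2 ^ (k * n) * nrm M n v else 0) (seq 0 N) n.
by case: le_dec => // _; apply; apply/in_seq; lia.
Qed.

Lemma sk_skf N : Rabs (sk M k v - skf M k v N) <= b * (/ 2) ^ N.
Proof.
have h1 := skf_le N; have h2 := sk_le N; have b0 := cls1_b0.
have h3 : 0 <= (/ 2) ^ N by apply: pow_le; lra.
have h4 : 0 <= b * (/ 2) ^ N by nra.
have h5 : 0 <= skf M k v N by exact: lmx_ge0.
rewrite Rabs_pos_eq; last lra.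
move: h2; rmx.
Qed.
End Sk.

(** Strictness survives the supremum: a tail is at most [tau k / 2], and what remains is a finite
    maximum of numbers below [tau k]. *)
Lemma sk_lt M tau v k : good M tau v -> sk M k v < tau k.
Proof.
move=> h; have hb := good_cls _ _ _ (S k) h; have [ht _] := h.
have ht2 : 0 < tau k / 2 by have := ht k; lra.
have [N hN] := half_pow_small (bd tau (S k)) _ ht2.
apply: Rle_lt_trans (sk_le _ _ _ _ hb N) _; apply: Rmax_lub_lt; last by have := hN N (le_n N); have := ht k; lra.
apply: lmx_lt => // n _; case: le_dec => // hk; exact: good_lt.
Qed.

(** Convergence of the entries does not control a supremum over all rows; the decay bound [b],
    uniform along the filter, does. The majorants exist to supply such bounds. *)
Lemma tends_sk {N} (F : (N -> Prop) -> Prop) M k (vs : N -> nat -> nat -> R) v b : filt F ->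
  (forall n m, tends F (fun i => vs i n m) (v n m)) -> F (fun i => cls1 M (vs i) (S k) b) ->
  cls1 M v (S k) b -> tends F (fun i => sk M k (vs i)) (sk M k v).
Proof.
move=> hF h1 h2 h3; apply: tends_approx => // e he.
have [n0 hn] := half_pow_small b _ he; have hn0 := hn n0 (le_n n0).
exists (fun i => skf M k (vs i) n0), (skf M k v n0); split.
  by apply: (filt1 _ hF h2) => i hi; apply: Rle_trans (sk_skf _ _ _ _ hi n0) hn0.
split; last by apply: Rle_trans (sk_skf _ _ _ _ h3 n0) hn0.
apply: tends_lmx => // n _; case: le_dec => hk; last exact: tends_const.
apply: tends_mult => //; first exact: tends_const.
exact: tends_nrm.
Qed.

Definition VT : space := prodS (funS nat Rw) Rw.
Definition VTS (M : nat -> nat) : space := subS VT (fun z => good M (snd z) (fst z)).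

(** [sig] is a homeomorphism of the line onto the open interval (-1, 1), with inverse [gis]. *)
Definition sig (t : R) : R := t / (1 + Rabs t).
Definition gis (t : R) : R := t / (1 - Rabs t).

Lemma Rabs_quot a b : Rabs (a / b) = Rabs a / Rabs b.
Proof. by rewrite /Rdiv Rabs_mult Rabs_inv. Qed.

Lemma sig_lt t : Rabs (sig t) < 1.
Proof.
rewrite /sig Rabs_quot.
have h := Rabs_pos t; rewrite (Rabs_pos_eq (1 + _)); last lra.
apply: (Rmult_lt_reg_r (1 + Rabs t)); first lra.
have -> : Rabs t / (1 + Rabs t) * (1 + Rabs t) = Rabs t by field; lra.
lra.
Qed.

Lemma gis_sig t : gis (sig t) = t.
Proof.
rewrite /gis /sig; have h := Rabs_pos t.
rewrite Rabs_quot.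
rewrite (Rabs_pos_eq (1 + _)); last lra.
by field; split; lra.
Qed.

Lemma sig_gis t : Rabs t < 1 -> sig (gis t) = t.
Proof.
move=> ht; rewrite /gis /sig; have h := Rabs_pos t.
rewrite Rabs_quot.
rewrite (Rabs_pos_eq (1 - _)); last lra.
by field; split; lra.
Qed.

Lemma tends_sig {N} (F : (N -> Prop) -> Prop) f l : filt F -> tends F f l -> tends F (fun m => sig (f m)) (sig l).
Proof.
move=> hF h; apply: tends_div => //; first by have := Rabs_pos l; lra.
by apply: tends_plus => //; [exact: tends_const | exact: tends_abs].
Qed.

Lemma tends_gis {N} (F : (N -> Prop) -> Prop) f l : filt F -> Rabs l < 1 -> tends F f l -> tends F (fun m => gis (f m)) (gis l).
Proof.
move=> hF hl h; apply: tends_div => //; first lra.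
by apply: tends_minus => //; [exact: tends_const | exact: tends_abs].
Qed.

Lemma tends_beta {N} (F : (N -> Prop) -> Prop) (ts : N -> nat -> R) t n : filt F ->
  (forall k, tends F (fun i => ts i k) (t k)) -> tends F (fun i => beta (ts i) n) (beta t n).
Proof.
move=> hF h; apply: tends_bmin => // k _; apply: tends_div => //; last exact: tends_const.
have := pow2_pos (k * n); lra.
Qed.

(* The entries [v n m] with [m >= M n] are unconstrained dummies. *)
Lemma iso_VTS M : iso (VTS M) VT.
Proof.
pose f (z : VT) : VT := (fun n m => if lt_dec m (M n) then gis (fst z n m / beta (snd z) n) else fst z n m,
  fun k => ln (snd z k)).
pose g (z : VT) : VT := (fun n m => if lt_dec m (M n) then beta (fun k => exp (snd z k)) n * sig (fst z n m) else fst z n m,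
  fun k => exp (snd z k)).
exists f, g.
have small : forall v tau n m, good M tau v -> (m < M n)%nat -> Rabs (v n m / beta tau n) < 1.
  move=> v tau n m h hm; have hb := beta_pos tau n (proj1 h).
  rewrite Rabs_quot.
  rewrite (Rabs_pos_eq (beta _ _)); last lra.
  apply: (Rmult_lt_reg_r (beta tau n)) => //.
  have -> : Rabs (v n m) / beta tau n * beta tau n = Rabs (v n m) by field; lra.
  by rewrite Rmult_1_l; apply: (proj2 h).
split.
  split; first by [].
  move=> N F zs [v tau] hF h1 [_ h2] [h3 h4]; split => /=; last first.
    move=> k; apply: tends_ln => //; [exact: (proj1 h2) | exact: h4].
  move=> n m; case: lt_dec => hm; last exact: h3.
  apply: tends_gis => //; first exact: small.
  apply: tends_div => //; first by have := beta_pos tau n (proj1 h2); lra.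
    exact: h3.
  by apply: tends_beta.
split.
  split.
    move=> [v s] _; split => //; split => /=; first by move=> k; exact: exp_pos.
    move=> n m hm; case: lt_dec => // _.
    have hb := beta_pos (fun k => exp (s k)) n (fun k => exp_pos _).
    rewrite Rabs_mult Rabs_pos_eq; last lra.
    by have := sig_lt (v n m); nra.
  move=> N F zs [v tau] hF _ _ [h3 h4].
  have h5 : forall k, tends F (fun i => exp (snd (zs i) k)) (exp (tau k)) by move=> k; apply: tends_exp => //; exact: h4.
  split => /=; last exact: h5.
  move=> n m; case: lt_dec => hm; last exact: h3.
  apply: tends_mult => //; first by apply: tends_beta.
  apply: tends_sig => //; exact: h3.
split.
  move=> [v tau] [_ h]; rewrite /f /g /=; have [h1 _] := h.
  have he : (fun k => exp (ln (tau k))) = tau.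
    by apply: functional_extensionality => k; rewrite exp_ln.
  rewrite he; congr pair; apply: functional_extensionality => n; apply: functional_extensionality => m.
  case: lt_dec => hm //; rewrite sig_gis; last exact: small.
  by field; have := beta_pos tau n h1; simpl; lra.
split => // -[v s] _; rewrite /f /g /=; congr pair; last first.
  by apply: functional_extensionality => k; rewrite ln_exp.
apply: functional_extensionality => n; apply: functional_extensionality => m.
case: lt_dec => hm //.
have hb := beta_pos (fun k => exp (s k)) n (fun k => exp_pos _).
have -> : beta (fun k => exp (s k)) n * sig (v n m) / beta (fun k => exp (s k)) n = sig (v n m) by field; lra.
exact: gis_sig.
Qed.

Lemma iso_VT : iso VT Rw.
Proof.
apply: hov_trans iso_Rw2.
exact: (hov_prod _ _ _ _ _ _ iso_Rw_nat (hov_refl _ _)).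
Qed.

(** * The factor theorem *)

Section Factor.
(** [e] is a pseudo-metric on all of [E] that separates the points of one fibre; convergence in the
    total space means convergence in the base together with [e] tending to 0. The loss of [2 ^ n] in
    [c_near] is affordable because the rows decay faster than any geometric sequence, and
    [eta_small] asks the same of [eta]. *)
Context (Y : space) (E : Type) (X : Y -> E -> Prop) (e : E -> E -> R)
  (M : nat -> nat) (S_ : nat -> nat -> Y -> E -> R) (c : nat -> Y -> (nat -> R) -> E)
  (eta : nat -> R) (ceta : nat -> R) (C : Y -> R).
Context (e_ge0 : forall a b, 0 <= e a b) (e_refl : forall a, e a a = 0)
  (e_sym : forall a b, e a b = e b a)
  (e_tri : forall a b d, e a d <= e a b + e b d)
  (e_eq : forall y a b, ok Y y -> X y a -> X y b -> e a b = 0 -> a = b)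
  (complete : forall y (b : nat -> E) K, ok Y y -> (forall n, X y (b n)) -> 0 <= K ->
     (forall n, e (b n) (b (S n)) <= K * (/ 2) ^ n) ->
     exists B, X y B /\ forall d, 0 < d -> exists n0, forall n, (n0 <= n)%nat -> e (b n) B <= d)
  (S_lip : forall n m y a b, ok Y y -> X y a -> X y b -> Rabs (S_ n m y a - S_ n m y b) <= e a b)
  (S_cv : forall n m N F (ys : N -> Y) y (bs : N -> E) b, filt F -> (forall i, ok Y (ys i)) -> ok Y y ->
     (forall i, X (ys i) (bs i)) -> X y b -> cv Y N F ys y -> tends F (fun i => e (bs i) b) 0 ->
     tends F (fun i => S_ n m (ys i) (bs i)) (S_ n m y b))
  (c_X : forall n y w, ok Y y -> X y (c n y w))
  (c_cv : forall n N F (ys : N -> Y) y (ws : N -> nat -> R) w, filt F -> (forall i, ok Y (ys i)) -> ok Y y ->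
     cv Y N F ys y -> (forall m, tends F (fun i => ws i m) (w m)) ->
     tends F (fun i => e (c n (ys i) (ws i)) (c n y w)) 0)
  (C_ge0 : forall y, ok Y y -> 0 <= C y)
  (C_cv : forall N F (ys : N -> Y) y, filt F -> (forall i, ok Y (ys i)) -> ok Y y ->
     cv Y N F ys y -> tends F (fun i => C (ys i)) (C y))
  (c_near : forall n y w b d, ok Y y -> X y b -> 0 <= d ->
     (forall m, (m < M n)%nat -> Rabs (w m - S_ n m y b) <= d) ->
     e (c n y w) b <= C y * 2 ^ n * (d + eta n))
  (eta_ge0 : forall n, 0 <= eta n)
  (eta_small : forall k n, 2 ^ (k * n) * eta n <= ceta k).

Definition totS : space := Space (Y * E) (fun z => ok Y (fst z) /\ X (fst z) (snd z))
  (fun N F zs z => cv Y N F (fun i => fst (zs i)) (fst z) /\ tends F (fun i => e (snd (zs i)) (snd z)) 0).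

(** Position [S n] decodes row [n]; the starting point, decoded from a row of zeros, depends on the
    base point alone. *)
Definition fwP (y : Y) (b : E) (v : nat -> nat -> R) (n : nat) : E :=
  match n with O => c O y (fun _ => 0) | S n => c n y (fun m => v n m + S_ n m y b) end.

Definition fwU y b v (n m : nat) : R := v n m + S_ n m y b - S_ n m y (fwP y b v n).

Fixpoint bwP (y : Y) (u : nat -> nat -> R) (n : nat) : E :=
  match n with O => c O y (fun _ => 0) | S n => c n y (fun m => u n m + S_ n m y (bwP y u n)) end.

Definition limE (y : Y) (b : nat -> E) : E :=
  epsilon (inhabits (b O)) (fun B => X y B /\ forall d, 0 < d -> exists n0, forall n, (n0 <= n)%nat -> e (b n) B <= d).

Definition bwB y u := limE y (bwP y u).
Definition bwV y u (n m : nat) : R := u n m + S_ n m y (bwP y u n) - S_ n m y (bwB y u).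

Lemma limE_eq y b B : ok Y y -> X y B ->
  (forall d, 0 < d -> exists n0, forall n, (n0 <= n)%nat -> e (b n) B <= d) -> limE y b = B.
Proof.
move=> hy hB h; rewrite /limE.
have := epsilon_spec (inhabits (b O)) (fun B => X y B /\ forall d, 0 < d -> exists n0, forall n, (n0 <= n)%nat -> e (b n) B <= d).
move=> /(_ (ex_intro _ B (conj hB h))); set B' := epsilon _ _; move=> [h1 h2].
apply: (e_eq y) => //; apply: Rle_antisym; last exact: e_ge0.
apply: Rle_eps => d hd; have hd2 : 0 < d / 2 by lra.
have [n1 hn1] := h _ hd2; have [n2 hn2] := h2 _ hd2.
have h3 := hn1 (n1 + n2)%nat ltac:(lia); have h4 := hn2 (n1 + n2)%nat ltac:(lia).
have := e_tri B' (b (n1 + n2)%nat) B; rewrite (e_sym B' (b _)); lra.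
Qed.

Lemma fwP_X y b v n : ok Y y -> X y (fwP y b v n).
Proof. by move=> hy; case: n => [|n] /=; exact: c_X. Qed.

Lemma bwP_X y u n : ok Y y -> X y (bwP y u n).
Proof. by move=> hy; case: n => [|n] /=; exact: c_X. Qed.

(** What is decoded from row [n] is [v n m + S_ n m y b], that is [u n m] plus the value of
    [S_ n m y] at the [n]-th decoded point; so by induction the decoded points can be computed from
    [u] alone. *)
Lemma bwP_fw y b v n : bwP y (fwU y b v) n = fwP y b v n.
Proof.
elim: n => [|n ih] //=; congr c; apply: functional_extensionality => m.
by rewrite ih /fwU; lra.
Qed.

Lemma fwP_bw y u n : fwP y (bwB y u) (bwV y u) n = bwP y u n.
Proof.
case: n => [|n] //=; congr c; apply: functional_extensionality => m.
by rewrite /bwV; lra.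
Qed.

Lemma fwP_near y b v n : ok Y y -> X y b ->
  e (fwP y b v (S n)) b <= C y * 2 ^ n * (nrm M n v + eta n).
Proof.
move=> hy hb /=; apply: c_near => //; first exact: nrm_ge0.
by move=> m hm; rewrite Rplus_minus_r; exact: nrm_ub.
Qed.

Lemma fwU_nrm y b v n : ok Y y -> X y b ->
  nrm M n (fwU y b v) <= nrm M n v + e (fwP y b v n) b.
Proof.
move=> hy hb; apply: nrm_add; first exact: e_ge0.
move=> m _; rewrite /fwU (_ : _ - _ = S_ n m y b - S_ n m y (fwP y b v n)); last lra.
rewrite e_sym; apply: S_lip => //; exact: fwP_X.
Qed.

Lemma bwP_near y u n : ok Y y ->
  e (bwP y u n) (bwP y u (S n)) <= C y * 2 ^ n * (nrm M n u + eta n).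
Proof.
move=> hy /=; rewrite e_sym; apply: c_near => //; [exact: bwP_X | exact: nrm_ge0 |].
by move=> m hm; rewrite Rplus_minus_r; exact: nrm_ub.
Qed.

(** The factor [2 ^ n] of [c_near] costs exactly one order of decay. *)
Lemma scale_bound K j n v b : 0 <= K -> cls1 M v (S j) b ->
  2 ^ (j * n) * (K * 2 ^ n * (nrm M n v + eta n)) <= K * (b + ceta (S j)).
Proof.
move=> hK h; have h1 := h n; have h2 := eta_small (S j) n.
have e1 : 2 ^ (S j * n) = 2 ^ n * 2 ^ (j * n) by rewrite -pow_add.
rewrite e1 in h1 h2.
have -> : 2 ^ (j * n) * (K * 2 ^ n * (nrm M n v + eta n)) =
  K * (2 ^ n * 2 ^ (j * n) * nrm M n v + 2 ^ n * 2 ^ (j * n) * eta n) by ring.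
by apply: Rmult_le_compat_l => //; lra.
Qed.

Lemma ceta_ge0 k : 0 <= ceta k.
Proof. have := eta_small k 0; rewrite Nat.mul_0_r /= Rmult_1_l; have := eta_ge0 0; lra. Qed.

(** Row 0 is compared with the starting point, at distance at most [a] from [b]. Row [S n] uses the
    point decoded from row [n], and this shift of the index costs the factor [2 ^ j]. *)
Lemma cls1_fw y b v j b1 b2 a : ok Y y -> X y b -> cls1 M v j b1 -> cls1 M v (S j) b2 ->
  e (c O y (fun _ => 0)) b <= a ->
  cls1 M (fwU y b v) j (b1 + a + 2 ^ j * (C y * (b2 + ceta (S j)))).
Proof.
move=> hy hb h1 h2 ha n.
have hC := C_ge0 y hy; have hce := ceta_ge0 (S j); have hb2 := cls1_b0 _ _ _ _ h2.
have hpos : 0 <= 2 ^ j * (C y * (b2 + ceta (S j))).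
  by apply: Rmult_le_pos; [exact: Rlt_le (pow2_pos _) | apply: Rmult_le_pos; lra].
have ha0 : 0 <= a by apply: Rle_trans ha; exact: e_ge0.
have hn := fwU_nrm y b v n hy hb; have hp := pow2_pos (j * n); have h1n := h1 n.
have : 2 ^ (j * n) * nrm M n (fwU y b v) <= 2 ^ (j * n) * nrm M n v + 2 ^ (j * n) * e (fwP y b v n) b.
  by rewrite -Rmult_plus_distr_l; apply: Rmult_le_compat_l => //; lra.
case: n hn hp h1n => [|n] hn hp h1n.
  by rewrite Nat.mul_0_r /= in h1n *; lra.
have h3 := fwP_near y b v n hy hb; have h4 := scale_bound _ _ n _ _ hC h2.
have e1 : 2 ^ (j * S n) = 2 ^ j * 2 ^ (j * n) by rewrite -pow_add; congr pow; lia.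
have : 2 ^ (j * S n) * e (fwP y b v (S n)) b <= 2 ^ j * (C y * (b2 + ceta (S j))).
  rewrite e1 Rmult_assoc; apply: Rmult_le_compat_l; first exact: Rlt_le (pow2_pos _).
  apply: Rle_trans h4; apply: Rmult_le_compat_l => //; exact: Rlt_le (pow2_pos _).
lra.
Qed.

(** Decay of order 2 suffices: one order pays for the factor [2 ^ n] in [c_near], the other makes
    the error tend to 0. *)
Lemma fw_lim y b v d : ok Y y -> X y b -> (exists b2, cls1 M v 2 b2) -> 0 < d ->
  exists n0, forall n, (n0 <= n)%nat -> e (fwP y b v n) b <= d.
Proof.
move=> hy hb [b2 h2] hd; have hC := C_ge0 y hy.
have [n0 hn0] := half_pow_small (C y * (b2 + ceta 2)) d hd.
exists (S n0) => n hn; case: n hn => [|n] hn; first lia.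
apply: Rle_trans (fwP_near y b v n hy hb) _; apply: Rle_trans (hn0 n _); last lia.
have := scale_bound _ _ n _ _ hC h2; rewrite Nat.mul_1_l => h.
have hp := pow2_pos n; rewrite pow_inv; apply: (Rmult_le_reg_l (2 ^ n)) => //.
have -> : 2 ^ n * (C y * (b2 + ceta 2) * / 2 ^ n) = C y * (b2 + ceta 2) by field; lra.
exact: h.
Qed.

Lemma bwP_step y u j b : ok Y y -> cls1 M u (S j) b -> forall n,
  e (bwP y u n) (bwP y u (S n)) <= C y * (b + ceta (S j)) * (/ 2 ^ j) ^ n.
Proof.
move=> hy h n; have hC := C_ge0 y hy.
apply: Rle_trans (bwP_near y u n hy) _.
have := scale_bound _ _ n _ _ hC h => h1.
have hp := pow2_pos (j * n); rewrite pow_inv -pow_mult; apply: (Rmult_le_reg_l (2 ^ (j * n))) => //.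
have -> : 2 ^ (j * n) * (C y * (b + ceta (S j)) * / 2 ^ (j * n)) = C y * (b + ceta (S j)) by field; lra.
exact: h1.
Qed.

Lemma geom_tail (b : nat -> E) B K q : 0 <= K -> 0 <= q <= / 2 ->
  (forall n, e (b n) (b (S n)) <= K * q ^ n) ->
  (forall d, 0 < d -> exists n0, forall n, (n0 <= n)%nat -> e (b n) B <= d) ->
  forall n, e (b n) B <= 2 * K * q ^ n.
Proof.
move=> hK hq h1 h2 n.
have hqp : forall k, 0 <= q ^ k by move=> k; apply: pow_le; lra.
(* Telescoping: since [q <= / 2], a step [K * q ^ m] is at most [2 * K * (q ^ m - q ^ (m + 1))]. *)
have h3 : forall p, e (b n) (b (n + p)%nat) <= 2 * K * (q ^ n - q ^ (n + p)).
  elim=> [|p ih]; first by rewrite Nat.add_0_r e_refl; lra.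
  have := e_tri (b n) (b (n + p)%nat) (b (n + S p)%nat).
  have := h1 (n + p)%nat; rewrite Nat.add_succ_r /= => h4 h5.
  have hk := hqp (n + p)%nat.
  have : q * q ^ (n + p) <= / 2 * q ^ (n + p) by apply: Rmult_le_compat_r; lra.
  move=> h6; have : K * (2 * (q * q ^ (n + p))) <= K * q ^ (n + p) by apply: Rmult_le_compat_l; lra.
  lra.
apply: Rle_eps => d hd; have [n0 hn0] := h2 d hd.
have h4 := hn0 (n + n0)%nat ltac:(lia); have h5 := h3 n0.
have := e_tri (b n) (b (n + n0)%nat) B; have := hqp (n + n0)%nat => h6 h7.
have : 0 <= K * q ^ (n + n0) by apply: Rmult_le_pos.
lra.
Qed.

Lemma bwB_spec y u : ok Y y -> (exists b, cls1 M u 2 b) -> X y (bwB y u) /\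
  forall d, 0 < d -> exists n0, forall n, (n0 <= n)%nat -> e (bwP y u n) (bwB y u) <= d.
Proof.
move=> hy [b hb]; have hC := C_ge0 y hy; have hce := ceta_ge0 2; have hb2 := cls1_b0 _ _ _ _ hb.
apply: (epsilon_spec (inhabits (bwP y u O)) (fun B => X y B /\ forall d, 0 < d -> exists n0, forall n, (n0 <= n)%nat -> e (bwP y u n) B <= d)).
apply: (complete y _ (C y * (b + ceta 2))) => //; first by move=> n; exact: bwP_X.
  by apply: Rmult_le_pos; lra.
have := bwP_step y u 1 b hy hb; rewrite pow_1; exact.
Qed.

Lemma bwB_near y u j b b2 n : ok Y y -> (1 <= j)%nat -> (exists b, cls1 M u 2 b) -> cls1 M u (S j) b -> C y * (b + ceta (S j)) <= b2 ->
  e (bwP y u n) (bwB y u) <= 2 * b2 * (/ 2 ^ j) ^ n.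
Proof.
move=> hy hj hb2 hb hbb; have [h1 h2] := bwB_spec y u hy hb2.
have hC := C_ge0 y hy; have hce := ceta_ge0 (S j); have hb3 := cls1_b0 _ _ _ _ hb.
have hp := pow2_pos j.
have hi : 0 < / 2 ^ j by apply: Rinv_0_lt_compat.
have hle : / 2 ^ j <= / 2.
  apply: Rinv_le_contravar; first lra.
  by have := pow2_mono 1 j hj; rewrite pow_1.
have := geom_tail _ _ (C y * (b + ceta (S j))) (/ 2 ^ j) _ _ (bwP_step y u j b hy hb) h2 n.
have : 0 <= C y * (b + ceta (S j)) by apply: Rmult_le_pos; lra.
move=> h3 /(_ h3 (conj (Rlt_le _ _ hi) hle)) h4; apply: Rle_trans h4 _.
apply: Rmult_le_compat_r; last lra.
by apply: pow_le; lra.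
Qed.

Lemma bwV_nrm y u n : ok Y y -> (exists b, cls1 M u 2 b) ->
  nrm M n (bwV y u) <= nrm M n u + e (bwP y u n) (bwB y u).
Proof.
move=> hy h; have [h1 h2] := bwB_spec y u hy h; apply: nrm_add; first exact: e_ge0.
move=> m _; rewrite /bwV (_ : _ - _ = S_ n m y (bwP y u n) - S_ n m y (bwB y u)); last lra.
apply: S_lip => //; exact: bwP_X.
Qed.

Lemma cls1_bw y u j b1 b2 b3 : ok Y y -> (1 <= j)%nat -> (exists b, cls1 M u 2 b) -> cls1 M u j b1 ->
  cls1 M u (S j) b2 -> C y * (b2 + ceta (S j)) <= b3 ->
  cls1 M (bwV y u) j (b1 + 2 * b3).
Proof.
move=> hy hj h2 hb1 hb2 hb3 n.
have h3 := bwV_nrm y u n hy h2; have h4 := bwB_near y u j b2 b3 n hy hj h2 hb2 hb3.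
have h5 := hb1 n; have hp := pow2_pos (j * n).
have : 2 ^ (j * n) * nrm M n (bwV y u) <= 2 ^ (j * n) * nrm M n u + 2 ^ (j * n) * (2 * b3 * (/ 2 ^ j) ^ n).
  by rewrite -Rmult_plus_distr_l; apply: Rmult_le_compat_l => //; lra.
rewrite pow_inv -pow_mult.
have -> : 2 ^ (j * n) * (2 * b3 * / 2 ^ (j * n)) = 2 * b3 by field; lra.
lra.
Qed.

Lemma cls1_0 v b : cls1 M v 1 b -> cls1 M v 0 b.
Proof.
move=> h n; apply: Rle_trans (h n); apply: Rmult_le_compat_r; first exact: nrm_ge0.
by apply: pow2_mono; lia.
Qed.

Definition fwT (z : prodS totS VT) : prodS Y VT :=
  let y := fst (fst z) in let b := snd (fst z) in let v := fst (snd z) in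
  (y, (fwU y b v, fun k => sk M k (fwU y b v) + (snd (snd z) k - sk M k v))).

Definition bwT (z : prodS Y VT) : prodS totS VT :=
  let y := fst z in let u := fst (snd z) in
  ((y, bwB y u), (bwV y u, fun k => sk M k (bwV y u) + (snd (snd z) k - sk M k u))).

(** Converse to [sk_lt]. Since [fwT] and [bwT] preserve the difference [tau k - sk M k v], its
    positivity is all that has to be carried over. *)
Lemma good_majorant v tau : (forall k, exists b, cls1 M v (S k) b) -> (forall k, sk M k v < tau k) -> good M tau v.
Proof.
move=> h1 h2; split.
  move=> k; have [b hb] := h1 k; apply: Rle_lt_trans (h2 k); exact: sk_ge0 hb.
move=> n m hm; rewrite /beta.
have [k [hk ->]] := bmin_attain (fun k => tau k / 2 ^ (k * n)) n.
have [b hb] := h1 k; have h3 := sk_ub _ _ _ _ hb n hk.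
have hp := pow2_pos (k * n).
apply: Rle_lt_trans (nrm_ub _ _ _ _ hm) _.
apply: (Rmult_lt_reg_l (2 ^ (k * n))) => //.
have -> : 2 ^ (k * n) * (tau k / 2 ^ (k * n)) = tau k by field; lra.
exact: Rle_lt_trans h3 (h2 k).
Qed.

Lemma fwU_cls y b v tau : ok Y y -> X y b -> good M tau v -> forall j, exists a, cls1 M (fwU y b v) j a.
Proof.
move=> hy hb h j; eexists; apply: (cls1_fw _ _ _ _ _ _ _ hy hb); [exact: good_cls h | exact: good_cls h | exact: Rle_refl].
Qed.

Lemma bwV_cls y u tau : ok Y y -> good M tau u -> forall j, exists a, cls1 M (bwV y u) j a.
Proof.
move=> hy h j; have h2 : exists b, cls1 M u 2 b by eexists; exact: good_cls h.
(* [cls1_bw] covers the orders from 1 on, where the ratio [/ 2 ^ j] is at most 1/2; order 0 follows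
   from order 1. *)
have hS : forall j, exists a, cls1 M (bwV y u) (S j) a.
  move=> k; eexists; apply: (cls1_bw _ _ _ _ _ _ hy _ h2); [lia | exact: good_cls h | exact: good_cls h | exact: Rle_refl].
case: j => [|j]; last exact: hS.
have [a ha] := hS O; exists a; exact: cls1_0.
Qed.

Lemma e_lim N F (bs bs' : N -> E) b b' : filt F -> tends F (fun i => e (bs i) b) 0 ->
  tends F (fun i => e (bs' i) b') 0 -> tends F (fun i => e (bs i) (bs' i)) (e b b').
Proof.
move=> hF h1 h2 d hd; have hd2 : 0 < d / 2 by lra.
apply: (filt2 _ _ hF (h1 _ hd2) (h2 _ hd2)) => i.
rewrite !Rminus_0_r (Rabs_pos_eq (e (bs i) b)) // (Rabs_pos_eq (e (bs' i) b')) // => h3 h4.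
have t1 := e_tri (bs i) b (bs' i); have t2 := e_tri b b' (bs' i).
have t3 := e_tri b (bs i) b'; have t4 := e_tri (bs i) (bs' i) b'.
have s1 := e_sym b (bs i); have s2 := e_sym b' (bs' i).
apply: Rabs_le; lra.
Qed.

(** [bd] involves only two entries of the majorant, so convergence of the entries gives, for each
    order, a decay bound that holds uniformly along the filter. *)
Lemma ev_bd N F (ts : N -> nat -> R) t j : filt F -> (forall k, tends F (fun i => ts i k) (t k)) ->
  F (fun i => bd (ts i) j <= bd t j + 1).
Proof.
move=> hF h; have : tends F (fun i => bd (ts i) j) (bd t j).
  by apply: tends_plus => //; apply: tends_mult => //; exact: tends_const.
move=> /(_ 1 Rlt_0_1); move=> h1; apply: (filt1 _ hF h1) => i h2; have := Rle_abs (bd (ts i) j - bd t j); lra.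
Qed.

Lemma cls1_le v j b b' : b <= b' -> cls1 M v j b -> cls1 M v j b'.
Proof. by move=> h h1 n; apply: Rle_trans (h1 n) h. Qed.

Lemma cont_fw : cont (prodS totS (VTS M)) (prodS Y (VTS M)) fwT.
Proof.
split.
  move=> [[y b] [v tau]] [/= [hy hb] [_ h]]; split => //; split => //=.
  apply: good_majorant => k; first exact: fwU_cls hy hb h _.
  have := sk_lt _ _ _ k h; lra.
move=> N F zs [[y b] [v tau]] hF h1 [/= [hy hb] [_ h]] [/= [c1 c2] [c3 c4]].
pose ys i := fst (fst (zs i)); pose bs i := snd (fst (zs i)); pose vs i := fst (snd (zs i)); pose ts i := snd (snd (zs i)).
have hys : forall i, ok Y (ys i) by move=> i; apply (h1 i).
have hbs : forall i, X (ys i) (bs i) by move=> i; apply (h1 i).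
have hgs : forall i, good M (ts i) (vs i) by move=> i; apply (h1 i).
have hP : forall n, tends F (fun i => e (fwP (ys i) (bs i) (vs i) n) (fwP y b v n)) 0.
  case=> [|n] /=; apply: c_cv => //; first by move=> m; exact: tends_const.
  by move=> m; apply: tends_plus => //; [exact: c3 | exact: S_cv].
have hU : forall n m, tends F (fun i => fwU (ys i) (bs i) (vs i) n m) (fwU y b v n m).
  move=> n m; apply: tends_minus => //.
    by apply: tends_plus => //; [exact: c3 | exact: S_cv].
  by apply: S_cv => // [i|]; exact: fwP_X.
split; [exact: c1 | split; [exact: hU |]] => k.
have hC1 := C_cv _ _ _ _ hF hys hy c1.
have hC2 : F (fun i => C (ys i) <= C y + 1).
  by apply: (filt1 _ hF (hC1 1 Rlt_0_1)) => i h2; have := Rle_abs (C (ys i) - C y); lra.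
have hE : F (fun i => e (c O (ys i) (fun _ => 0)) (bs i) <= e (c O y (fun _ => 0)) b + 1).
  have := e_lim _ _ _ _ _ _ hF (hP O) c2 1 Rlt_0_1; move=> h2; apply: (filt1 _ hF h2) => i h3; have h4 := Rle_trans _ _ _ (Rle_abs _) h3; rewrite /= -/(bs i) in h4; lra.
apply: tends_plus => //; last apply: tends_minus => //.
- pose b1 := bd tau (S k) + 1; pose b2 := bd tau (S (S k)) + 1; pose a := e (c O y (fun _ => 0)) b + 1.
  pose K := b1 + a + 2 ^ (S k) * ((C y + 1) * (b2 + ceta (S (S k)))).
  have hce := ceta_ge0 (S (S k)).
  (* The bound [K] serves both the limit point and, eventually, the members of the family, as
     [tends_sk] demands. *)
  have mono : forall y' b' v' tau', ok Y y' -> X y' b' -> good M tau' v' -> C y' <= C y + 1 ->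
     e (c O y' (fun _ => 0)) b' <= a -> bd tau' (S k) <= b1 -> bd tau' (S (S k)) <= b2 ->
     cls1 M (fwU y' b' v') (S k) K.
    move=> y' b' v' tau' ok1 ok2 ok3 le1 le2 le3 le4.
    have hg1 := cls1_le _ _ _ _ le3 (good_cls _ _ _ (S k) ok3).
    have hg2 := cls1_le _ _ _ _ le4 (good_cls _ _ _ (S (S k)) ok3).
    have hb2 := cls1_b0 _ _ _ _ hg2.
    apply: cls1_le (cls1_fw _ _ _ _ _ _ _ ok1 ok2 hg1 hg2 le2).
    apply: Rplus_le_compat_l; apply: Rmult_le_compat_l; first exact: Rlt_le (pow2_pos _).
    by apply: Rmult_le_compat_r; lra.
  apply: (tends_sk _ _ _ _ _ K) => //.
    apply: (filt2 _ _ hF hC2 (filt2 (P := fun i => _ /\ _) _ _ hF hE (filt2 (P := fun i => _ /\ _) _ _ hF (ev_bd _ _ _ _ (S k) hF c4) (ev_bd _ _ _ _ (S (S k)) hF c4) (fun i a b => conj a b)) (fun i a b => conj a b))).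
    by move=> i k1 [k2 [k3 k4]]; exact: (mono _ _ _ _ (hys i) (hbs i) (hgs i)).
  by apply: (mono _ _ _ _ hy hb h); rewrite /a /b1 /b2; lra.
- apply: (tends_sk _ _ _ _ _ (bd tau (S k) + 1)) => //.
    apply: (filt1 _ hF (ev_bd _ _ _ _ (S k) hF c4)) => i hi; exact: cls1_le hi (good_cls _ _ _ _ (hgs i)).
  by apply: cls1_le (good_cls _ _ _ _ h); lra.
Qed.

Lemma cont_bw : cont (prodS Y (VTS M)) (prodS totS (VTS M)) bwT.
Proof.
have ex2 : forall tau u, good M tau u -> exists b, cls1 M u 2 b by move=> tau u hh; eexists; exact: good_cls hh.
split.
  move=> [y [u tau]] [/= hy [_ h]]; split; last first.
    split => //=; apply: good_majorant => k; first exact: bwV_cls hy h _.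
    have := sk_lt _ _ _ k h; lra.
  by split => //=; apply (bwB_spec y u hy); exact: ex2 h.
move=> N F zs [y [u tau]] hF h1 [/= hy [_ h]] [/= c1 [c3 c4]].
pose ys i := fst (zs i); pose us i := fst (snd (zs i)); pose ts i := snd (snd (zs i)).
have hys : forall i, ok Y (ys i) by move=> i; apply (h1 i).
have hgs : forall i, good M (ts i) (us i) by move=> i; apply (h1 i).
have hP : forall n, tends F (fun i => e (bwP (ys i) (us i) n) (bwP y u n)) 0.
  elim=> [|n ih] /=; apply: c_cv => //; first by move=> m; exact: tends_const.
  move=> m; apply: tends_plus => //; first exact: c3.
  by apply: S_cv => // [i|]; exact: bwP_X.
have hC1 := C_cv _ _ _ _ hF hys hy c1.
have hC2 : F (fun i => C (ys i) <= C y + 1).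
  by apply: (filt1 _ hF (hC1 1 Rlt_0_1)) => i h2; have := Rle_abs (C (ys i) - C y); lra.
pose Kj j := (C y + 1) * (bd tau (S j) + 1 + ceta (S j)).
have leK : forall j y' tau' u', ok Y y' -> good M tau' u' -> C y' <= C y + 1 -> bd tau' (S j) <= bd tau (S j) + 1 ->
   C y' * (bd tau' (S j) + ceta (S j)) <= Kj j.
  move=> j y' tau' u' o1 o2 o3 o4; rewrite /Kj; have hce := ceta_ge0 (S j).
  have hb := cls1_b0 _ _ _ _ (good_cls _ _ _ (S j) o2); have hc := C_ge0 _ o1.
  by apply: Rmult_le_compat; lra.
(* Three terms: both limits are replaced by their [n0]-th approximations, with an error uniform
   along the filter, and these approximations converge by [hP]. *)
have hB : tends F (fun i => e (bwB (ys i) (us i)) (bwB y u)) 0.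
  move=> d hd; have hd3 : 0 < d / 3 by lra.
  have [n0 hn0] := half_pow_small (2 * Kj 1%nat) _ hd3; have hn := hn0 n0 (le_n _).
  have far : forall y' tau' u', ok Y y' -> good M tau' u' -> C y' <= C y + 1 -> bd tau' 2 <= bd tau 2 + 1 ->
     e (bwP y' u' n0) (bwB y' u') <= d / 3.
    move=> y' tau' u' o1 o2 o3 o4.
    apply: Rle_trans (bwB_near _ _ 1 _ _ n0 o1 (le_n _) (ex2 _ _ o2) (good_cls _ _ _ 2 o2) (leK 1%nat _ _ _ o1 o2 o3 o4)) _.
    by rewrite pow_1.
  have f1 := far y tau u hy h ltac:(lra) ltac:(lra).
  apply: (filt2 _ _ hF (hP n0 _ hd3) (filt2 (P := fun i => _ /\ _) _ _ hF hC2 (ev_bd _ _ _ _ 2 hF c4) (fun i a b => conj a b))).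
  move=> i; rewrite !Rminus_0_r !Rabs_pos_eq; try exact: e_ge0.
  move=> k1 [k2 k3]; have f2 := far _ _ _ (hys i) (hgs i) k2 k3.
  have t1 := e_tri (bwB (ys i) (us i)) (bwP (ys i) (us i) n0) (bwB y u).
  have t2 := e_tri (bwP (ys i) (us i) n0) (bwP y u n0) (bwB y u).
  rewrite (e_sym (bwB (ys i) (us i)) (bwP _ _ _)) in t1; lra.
have hXB : forall y' tau' u', ok Y y' -> good M tau' u' -> X y' (bwB y' u').
  by move=> y' tau' u' o1 o2; apply (bwB_spec y' u' o1); exact: ex2 o2.
have hV : forall n m, tends F (fun i => bwV (ys i) (us i) n m) (bwV y u n m).
  move=> n m; apply: tends_minus => //.
    apply: tends_plus => //; first exact: c3.
    by apply: S_cv => // [i|]; exact: bwP_X.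
  apply: S_cv => // [i|]; last exact: hXB h.
  exact: hXB (hys i) (hgs i).
split; first by split; [exact: c1 | exact: hB].
split; [exact: hV |] => k /=.
apply: tends_plus => //; last apply: tends_minus => //.
- pose K := bd tau (S k) + 1 + 2 * Kj (S k).
  have mono : forall y' tau' u', ok Y y' -> good M tau' u' -> C y' <= C y + 1 ->
     bd tau' (S k) <= bd tau (S k) + 1 -> bd tau' (S (S k)) <= bd tau (S (S k)) + 1 ->
     cls1 M (bwV y' u') (S k) K.
    move=> y' tau' u' o1 o2 le1 le3 le4.
    apply: cls1_le (cls1_bw _ _ (S k) _ _ _ o1 ltac:(lia) (ex2 _ _ o2) (good_cls _ _ _ _ o2) (good_cls _ _ _ _ o2) (leK _ _ _ _ o1 o2 le1 le4)).
    rewrite /K; lra.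
  apply: (tends_sk _ _ _ _ _ K) => //.
    apply: (filt2 _ _ hF hC2 (filt2 (P := fun i => _ /\ _) _ _ hF (ev_bd _ _ _ _ (S k) hF c4) (ev_bd _ _ _ _ (S (S k)) hF c4) (fun i a b => conj a b))).
    by move=> i k1 [k3 k4]; exact: (mono _ _ _ (hys i) (hgs i)).
  by apply: (mono _ _ _ hy h); lra.
- apply: (tends_sk _ _ _ _ _ (bd tau (S k) + 1)) => //.
    apply: (filt1 _ hF (ev_bd _ _ _ _ (S k) hF c4)) => i hi; exact: cls1_le hi (good_cls _ _ _ _ (hgs i)).
  by apply: cls1_le (good_cls _ _ _ _ h); lra.
Qed.

Theorem factor : hov (prodS totS Rw) (prodS Y Rw) (fun z => fst (fst z)) (fun z => fst z).
Proof.
have key : hov (prodS totS (VTS M)) (prodS Y (VTS M)) (fun z => fst (fst z)) (fun z => fst z).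
  exists fwT, bwT; split; first exact: cont_fw.
  split; first exact: cont_bw.
  split; last split => //.
    move=> [[y b] [v tau]] [/= [hy hb] [_ h]]; rewrite /fwT /bwT /=.
    have eB : bwB y (fwU y b v) = b.
      apply: limE_eq => // d hd; have [n0 hn0] := fw_lim y b v d hy hb (ex_intro _ _ (good_cls _ _ _ 2 h)) hd.
      by exists n0 => n hn; rewrite bwP_fw; exact: hn0.
    have eV : bwV y (fwU y b v) = v.
      apply: functional_extensionality => n; apply: functional_extensionality => m.
      by rewrite /bwV eB bwP_fw /fwU; lra.
    rewrite eB eV; do 2 congr pair; apply: functional_extensionality => k; lra.
  move=> [y [u tau]] [/= hy [_ h]]; rewrite /fwT /bwT /=.
  have eU : fwU y (bwB y u) (bwV y u) = u.
    apply: functional_extensionality => n; apply: functional_extensionality => m.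
    by rewrite /fwU fwP_bw /bwV; lra.
  rewrite eU; do 2 congr pair; apply: functional_extensionality => k; lra.
have hR : iso (VTS M) Rw by apply: hov_trans (iso_VTS M) iso_VT.
apply: hov_trans (hov_prod _ _ _ _ (fun z : totS => fst z) _ (hov_refl totS _) (hov_sym _ _ _ _ hR)) _.
apply: hov_trans key _.
exact: (hov_prod _ _ _ _ (fun z : Y => z) (fun z : Y => z) (hov_refl Y _) hR).
Qed.
End Factor.

(** * Half-lines are absorbed by the countable power of the line *)

Definition unitS : space := Space unit (fun _ => True) (fun _ _ _ _ => True).
Definition Hsp : space := subS Rsp (fun t => 0 <= t).
Definition Hw : space := funS nat Hsp.

(** The factor theorem over a one-point base with the half-line as fibre: the only number read off
    from [b] is [b] itself, the decoder is the retraction [Rmax 0], and [eta] is 0. *)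
Lemma iso_half : iso (prodS Hsp Rw) Rw.
Proof.
have h := factor unitS R (fun _ t => 0 <= t) (fun a b => Rabs (a - b)) (fun _ => 1%nat)
  (fun _ _ _ b => b) (fun _ _ w => Rmax 0 (w O)) (fun _ => 0) (fun _ => 0) (fun _ => 1).
have h1 : hov (prodS (totS unitS R (fun _ t => 0 <= t) (fun a b => Rabs (a - b))) Rw)
    (prodS unitS Rw) (fun z => fst (fst z)) (fun z => fst z).
  { apply: h => //.
  - move=> a b; exact: Rabs_pos.
  - move=> a; rewrite Rminus_diag; exact: Rabs_R0.
  - move=> a b; exact: Rabs_minus_sym.
  - move=> a b d; have -> : a - d = (a - b) + (b - d) by ring.
    exact: Rabs_triang.
  - move=> _ a b _ _ _ hab; rmx.
  - move=> _ b K _ hb hK hstep.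
    have hc : Cauchy_crit b.
      move=> eps heps; have [n0 hn0] := half_pow_small (2 * K) (eps / 2) ltac:(lra).
      have close : forall n p, Rabs (b n - b (n + p)%nat) <= 2 * K * ((/ 2) ^ n - (/ 2) ^ (n + p)).
        move=> n; elim=> [|p ih]; first by rewrite Nat.add_0_r !Rminus_diag Rabs_R0; lra.
        rewrite Nat.add_succ_r /=; have := hstep (n + p)%nat; move: ih; rmx.
      have close2 : forall n m, (n0 <= n)%nat -> (n <= m)%nat -> Rabs (b n - b m) <= eps / 2.
        move=> n m hn hm; have := close n (m - n)%nat; have -> : (n + (m - n) = m)%nat by lia.
        have := hn0 n hn; have : 0 <= (/ 2) ^ m by apply: pow_le; lra.
        move=> h2 h3 h4; have : 0 <= K * (/ 2) ^ m by apply: Rmult_le_pos.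
        lra.
      exists n0 => n m hn hm; rewrite /Rdist; case: (le_lt_dec n m) => hnm.
        have := close2 n m ltac:(lia) hnm; lra.
      have := close2 m n ltac:(lia) ltac:(lia); rewrite Rabs_minus_sym; lra.
    have [B hB] := R_complete b hc; exists B; split.
      apply: Rnot_lt_le => hneg; have [n hn] := hB (- B) ltac:(lra).
      have := hn n (le_n _); have := hb n; rewrite /Rdist; rmx.
    move=> d hd; have [n0 hn0] := hB d hd; exists n0 => n hn.
    have := hn0 n ltac:(lia); rewrite /Rdist; lra.
  - move=> _ _ _ a b _ _ _; lra.
  - move=> _ _ N F ys y bs b hF _ _ _ _ _ h1 ep hep; apply: (filt1 _ hF (h1 _ hep)) => i.
    by rewrite Rminus_0_r Rabs_Rabsolu.
  - move=> _ _ w _; exact: Rmax_l.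
  - move=> _ N F ys y ws w hF _ _ _ h1.
    have h2 : tends F (fun i => Rmax 0 (ws i O)) (Rmax 0 (w O)) by apply: tends_max => //; exact: tends_const.
    by move=> ep hep; apply: (filt1 _ hF (h2 _ hep)) => i; rewrite Rminus_0_r Rabs_Rabsolu.
  - move=> _ _; lra.
  - move=> N F ys y hF _ _ _; exact: tends_const.
  - move=> n _ w b d _ hb hd /(_ O ltac:(lia)) hw; have h1 := pow2_ge1 n.
    have h2 : Rabs (Rmax 0 (w O) - b) <= d by move: hw; rmx.
    nra.
  - move=> _; lra.
  - move=> k n; lra.
  }
have h2 : iso (prodS Hsp Rw) (prodS (totS unitS R (fun _ t => 0 <= t) (fun a b => Rabs (a - b))) Rw).
  apply: (hov_prod Hsp (totS unitS R (fun _ t => 0 <= t) (fun a b => Rabs (a - b))) Rw Rw (fun _ => tt) (fun _ => tt) _ (hov_refl _ _)).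
  exists (fun t => (tt, t)), (fun z => snd z).
  split.
    split; first by move=> t [_ ht].
    move=> N F xs x0 hF _ _ hx; split => // ep hep; apply: (filt1 _ hF (hx _ hep)) => i /=.
    by rewrite Rminus_0_r Rabs_Rabsolu.
  split.
    split; first by move=> [u t] [_ ht].
    move=> N F xs x0 hF _ _ [_ hx] ep hep; apply: (filt1 _ hF (hx _ hep)) => i /=.
    by rewrite Rminus_0_r Rabs_Rabsolu.
  by split => //; split => // -[[] t].
apply: hov_trans h2 _; apply: (hov_trans _ (prodS unitS Rw) _ _ (fun _ => tt)).
  move: h1 => [f [g [hf [hg [e1 [e2 _]]]]]]; by exists f, g.
exists (fun z => snd z), (fun t => (tt, t)).
split; first by split; [move=> [u t] [] | move=> N F xs x0 _ _ _ []].
split; first by split; [move=> t ht; split | move=> N F xs x0 _ _ _; split].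
by split; [move=> [[] t] | split].
Qed.

Lemma iso_Hw : iso (prodS Hw Rw) Rw.
Proof.
have h1 : iso (prodS Hw Rw) (prodS Hw (funS nat Rw)).
  exact: (hov_prod Hw Hw Rw (funS nat Rw) (fun _ => tt) (fun _ => tt) (hov_refl _ _) (hov_sym _ _ _ _ iso_Rw_nat)).
apply: hov_trans h1 _; apply: (hov_trans _ _ _ _ (fun _ => tt)  _ (hov_sym _ _ _ _ (iso_fprod nat Hsp Rw))).
apply: hov_trans iso_Rw_nat; exact: iso_funS iso_half.
Qed.

Definition majS (X : space) (thr : X -> nat -> R) : space :=
  subS (prodS X (funS nat Rsp)) (fun z => forall k, thr (fst z) k <= snd z k).

Lemma hov_maj {B} (X : space) (p : X -> B) thr :
  (forall k (N : Type) F (xs : N -> X) x0, filt F -> (forall i, ok X (xs i)) -> ok X x0 -> cv X N F xs x0 ->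
     tends F (fun i => thr (xs i) k) (thr x0 k)) ->
  hov (prodS X Hw) (majS X thr) (fun z => p (fst z)) (fun z => p (fst z)).
Proof.
move=> hthr.
exists (fun z => (fst z, fun k => snd z k + thr (fst z) k)), (fun z => (fst z, fun k => snd z k - thr (fst z) k)).
split.
  split.
    by move=> [x t] [/= hx ht]; split => //= k; have [_ /= h1] := ht k; lra.
  move=> N F zs z hF h1 [h2 _] [h3 h4]; split => //= k; apply: tends_plus => //; first exact: h4.
  by apply: hthr => // i; apply (h1 i).
split.
  split.
    by move=> [x t] [[/= hx _] ht]; split => //= k; split => //; have := ht k; lra.
  move=> N F zs z hF h1 [[h2 _] _] [h3 h4]; split => //= k; apply: tends_minus => //; first exact: h4.
  by apply: hthr => // i; apply (h1 i).
split; first by move=> [x t] _ /=; congr pair; apply: functional_extensionality => k; lra.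
by split => // -[x t] _ /=; congr pair; apply: functional_extensionality => k; lra.
Qed.

Lemma absorb_Hw {B} (X : space) (p : X -> B) :
  hov (prodS X Rw) (prodS (prodS X Hw) Rw) (fun z => p (fst z)) (fun z => p (fst (fst z))).
Proof.
apply: hov_trans (hov_sym _ _ _ _ (hov_assoc X Hw Rw p)).
exact: hov_prod (hov_refl X p) (hov_sym _ _ _ _ iso_Hw).
Qed.

(** Subtracting the continuous threshold turns the adjoined sequences into points of [Hw], which
    [Rw] absorbs. So data bounded below by a continuous function of the point, such as lower bounds
    for a set, can be adjoined for free. *)
Lemma absorb_maj {B} (X : space) (p : X -> B) thr :
  (forall k (N : Type) F (xs : N -> X) x0, filt F -> (forall i, ok X (xs i)) -> ok X x0 -> cv X N F xs x0 ->
     tends F (fun i => thr (xs i) k) (thr x0 k)) ->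
  hov (prodS X Rw) (prodS (majS X thr) Rw) (fun z => p (fst z)) (fun z => p (fst (fst z))).
Proof.
move=> h; apply: hov_trans (absorb_Hw X p) _.
exact: (hov_prod _ _ _ _ (fun z : prodS X Hw => p (fst z)) (fun z : majS X thr => p (fst z)) (hov_maj X p thr h) (hov_refl _ _)).
Qed.

(** * Ultrafilters *)

Definition ultra {N : Type} (U : (N -> Prop) -> Prop) : Prop :=
  filt U /\ ~ U (fun _ => False) /\ forall P, U P \/ U (fun m => ~ P m).

Lemma ultra_ex {N : Type} (F : (N -> Prop) -> Prop) : filt F -> ~ F (fun _ => False) ->
  exists U, ultra U /\ forall P, F P -> U P.
Proof.
move=> hF hp.
have pf : filter.ProperFilter F.
  constructor; first exact: hp.
  constructor.
  - exact: (proj1 hF).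
  - by move=> P Q; exact: (proj1 (proj2 hF)).
  - by move=> P Q h1; apply: (proj2 (proj2 hF)).
have [U [hU hs]] := @filter.ultraFilterLemma N F pf.
have hUp : filter.ProperFilter U by case: hU.
have hUf : filter.Filter U by case: hUp.
exists U; split; last exact: hs.
split.
  split; first exact: (@filter.filterT _ U hUf).
  split; first by move=> P Q; exact: (@filter.filterI _ U hUf P Q).
  by move=> P Q h; exact: (@filter.filterS _ U hUf P Q).
split; first exact: (@filter.filter_not_empty _ U hUp).
by move=> P; exact: (@filter.in_ultra_setVsetC _ U P hU).
Qed.

Lemma ulim_R {N : Type} (U : (N -> Prop) -> Prop) (f : N -> R) lo hi : ultra U ->
  U (fun m => lo <= f m <= hi) -> exists x, tends U f x.
Proof.
move=> [hU [hp hd]] hf.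
(* The limit is the supremum of the reals lying below [f] on a set of the ultrafilter. *)
pose Es := fun r => U (fun m => r <= f m).
have hb : forall r, Es r -> r <= hi.
  move=> r hr; apply: Rnot_lt_le => h; apply: hp; apply: (filt2 _ _ hU hr hf) => m; lra.
have hlo : Es lo by apply: (filt1 _ hU hf) => m; lra.
have [l1 l2] := supr_lub Es hi (ex_intro _ lo hlo) hb.
exists (supr Es) => ep hep.
have [r [hr1 hr2]] : exists r, Es r /\ supr Es - ep < r.
  by apply: (supr_approx Es hi _ (ex_intro _ lo hlo) hb); lra.
have h2 : U (fun m => ~ (supr Es + ep <= f m)).
  case: (hd (fun m => supr Es + ep <= f m)) => // h3; have := l1 _ h3; lra.
apply: (filt2 _ _ hU hr1 h2) => m h3 /Rnot_le_lt h4; apply: Rabs_le; lra.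
Qed.

(** * Hausdorff nearness and max-times convexity *)

Section Sets.
Context {I : Type}.
Notation T := (I -> R).

Definition cube (a : T) : Prop := forall i, 0 <= a i <= 1.

Definition hl (w : T) (ep : R) (A B : T -> Prop) : Prop :=
  forall a, A a -> exists b, B b /\ forall i, w i * Rabs (a i - b i) <= ep.

Definition hn (w : T) (ep : R) (A B : T -> Prop) : Prop := hl w ep A B /\ hl w ep B A.

Lemma hl_refl w ep A : 0 <= ep -> hl w ep A A.
Proof. by move=> h a ha; exists a; split => // i; rewrite Rminus_diag Rabs_R0; lra. Qed.

Lemma hl_mono w w' ep ep' A B : (forall i, w' i <= w i) -> ep <= ep' -> hl w ep A B -> hl w' ep' A B.
Proof.
move=> hw he h a /h [b [hb h1]]; exists b; split => // i.
have := h1 i; have := Rabs_pos (a i - b i); have := hw i.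
move=> h2 h3 h4; have : w' i * Rabs (a i - b i) <= w i * Rabs (a i - b i) by apply: Rmult_le_compat_r.
lra.
Qed.

Lemma hl_trans w e1 e2 A B D : (forall i, 0 <= w i) -> hl w e1 A B -> hl w e2 B D -> hl w (e1 + e2) A D.
Proof.
move=> hw h1 h2 a /h1 [b [/h2 [d [hd h4]] h3]]; exists d; split => // i.
have := h3 i; have := h4 i; have := hw i.
have -> : a i - d i = (a i - b i) + (b i - d i) by ring.
have := Rabs_triang (a i - b i) (b i - d i); nra.
Qed.

Lemma hn_sym w ep A B : hn w ep A B -> hn w ep B A.
Proof. by case. Qed.

Lemma hn_refl w ep A : 0 <= ep -> hn w ep A A.
Proof. by split; exact: hl_refl. Qed.

Lemma hn_mono w w' ep ep' A B : (forall i, w' i <= w i) -> ep <= ep' -> hn w ep A B -> hn w' ep' A B.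
Proof. by move=> h1 h2 [h3 h4]; split; apply: hl_mono; eassumption. Qed.

Lemma hn_trans w e1 e2 A B D : (forall i, 0 <= w i) -> hn w e1 A B -> hn w e2 B D -> hn w (e1 + e2) A D.
Proof.
move=> hw [h1 h2] [h3 h4]; split; first by apply: hl_trans; eassumption.
by rewrite Rplus_comm; apply: hl_trans; eassumption.
Qed.

(** With this weight [hn] is Hausdorff nearness in the coordinates of [l], a basic entourage for the
    product topology. *)
Definition ind (l : list I) : T := fun i => if excluded_middle_informative (In i l) then 1 else 0.

Lemma ind_in l i : In i l -> ind l i = 1.
Proof. by move=> h; rewrite /ind; case: excluded_middle_informative. Qed.
Lemma ind_out l i : ~ In i l -> ind l i = 0.
Proof. by move=> h; rewrite /ind; case: excluded_middle_informative. Qed.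
Lemma ind01 l i : 0 <= ind l i <= 1.
Proof. by rewrite /ind; case: excluded_middle_informative => _; lra. Qed.

Lemma ind_le (l : list I) ep (a b : T) : 0 <= ep -> (forall i, In i l -> Rabs (a i - b i) <= ep) ->
  forall i, ind l i * Rabs (a i - b i) <= ep.
Proof.
move=> he h i; case: (classic (In i l)) => hi; first by rewrite ind_in // Rmult_1_l; exact: h.
by rewrite ind_out // Rmult_0_l.
Qed.

Lemma ind_ge (l : list I) ep (a b : T) : (forall i, ind l i * Rabs (a i - b i) <= ep) ->
  forall i, In i l -> Rabs (a i - b i) <= ep.
Proof. by move=> h i hi; have := h i; rewrite ind_in // Rmult_1_l. Qed.

Definition htends {N : Type} (F : (N -> Prop) -> Prop) (As : N -> T -> Prop) (A : T -> Prop) : Prop :=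
  forall l ep, 0 < ep -> F (fun m => hn (ind l) ep (As m) A).

(** The Hausdorff distance with weights [w], truncated at 1. *)
Definition ed (w : T) (A B : T -> Prop) : R := infr (fun ep => 0 <= ep /\ (1 <= ep \/ hn w ep A B)).

Section Ed.
Context (w : T) (hw : forall i, 0 <= w i).

Lemma ed_ge0 A B : 0 <= ed w A B.
Proof. by apply: infr_ge; [exists 1; split; [lra | left; lra] | move=> x []]. Qed.

Lemma ed_le A B ep : 0 <= ep -> hn w ep A B -> ed w A B <= ep.
Proof. by move=> h1 h2; apply: (infr_lb _ 0); [move=> x [] | split => //; right]. Qed.

Lemma ed_le1 A B : ed w A B <= 1.
Proof. by apply: (infr_lb _ 0); [move=> x [] | split; [lra | left; lra]]. Qed.

Lemma ed_lt A B ep : ed w A B < ep -> exists d, 0 <= d < ep /\ (1 <= d \/ hn w d A B).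
Proof.
move=> h; have [||d [[h1 h2] h3]] := infr_approx _ 0 ep _ _ h.
- by exists 1; split; [lra | left; lra].
- by move=> x [].
- by exists d.
Qed.

Lemma ed_lt1 A B ep : ed w A B < ep -> ep <= 1 -> hn w ep A B.
Proof.
move=> /ed_lt [d [h1 [h2|h2]]] h3; first lra.
by apply: hn_mono h2; [move=> i; lra | lra].
Qed.

Lemma ed_refl A : ed w A A = 0.
Proof. by apply: Rle_antisym; [apply: ed_le; [lra | apply: hn_refl; lra] | exact: ed_ge0]. Qed.

Lemma ed_sym A B : ed w A B = ed w B A.
Proof.
suff h : forall A B, ed w A B <= ed w B A by apply: Rle_antisym.
move=> A' B'; apply: Rle_eps => d hd.
have [d' [h1 [h2|h2]]] := ed_lt B' A' (ed w B' A' + d) ltac:(lra).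
  by have := ed_le1 A' B'; lra.
by apply: Rle_trans (ed_le _ _ d' _ (hn_sym _ _ _ _ h2)) _; lra.
Qed.

Lemma ed_tri A B D : ed w A D <= ed w A B + ed w B D.
Proof.
apply: Rle_eps => d hd.
have [d1 [h1 [h2|h2]]] := ed_lt A B (ed w A B + d / 2) ltac:(lra).
  by have := ed_le1 A D; have := ed_ge0 B D; lra.
have [d2 [h3 [h4|h4]]] := ed_lt B D (ed w B D + d / 2) ltac:(lra).
  by have := ed_le1 A D; have := ed_ge0 A B; lra.
apply: Rle_trans (ed_le _ _ (d1 + d2) _ (hn_trans _ _ _ _ _ _ hw h2 h4)) _; lra.
Qed.

Lemma ed_dist A B D : Rabs (ed w A D - ed w B D) <= ed w A B.
Proof.
have h1 := ed_tri A B D; have h2 := ed_tri B A D; rewrite (ed_sym B A) in h2.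
apply: Rabs_le; lra.
Qed.
End Ed.

(** Such weights exist only when [al] is countable. Weights tending to 0 make the weighted supremum
    distance compatible with the product topology on [0,1]-valued functions that are constant
    outside [al]. *)
Definition wt (al : I -> Prop) (w : T) : Prop :=
  (forall i, 0 <= w i <= 1) /\ (forall i, al i -> 0 < w i) /\
  (forall d, 0 < d -> exists l, forall i, ~ In i l -> w i <= d).

Definition supp (al : I -> Prop) (A : T -> Prop) : Prop :=
  forall a, A a -> cube a /\ forall i, ~ al i -> a i = 1.

Lemma wt_pos al w l ep : wt al w -> 0 < ep -> exists d, 0 < d <= 1 / 2 /\ forall i, In i l -> al i -> d <= w i * ep.
Proof.
move=> [h0 [h1 _]] he; elim: l => [|j l [d [hd ih]]].
  by exists (1 / 2); split; [lra | move=> i []].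
case: (classic (al j)) => hj; last first.
  by exists d; split => // i [<-|hi] // hal; exact: ih.
have := h1 j hj => hwj; have hp : 0 < w j * ep by apply: Rmult_lt_0_compat.
exists (Rmin d (w j * ep)); split; first by rmx.
by move=> i [<-|hi] hal; [exact: Rmin_r | exact: Rle_trans (Rmin_l _ _) (ih _ hi hal)].
Qed.

Lemma hn_ind_of_wt al w l ep d A B : supp al A -> supp al B -> (forall i, 0 <= w i) -> 0 < ep ->
  (forall i, In i l -> al i -> 0 < w i /\ d <= w i * ep) -> hn w d A B -> hn (ind l) ep A B.
Proof.
move=> hA hB hw he hd.
have hh : forall A B, supp al A -> supp al B -> hl w d A B -> hl (ind l) ep A B.
  move=> A' B' hA' hB' h a ha; have [b [hb h1]] := h a ha; exists b; split => //.
  apply: ind_le; first lra.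
  move=> i hi; case: (classic (al i)) => hal.
    have [hwi h2] := hd i hi hal; apply: (Rmult_le_reg_l (w i)) => //; have := h1 i; lra.
  by rewrite (proj2 (hA' _ ha)) // (proj2 (hB' _ hb)) // Rminus_diag Rabs_R0; lra.
by move=> [h1 h2]; split; apply: hh.
Qed.

Lemma hn_wt_of_ind al w l ep A B : supp al A -> supp al B -> wt al w -> 0 <= ep ->
  (forall i, ~ In i l -> w i <= ep) -> hn (ind l) ep A B -> hn w ep A B.
Proof.
move=> hA hB [hw _] he hd.
have hh : forall A B, supp al A -> supp al B -> hl (ind l) ep A B -> hl w ep A B.
  move=> A' B' hA' hB' h a ha; have [b [hb h1]] := h a ha; exists b; split => // i.
  have := hw i => hwi; have ca := proj1 (hA' a ha) i; have cb := proj1 (hB' b hb) i.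
  case: (classic (In i l)) => hi.
    have := ind_ge _ _ _ _ h1 i hi; have := Rabs_pos (a i - b i); nra.
  have := hd i hi; have : Rabs (a i - b i) <= 1 by apply: Rabs_le; lra.
  have := Rabs_pos (a i - b i); nra.
by move=> [h1 h2]; split; apply: hh.
Qed.

(** Finitely many coordinates of [al] have weights bounded away from 0, and the coordinates outside
    [al] are constant. Together with the converse [htends_ed], a single pseudo-metric replaces all
    finite lists of coordinates. *)
Lemma ed_htends {N : Type} (F : (N -> Prop) -> Prop) al w As A : filt F -> wt al w ->
  (forall m, supp al (As m)) -> supp al A -> tends F (fun m => ed w (As m) A) 0 -> htends F As A.
Proof.
move=> hF hw hAs hA h l ep hep; have [d [hd1 hd2]] := wt_pos al w l ep hw hep.
have hw0 : forall i, 0 <= w i by move=> i; apply (proj1 hw i).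
have hd : 0 < d / 2 by lra.
apply: (filt1 _ hF (h _ hd)) => m; rewrite Rminus_0_r Rabs_pos_eq; last exact: ed_ge0.
move=> h1; apply: (hn_ind_of_wt al w l ep d) => //.
  by move=> i hi hal; split; [exact: (proj1 (proj2 hw)) | exact: hd2].
by apply: ed_lt1 => //; lra.
Qed.

Lemma htends_ed {N : Type} (F : (N -> Prop) -> Prop) al w As A : filt F -> wt al w ->
  (forall m, supp al (As m)) -> supp al A -> htends F As A -> tends F (fun m => ed w (As m) A) 0.
Proof.
move=> hF hw hAs hA h ep hep; have [l hl0] := proj2 (proj2 hw) ep hep.
apply: (filt1 _ hF (h l _ hep)) => m h1; rewrite Rminus_0_r Rabs_pos_eq; last exact: ed_ge0.
apply: ed_le => //; first lra.
by apply: (hn_wt_of_ind al w l) => //; lra.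
Qed.

(** ** Closures and compactness *)

Definition cl (A : T -> Prop) (x : T) : Prop :=
  forall l ep, 0 < ep -> exists a, A a /\ forall i, In i l -> Rabs (x i - a i) <= ep.

Definition closed (A : T -> Prop) : Prop := forall x, cl A x -> A x.

Lemma cl_sub (A : T -> Prop) x : A x -> cl A x.
Proof. by move=> h l ep he; exists x; split => // i _; rewrite Rminus_diag Rabs_R0; lra. Qed.

Lemma closed_cl A : closed (cl A).
Proof.
move=> x hx l ep he; have [y [hy h1]] := hx l (ep / 2) ltac:(lra).
have [a [ha h2]] := hy l (ep / 2) ltac:(lra); exists a; split => // i hi.
have := h1 i hi; have := h2 i hi; rmx.
Qed.

Lemma cl_mono (A B : T -> Prop) x : (forall a, A a -> B a) -> cl A x -> cl B x.
Proof. by move=> h hx l ep he; have [a [/h ha h1]] := hx l ep he; exists a. Qed.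

Lemma cl_coord (A : T -> Prop) (lo hi : R) i x : (forall a, A a -> lo <= a i <= hi) -> cl A x -> lo <= x i <= hi.
Proof.
move=> h hx; split; apply: Rle_eps => d hd; have [a [/h h1 h2]] := hx (i :: nil) d hd;
  have := h2 i (or_introl eq_refl); rmx.
Qed.

Lemma supp_cl al A : supp al A -> supp al (cl A).
Proof.
move=> h x hx; split; first by move=> i; apply: (cl_coord A) => // a /h [] hc _; exact: hc.
move=> i hi; have h1 : 1 <= x i <= 1 by apply: (cl_coord A) => // a /h [_ ->] //; lra.
lra.
Qed.

Lemma hn_cl al w d A : wt al w -> supp al A -> 0 < d -> hn w d (cl A) A.
Proof.
move=> hw hA hd; split; last by move=> a ha; exists a; split; [exact: cl_sub | move=> i; rewrite Rminus_diag Rabs_R0; lra].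
move=> x hx; have [l hl0] := proj2 (proj2 hw) d hd.
have [a [ha h1]] := hx l d hd; exists a; split => // i.
have := proj1 hw i => hwi; have cx := proj1 (supp_cl _ _ hA _ hx) i; have ca := proj1 (hA _ ha) i.
case: (classic (In i l)) => hi.
  have := h1 i hi; have := Rabs_pos (x i - a i); nra.
have := hl0 i hi; have : Rabs (x i - a i) <= 1 by apply: Rabs_le; lra.
have := Rabs_pos (x i - a i); nra.
Qed.

(** [ed] does not see closures, so mixtures can be compared before they are closed. *)
Lemma ed_cl al w A : wt al w -> supp al A -> ed w (cl A) A = 0.
Proof.
move=> hw hA; have hw0 : forall i, 0 <= w i by move=> i; apply (proj1 hw i).
apply: Rle_antisym; last exact: ed_ge0.
apply: Rle_eps => d hd; apply: ed_le => //; first lra.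
by rewrite Rplus_0_l; apply: hn_cl hw hA hd.
Qed.

Lemma closed_lim {N : Type} (U : (N -> Prop) -> Prop) (A : T -> Prop) (b : N -> T) x : filt U ->
  ~ U (fun _ => False) -> closed A -> U (fun m => A (b m)) -> (forall i, tends U (fun m => b m i) (x i)) -> A x.
Proof.
move=> hU hp hA hb hx; apply: hA => l ep he; apply: NNPP => hn0; apply: hp.
have h1 : U (fun m => forall i, In i l -> Rabs (b m i - x i) <= ep).
  by apply: filt_list => // i _; exact: hx.
apply: (filt2 _ _ hU hb h1) => m h2 h3; apply: hn0; exists (b m); split => // i hi.
by rewrite Rabs_minus_sym; exact: h3.
Qed.

(** Tychonoff compactness of the cube, in ultrafilter form. *)
Lemma ulim_T {N : Type} (U : (N -> Prop) -> Prop) (b : N -> T) : ultra U ->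
  (forall m, cube (b m)) -> exists x, cube x /\ forall i, tends U (fun m => b m i) (x i).
Proof.
move=> hU hb; have [x hx] := choice_fun (fun i r => tends U (fun m => b m i) r)
  (fun i => ulim_R U (fun m => b m i) 0 1 hU (filtT _ _ (proj1 hU) (fun m => hb m i))).
exists x; split => // i; have [hF [hp _]] := hU.
split.
  apply: (tends_le_lim U hF (fun _ => 0) (fun m => b m i)) => //; first exact: tends_const.
  by apply: filtT => // m; apply (hb m i).
apply: (tends_le_lim U hF (fun m => b m i) (fun _ => 1)) => //; first exact: tends_const.
by apply: filtT => // m; apply (hb m i).
Qed.

Lemma tends_cst_lim {N : Type} (U : (N -> Prop) -> Prop) f (c l : R) : ultra U ->
  U (fun m => f m = c) -> tends U f l -> l = c.
Proof.
move=> [hU [hp _]] h1 h2; apply: Rle_antisym; apply: Rle_eps => d hd; apply: Rnot_lt_le => h3; apply: hp.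
  by apply: (filt2 _ _ hU h1 (h2 _ hd)) => m ->; rmx.
by apply: (filt2 _ _ hU h1 (h2 _ hd)) => m ->; rmx.
Qed.

(** ** Max-times convex sets *)

Definition one : T := fun _ => 1.

Definition comb (p q : R) (a b : T) : T := fun i => Rmax (p * a i) (q * b i).

Definition mconv (B : T -> Prop) : Prop :=
  forall a b p q, B a -> B b -> 0 <= p <= 1 -> 0 <= q <= 1 -> Rmax p q = 1 -> B (comb p q a b).

Definition lcomb {A : Type} (l : list A) (p : A -> R) (b : A -> T) : T :=
  fun i => lmx (fun x => p x * b x i) l.

Definition nneg (B : T -> Prop) : Prop := forall b, B b -> forall i, 0 <= b i.

(** The induction starts from an entry of weight 1, so that every partial combination is already
    normalized and stays in [B]. *)
Lemma mconv_lcomb {A : Type} (l : list A) p b (B : T -> Prop) : mconv B -> nneg B ->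
  (forall x, In x l -> 0 <= p x <= 1 /\ B (b x)) -> (exists x, In x l /\ p x = 1) -> B (lcomb l p b).
Proof.
move=> hB hn0 hl0 [x0 [hx0 hp]].
have key : forall b0, B b0 -> B (fun i => Rmax (b0 i) (lmx (fun x => p x * b x i) l)).
  move=> b0 hb0; elim: l hl0 {hx0} => [|x l ih] h.
    rewrite (_ : (fun i => _) = b0) //; apply: functional_extensionality => i /=.
    by apply: Rmax_left; apply: hn0.
  have [h1 h2] := h x (or_introl eq_refl).
  rewrite (_ : (fun i => _) = comb 1 (p x) (fun i => Rmax (b0 i) (lmx (fun x => p x * b x i) l)) (b x)).
    apply: hB => //; [by apply: ih => y hy; apply: h; right | lra | rmx].
  apply: functional_extensionality => i; rewrite /comb /=; move: (lmx _ l) (p x * b x i) (b0 i) => u v z; rmx.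
have [h1 h2] := hl0 _ hx0; rewrite (_ : lcomb l p b = fun i => Rmax (b x0 i) (lmx (fun x => p x * b x i) l)); first exact: key.
apply: functional_extensionality => i; rewrite Rmax_right //.
by have := lmx_ub (fun x => p x * b x i) l x0 hx0; rewrite hp; lra.
Qed.

Lemma lcomb_near {A : Type} (l : list A) p p' b b' (w : T) ep dp i : 0 <= w i <= 1 -> 0 <= ep -> 0 <= dp ->
  (forall x, In x l -> 0 <= p x <= 1) ->
  (forall x, In x l -> Rabs (p x - p' x) <= dp) -> (forall x, In x l -> 0 <= b' x i <= 1) ->
  (forall x, In x l -> w i * Rabs (b x i - b' x i) <= ep) ->
  w i * Rabs (lcomb l p b i - lcomb l p' b' i) <= ep + dp.
Proof.
move=> hw he hdp hp hpp hb' hbb; apply: lmx_distk; [lra | lra |] => x hx.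
have [p0 p1] := hp x hx; have h1 := hpp x hx; have [b0 b1] := hb' x hx; have h2 := hbb x hx.
have -> : p x * b x i - p' x * b' x i = p x * (b x i - b' x i) + (p x - p' x) * b' x i by ring.
have h3 := Rabs_triang (p x * (b x i - b' x i)) ((p x - p' x) * b' x i).
have h4 : Rabs (p x * (b x i - b' x i)) = p x * Rabs (b x i - b' x i) by rewrite Rabs_mulk.
have h5 : Rabs ((p x - p' x) * b' x i) = Rabs (p x - p' x) * b' x i by rewrite Rabs_mult (Rabs_pos_eq (b' x i)).
have a1 := Rabs_pos (b x i - b' x i); have a2 := Rabs_pos (p x - p' x).
have h6 : w i * (p x * Rabs (b x i - b' x i)) <= ep.
  have -> : w i * (p x * Rabs (b x i - b' x i)) = p x * (w i * Rabs (b x i - b' x i)) by ring.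
  have : 0 <= w i * Rabs (b x i - b' x i) by apply: Rmult_le_pos; lra.
  nra.
have h7 : w i * (Rabs (p x - p' x) * b' x i) <= dp.
  have : Rabs (p x - p' x) * b' x i <= dp by nra.
  have : 0 <= Rabs (p x - p' x) * b' x i by apply: Rmult_le_pos.
  nra.
have : w i * Rabs (p x * (b x i - b' x i) + (p x - p' x) * b' x i) <= w i * (p x * Rabs (b x i - b' x i) + Rabs (p x - p' x) * b' x i).
  by apply: Rmult_le_compat_l; lra.
lra.
Qed.

Lemma mconv_cl B : mconv B -> mconv (cl B).
Proof.
move=> hB a b p q ha hb hp hq hpq l ep he.
have [a' [ha' h1]] := ha l ep he; have [b' [hb' h2]] := hb l ep he.
exists (comb p q a' b'); split; first exact: hB.
move=> i hi; apply: Rmax_dist.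
  have := h1 i hi; rewrite -Rmult_minus_distr_l Rabs_mulk; [have := Rabs_pos (a i - a' i); nra | lra].
have := h2 i hi; rewrite -Rmult_minus_distr_l Rabs_mulk; [have := Rabs_pos (b i - b' i); nra | lra].
Qed.

Definition hull (X : T -> Prop) (x : T) : Prop :=
  exists l : list (R * T), (forall z, In z l -> 0 <= fst z <= 1 /\ X (snd z)) /\
    (exists z, In z l /\ fst z = 1) /\ x = lcomb l fst snd.

Lemma hull_incl (X : T -> Prop) x : nneg X -> X x -> hull X x.
Proof.
move=> hn0 hx; exists ((1, x) :: nil); split; first by move=> z [<-|[]] /=; split => //; lra.
split; first by exists (1, x); split => //; left.
by apply: functional_extensionality => i; rewrite /lcomb /= Rmult_1_l Rmax_left //; exact: hn0.
Qed.

Lemma hull_mconv X : mconv (hull X).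
Proof.
move=> a b p q [la [a1 [a2 ->]]] [lb [b1 [b2 ->]]] hp hq hpq.
exists (map (fun z => (p * fst z, snd z)) la ++ map (fun z => (q * fst z, snd z)) lb); split; last split.
- move=> z /in_app_iff [] /in_map_iff [y [<- hy]] /=.
    by have [h1 h2] := a1 _ hy; split => //; nra.
  by have [h1 h2] := b1 _ hy; split => //; nra.
- have [hpp|hqq] : p = 1 \/ q = 1 by rmx.
    have [z [hz1 hz2]] := a2; exists (p * fst z, snd z); split; last by rewrite /= hpp hz2; lra.
    by apply/in_app_iff; left; apply/in_map_iff; exists z.
  have [z [hz1 hz2]] := b2; exists (q * fst z, snd z); split; last by rewrite /= hqq hz2; lra.
  by apply/in_app_iff; right; apply/in_map_iff; exists z.
- apply: functional_extensionality => i; rewrite /comb /lcomb lmx_app !lmx_map /= !lmx_scale; try lra.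
  by congr Rmax; apply: lmx_ext => z _; ring.
Qed.

(** Each generator is replaced by a near point of [B]; the same weights combine these inside [B]
    without increasing the distance. *)
Lemma hl_hull_conv w ep X B : (forall i, 0 <= w i <= 1) -> 0 <= ep -> mconv B -> (forall b, B b -> cube b) ->
  hl w ep X B -> hl w ep (hull X) B.
Proof.
move=> hw he hB hc h x [l [h1 [h2 ->]]].
have [g hg] := choice_on (fun _ => 0) X (fun a b => B b /\ forall i, w i * Rabs (a i - b i) <= ep) h.
exists (lcomb l fst (fun z => g (snd z))); split.
  apply: mconv_lcomb => //; first by move=> b /hc hb i; apply hb.
  by move=> z /h1 [h3 h4]; split => //; apply (hg _ h4).
move=> i; have := lcomb_near l fst fst snd (fun z => g (snd z)) w ep 0 i (hw i) he ltac:(lra); rewrite Rplus_0_r; apply.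
- by move=> z /h1 [].
- by move=> z _; rewrite Rminus_diag Rabs_R0; lra.
- by move=> z /h1 [_ /hg [/hc hz _]]; exact: hz.
- by move=> z /h1 [_ /hg [_ hz]]; exact: hz.
Qed.

Lemma cube_lcomb {A : Type} (l : list A) p b : (forall x, In x l -> 0 <= p x <= 1 /\ cube (b x)) -> cube (lcomb l p b).
Proof.
move=> h i; split; first exact: lmx_ge0.
apply: lmx_le; first lra.
move=> x /h [h1 h2]; have := h2 i; nra.
Qed.

Lemma cube_hull X : (forall x, X x -> cube x) -> forall x, hull X x -> cube x.
Proof. by move=> h x [l [h1 [_ ->]]]; apply: cube_lcomb => z /h1 [h2 /h]. Qed.

Lemma hl_hull w ep X X' : (forall i, 0 <= w i <= 1) -> 0 <= ep -> (forall b, X' b -> cube b) ->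
  hl w ep X X' -> hl w ep (hull X) (hull X').
Proof.
move=> hw he hc h; apply: hl_hull_conv => //; first exact: hull_mconv.
  exact: cube_hull.
move=> x /h [b [hb h1]]; exists b; split => //; apply: hull_incl => // y /hc hy i; apply hy.
Qed.

(** The weighted maximum of sets, which plays the part of a convex combination under a partition of
    unity. *)
Definition mix (K : nat) (p : nat -> R) (G : nat -> T -> Prop) (x : T) : Prop :=
  exists b : nat -> T, (forall k, (k < K)%nat -> G k (b k)) /\ x = lcomb (seq 0 K) p b.

Lemma mix_mconv K p G : (forall k, (k < K)%nat -> mconv (G k) /\ 0 <= p k) -> mconv (mix K p G).
Proof.
move=> h a b s t [ba [ha ->]] [bb [hb ->]] hs ht hst.
exists (fun k => comb s t (ba k) (bb k)); split.
  by move=> k hk; apply: (proj1 (h k hk)) => //; [exact: ha | exact: hb].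
apply: functional_extensionality => i; rewrite /comb /lcomb !lmx_scale; try lra.
rewrite lmx_max; apply: lmx_ext => k /in_seq hk.
by rewrite Rmul_maxk; [congr Rmax; ring | apply (h k); lia].
Qed.

Lemma mix_near K p p' G G' w ep dp : (forall i, 0 <= w i <= 1) -> 0 <= ep -> 0 <= dp ->
  (forall k, (k < K)%nat -> 0 <= p k <= 1 /\ Rabs (p k - p' k) <= dp) ->
  (forall k, (k < K)%nat -> forall b, G' k b -> cube b) ->
  (forall k, (k < K)%nat -> hl w ep (G k) (G' k)) -> hl w (ep + dp) (mix K p G) (mix K p' G').
Proof.
move=> hw he hdp hp hc h x [b [hb ->]].
have [b' hb'] := choice_on (fun _ => 0) (fun k => (k < K)%nat)
  (fun k y => G' k y /\ forall i, w i * Rabs (b k i - y i) <= ep) (fun k hk => h k hk _ (hb k hk)).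
exists (lcomb (seq 0 K) p' b'); split; first by exists b'; split => // k /hb' [].
move=> i; apply: lcomb_near => // k /in_seq hk.
- by apply (hp k); lia.
- by apply (hp k); lia.
- by apply: hc; [|apply: (proj1 (hb' k _))]; lia.
- by apply: (proj2 (hb' k _)); lia.
Qed.

(** Sets of weight 0 contribute nothing and may be far from [B]; in them an arbitrary point is
    chosen. For the others, convexity keeps the mixture of near points inside [B]. *)
Lemma mix_conv K p G B w ep : (forall i, 0 <= w i <= 1) -> 0 <= ep -> mconv B -> (forall b, B b -> cube b) ->
  (forall k, (k < K)%nat -> 0 <= p k <= 1) -> (exists k, (k < K)%nat /\ p k = 1) ->
  (exists b, B b) ->
  (forall k, (k < K)%nat -> (forall b, G k b -> cube b) /\ exists b, G k b) ->
  (forall k, (k < K)%nat -> 0 < p k -> hn w ep (G k) B) -> hn w ep (mix K p G) B.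
Proof.
move=> hw he hB hc hp [k0 [hk0 hp0]] [b0 hb0] hG h.
have nn : nneg B by move=> b /hc hb i; apply hb.
split.
  move=> x [b [hb ->]].
  have [b' hb'] := choice_on (fun _ => 0) (fun k => (k < K)%nat)
    (fun k y => B y /\ (0 < p k -> forall i, w i * Rabs (b k i - y i) <= ep)) (fun k hk => ltac:(
      case: (Rlt_dec 0 (p k)) => hpk; [case: (proj1 (h k hk hpk) _ (hb k hk)) => y [hy1 hy2]; by exists y | by exists b0])).
  exists (lcomb (seq 0 K) p b'); split.
    apply: mconv_lcomb => //.
      by move=> k /in_seq hk; split; [apply: hp; lia | apply: (proj1 (hb' k _)); lia].
    by exists k0; split => //; apply/in_seq; lia.
  move=> i; rewrite /lcomb; apply: lmx_distk => //; first by apply (hw i).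
  move=> k /in_seq hk; have hkK : (k < K)%nat by lia.
  have [p1 p2] := hp k hkK; rewrite -Rmult_minus_distr_l Rabs_mulk //.
  case: (Rlt_dec 0 (p k)) => hpk; last by rewrite (_ : p k = 0); [lra | lra].
  have := proj2 (hb' k hkK) hpk i; have := Rabs_pos (b k i - b' k i); have [w1 w2] := hw i.
  set u := Rabs _ => hu; have -> : w i * (p k * u) = p k * (w i * u) by ring.
  have : 0 <= w i * u by apply: Rmult_le_pos.
  nra.
move=> b hb.
have [b' hb'] := choice_on (fun _ => 0) (fun k => (k < K)%nat)
  (fun k y => G k y /\ (0 < p k -> forall i, w i * Rabs (b i - y i) <= ep)) (fun k hk => ltac:(
    case: (Rlt_dec 0 (p k)) => hpk; [case: (proj2 (h k hk hpk) _ hb) => y [hy1 hy2]; by exists y | case: (proj2 (hG k hk)) => y hy; by exists y])).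
exists (lcomb (seq 0 K) p b'); split; first by exists b'; split => // k /hb' [].
(* [b] is the mixture of copies of itself, because some weight equals 1. *)
move=> i; have -> : b i = lmx (fun k => p k * b i) (seq 0 K).
  symmetry; apply: lmx_unit; first exact: nn.
    by move=> k /in_seq hk; apply: hp; lia.
  by exists k0; split => //; apply/in_seq; lia.
apply: lmx_distk => //; first by apply (hw i).
move=> k /in_seq hk; have hkK : (k < K)%nat by lia.
have [p1 p2] := hp k hkK; rewrite -Rmult_minus_distr_l Rabs_mulk //.
case: (Rlt_dec 0 (p k)) => hpk; last by rewrite (_ : p k = 0); [lra | lra].
have := proj2 (hb' k hkK) hpk i; have := Rabs_pos (b i - b' k i); have [w1 w2] := hw i.
set u := Rabs _ => hu; have -> : w i * (p k * u) = p k * (w i * u) by ring.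
have : 0 <= w i * u by apply: Rmult_le_pos.
nra.
Qed.
End Sets.

(** * Restriction to a set of coordinates, and finite nets *)

Section Cut.
Context {I : Type}.
Notation T := (I -> R).

(** Outside [D] the value is 1, that of the greatest point [one]. Normalized max-times combinations
    preserve the constant 1, so [cut] commutes with them. *)
Definition cut (D : I -> Prop) (a : T) : T := fun i => if excluded_middle_informative (D i) then a i else 1.

Lemma cut_in (D : I -> Prop) a i : D i -> cut D a i = a i.
Proof. by rewrite /cut; case: excluded_middle_informative. Qed.
Lemma cut_out (D : I -> Prop) a i : ~ D i -> cut D a i = 1.
Proof. by rewrite /cut; case: excluded_middle_informative. Qed.

Lemma cut_lcomb {A : Type} D (l : list A) p (b : A -> T) : (forall x, In x l -> 0 <= p x <= 1) ->
  (exists x, In x l /\ p x = 1) -> cut D (lcomb l p b) = lcomb l p (fun x => cut D (b x)).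
Proof.
move=> h1 h2; apply: functional_extensionality => i; case: (classic (D i)) => hi.
  by rewrite cut_in // /lcomb; apply: lmx_ext => x _; rewrite cut_in.
rewrite cut_out // /lcomb; rewrite -[LHS](lmx_unit p l 1) //; last lra.
by apply: lmx_ext => x _; rewrite cut_out.
Qed.

Lemma cut_comb D p q (a b : T) : 0 <= p <= 1 -> 0 <= q <= 1 -> Rmax p q = 1 ->
  cut D (comb p q a b) = comb p q (cut D a) (cut D b).
Proof.
move=> hp hq hpq; apply: functional_extensionality => i; case: (classic (D i)) => hi.
  by rewrite /comb !cut_in.
by rewrite /comb !cut_out // !Rmult_1_r.
Qed.

(** The sets [exp (K - max K)], for [K] compact max-plus convex in the coordinates [al];
    a set is extended by the constant 1 outside [al]. *)
Definition okP (al : I -> Prop) (A : T -> Prop) : Prop :=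
  A one /\ mconv A /\ closed A /\ supp al A /\ exists l : T, (forall i, 0 < l i) /\ forall a, A a -> forall i, l i <= a i.

Definition Psp (al : I -> Prop) : space := Space (T -> Prop) (okP al) (fun N F As A => htends F As A).

Lemma lcomb_lb {A : Type} (l : list A) p (b : A -> T) i c :
  (exists x, In x l /\ p x = 1) -> (forall x, In x l -> c <= b x i) -> c <= lcomb l p b i.
Proof.
move=> [x [hx hp]] h; apply: Rle_trans (h x hx) _.
by have := lmx_ub (fun x => p x * b x i) l x hx; rewrite hp Rmult_1_l.
Qed.

Fixpoint powl {A : Type} (l : list A) : list (list A) :=
  match l with nil => nil :: nil | x :: l => powl l ++ map (cons x) (powl l) end.

Lemma powl_ex {A : Type} (l : list A) (P : A -> Prop) :
  exists l', In l' (powl l) /\ forall x, In x l' <-> In x l /\ P x.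
Proof.
elim: l => [|y l [l' [h1 h2]]] /=; first by exists nil; split; [left | move=> x; split => // -[]].
case: (classic (P y)) => hy.
  exists (y :: l'); split; first by apply/in_app_iff; right; apply/in_map_iff; exists l'.
  move=> x; split; first by move=> [<-|/h2 [h3 h4]]; [split; [left|] | split; [right|]].
  by move=> [[<-|h3] h4]; [left | right; apply/h2].
exists l'; split; first by apply/in_app_iff; left.
move=> x; split; first by move=> /h2 [h3 h4]; split; [right|].
by move=> [[<-|h3] h4] //; apply/h2.
Qed.

Lemma powl_sub {A : Type} (l l' : list A) x : In l' (powl l) -> In x l' -> In x l.
Proof.
elim: l l' => [|y l ih] l' /=; first by move=> [<-|[]].
move=> /in_app_iff [h|/in_map_iff [l1 [<- h]]] hx; first by right; exact: ih h hx.
by case: hx => [->|hx]; [left | right; exact: ih h hx].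
Qed.

Lemma grid_ex h : 0 < h -> exists g : list R, (forall s, In s g -> 0 <= s <= 1) /\
  forall t, 0 <= t <= 1 -> exists s, In s g /\ Rabs (t - s) <= h.
Proof.
move=> hh.
have key : forall n, exists g : list R, (forall s, In s g -> 0 <= s <= 1) /\
  forall t, 0 <= t <= 1 -> t <= INR n * h -> exists s, In s g /\ Rabs (t - s) <= h.
  elim=> [|n [g [h1 h2]]].
    exists (0 :: nil); split; first by move=> s [<-|[]]; lra.
    by move=> t ht h3; exists 0; split; [left | rewrite /= in h3; apply: Rabs_le; lra].
  have hn := pos_INR n.
  have hnh : 0 <= INR n * h by apply: Rmult_le_pos; lra.
  exists (Rmin 1 (INR n * h) :: g); split; first by move=> s [<-|/h1 //]; rmx.
  move=> t ht h3; case: (Rle_dec t (INR n * h)) => h4.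
    by have [s [h5 h6]] := h2 t ht h4; exists s; split => //; right.
  exists (Rmin 1 (INR n * h)); split; first by left.
  by rewrite S_INR in h3; rmx.
have [n hn] := INR_unbounded (/ h); have [g [h1 h2]] := key n; exists g; split => // t ht; apply: h2 => //.
have : / h * h <= INR n * h by apply: Rmult_le_compat_r; lra.
rewrite Rinv_l; lra.
Qed.

Lemma net_ex (l : list I) h : 0 < h -> exists net : list T, (forall y, In y net -> cube y) /\
  forall x, cube x -> exists y, In y net /\ forall i, In i l -> Rabs (x i - y i) <= h.
Proof.
move=> hh; have [g [g1 g2]] := grid_ex h hh.
elim: l => [|j l [net [h1 h2]]].
  exists (one :: nil); split; first by move=> y [<-|[]] i; rewrite /one; lra.
  by move=> x _; exists one; split; [left|].
pose up (ys : T * R) : T := fun i => if excluded_middle_informative (i = j) then snd ys else fst ys i.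
exists (map up (list_prod net g)); split.
  move=> y /in_map_iff [[y' s] [<- /in_prod_iff [hy hs]]] i; rewrite /up /=.
  by case: excluded_middle_informative => _; [exact: g1 | exact: h1].
move=> x hx; have [y [hy1 hy2]] := h2 x hx; have [s [hs1 hs2]] := g2 _ (hx j).
exists (up (y, s)); split; first by apply/in_map_iff; exists (y, s); split => //; apply/in_prod_iff.
move=> i hi; rewrite /up /=; case: excluded_middle_informative => [->|hne] //.
by apply: hy2; case: hi => // heq; case: hne.
Qed.
End Cut.

(** * The fibres of the projection of hyperspaces *)

(** Smaller than every geometric sequence, since [k * n - n * n <= k * k]. *)
Definition eta (n : nat) : R := / 2 ^ (n * n).

Lemma eta_pos n : 0 < eta n.
Proof. apply: Rinv_0_lt_compat; exact: pow2_pos. Qed.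

Lemma eta_sm k n : 2 ^ (k * n) * eta n <= 2 ^ (k * k).
Proof.
rewrite /eta; have hp := pow2_pos (n * n); apply: (Rmult_le_reg_r (2 ^ (n * n))) => //.
rewrite Rmult_assoc Rinv_l; last lra.
rewrite Rmult_1_r -pow_add; apply: pow2_mono; nia.
Qed.

Section Fib.
Context {I : Type} (al be ga : I -> Prop) (w : I -> R) (L : nat -> list I).
Notation T := (I -> R).
(** [be] are the base coordinates and [ga] those of the fibre. [L n] contains every coordinate of
    weight above [eta n], hence all that counts at precision [eta n]. *)
Context (hw : wt al w) (hal : forall i, al i <-> be i \/ ga i) (hdis : forall i, be i -> ~ ga i)
  (hL : forall n i, ~ In i (L n) -> w i <= eta n).

(** The bound [lo] makes the fibre over [A] complete: without it coordinates may tend to 0. *)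
Definition prefib (A : T -> Prop) (lo : T) (B : T -> Prop) : Prop :=
  (forall b, B b -> forall i, ga i -> lo i <= b i) /\ B one /\ mconv B /\
  (forall b, B b -> A (cut be b)) /\ (forall a, A a -> exists b, B b /\ cut be b = a) /\ supp al B.

Definition fib (A : T -> Prop) (lo : T) (B : T -> Prop) : Prop := prefib A lo B /\ closed B.

Lemma fib_bd A lo B b i : fib A lo B -> B b -> ga i -> lo i <= b i.
Proof. by move=> [[h _] _] hb; exact: h. Qed.
Lemma fib_one A lo B : fib A lo B -> B one.
Proof. by move=> [[_ [h _]] _]. Qed.
Lemma fib_mconv A lo B : fib A lo B -> mconv B.
Proof. by move=> [[_ [_ [h _]]] _]. Qed.
Lemma fib_cut A lo B b : fib A lo B -> B b -> A (cut be b).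
Proof. by move=> [[_ [_ [_ [h _]]]] _]; exact: h. Qed.
Lemma fib_surj A lo B a : fib A lo B -> A a -> exists b, B b /\ cut be b = a.
Proof. by move=> [[_ [_ [_ [_ [h _]]]]] _]; exact: h. Qed.
Lemma fib_supp A lo B : fib A lo B -> supp al B.
Proof. by move=> [[_ [_ [_ [_ [_ h]]]]] _]. Qed.

Lemma w01 i : 0 <= w i <= 1. Proof. exact: (proj1 hw). Qed.
Lemma w0 i : 0 <= w i. Proof. by apply w01. Qed.

Lemma fib_cl A lo B : closed A -> prefib A lo B -> fib A lo (cl B).
Proof.
move=> hA [h1 [h2 [h3 [h4 [h5 h6]]]]]; split; last exact: closed_cl.
split.
  move=> b hb i hi; apply: Rle_eps => d hd; have [b' [hb' h7]] := hb (i :: nil) d hd.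
  by have := h1 _ hb' i hi; have := h7 i (or_introl eq_refl); rmx.
split; first exact: cl_sub.
split; first exact: mconv_cl.
split.
  move=> b hb; apply: hA => l d hd; have [b' [hb' h7]] := hb l d hd.
  exists (cut be b'); split; first exact: h4.
  move=> i hi; case: (classic (be i)) => hbe; first by rewrite !cut_in //; exact: h7.
  by rewrite !cut_out // Rminus_diag Rabs_R0; lra.
split; first by move=> a /h5 [b [hb hc]]; exists b; split => //; exact: cl_sub.
exact: supp_cl.
Qed.

Lemma ed_eq0 a b : supp al a -> supp al b -> closed a -> closed b -> ed w a b = 0 -> a = b.
Proof.
move=> ha hb ca cb h.
have key : forall a b, supp al a -> supp al b -> closed b -> ed w a b = 0 -> forall x, a x -> b x.
  move=> a' b' ha' hb' cb' h' x hx; apply: cb' => l d hd.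
  have [d0 [hd0 h1]] := wt_pos al w l d hw hd.
  have h2 : hn w d0 a' b' by apply: ed_lt1; [rewrite h'; lra | lra].
  have h3 := hn_ind_of_wt al w l d d0 a' b' ha' hb' w0 hd (fun i hi hali => conj (proj1 (proj2 hw) i hali) (h1 i hi hali)) h2.
  by have [y [hy h4]] := proj1 h3 x hx; exists y; split => //; exact: ind_ge.
apply: functional_extensionality => x; apply: propositional_extensionality; split; apply: key => //.
by rewrite ed_sym.
Qed.

(** Ultrafilter limits of points taken from the sets [b m] belong to the limit set [B]; they supply
    the points needed for nearness and for surjectivity onto [A]. The remaining conditions pass to
    [B] by approximation. *)
Lemma fib_complete A lo (b : nat -> T -> Prop) K : closed A -> (forall n, fib A lo (b n)) -> 0 <= K ->
  (forall n, ed w (b n) (b (S n)) <= K * (/ 2) ^ n) ->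
  exists B, fib A lo B /\ forall d, 0 < d -> exists n0, forall n, (n0 <= n)%nat -> ed w (b n) B <= d.
Proof.
move=> hA hb hK hstep.
pose t n := 2 * K * (/ 2) ^ n.
have hp : forall n, 0 < (/ 2) ^ n by move=> n; apply: pow_lt; lra.
have tail : forall n m, (n <= m)%nat -> ed w (b n) (b m) <= t n.
  move=> n m hnm; have -> : m = (n + (m - n))%nat by lia.
  have : ed w (b n) (b (n + (m - n))%nat) <= 2 * K * ((/ 2) ^ n - (/ 2) ^ (n + (m - n))).
    elim: (m - n)%nat => [|p ih]; first by rewrite Nat.add_0_r ed_refl; lra.
    have := ed_tri w w0 (b n) (b (n + p)%nat) (b (n + S p)%nat); have := hstep (n + p)%nat.
    rewrite Nat.add_succ_r /=; lra.
  have : 0 <= K * (/ 2) ^ (n + (m - n)) by apply: Rmult_le_pos => //; exact: Rlt_le (hp _).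
  rewrite /t; lra.
have tsm : forall d, 0 < d -> exists n0, forall n, (n0 <= n)%nat -> t n < d.
  move=> d hd; have [n0 hn0] := half_pow_small (2 * K) (d / 2) ltac:(lra).
  by exists n0 => n hn; have := hn0 n hn; rewrite /t; lra.
have close : forall n m d, (n <= m)%nat -> t n < d -> d <= 1 -> hn w d (b n) (b m).
  by move=> n m d hnm h1 h2; apply: ed_lt1 => //; have := tail n m hnm; lra.
have sb : forall n, supp al (b n) by move=> n; exact: fib_supp (hb n).
pose pt (x : T) := cube x /\ forall i, ~ al i -> x i = 1.
(* [t n] bounds the distance from [b n] to all later sets. Only [d <= 1] is considered because [ed]
   is truncated at 1. *)
pose B x := pt x /\ forall n d, t n < d -> d <= 1 -> exists y, b n y /\ forall i, w i * Rabs (x i - y i) <= d.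
pose F (P : nat -> Prop) := exists n0, forall n, (n0 <= n)%nat -> P n.
have hF : filt F.
  split; first by exists O.
  split; last by move=> P Q h [n0 hn0]; exists n0 => n hn; apply: h; exact: hn0.
  move=> P Q [n1 h1] [n2 h2]; exists (n1 + n2)%nat => n hn; split; [apply: h1 | apply: h2]; lia.
have [U [hU hUF]] : exists U, ultra U /\ forall P, F P -> U P.
  by apply: ultra_ex => // -[n0 hn0]; exact: (hn0 n0 (le_n _)).
have [hUf [hUp _]] := hU.
have ev : forall n, U (fun m => (n <= m)%nat) by move=> n; apply: hUF; exists n.
have wlim : forall (f g : nat -> T) x y d, (forall i, tends U (fun m => f m i) (x i)) ->
   (forall i, tends U (fun m => g m i) (y i)) -> U (fun m => forall i, w i * Rabs (f m i - g m i) <= d) ->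
   forall i, w i * Rabs (x i - y i) <= d.
  move=> f g x y d hx hy h i.
  apply: (tends_le_lim U hUf (fun m => w i * Rabs (f m i - g m i)) (fun _ => d)) => //.
    by apply: tends_mult => //; [exact: tends_const | apply: tends_abs => //; apply: tends_minus].
    exact: tends_const.
  by apply: (filt1 _ hUf h) => m; apply.
have cubeb : forall n y, b n y -> cube y by move=> n y /sb [].
have keya : forall (x_ : nat -> T) x, (forall m, b m (x_ m)) -> (forall i, tends U (fun m => x_ m i) (x i)) -> cube x -> B x.
  move=> x_ x hx_ hx cx; split.
    split => // i hi; apply: (tends_cst_lim U (fun m => x_ m i) 1) => //.
    by apply: filtT => // m; apply (sb m _ (hx_ m)).
  move=> n d h1 h2.
  have [y_ hy_] := choice_on (fun _ => 0) (fun m => (n <= m)%nat) (fun m y => b n y /\ forall i, w i * Rabs (x_ m i - y i) <= d)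
    (fun m hm => proj2 (close n m d hm h1 h2) _ (hx_ m)).
  (* [one] fills the indices below [n], which the ultrafilter neglects. *)
  pose z_ m := if le_dec n m then y_ m else one.
  have hz : forall m, b n (z_ m) by move=> m; rewrite /z_; case: le_dec => hm; [apply (hy_ m hm) | exact: fib_one (hb n)].
  have [y [cy hy]] := ulim_T U z_ hU (fun m => cubeb _ _ (hz m)).
  exists y; split.
    by apply: (closed_lim U (b n) z_) => //; [apply (hb n) | apply: filtT].
  apply: (wlim x_ z_) => //; apply: (filt1 _ hUf (ev n)) => m hm i.
  by rewrite /z_; case: le_dec => // hm'; apply (hy_ m hm).
have approx : forall x l d, B x -> 0 < d -> exists n y, b n y /\ forall i, In i l -> Rabs (x i - y i) <= d.
  move=> x l d [[cx ox] hx] hd; have [d0 [hd0 h1]] := wt_pos al w l d hw hd.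
  have [n hn0] := tsm d0 ltac:(lra); have [y [hy h2]] := hx n d0 (hn0 n (le_n _)) ltac:(lra).
  exists n, y; split => // i hi; case: (classic (al i)) => hali.
    apply: (Rmult_le_reg_l (w i)); first exact: (proj1 (proj2 hw)).
    by have := h2 i; have := h1 i hi hali; lra.
  by rewrite ox // (proj2 (sb n y hy)) // Rminus_diag Rabs_R0; lra.
have suppB : supp al B by move=> x [].
have nearB : forall n d, t n < d -> d <= 1 -> hn w d (b n) B.
  move=> n d h1 h2; split; last by move=> x [_ hx]; exact: hx.
  move=> y hy.
  have [x_ hx_] := choice_on (fun _ => 0) (fun m => (n <= m)%nat) (fun m x => b m x /\ forall i, w i * Rabs (y i - x i) <= d)
    (fun m hm => proj1 (close n m d hm h1 h2) _ hy).
  pose z_ m := if le_dec n m then x_ m else one.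
  have hz : forall m, b m (z_ m) by move=> m; rewrite /z_; case: le_dec => hm; [apply (hx_ m hm) | exact: fib_one (hb m)].
  have [x [cx hx]] := ulim_T U z_ hU (fun m => cubeb _ _ (hz m)).
  exists x; split; first exact: keya hz hx cx.
  apply: (wlim (fun _ => y) z_) => //; first by move=> i; exact: tends_const.
  apply: (filt1 _ hUf (ev n)) => m hm i.
  by rewrite /z_; case: le_dec => // hm'; apply (hx_ m hm).
exists B; split; last first.
  move=> d hd; have [n0 hn0] := tsm (Rmin d 1) ltac:(rmx); exists n0 => n hn.
  apply: Rle_trans (Rmin_l d 1); apply: ed_le; [rmx | apply: nearB; [exact: hn0 | exact: Rmin_r]].
split; last first.
  move=> x hx; split; first by have [h1 h2] := supp_cl al B suppB x hx.
  (* The strict inequality [t n < d] leaves the room [dd] for the passage from the closure of [B] to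
     [B]. *)
  move=> n d h1 h2; pose d' := (t n + d) / 2; pose dd := (d - t n) / 2.
  have [y [hy h3]] := proj1 (hn_cl al w dd B hw suppB ltac:(rewrite /dd; lra)) x hx.
  have [z [hz h4]] := proj2 hy n d' ltac:(rewrite /d'; lra) ltac:(rewrite /d'; lra).
  exists z; split => // i; have := h3 i; have := h4 i; have := w0 i.
  have -> : x i - z i = (x i - y i) + (y i - z i) by ring.
  have := Rabs_triang (x i - y i) (y i - z i); rewrite /dd /d'; nra.
split.
  move=> x hx i hi; apply: Rle_eps => d hd; have [n [y [hy h1]]] := approx x (i :: nil) d hx hd.
  by have := h1 i (or_introl eq_refl); have := fib_bd _ _ _ _ _ (hb n) hy hi; rmx.
split.
  split; first by split => // i; rewrite /one; lra.
  move=> n d h1 h2; exists one; split; first exact: fib_one (hb n).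
  move=> i; rewrite Rminus_diag Rabs_R0 Rmult_0_r; have : 0 <= t n; last by lra.
  by apply: Rmult_le_pos; [lra | exact: Rlt_le].
split.
  move=> x x' p q [[cx ox] hx] [[cx' ox'] hx'] hp1 hq hpq; split.
    split; first by move=> i; rewrite /comb; have := cx i; have := cx' i; split; [apply: Rle_trans (Rmax_l _ _); nra | apply: Rmax_lub; nra].
    by move=> i hi; rewrite /comb ox // ox' // !Rmult_1_r.
  move=> n d h1 h2; have [y [hy h3]] := hx n d h1 h2; have [y' [hy' h4]] := hx' n d h1 h2.
  exists (comb p q y y'); split; first exact: (fib_mconv _ _ _ (hb n)).
  move=> i; rewrite /comb -Rabs_mulk; last exact: w0.
  rewrite Rmult_minus_distr_l !Rmul_maxk; try exact: w0.
  have h0 := w0 i.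
  have bnd : forall s u v, 0 <= s <= 1 -> w i * Rabs (u - v) <= d -> Rabs (w i * (s * u) - w i * (s * v)) <= d.
    move=> s u v hs huv; have -> : w i * (s * u) - w i * (s * v) = (w i * s) * (u - v) by ring.
    rewrite Rabs_mulk; last by apply: Rmult_le_pos; lra.
    have := Rabs_pos (u - v) => hpos; have : 0 <= w i * Rabs (u - v) by apply: Rmult_le_pos.
    nra.
  by apply: Rmax_dist; apply: bnd.
split.
  move=> x hx; apply: hA => l d hd; have [n [y [hy h1]]] := approx x l d hx hd.
  exists (cut be y); split; first exact: fib_cut (hb n) hy.
  move=> i hi; case: (classic (be i)) => hbe; first by rewrite !cut_in //; exact: h1.
  by rewrite !cut_out // Rminus_diag Rabs_R0; lra.
split => //.
move=> a ha.
(* Preimages of [a] in all the [b m] have the same [be] coordinates, so their ultrafilter limit is a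
   preimage in [B]. *)
have [x_ hx_] := choice_fun (fun m x => b m x /\ cut be x = a) (fun m => fib_surj _ _ _ _ (hb m) ha).
have [x [cx hx]] := ulim_T U x_ hU (fun m => cubeb _ _ (proj1 (hx_ m))).
exists x; split; first by apply: (keya x_) => // m; apply (hx_ m).
apply: functional_extensionality => i; case: (classic (be i)) => hbe.
  rewrite cut_in //; apply: (tends_cst_lim U (fun m => x_ m i)) => //; apply: filtT => // m.
  by rewrite -(proj2 (hx_ m)) cut_in.
by rewrite cut_out // -(proj2 (hx_ O)) cut_out.
Qed.

(** ** Finite families of continuous sections *)

(** In [sgm_dense] a selection is matched with a point of the fibre up to [4 * hh n], which has to
    be [eta n]. *)
Definition hh (n : nat) : R := eta n / 4.

Lemma hh_pos n : 0 < hh n.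
Proof. by have := eta_pos n; rewrite /hh; lra. Qed.

Definition net (n : nat) : list T :=
  proj1_sig (constructive_indefinite_description _ (net_ex (L n) (hh n) (hh_pos n))).

Lemma net_spec n : (forall y, In y (net n) -> cube y) /\
  forall x, cube x -> exists y, In y (net n) /\ forall i, In i (L n) -> Rabs (x i - y i) <= hh n.
Proof. exact: (proj2_sig (constructive_indefinite_description _ (net_ex (L n) (hh n) (hh_pos n)))). Qed.

(** The distance to a node over the coordinates outside [ga], where a point of the fibre agrees with
    its projection. *)
Definition dL (n : nat) (a y : T) : R :=
  lmx (fun i => if excluded_middle_informative (ga i) then 0 else Rabs (a i - y i)) (L n).

Lemma dL_ub n a y i : In i (L n) -> ~ ga i -> Rabs (a i - y i) <= dL n a y.
Proof.
move=> hi hg; have := lmx_ub (fun i => if excluded_middle_informative (ga i) then 0 else Rabs (a i - y i)) (L n) i hi.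
by case: excluded_middle_informative.
Qed.

Lemma dL_le n a y c : 0 <= c -> (forall i, In i (L n) -> ~ ga i -> Rabs (a i - y i) <= c) -> dL n a y <= c.
Proof. by move=> hc h; apply: lmx_le => // i hi; case: excluded_middle_informative => // hg; exact: h. Qed.

Lemma dL_dist n a a' y c : 0 <= c -> (forall i, In i (L n) -> Rabs (a i - a' i) <= c) ->
  Rabs (dL n a y - dL n a' y) <= c.
Proof.
move=> hc h; apply: lmx_dist => // i hi; case: excluded_middle_informative => hg.
  by rewrite Rminus_diag Rabs_R0.
by have := h i hi; rmx.
Qed.

(** A bump function: 1 within distance [hh n] of the node [y], and 0 beyond [2 * hh n]. *)
Definition pf (n : nat) (y a : T) : R := clamp (2 - dL n a y / hh n).

(** The selection [vf] interpolates the pairs (node [y], value [s]) of the list [Z]. *)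
Definition vf (n : nat) (Z : list (T * T)) (lo a : T) : T := fun i =>
  if excluded_middle_informative (In i (L n))
  then Rmax (lo i) (lmx (fun ys => pf n (fst ys) a * snd ys i) Z) else 1.

Definition gp n Z lo a : T := fun i => if excluded_middle_informative (ga i) then vf n Z lo a i else a i.

(** [one] is added because the graph of a selection over [A] need not contain it. *)
Definition Gam n (ZZ : list (list (T * T))) (A : T -> Prop) (lo x : T) : Prop :=
  x = one \/ exists Z a, In Z ZZ /\ A a /\ x = gp n Z lo a.

(** The graph of one selection is too thin to approximate a set in the fibre; the hull of finitely
    many graphs is not, by [sgm_dense], and it still varies continuously with [A]. *)
Definition sgm n ZZ A lo : T -> Prop := hull (Gam n ZZ A lo).

Definition NN n := list_prod (net n) (net n).
(** Built with a head, so that every section contains at least one selection and therefore projects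
    onto [A]; the default value in [sec] is nonempty for the same reason. *)
Definition secs n : list (list (list (T * T))) :=
  map (fun p => fst p :: snd p) (list_prod (powl (NN n)) (powl (powl (NN n)))).
Definition Ms n := length (secs n).
Definition sec n k := nth k (secs n) (nil :: nil).

Definition goodlo (lo : T) := forall i, 0 < lo i <= 1.

Lemma sec_sub n k Z z : In Z (sec n k) -> In z Z -> cube (fst z) /\ cube (snd z).
Proof.
rewrite /sec; have [h|h] := nth_in_or_default k (secs n) (nil :: nil); last first.
  by rewrite h => -[<-|[]] [].
move: h => /in_map_iff [[Z0 ZZ] [<- /in_prod_iff [h1 h2]]] /= hZ hz.
have : In z (NN n).
  case: hZ => [<-|hZ] in hz *; first exact: powl_sub h1 hz.
  exact: powl_sub (powl_sub _ _ _ h2 hZ) hz.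
case: z {hz} => y s /in_prod_iff [hy hs]; have [hc _] := net_spec n.
by split; apply: hc.
Qed.

Lemma sec_ne n k : exists Z, In Z (sec n k).
Proof.
rewrite /sec; have [h|h] := nth_in_or_default k (secs n) (nil :: nil); last by rewrite h; exists nil; left.
by move: h => /in_map_iff [[Z0 ZZ] [<- _]]; exists Z0; left.
Qed.

Lemma pf01 n y a : 0 <= pf n y a <= 1. Proof. exact: clamp01. Qed.

Lemma vf_bd n k Z lo a i : goodlo lo -> In Z (sec n k) -> lo i <= vf n Z lo a i <= 1.
Proof.
move=> hlo hZ; have h1 := hlo i; rewrite /vf; case: excluded_middle_informative => hi; last lra.
split; first exact: Rmax_l.
apply: Rmax_lub; first lra.
apply: lmx_le; first lra.
move=> z hz; have [_ /(_ i) h2] := sec_sub n k Z z hZ hz; have := pf01 n (fst z) a; nra.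
Qed.

Lemma gp_cube n k Z lo a : goodlo lo -> In Z (sec n k) -> cube a -> cube (gp n Z lo a).
Proof.
move=> hlo hZ ha i; rewrite /gp; case: excluded_middle_informative => hg; last exact: ha.
by have := vf_bd n k Z lo a i hlo hZ; have := hlo i; lra.
Qed.

Lemma cut_gp n Z lo a : (forall i, ~ be i -> a i = 1) -> cut be (gp n Z lo a) = a.
Proof.
move=> ha; apply: functional_extensionality => i; case: (classic (be i)) => hb; last by rewrite cut_out // ha.
by rewrite cut_in // /gp; case: excluded_middle_informative => // hg; case: (hdis i hb hg).
Qed.

Lemma cut_one D : cut D one = one :> T.
Proof. by apply: functional_extensionality => i; rewrite /cut /one; case: excluded_middle_informative. Qed.

Section OneBase.
Context (A : T -> Prop) (lo : T) (hA : okP be A) (hlo : goodlo lo).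

Lemma A_one : A one. Proof. by case: hA. Qed.
Lemma A_mconv : mconv A. Proof. by case: hA => _ []. Qed.
Lemma A_closed : closed A. Proof. by case: hA => _ [_ []]. Qed.
Lemma A_supp : supp be A. Proof. by case: hA => _ [_ [_ []]]. Qed.
Lemma A_nneg : nneg A. Proof. by move=> b /A_supp [hb _] i; apply hb. Qed.

Lemma Gam_cube n k x : Gam n (sec n k) A lo x -> cube x.
Proof.
move=> [->|[Z [a [hZ [ha ->]]]]]; first by move=> i; rewrite /one; lra.
by apply: gp_cube => //; [exact: hZ | apply (A_supp a ha)].
Qed.

Lemma sgm_prefib n k : prefib A lo (sgm n (sec n k) A lo).
Proof.
have gc := Gam_cube n k.
have gn : nneg (Gam n (sec n k) A lo) by move=> x /gc h i; apply h.
split.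
  move=> b [l [h1 [h2 ->]]] i hi; apply: lcomb_lb => // z /h1 [_ [->|[Z [a [hZ [ha ->]]]]]].
    by rewrite /one; apply hlo.
  by rewrite /gp; case: excluded_middle_informative => // _; apply: (proj1 (vf_bd n k Z lo a i hlo hZ)).
split; first by apply: hull_incl => //; left.
split; first exact: hull_mconv.
split.
  move=> b [l [h1 [h2 ->]]]; rewrite cut_lcomb //; last by move=> x /h1 [].
  apply: mconv_lcomb => //; [exact: A_mconv | exact: A_nneg |].
  move=> z /h1 [h3 [->|[Z [a [hZ [ha ->]]]]]]; split => //; first by rewrite cut_one; exact: A_one.
  by rewrite cut_gp //; apply (A_supp a ha).
split.
  move=> a ha; have [Z hZ] := sec_ne n k; exists (gp n Z lo a); split.
    by apply: hull_incl => //; right; exists Z, a.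
  by apply: cut_gp; apply (A_supp a ha).
move=> x hx; split; first exact: cube_hull gc x hx.
move=> i hi; have [l [h1 [h2 ->]]] := hx.
rewrite /lcomb -[RHS](lmx_unit fst l 1) //; [|lra|by move=> z /h1 []].
apply: lmx_ext => z /h1 [_ [->|[Z [a [hZ [ha ->]]]]]]; first by [].
have hn : ~ ga i by move=> hg; apply: hi; apply/hal; right.
have hb : ~ be i by move=> hb; apply: hi; apply/hal; left.
by rewrite /gp; case: excluded_middle_informative => // _; rewrite (proj2 (A_supp a ha)).
Qed.

(** The section collects all selections whose graph over [A] stays near [B]. Its hull stays near [B]
    by convexity. Conversely each [b0] in [B] is nearly hit by a selection that takes the values of
    [b0] at all nodes near the projection of [b0]. Coordinates outside [L n] weigh at most
    [eta n]. *)
Lemma sgm_dense n B : fib A lo B -> exists k, (k < Ms n)%nat /\ hn w (eta n) (sgm n (sec n k) A lo) B.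
Proof.
move=> hB; have hBs := fib_supp _ _ _ hB; have hBm := fib_mconv _ _ _ hB.
have hBc : forall b, B b -> cube b by move=> b /hBs [].
have hBn : nneg B by move=> b /hBc h i; apply h.
have hp := hh_pos n; have [n1 n2] := net_spec n.
pose goodZ (Z : list (T * T)) := forall a, A a -> exists b, B b /\ forall i, In i (L n) -> Rabs (gp n Z lo a i - b i) <= 4 * hh n.
have cover : forall b0, B b0 -> exists Z, In Z (powl (NN n)) /\ goodZ Z /\
   forall i, In i (L n) -> Rabs (gp n Z lo (cut be b0) i - b0 i) <= hh n.
  move=> b0 hb0.
  pose wit (ys : T * T) b := B b /\ (forall i, In i (L n) -> Rabs (snd ys i - b i) <= hh n) /\
     dL n b (fst ys) <= 2 * hh n /\ (dL n b0 (fst ys) <= 2 * hh n -> forall i, In i (L n) -> Rabs (snd ys i - b0 i) <= hh n).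
  have [Z [hZ1 hZ2]] := powl_ex (NN n) (fun ys => exists b, wit ys b).
  exists Z; split => //.
  have [f hf] := choice_on (fun _ => 0) (fun ys => exists b, wit ys b) wit (fun ys h => h).
  have hZw : forall ys, In ys Z -> wit ys (f ys) by move=> ys /hZ2 [_ h]; exact: hf.
  (* Over every point of [A] some node has weight 1, so the weights of the selection are normalized
     there. *)
  have full : forall a, A a -> exists ys, In ys Z /\ pf n (fst ys) a = 1.
    move=> a ha; have [b [hb hab]] := fib_surj _ _ _ _ hB ha.
    have ab : forall i, In i (L n) -> ~ ga i -> a i = b i.
      move=> i _ hg; rewrite -hab; case: (classic (be i)) => hbe; first by rewrite cut_in.
      by rewrite cut_out // (proj2 (hBs _ hb)) // => /hal [].
    have [y [hy1 hy2]] := n2 a (proj1 (A_supp a ha)).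
    have dy : dL n a y <= hh n by apply: dL_le => //; [lra | move=> i hi _; exact: hy2].
    have dyb : dL n b y <= hh n by apply: dL_le; [lra | move=> i hi hg; rewrite -(ab i hi hg); exact: hy2].
    have p1 : pf n y a = 1.
      apply: clamp_1; have : dL n a y / hh n <= 1; last lra.
      apply: (Rmult_le_reg_r (hh n)) => //; rewrite /Rdiv Rmult_assoc Rinv_l; lra.
    (* Near [b0] the witness has to be [b0] itself; elsewhere a point of [B] over [a] will do. *)
    case: (Rle_dec (dL n b0 y) (2 * hh n)) => h0.
      have [s [hs1 hs2]] := n2 b0 (hBc _ hb0).
      exists (y, s); split => //; apply/hZ2; split; first by apply/in_prod_iff.
      by exists b0; split => //; split; [|split] => //= [i hi|_ i hi]; rewrite Rabs_minus_sym; exact: hs2.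
    have [s [hs1 hs2]] := n2 b (hBc _ hb).
    exists (y, s); split => //; apply/hZ2; split; first by apply/in_prod_iff.
    exists b; split => //; split; first by move=> i hi /=; rewrite Rabs_minus_sym; exact: hs2.
    by split => //=; lra.
  have near_d : forall (a : T) (ys : T * T), 0 < pf n (fst ys) a -> dL n a (fst ys) < 2 * hh n.
    move=> a ys h0; have h := clamp_pos _ h0; have h1 : dL n a (fst ys) / hh n < 2 by lra.
    have := Rmult_lt_compat_r (hh n) _ _ hp h1; rewrite /Rdiv Rmult_assoc Rinv_l; lra.
  split.
    move=> a ha; have [ys0 [hys0 hp0]] := full a ha.
    exists (lcomb Z (fun ys => pf n (fst ys) a) f); split.
      apply: mconv_lcomb => //; last by exists ys0.
      by move=> ys hys; split; [exact: pf01 | apply (hZw ys hys)].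
    move=> i hi; rewrite /gp; case: excluded_middle_informative => hg.
      rewrite /vf; case: excluded_middle_informative => // _.
      (* Taking the maximum with [lo i] does not increase the distance to a point that satisfies the
         same lower bound. *)
      have lb : lo i <= lcomb Z (fun ys => pf n (fst ys) a) f i.
        apply: lcomb_lb; first by exists ys0.
        by move=> ys /hZw [hfb _]; exact: fib_bd hB hfb hg.
      have : Rabs (lmx (fun ys => pf n (fst ys) a * snd ys i) Z - lcomb Z (fun ys => pf n (fst ys) a) f i) <= hh n.
        apply: lmx_dist; first lra.
        move=> ys /hZw [_ [h1 _]]; rewrite -Rmult_minus_distr_l Rabs_mulk; last by apply pf01.
        have := h1 i hi; have := pf01 n (fst ys) a; have := Rabs_pos (snd ys i - f ys i); nra.
      move: lb; set u := lcomb _ _ _ _; set v := lmx _ _ => lb; rmx.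
    have an := proj1 (A_supp a ha) i.
    have coord : forall ys, In ys Z -> 0 < pf n (fst ys) a -> Rabs (f ys i - a i) <= 4 * hh n.
      move=> ys /hZw [_ [_ [h2 _]]] /near_d h3.
      have := dL_ub n (f ys) (fst ys) i hi hg; have := dL_ub n a (fst ys) i hi hg; rmx.
    rewrite Rabs_minus_sym; apply: Rabs_le; split.
      have [h1 h2] := hZw _ hys0; have := coord _ hys0 ltac:(lra) => h3.
      have : f ys0 i <= lcomb Z (fun ys => pf n (fst ys) a) f i.
        have := lmx_ub (fun ys => pf n (fst ys) a * f ys i) Z ys0 hys0; rewrite hp0 Rmult_1_l; exact.
      move: h3; rmx.
    have : lcomb Z (fun ys => pf n (fst ys) a) f i <= a i + 4 * hh n; last lra.
    apply: lmx_le; first lra.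
    move=> ys hys; have [p0 p1] := pf01 n (fst ys) a.
    case: (Rlt_dec 0 (pf n (fst ys) a)) => hpos; last by rewrite (_ : pf n (fst ys) a = 0); lra.
    have := coord ys hys hpos; have := hBc _ (proj1 (hZw _ hys)) i.
    move=> h1 h2; have : f ys i <= a i + 4 * hh n by move: h2; rmx.
    nra.
  have ha0 : A (cut be b0) by exact: fib_cut hB hb0.
  move=> i hi; rewrite /gp; case: excluded_middle_informative => hg; last first.
    case: (classic (be i)) => hbe; first by rewrite cut_in // Rminus_diag Rabs_R0; lra.
    by rewrite cut_out // (proj2 (hBs _ hb0)); [rewrite Rminus_diag Rabs_R0; lra | move=> /hal []].
  rewrite /vf; case: excluded_middle_informative => // _.
  have lb := fib_bd _ _ _ _ _ hB hb0 hg.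
  have dcut : forall y, dL n (cut be b0) y = dL n b0 y.
    move=> y; apply: lmx_ext => j _; case: excluded_middle_informative => // hgj.
    case: (classic (be j)) => hbe; first by rewrite cut_in.
    by rewrite cut_out // (proj2 (hBs _ hb0)) // => /hal [].
  have val : forall ys, In ys Z -> 0 < pf n (fst ys) (cut be b0) -> Rabs (snd ys i - b0 i) <= hh n.
    move=> ys /hZw [_ [_ [_ h]]] /near_d; rewrite dcut => h1; apply: h => //; lra.
  have [ys0 [hys0 hp0]] := full _ ha0.
  have h1 : b0 i - hh n <= lmx (fun ys => pf n (fst ys) (cut be b0) * snd ys i) Z.
    have := lmx_ub (fun ys => pf n (fst ys) (cut be b0) * snd ys i) Z ys0 hys0; rewrite hp0 Rmult_1_l.
    have := val _ hys0 ltac:(lra); rmx.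
  have h2 : lmx (fun ys => pf n (fst ys) (cut be b0) * snd ys i) Z <= b0 i + hh n.
    have hb0i := hBc _ hb0 i; apply: lmx_le; first lra.
    move=> ys hys; have [p0 p1] := pf01 n (fst ys) (cut be b0).
    case: (Rlt_dec 0 (pf n (fst ys) (cut be b0))) => hpos; last by rewrite (_ : pf n (fst ys) (cut be b0) = 0); lra.
    have h3 := val ys hys hpos; have : snd ys i <= b0 i + hh n by move: h3; rmx.
    nra.
  move: h1 h2; set u := lmx _ _ => h1 h2; rmx.
(* [ZZ] lists all good selections; [Z0], a good one as well, serves as the head that [secs]
   requires. *)
have [ZZ [hZZ1 hZZ2]] := powl_ex (powl (NN n)) goodZ.
have [Z0 [hZ01 [hZ02 _]]] := cover one (fib_one _ _ _ hB).
have hin : In (Z0 :: ZZ) (secs n).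
  by apply/in_map_iff; exists (Z0, ZZ); split => //; apply/in_prod_iff.
have [k [hk1 hk2]] := In_nth (secs n) (Z0 :: ZZ) (nil :: nil) hin.
exists k; split => //.
have hs : forall Z, In Z (sec n k) -> goodZ Z by rewrite /sec hk2 => Z [<-|/hZZ2 [_ h]].
have hlist : hl w (eta n) (Gam n (sec n k) A lo) B.
  move=> x hx; have cx := Gam_cube n k x hx; case: hx cx => [->|[Z [a [hZ [ha ->]]]]] cx.
    exists one; split; first exact: fib_one hB.
    by move=> i; rewrite Rminus_diag Rabs_R0 Rmult_0_r; exact: Rlt_le (eta_pos n).
  have [b [hb h1]] := hs Z hZ a ha; exists b; split => // i.
  have wi := w01 i; have cb := hBc b hb i; have cxi := cx i; have hpos := Rabs_pos (gp n Z lo a i - b i).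
  case: (classic (In i (L n))) => hi; first by have := h1 i hi; rewrite /hh; nra.
  have := hL n i hi; have : Rabs (gp n Z lo a i - b i) <= 1 by apply: Rabs_le; lra.
  nra.
split; first by apply: hl_hull_conv => //; [exact: w01 | exact: Rlt_le (eta_pos n)].
move=> b hb; have [Z [hZ1 [hZ2 h1]]] := cover b hb.
exists (gp n Z lo (cut be b)); split.
  apply: hull_incl; first by move=> x /Gam_cube h i; apply h.
  right; exists Z, (cut be b); split; last by split => //; exact: fib_cut hB hb.
  by rewrite /sec hk2; right; apply/hZZ2.
move=> i; have wi := w01 i; have cb := hBc b hb i.
have hZk : In Z (sec n k) by rewrite /sec hk2; right; apply/hZZ2.
have cg := gp_cube n k Z lo (cut be b) hlo hZk (proj1 (A_supp _ (fib_cut _ _ _ _ hB hb))) i.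
have hpos := Rabs_pos (b i - gp n Z lo (cut be b) i); have hep := eta_pos n.
case: (classic (In i (L n))) => hi; first by have := h1 i hi; rewrite Rabs_minus_sym /hh; nra.
have := hL n i hi; have : Rabs (b i - gp n Z lo (cut be b) i) <= 1 by apply: Rabs_le; lra.
nra.
Qed.
End OneBase.

Lemma mix_prefib A lo K p G : okP be A -> (forall k, (k < K)%nat -> prefib A lo (G k)) ->
  (forall k, (k < K)%nat -> 0 <= p k <= 1) -> (exists k, (k < K)%nat /\ p k = 1) -> prefib A lo (mix K p G).
Proof.
move=> hA hG hp [k0 [hk0 hp0]].
have h1 : forall k, In k (seq 0 K) -> 0 <= p k <= 1 by move=> k /in_seq hk; apply: hp; lia.
have h2 : exists k, In k (seq 0 K) /\ p k = 1 by exists k0; split => //; apply/in_seq; lia.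
have hlt : forall k, In k (seq 0 K) -> (k < K)%nat by move=> k /in_seq; lia.
split.
  move=> b [x [hx ->]] i hi; apply: lcomb_lb => // k /hlt hk; apply (hG k hk) => //; exact: hx.
split.
  exists (fun _ => one); split; first by move=> k hk; apply (hG k hk).
  by apply: functional_extensionality => i; rewrite /lcomb lmx_unit // /one; lra.
split.
  by apply: mix_mconv => k hk; split; [apply (hG k hk) | apply (hp k hk)].
split.
  move=> b [x [hx ->]]; rewrite cut_lcomb //; apply: mconv_lcomb => //; [exact: A_mconv hA | exact: A_nneg hA |].
  move=> k hk; split; first exact: h1.
  have hk2 := hlt k hk; have [_ [_ [_ [h _]]]] := hG k hk2; apply: h; exact: hx.
split.
  move=> a ha.
  have [x hx] := choice_on (fun _ => 0) (fun k => (k < K)%nat) (fun k b => G k b /\ cut be b = a)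
    (fun k hk => let: conj _ (conj _ (conj _ (conj _ (conj h _)))) := hG k hk in h a ha).
  exists (lcomb (seq 0 K) p x); split; first by exists x; split => // k /hx [].
  rewrite cut_lcomb //; apply: functional_extensionality => i.
  rewrite -[RHS](lmx_unit p (seq 0 K) (a i)) //; last by apply: (A_nneg A hA).
  by apply: lmx_ext => k /hlt /hx [_ ->].
move=> b [x [hx ->]].
have hs : forall k, In k (seq 0 K) -> cube (x k) /\ forall i, ~ al i -> x k i = 1.
  move=> k /hlt hk; have [_ [_ [_ [_ [_ h]]]]] := hG k hk; apply: h; exact: hx.
split; first by apply: cube_lcomb => k hk; split; [exact: h1 | apply (hs k hk)].
move=> i hi; rewrite /lcomb -[RHS](lmx_unit p (seq 0 K) 1) //; last lra.
by apply: lmx_ext => k hk; rewrite (proj2 (hs k hk)).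
Qed.

Lemma mul_le_of_le p x e : 0 <= p <= 1 -> 0 <= x -> x <= e -> p * x <= e.
Proof. nra. Qed.

Lemma mul_le_of_le1 p x e : p <= e -> 0 <= p -> 0 <= x <= 1 -> p * x <= e.
Proof. nra. Qed.

(** The weights [pf] are Lipschitz in the base point with constant [/ hh n], whence the term
    [d / hh n]; the lower bounds enter through a maximum and account for the other [d]. *)
Lemma Gam_near n k A A' lo lo' l d ep : okP be A -> okP be A' -> goodlo lo -> goodlo lo' -> 0 < d ->
  hl (ind (l ++ L n)%list) d A A' -> (forall i, In i (L n) -> Rabs (lo i - lo' i) <= d) ->
  (forall i, ~ In i l -> w i <= ep) -> d + d / hh n <= ep ->
  hl w ep (Gam n (sec n k) A lo) (Gam n (sec n k) A' lo').
Proof.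
move=> hA hA' hlo hlo' hd hAA hll hlw hep.
have hhp := hh_pos n; have hdh : 0 < d / hh n by apply: Rdiv_lt_0_compat.
move=> x [->|[Z [a [hZ [ha ->]]]]].
  by exists one; split; [left | move=> i; rewrite Rminus_diag Rabs_R0; lra].
have [a' [ha' h1]] := hAA a ha; exists (gp n Z lo' a'); split; first by right; exists Z, a'.
have h2 := ind_ge _ _ _ _ h1.
have hL2 : forall i, In i (L n) -> Rabs (a i - a' i) <= d by move=> i hi; apply: h2; apply/in_app_iff; right.
move=> i; have wi := w01 i; have ca := proj1 (A_supp A hA a ha) i; have ca' := proj1 (A_supp A' hA' a' ha') i.
rewrite /gp; case: excluded_middle_informative => hg; last first.
  have hpos := Rabs_pos (a i - a' i); case: (classic (In i l)) => hi.
    have h3 := h2 i ltac:(by apply/in_app_iff; left).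
    by apply: mul_le_of_le => //; lra.
  apply: mul_le_of_le1; [exact: hlw | lra |].
  by split => //; apply: Rabs_le; lra.
rewrite /vf; case: excluded_middle_informative => hi; last by rewrite Rminus_diag Rabs_R0; lra.
have key : Rabs (lmx (fun ys => pf n (fst ys) a * snd ys i) Z - lmx (fun ys => pf n (fst ys) a' * snd ys i) Z) <= d / hh n.
  apply: lmx_dist; first lra.
  move=> ys hys; have [_ /(_ i) cs] := sec_sub n k Z ys hZ hys.
  rewrite -Rmult_minus_distr_r Rabs_mult (Rabs_pos_eq (snd ys i)); last lra.
  have : Rabs (pf n (fst ys) a - pf n (fst ys) a') <= d / hh n.
    apply: clamp_dist; have -> : 2 - dL n a (fst ys) / hh n - (2 - dL n a' (fst ys) / hh n) = / hh n * (dL n a' (fst ys) - dL n a (fst ys)).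
      by rewrite /Rdiv; ring.
    rewrite Rabs_mulk; last by apply: Rlt_le; apply: Rinv_0_lt_compat.
    rewrite Rmult_comm; apply: Rmult_le_compat_r; first by apply: Rlt_le; apply: Rinv_0_lt_compat.
    by rewrite Rabs_minus_sym; apply: dL_dist => //; lra.
  have := Rabs_pos (pf n (fst ys) a - pf n (fst ys) a'); nra.
have h3 : Rabs (Rmax (lo i) (lmx (fun ys => pf n (fst ys) a * snd ys i) Z) - Rmax (lo' i) (lmx (fun ys => pf n (fst ys) a' * snd ys i) Z)) <= ep.
  by apply: Rmax_dist; [have := hll i hi; lra | lra].
by apply: mul_le_of_le => //; exact: Rabs_pos.
Qed.

Lemma Gam_hn n k A A' lo lo' l d ep : okP be A -> okP be A' -> goodlo lo -> goodlo lo' -> 0 < d ->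
  hn (ind (l ++ L n)%list) d A A' -> (forall i, In i (L n) -> Rabs (lo i - lo' i) <= d) ->
  (forall i, ~ In i l -> w i <= ep) -> d + d / hh n <= ep ->
  hn w ep (sgm n (sec n k) A lo) (sgm n (sec n k) A' lo').
Proof.
move=> hA hA' hlo hlo' hd [h1 h2] hll hlw hep.
have hhp := hh_pos n; have hdh : 0 < d / hh n by apply: Rdiv_lt_0_compat.
split; apply: hl_hull; try exact: w01; try lra.
- exact: Gam_cube hA' hlo' n k.
- exact: Gam_near hA hA' hlo hlo' hd h1 hll hlw hep.
- exact: Gam_cube hA hlo n k.
- apply: (Gam_near n k A' A lo' lo l d ep) => // i hi; rewrite Rabs_minus_sym; exact: hll.
Qed.

(** * The factor theorem for hyperspace fibres over a parameter space *)

Section FibFactor.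
Context (Y : space) (Aof : Y -> T -> Prop) (lof : Y -> T)
  (hYA : forall y, ok Y y -> okP be (Aof y)) (hYl : forall y, ok Y y -> goodlo (lof y))
  (hYc : forall N F (ys : N -> Y) y, filt F -> (forall i, ok Y (ys i)) -> ok Y y -> cv Y N F ys y ->
     htends F (fun m => Aof (ys m)) (Aof y) /\ forall i, tends F (fun m => lof (ys m) i) (lof y i)).

Definition fS (n k : nat) (y : Y) (B : T -> Prop) : R := ed w B (sgm n (sec n k) (Aof y) (lof y)).

(** Only the sections whose coded distance is nearly minimal get a positive weight. *)
Definition fp (n : nat) (v : nat -> R) (k : nat) : R := clamp (2 - (v k - bmin v (Ms n - 1)) / eta n).

Definition fmix (n : nat) (y : Y) (v : nat -> R) : T -> Prop :=
  mix (Ms n) (fp n v) (fun k => sgm n (sec n k) (Aof y) (lof y)).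

Definition fc (n : nat) (y : Y) (v : nat -> R) : T -> Prop := cl (fmix n y v).

Lemma Ms_pos n : (0 < Ms n)%nat.
Proof.
have [Z [hZ _]] := powl_ex (NN n) (fun _ => True); have [ZZ [hZZ _]] := powl_ex (powl (NN n)) (fun _ => True).
have : In (Z :: ZZ) (secs n) by apply/in_map_iff; exists (Z, ZZ); split => //; apply/in_prod_iff.
by rewrite /Ms; case: (secs n) => [|x l] //= _; lia.
Qed.

Lemma fp_one n v : exists k, (k < Ms n)%nat /\ fp n v k = 1.
Proof.
have hM := Ms_pos n; have [k [hk hv]] := bmin_attain v (Ms n - 1).
exists k; split; first lia.
by rewrite /fp hv; apply: clamp_1; rewrite Rminus_diag /Rdiv Rmult_0_l; lra.
Qed.

Lemma fmix_prefib n y v : ok Y y -> prefib (Aof y) (lof y) (fmix n y v).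
Proof.
move=> hy; apply: mix_prefib; first exact: hYA.
- by move=> k _; apply: sgm_prefib; [exact: hYA | exact: hYl].
- by move=> k _; exact: clamp01.
- exact: fp_one.
Qed.

Lemma fc_fib n y v : ok Y y -> fib (Aof y) (lof y) (fc n y v).
Proof. by move=> hy; apply: fib_cl; [exact: A_closed (hYA y hy) | exact: fmix_prefib]. Qed.

Lemma sgm_tends n k N F (ys : N -> Y) y : filt F -> (forall i, ok Y (ys i)) -> ok Y y -> cv Y N F ys y ->
  forall ep, 0 < ep -> F (fun m => hn w ep (sgm n (sec n k) (Aof (ys m)) (lof (ys m))) (sgm n (sec n k) (Aof y) (lof y))).
Proof.
move=> hF h1 hy hc ep hep; have [hcA hcl] := hYc _ _ _ _ hF h1 hy hc.
have hhp := hh_pos n.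
have [l hl0] := proj2 (proj2 hw) ep hep.
pose d := ep * hh n / (1 + hh n).
have hd : 0 < d by apply: Rdiv_lt_0_compat; nra.
have hde : d + d / hh n = ep by rewrite /d; field; lra.
have h2 := filt_list F (L n) (fun i m => Rabs (lof (ys m) i - lof y i) <= d) hF (fun i _ => hcl i d hd).
apply: (filt2 _ _ hF (hcA (l ++ L n)%list d hd) h2) => m h3 h4.
by apply: (Gam_hn n k _ _ _ _ l d) => //; [exact: hYA | exact: hYA | exact: hYl | exact: hYl | lra].
Qed.

Lemma sgm_tends_ed n k N F (ys : N -> Y) y : filt F -> (forall i, ok Y (ys i)) -> ok Y y -> cv Y N F ys y ->
  tends F (fun m => ed w (sgm n (sec n k) (Aof (ys m)) (lof (ys m))) (sgm n (sec n k) (Aof y) (lof y))) 0.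
Proof.
move=> hF h1 hy hc ep hep; apply: (filt1 _ hF (sgm_tends n k _ _ _ _ hF h1 hy hc ep hep)) => m h.
by rewrite Rminus_0_r Rabs_pos_eq; [apply: ed_le => //; lra | exact: ed_ge0].
Qed.

Lemma fS_lip n k y B B' : Rabs (fS n k y B - fS n k y B') <= ed w B B'.
Proof. by apply: ed_dist; exact: w0. Qed.

Lemma fS_cv n k N F (ys : N -> Y) y (bs : N -> T -> Prop) b : filt F -> (forall i, ok Y (ys i)) -> ok Y y ->
  cv Y N F ys y -> tends F (fun i => ed w (bs i) b) 0 -> tends F (fun i => fS n k (ys i) (bs i)) (fS n k y b).
Proof.
move=> hF h1 hy hc hb ep hep; have hep2 : 0 < ep / 2 by lra.
apply: (filt2 _ _ hF (hb _ hep2) (sgm_tends_ed n k _ _ _ _ hF h1 hy hc _ hep2)) => m.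
rewrite !Rminus_0_r.
move=> /(Rle_trans _ _ _ (Rle_abs _)) h2 /(Rle_trans _ _ _ (Rle_abs _)) h3; rewrite /fS; set s := sgm _ _ _ _ in h3 *; set s' := sgm _ _ _ _ in h3 *.
have d1 := ed_dist w w0 (bs m) b s; have d2 := ed_dist w w0 s s' b.
rewrite (ed_sym w s b) (ed_sym w s' b) in d2.
move: d1 d2; rmx.
Qed.

Lemma fc_cv n N F (ys : N -> Y) y (vs : N -> nat -> R) v : filt F -> (forall i, ok Y (ys i)) -> ok Y y ->
  cv Y N F ys y -> (forall m, tends F (fun i => vs i m) (v m)) ->
  tends F (fun i => ed w (fc n (ys i) (vs i)) (fc n y v)) 0.
Proof.
move=> hF h1 hy hc hv ep hep; have hep2 : 0 < ep / 2 by lra.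
have hp : forall k, tends F (fun i => fp n (vs i) k) (fp n v k).
  move=> k; apply: tends_clamp => //; apply: tends_minus => //; first exact: tends_const.
  apply: tends_div => //; [have := eta_pos n; lra | | exact: tends_const].
  by apply: tends_minus => //; apply: tends_bmin.
have f1 := filt_list F (seq 0 (Ms n)) (fun k m => Rabs (fp n (vs m) k - fp n v k) <= ep / 2) hF (fun k _ => hp k _ hep2).
have f2 := filt_list F (seq 0 (Ms n)) (fun k m => hn w (ep / 2) (sgm n (sec n k) (Aof (ys m)) (lof (ys m))) (sgm n (sec n k) (Aof y) (lof y))) hF
   (fun k _ => sgm_tends n k _ _ _ _ hF h1 hy hc _ hep2).
apply: (filt2 _ _ hF f1 f2) => m g1 g2; rewrite Rminus_0_r Rabs_pos_eq; last exact: ed_ge0.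
have sup : forall y v, ok Y y -> supp al (fmix n y v) by move=> y' v' hy'; have [_ [_ [_ [_ [_ h]]]]] := fmix_prefib n y' v' hy'.
have near : hn w ep (fmix n (ys m) (vs m)) (fmix n y v).
  have cb : forall y', ok Y y' -> forall k, (k < Ms n)%nat -> forall b, sgm n (sec n k) (Aof y') (lof y') b -> cube b.
    by move=> y' hy' k hk; apply: cube_hull; apply: Gam_cube; [exact: hYA | exact: hYl].
  have e2 : ep = ep / 2 + ep / 2 by lra.
  have i1 : forall k, (k < Ms n)%nat -> In k (seq 0 (Ms n)) by move=> k hk; apply/in_seq; lia.
  rewrite e2; split; apply: mix_near; try exact: w01; try lra; try (by apply: cb); try (by move=> k hk; apply (g2 k (i1 k hk))).
  { by move=> k hk; split; [exact: clamp01 | exact: g1 k (i1 k hk)]. }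
  { by move=> k hk; split; [exact: clamp01 | rewrite Rabs_minus_sym; exact: g1 k (i1 k hk)]. }
have t1 := ed_tri w w0 (fc n (ys m) (vs m)) (fmix n (ys m) (vs m)) (fc n y v).
have t2 := ed_tri w w0 (fmix n (ys m) (vs m)) (fmix n y v) (fc n y v).
have t3 := ed_le w _ _ ep ltac:(lra) near.
have z1 := ed_cl al w _ hw (sup (ys m) (vs m) (h1 m)); have z2 := ed_cl al w _ hw (sup y v hy).
rewrite (ed_sym w (fmix n y v)) in t2; rewrite -/(fc n (ys m) (vs m)) in z1; rewrite -/(fc n y v) in z2; lra.
Qed.

(** Some section has coded distance at most [eta n + d]. A section of positive weight exceeds the
    minimum by less than [2 * eta n], so its true distance from [B] is at most
    [2 * d + 3 * eta n]. *)
Lemma fc_near n y v B d : ok Y y -> fib (Aof y) (lof y) B -> 0 <= d ->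
  (forall k, (k < Ms n)%nat -> Rabs (v k - fS n k y B) <= d) -> ed w (fc n y v) B <= 2 * d + 3 * eta n.
Proof.
move=> hy hB hd hv; have hep := eta_pos n; have hM := Ms_pos n.
have sup : supp al (fmix n y v) by have [_ [_ [_ [_ [_ h]]]]] := fmix_prefib n y v hy.
have z1 := ed_cl al w _ hw sup; rewrite -/(fc n y v) in z1.
have t1 := ed_tri w w0 (fc n y v) (fmix n y v) B.
suff : ed w (fmix n y v) B <= 2 * d + 3 * eta n by lra.
(* [ed] is truncated at 1, so a bound of at least 1 is trivial, and a smaller one can be turned into
   the nearness [hn]. *)
case: (Rle_dec 1 (2 * d + 3 * eta n)) => hbig; first by have := ed_le1 w (fmix n y v) B; lra.
have [k0 [hk0 hn0]] := sgm_dense _ _ (hYA y hy) (hYl y hy) n B hB.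
have e0 := ed_le w _ _ _ (Rlt_le _ _ hep) hn0.
have v0 : v k0 <= eta n + d by have := hv k0 hk0; rewrite /fS ed_sym; rmx.
have m0 : bmin v (Ms n - 1) <= v k0 by apply: bmin_le; lia.
have hBs := fib_supp _ _ _ hB.
apply: ed_le; first lra.
apply: mix_conv.
- exact: w01.
- lra.
- exact: fib_mconv hB.
- by move=> b /hBs [].
- by move=> k _; exact: clamp01.
- exact: fp_one.
- by exists one; exact: fib_one hB.
- move=> k hk; have [_ [h1 [_ [_ [_ h2]]]]] := sgm_prefib _ _ (hYA y hy) (hYl y hy) n k.
  by split; [move=> b /h2 [] | exists one].
- move=> k hk hpos; apply: ed_lt1; last lra.
  have h1 : 0 < 2 - (v k - bmin v (Ms n - 1)) / eta n by exact: clamp_pos hpos.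
  have h2 : (v k - bmin v (Ms n - 1)) / eta n < 2 by lra.
  have h3 : v k - bmin v (Ms n - 1) < 2 * eta n.
    have := Rmult_lt_compat_r (eta n) _ _ hep h2; rewrite /Rdiv Rmult_assoc Rinv_l; lra.
  have := hv k hk; rewrite /fS ed_sym; rmx.
Qed.

(** A closed part [Q] of the fibre is treated by following the decoder with a retraction [rho] onto
    it. [rho] need not be Lipschitz: [rho_near] allows the loss [2 ^ n] and the error [eta n], which
    the factor theorem tolerates. *)
Context (Q : Y -> (T -> Prop) -> Prop) (rho : Y -> (T -> Prop) -> T -> Prop) (C : Y -> R).
Notation fb y := (fib (Aof y) (lof y)).
Context (rho_fib : forall y B, ok Y y -> fb y B -> fb y (rho y B) /\ Q y (rho y B))
  (rho_cv : forall N F (ys : N -> Y) y (bs : N -> T -> Prop) b, filt F -> (forall i, ok Y (ys i)) -> ok Y y ->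
     (forall i, fb (ys i) (bs i)) -> fb y b ->
     cv Y N F ys y -> tends F (fun i => ed w (bs i) b) 0 -> tends F (fun i => ed w (rho (ys i) (bs i)) (rho y b)) 0)
  (rho_near : forall n y B B', ok Y y -> fb y B -> fb y B' -> Q y B' -> ed w (rho y B) B' <= C y * (2 ^ n * ed w B B' + eta n))
  (Q_closed : forall y (b : nat -> T -> Prop) B, ok Y y -> (forall n, fb y (b n) /\ Q y (b n)) -> fb y B ->
     (forall d, 0 < d -> exists n0, forall n, (n0 <= n)%nat -> ed w (b n) B <= d) -> Q y B)
  (C_ge0 : forall y, ok Y y -> 0 <= C y)
  (C_cv : forall N F (ys : N -> Y) y, filt F -> (forall i, ok Y (ys i)) -> ok Y y ->
     cv Y N F ys y -> tends F (fun i => C (ys i)) (C y)).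

(** The decoder is [rho] after [fc]. The constant 4 collects the [2 * d + 3 * eta n] of [fc_near],
    multiplied by [2 ^ n], and the additional [eta n] of [rho_near]. *)
Lemma fib_factor : hov (prodS (totS Y (T -> Prop) (fun y B => fb y B /\ Q y B) (ed w)) Rw) (prodS Y Rw)
  (fun z => fst (fst z)) (fun z => fst z).
Proof.
apply: (factor Y (T -> Prop) _ (ed w) Ms fS (fun n y v => rho y (fc n y v)) eta (fun k => 2 ^ (k * k)) (fun y => 4 * C y)).
- by move=> a b; exact: ed_ge0.
- by move=> a; exact: ed_refl.
- by move=> a b; exact: ed_sym.
- by move=> a b d; apply: ed_tri; exact: w0.
- move=> y a b _ [ha _] [hb _] h; apply: ed_eq0 => //; [exact: fib_supp ha | exact: fib_supp hb | |].
    by case: ha.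
  by case: hb.
- move=> y b K hy hb hK hs.
  have [B [h1 h2]] := fib_complete (Aof y) (lof y) b K (A_closed _ (hYA y hy)) (fun n => proj1 (hb n)) hK hs.
  by exists B; split => //; split => //; exact: Q_closed h2.
- by move=> n m y a b _ _ _; exact: fS_lip.
- by move=> n m N F ys y bs b hF h1 h2 _ _; exact: fS_cv.
- by move=> n y v hy; apply: rho_fib => //; exact: fc_fib.
- move=> n N F ys y vs v hF h1 h2 h3 h4; apply: rho_cv => //; [by move=> i; exact: fc_fib | exact: fc_fib |].
  exact: fc_cv.
- by move=> y hy; have := C_ge0 y hy; lra.
- move=> N F ys y hF h1 h2 h3; apply: tends_mult => //; [exact: tends_const | exact: C_cv].
- move=> n y v b d hy [hb hq] hd hv.
  have h1 := rho_near n _ _ _ hy (fc_fib n y v hy) hb hq; have h2 := fc_near n y v b d hy hb hd hv.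
  have h3 := C_ge0 y hy; have h4 := eta_pos n; have h5 := pow2_ge1 n.
  apply: Rle_trans h1 _; have -> : 4 * C y * 2 ^ n * (d + eta n) = C y * (4 * (2 ^ n * d) + 4 * (2 ^ n * eta n)) by ring.
  apply: Rmult_le_compat_l => //.
  have : 2 ^ n * ed w (fc n y v) b <= 2 ^ n * (2 * d + 3 * eta n) by apply: Rmult_le_compat_l => //; lra.
  have : 0 <= 2 ^ n * d by apply: Rmult_le_pos; lra.
  nra.
- by move=> n; exact: Rlt_le (eta_pos n).
- exact: eta_sm.
Qed.
End FibFactor.
End Fib.

Lemma hov_base {B B' : Type} (X Y : space) (p : X -> B) (q : Y -> B) (f : B -> B') :
  hov X Y p q -> hov X Y (fun x => f (p x)) (fun y => f (q y)).
Proof.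
move=> [u [v [h1 [h2 [h3 [h4 h5]]]]]]; exists u, v; do 4 (split => //).
by move=> x hx; rewrite h5.
Qed.

Lemma totS_ext {B E : Type} (Y : space) (X X' : Y -> E -> Prop) e (p : Y -> B) :
  (forall y b, X y b -> X' y b) -> (forall y b, X' y b -> X y b) ->
  hov (totS Y E X e) (totS Y E X' e) (fun z => p (fst z)) (fun z => p (fst z)).
Proof.
move=> h1 h2; exists (fun z => z), (fun z => z).
split; first by split => // z [h3 h4]; split => //; exact: h1.
by split; first by split => // z [h3 h4]; split => //; exact: h2.
Qed.

(** * Projections between hyperspaces as bundles *)

Section Prs.
Context {I : Type}.
Notation T := (I -> R).

Lemma set_ext {A : Type} (P Q : A -> Prop) : (forall x, P x <-> Q x) -> P = Q.
Proof. by move=> h; apply: functional_extensionality => x; apply: propositional_extensionality. Qed.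

Definition prs (D : I -> Prop) (A : T -> Prop) (x : T) : Prop := exists a, A a /\ x = cut D a.

Lemma cut_cut (D D' : I -> Prop) a : (forall i, D i -> D' i) -> cut D (cut D' a) = cut D a.
Proof.
move=> h; apply: functional_extensionality => i; case: (classic (D i)) => hi; last by rewrite !cut_out.
by rewrite !cut_in //; exact: h.
Qed.

Lemma cut_supp (D : I -> Prop) a : (forall i, ~ D i -> a i = 1) -> cut D a = a.
Proof.
move=> h; apply: functional_extensionality => i; case: (classic (D i)) => hi; first by rewrite cut_in.
by rewrite cut_out // h.
Qed.

Lemma prs_prs (D D' : I -> Prop) A : (forall i, D i -> D' i) -> prs D (prs D' A) = prs D A.
Proof.
move=> h; apply: set_ext => x; split.
  by move=> [_ [[a [ha ->]] ->]]; exists a; rewrite cut_cut.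
by move=> [a [ha ->]]; exists (cut D' a); split; [exists a | rewrite cut_cut].
Qed.

(** The approximations of [x] by points [f a] generate a proper filter containing [A]. A refining
    ultrafilter makes [f] converge to [x], and by compactness of the cube it also makes the points
    [a] themselves converge. *)
Lemma cl_ultra (A : T -> Prop) (f : T -> T) x : (forall a, A a -> cube a) -> cl (fun y => exists a, A a /\ y = f a) x ->
  exists U : (T -> Prop) -> Prop, ultra U /\ U A /\ (forall i, tends U (fun a => f a i) (x i)) /\
    exists a, cube a /\ forall i, tends U (fun b => b i) (a i).
Proof.
move=> hA hx.
pose F (P : T -> Prop) := exists l ep, 0 < ep /\ forall a, A a -> (forall i, In i l -> Rabs (x i - f a i) <= ep) -> P a.
have hF : filt F.
  split; first by exists nil, 1; split; [lra |].
  split.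
    move=> P Q [l1 [e1 [h1 h2]]] [l2 [e2 [h3 h4]]]; exists (l1 ++ l2)%list, (Rmin e1 e2).
    split; first by rmx.
    move=> a ha h5; split; [apply: h2 | apply: h4] => // i hi.
      by apply: Rle_trans (Rmin_l e1 e2); apply: h5; apply/in_app_iff; left.
    by apply: Rle_trans (Rmin_r e1 e2); apply: h5; apply/in_app_iff; right.
  by move=> P Q h [l [e [h1 h2]]]; exists l, e; split => // a h3 h4; apply: h; exact: h2.
have [U [hU hs]] : exists U, ultra U /\ forall P, F P -> U P.
  apply: ultra_ex => // -[l [e [h1 h2]]]; have [_ [[a [ha ->]] h3]] := hx l e h1; exact: (h2 a).
have hUA : U A by apply: hs; exists nil, 1; split; [lra |].
exists U; split => //; split => //; split.
  move=> i ep hep; apply: hs; exists (i :: nil), ep; split => // a _ h.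
  by rewrite Rabs_minus_sym; apply: h; left.
have [_ [_ h01]] := hU.
(* Points outside [A] are replaced by [one], so that a family indexed by all of [T] lies in the
   cube; the ultrafilter contains [A] and does not notice. *)
have hb : forall b : T, exists b', cube b' /\ (A b -> b' = b).
  move=> b; case: (classic (A b)) => h; first by exists b; split => //; exact: hA.
  by exists one; split => // i; rewrite /one; lra.
have [g hg] := choice_fun _ hb; have [a [h1 h2]] := ulim_T U g hU (fun b => proj1 (hg b)).
exists a; split => // i ep hep; apply: (filt2 _ _ (proj1 hU) hUA (h2 i ep hep)) => b h3.
by rewrite (proj2 (hg b) h3).
Qed.

Lemma tends_uniq {N : Type} (U : (N -> Prop) -> Prop) f l l' : filt U -> ~ U (fun _ => False) ->
  tends U f l -> tends U f l' -> l = l'.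
Proof.
move=> hU hp h1 h2; apply: Rle_antisym.
  by apply: (tends_le_lim U hU f f) => //; apply: (filtT _ _ hU) => m; lra.
by apply: (tends_le_lim U hU f f) => //; apply: (filtT _ _ hU) => m; lra.
Qed.

Lemma tends_cut {N : Type} (U : (N -> Prop) -> Prop) D (b : N -> T) a : filt U ->
  (forall i, tends U (fun m => b m i) (a i)) -> forall i, tends U (fun m => cut D (b m) i) (cut D a i).
Proof.
move=> hU h i; case: (classic (D i)) => hi.
  by rewrite cut_in //; apply: (tends_ext _ hU _ _ _ _ (h i)) => m; rewrite cut_in.
by rewrite cut_out //; apply: (tends_ext _ hU (fun _ => 1)); [move=> m; rewrite cut_out | exact: tends_const].
Qed.

Lemma closed_prs D (A : T -> Prop) : (forall a, A a -> cube a) -> closed A -> closed (prs D A).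
Proof.
move=> hA hc x hx; have [U [hU [hUA [h1 [a [h2 h3]]]]]] := cl_ultra A (cut D) x hA hx.
have [hf [hp _]] := hU.
exists a; split; first exact: (closed_lim U A (fun b => b) a hf hp hc hUA h3).
apply: functional_extensionality => i.
exact: (tends_uniq U (fun b => cut D b i) _ _ hf hp (h1 i) (tends_cut U D (fun b => b) a hf h3 i)).
Qed.

Lemma okP_cube al (A : T -> Prop) : okP al A -> forall a, A a -> cube a.
Proof. by move=> [_ [_ [_ [h _]]]] a /h []. Qed.

Lemma okP_supp al (A : T -> Prop) : okP al A -> supp al A.
Proof. by move=> [_ [_ [_ [h _]]]]. Qed.

Lemma cube_cut D (a : T) : cube a -> cube (cut D a).
Proof.
move=> h i; case: (classic (D i)) => hi; first by rewrite cut_in.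
by rewrite cut_out //; lra.
Qed.

Lemma okP_prs al be (A : T -> Prop) : okP al A -> okP be (prs be A).
Proof.
move=> hA; have hc := okP_cube al A hA; have [h1 [h2 [h3 [h4 [l [h5 h6]]]]]] := hA.
split; first by exists one; split => //; rewrite cut_one.
split.
  move=> _ _ p q [a [ha ->]] [b [hb ->]] hp hq hpq.
  by exists (comb p q a b); split; [exact: h2 | rewrite cut_comb].
split; first exact: closed_prs.
split.
  move=> _ [a [ha ->]]; split; first exact: cube_cut (hc a ha).
  by move=> i hi; rewrite cut_out.
exists (cut be l); split.
  move=> i; case: (classic (be i)) => hi; first by rewrite cut_in.
  by rewrite cut_out //; lra.
move=> _ [a [ha ->]] i; case: (classic (be i)) => hi; first by rewrite !cut_in //; exact: h6.
by rewrite !cut_out //; lra.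
Qed.

Lemma hn_prs D l ep (A B : T -> Prop) : 0 <= ep -> hn (ind l) ep A B -> hn (ind l) ep (prs D A) (prs D B).
Proof.
move=> hep; have key : forall A B, hl (ind l) ep A B -> hl (ind l) ep (prs D A) (prs D B).
  move=> A' B' h _ [a [ha ->]]; have [b [hb h1]] := h a ha; exists (cut D b); split; first by exists b.
  move=> i; case: (classic (D i)) => hi; first by rewrite !cut_in.
  by rewrite !cut_out // Rminus_diag Rabs_R0; lra.
by move=> [h1 h2]; split; apply: key.
Qed.

Lemma htends_prs {N : Type} (F : (N -> Prop) -> Prop) D As (A : T -> Prop) : filt F ->
  htends F As A -> htends F (fun m => prs D (As m)) (prs D A).
Proof. by move=> hF h l ep hep; apply: (filt1 _ hF (h l ep hep)) => m; apply: hn_prs; lra. Qed.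

(** The weight of [i] in [al] is [eta (nu i)], and [L n] contains the finitely many such [i] with
    [nu i < n]. The last property ties weights to positions, for use in [tau_move]. *)
Lemma weight_ex (al : I -> Prop) (nu : I -> nat) : (forall i j, al i -> al j -> nu i = nu j -> i = j) ->
  exists (w : T) (L : nat -> list I), wt al w /\ (forall n i, ~ In i (L n) -> w i <= eta n) /\
    forall n i, (n <= nu i)%nat -> w i <= eta n.
Proof.
move=> hnu.
have hL : forall n, exists l, forall i, al i -> (nu i < n)%nat -> In i l.
  elim=> [|n [l hl0]]; first by exists nil => i _; lia.
  case: (classic (exists i, al i /\ nu i = n)) => h.
    have [i0 [h1 h2]] := h; exists (i0 :: l) => i hi hn0; case: (Nat.eq_dec (nu i) n) => h3.
      by left; apply: hnu => //; rewrite h2.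
    by right; apply: hl0 => //; lia.
  exists l => i hi hn0; apply: hl0 => //; case: (Nat.eq_dec (nu i) n) => h3; last lia.
  by case: h; exists i.
have [L hL0] := choice_fun _ hL.
pose w i := if excluded_middle_informative (al i) then eta (nu i) else 0.
have eta1 : forall n, eta n <= 1.
  by move=> n; have := eta_sm 0 n; rewrite /= Rmult_1_l.
have etam : forall n m, (n <= m)%nat -> eta m <= eta n.
  move=> n m h; apply: Rinv_le_contravar; first exact: pow2_pos.
  by apply: pow2_mono; nia.
have hwL : forall n i, ~ In i (L n) -> w i <= eta n.
  move=> n i hi; rewrite /w; case: excluded_middle_informative => hal; last exact: Rlt_le (eta_pos n).
  by apply: etam; case: (le_lt_dec n (nu i)) => // h; case: hi; exact: hL0.
have hwn : forall n i, (n <= nu i)%nat -> w i <= eta n.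
  move=> n i h; rewrite /w; case: excluded_middle_informative => hi; first exact: etam.
  exact: Rlt_le (eta_pos n).
exists w, L; split => //; split; last split.
- move=> i; rewrite /w; case: excluded_middle_informative => hal; last lra.
  by split; [exact: Rlt_le (eta_pos _) | exact: eta1].
- by move=> i hi; rewrite /w; case: excluded_middle_informative => // _; exact: eta_pos.
- move=> d hd; have [n hn0] := half_pow_small 1 d hd; exists (L (S n)) => i /hwL h.
  apply: Rle_trans h _; have := hn0 (S n) ltac:(lia).
  have : eta (S n) <= (/ 2) ^ (S n); last lra.
  by rewrite /eta pow_inv; apply: Rinv_le_contravar; [exact: pow2_pos | apply: pow2_mono; nia].
Qed.

Definition mi (A : T -> Prop) (i : I) : R := infr (fun r => exists a, A a /\ r = a i).

Lemma mi_le A a i : nneg A -> A a -> mi A i <= a i.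
Proof. by move=> h ha; apply: (infr_lb _ 0); [move=> _ [b [hb ->]]; exact: h | exists a]. Qed.

Lemma mi_ge (A : T -> Prop) i c : (exists a, A a) -> (forall a, A a -> c <= a i) -> c <= mi A i.
Proof. by move=> [a ha] h; apply: infr_ge; [exists (a i), a | move=> _ [b [hb ->]]; exact: h]. Qed.

Lemma mi_near A B i ep : nneg A -> nneg B -> (exists a, A a) -> (exists b, B b) ->
  hn (ind (i :: nil)) ep A B -> Rabs (mi A i - mi B i) <= ep.
Proof.
have key : forall A B, nneg A -> nneg B -> (exists b, B b) -> hl (ind (i :: nil)) ep B A -> mi A i <= mi B i + ep.
  move=> A' B' hA hB nB h; suff : mi A' i - ep <= mi B' i by lra.
  apply: mi_ge => // b hb; have [a [ha h1]] := h b hb.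
  have := mi_le A' a i hA ha; have := ind_ge _ _ _ _ h1 i (or_introl eq_refl); rmx.
move=> hA hB nA nB [h1 h2]; have := key A B hA hB nB h2; have := key B A hB hA nA h1 => h3 h4.
apply: Rabs_le; lra.
Qed.

Lemma okP_nneg al (A : T -> Prop) : okP al A -> nneg A.
Proof. by move=> h a /(okP_cube al A h) hc i; apply hc. Qed.

Lemma mi_bd al A i : okP al A -> 0 < mi A i <= 1.
Proof.
move=> h; have hn0 := okP_nneg al A h; have [h1 [_ [_ [_ [l [h2 h3]]]]]] := h; split.
  by apply: Rlt_le_trans (h2 i) _; apply: mi_ge; [exists one | move=> a ha; exact: h3].
by have := mi_le A one i hn0 h1; rewrite /one.
Qed.

Lemma mi_cv {N : Type} (F : (N -> Prop) -> Prop) al As A i : filt F -> (forall m, okP al (As m)) -> okP al A ->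
  htends F As A -> tends F (fun m => mi (As m) i) (mi A i).
Proof.
move=> hF h1 h2 h ep hep; apply: (filt1 _ hF (h (i :: nil) ep hep)) => m; apply: mi_near.
- exact: okP_nneg (h1 m).
- exact: okP_nneg h2.
- by exists one; exact: (proj1 (h1 m)).
- by exists one; exact: (proj1 h2).
Qed.

Lemma ln_le x y : 0 < x -> x <= y -> ln x <= ln y.
Proof.
move=> hx hxy; case: (Req_dec x y) => [->|hne]; first lra.
by apply: Rlt_le; apply: ln_increasing; lra.
Qed.

(** The family [f] on [ga], indexed along [nu] and extended by [0]. *)
Definition ext (ga : I -> Prop) (nu : I -> nat) (f : I -> R) (k : nat) : R :=
  epsilon (inhabits 0) (fun r => (exists i, ga i /\ nu i = k /\ r = f i) \/ ((forall i, ga i -> nu i <> k) /\ r = 0)).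

Section Ext.
Context (ga : I -> Prop) (nu : I -> nat) (hnu : forall i j, ga i -> ga j -> nu i = nu j -> i = j).

Lemma ext_in f i : ga i -> ext ga nu f (nu i) = f i.
Proof.
move=> hi; rewrite /ext; set P := (fun r => _); have : P (epsilon (inhabits 0) P).
  by apply: epsilon_spec; exists (f i); left; exists i.
by move=> [[j [h1 [/hnu h2 ->]]]|[h _]]; [rewrite h2 | case: (h i hi)].
Qed.

Lemma ext_out f k : (forall i, ga i -> nu i <> k) -> ext ga nu f k = 0.
Proof.
move=> hk; rewrite /ext; set P := (fun r => _); have : P (epsilon (inhabits 0) P).
  by apply: epsilon_spec; exists 0; right.
by move=> [[j [h1 [h2 _]]]|[_ h]] //; case: (hk j h1).
Qed.

Lemma ext_cases k : (exists i, ga i /\ nu i = k) \/ (forall i, ga i -> nu i <> k).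
Proof.
case: (classic (exists i, ga i /\ nu i = k)) => h; [by left | right => i h1 h2; apply: h; by exists i].
Qed.
End Ext.

(** Sequences [t] above this threshold encode the lower bounds [exp (- t)] for [A] on [ga]. The
    threshold is continuous in [A], so [absorb_maj] adjoins such a [t] for free. *)
Definition thr (ga : I -> Prop) (nu : I -> nat) (A : T -> Prop) : nat -> R := ext ga nu (fun i => - ln (mi A i)).

Definition lo_ (nu : I -> nat) (t : nat -> R) : T := fun i => exp (- t (nu i)).

Section Fibration.
Context (al be ga : I -> Prop) (nu : I -> nat) (w : T)
  (hal : forall i, al i <-> be i \/ ga i) (hdis : forall i, be i -> ~ ga i)
  (hnu : forall i j, ga i -> ga j -> nu i = nu j -> i = j) (hw : wt al w).

Lemma thr_in A i : ga i -> thr ga nu A (nu i) = - ln (mi A i).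
Proof. exact: ext_in. Qed.

Lemma thr_out A k : (forall i, ga i -> nu i <> k) -> thr ga nu A k = 0.
Proof. exact: ext_out. Qed.

Lemma thr_ge0 A k : okP al A -> 0 <= thr ga nu A k.
Proof.
move=> hA; case: (ext_cases ga nu k) => [[i [hi <-]]|h]; last by rewrite thr_out //; lra.
rewrite thr_in //; have [h1 h2] := mi_bd al A i hA.
by have := ln_le _ _ h1 h2; rewrite ln_1; lra.
Qed.

Lemma thr_cv k (N : Type) (F : (N -> Prop) -> Prop) As A : filt F -> (forall m, okP al (As m)) -> okP al A ->
  htends F As A -> tends F (fun m => thr ga nu (As m) k) (thr ga nu A k).
Proof.
move=> hF h1 h2 h; case: (ext_cases ga nu k) => [[i [hi <-]]|hk].
  apply: (tends_ext _ hF (fun m => 0 - ln (mi (As m) i))); first by move=> m; rewrite thr_in //; lra.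
  rewrite thr_in // -[- ln _]Rplus_0_l; apply: tends_minus => //; first exact: tends_const.
  by apply: tends_ln => //; [apply (mi_bd al) | exact: (mi_cv F al)].
apply: (tends_ext _ hF (fun m => 0)); first by move=> m; rewrite thr_out.
by rewrite thr_out //; exact: tends_const.
Qed.

Lemma lo_good t : (forall k, 0 <= t k) -> goodlo (lo_ nu t).
Proof.
move=> h i; split; first exact: exp_pos.
rewrite /lo_ -exp_0; case: (Req_dec (t (nu i)) 0) => [->|hne]; first by rewrite Ropp_0; lra.
by apply: Rlt_le; apply: exp_increasing; have := h (nu i); lra.
Qed.

Lemma lo_le A t i : okP al A -> ga i -> thr ga nu A (nu i) <= t (nu i) <-> lo_ nu t i <= mi A i.
Proof.
move=> hA hi; rewrite thr_in // /lo_; have [h1 _] := mi_bd al A i hA; split => h.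
  rewrite -(exp_ln (mi A i)) //; case: (Req_dec (ln (mi A i)) (- t (nu i))) => [->|hne]; first lra.
  by apply: Rlt_le; apply: exp_increasing; lra.
by have := ln_le _ _ (exp_pos _) h; rewrite ln_exp; lra.
Qed.

Lemma okP_fib A t : okP al A -> (forall k, thr ga nu A k <= t k) -> fib al be ga (prs be A) (lo_ nu t) A.
Proof.
move=> hA ht; have [h1 [h2 [h3 [h4 _]]]] := hA; split => //.
split.
  move=> b hb i hi; apply: Rle_trans (mi_le A b i (okP_nneg al A hA) hb).
  by apply/(lo_le A t i hA hi).
split => //; split => //.
split; first by move=> b hb; exists b.
by split => // _ [b [hb ->]]; exists b.
Qed.

Lemma fib_okP A0 t A : okP be A0 -> (forall k, 0 <= t k) -> fib al be ga A0 (lo_ nu t) A ->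
  okP al A /\ (forall k, thr ga nu A k <= t k) /\ A0 = prs be A.
Proof.
move=> h0 ht hA; have hl := lo_good t ht.
have h1 : okP al A.
  split; first exact: fib_one hA.
  split; first exact: fib_mconv hA.
  split; first by case: hA.
  split; first exact: fib_supp hA.
  have [_ [_ [_ [_ [l [l1 l2]]]]]] := h0.
  exists (fun i => Rmin 1 (Rmin (l i) (lo_ nu t i))); split.
    by move=> i; have := l1 i; have := hl i; rmx.
  move=> b hb i; case: (classic (ga i)) => hg; first by have := fib_bd _ _ _ _ _ _ _ _ hA hb hg; rmx.
  case: (classic (be i)) => hbe; first by have := l2 _ (fib_cut _ _ _ _ _ _ _ hA hb) i; rewrite cut_in //; rmx.
  by rewrite (proj2 (fib_supp _ _ _ _ _ _ hA b hb)); [rmx | move=> /hal []].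
split => //; split.
  move=> k; case: (ext_cases ga nu k) => [[i [hi <-]]|hk]; last by rewrite thr_out.
  apply/(lo_le A t i h1 hi); apply: mi_ge; first by exists one; exact: fib_one hA.
  by move=> a ha; exact: fib_bd hA ha hi.
apply: set_ext => x; split; first by move=> /(fib_surj _ _ _ _ _ _ _ hA) [b [hb <-]]; exists b.
by move=> [b [hb ->]]; exact: fib_cut hA hb.
Qed.

Definition Ybase : space := prodS (Psp be) Hw.

(** The lower bounds move from the total space into the base; the fibres over the enlarged base are
    complete. *)
Lemma hov_fib : hov (majS (Psp al) (thr ga nu))
  (totS Ybase (T -> Prop) (fun y => fib al be ga (fst y) (lo_ nu (snd y))) (ed w))
  (fun z => prs be (fst z)) (fun z => fst (fst z)).
Proof.
have hw0 : forall i, 0 <= w i by move=> i; apply (proj1 hw).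
exists (fun z => ((prs be (fst z), snd z), fst z)), (fun z => (snd z, snd (fst z))).
split.
  split.
    move=> [A t] [[/= hA _] ht]; split; last exact: okP_fib.
    split; first exact: okP_prs hA.
    by move=> k; split => //; have := ht k; have := thr_ge0 A k hA; rewrite /=; lra.
  move=> N F zs z hF h1 h2 [/= c1 c2]; split.
    by split => //=; exact: htends_prs.
  by apply: (htends_ed F al) => // [m|]; [apply: okP_supp; apply (h1 m) | apply: okP_supp; apply h2].
split.
  split.
    move=> [[A0 t] A] [[/= h0 ht] hf]; have [|h1 [h2 _]] := fib_okP A0 t A h0 _ hf; first by move=> k; apply (ht k).
    by split => //; split.
  move=> N F zs z hF h1 h2 [[/= c1 c2] c3]; split => //=.
  by apply: (ed_htends F al w) => // [m|]; [exact: fib_supp (proj2 (h1 m)) | exact: fib_supp (proj2 h2)].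
split; first by move=> [A t].
split => //.
move=> [[A0 t] A] [[/= h0 ht] hf]; have [|_ [_ <-]] // := fib_okP A0 t A h0 _ hf.
by move=> k; apply (ht k).
Qed.
End Fibration.

(** One bundle step. Lower bounds are adjoined above, the fibre theorem is applied with trivial [Q]
    and identical [rho], and the bounds left in the base are absorbed again. The injection [nu] says
    that [al] is countable. *)
Lemma hov_factor_P (al be ga : I -> Prop) (nu : I -> nat) :
  (forall i, al i <-> be i \/ ga i) -> (forall i, be i -> ~ ga i) ->
  (forall i j, al i -> al j -> nu i = nu j -> i = j) ->
  hov (prodS (Psp al) Rw) (prodS (Psp be) Rw) (fun z => prs be (fst z)) (fun z => fst z).
Proof.
move=> hal hdis hnu; have [w [L [hw [hL _]]]] := weight_ex al nu hnu.
have hnu' : forall i j, ga i -> ga j -> nu i = nu j -> i = j.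
  by move=> i j hi hj; apply: hnu; apply/hal; right.
have hw0 : forall i, 0 <= w i by move=> i; apply (proj1 hw).
apply: hov_trans (absorb_maj (Psp al) (prs be) (thr ga nu) _) _.
  by move=> k N F As A hF h1 h2 h; apply: (thr_cv al).
apply: hov_trans (hov_prod _ _ _ _ _ _ (hov_fib al be ga nu w hal hnu' hw) (hov_refl Rw _)) _.
apply: hov_trans (hov_sym _ _ _ _ (absorb_Hw (Psp be) (fun A => A))).
have hYA : forall y, ok (Ybase be) y -> okP be (fst y) by move=> y [].
have hYl : forall y, ok (Ybase be) y -> goodlo (lo_ nu (snd y)).
  by move=> y [_ h]; apply: lo_good => k; apply (h k).
have hYc : forall N F (ys : N -> Ybase be) y, filt F -> (forall i, ok (Ybase be) (ys i)) -> ok (Ybase be) y -> cv (Ybase be) N F ys y ->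
     htends F (fun m => fst (ys m)) (fst y) /\ forall i, tends F (fun m => lo_ nu (snd (ys m)) i) (lo_ nu (snd y) i).
  move=> N F ys y hF _ _ [h1 h2]; split => // i; apply: tends_exp => //.
  apply: (tends_ext _ hF (fun m => 0 - snd (ys m) (nu i))); first by move=> m; lra.
  by rewrite -[- _]Rplus_0_l; apply: tends_minus => //; [exact: tends_const | exact: h2].
have key := fib_factor al be ga w L hw hal hdis hL (Ybase be) (fun y => fst y) (fun y => lo_ nu (snd y)) hYA hYl hYc
   (fun _ _ => True) (fun _ B => B) (fun _ => 1).
apply: hov_trans (hov_prod _ _ Rw Rw _ _ (totS_ext (Ybase be) _ _ (ed w) (fun y => fst y) (fun y B h => conj h Logic.I) (fun y B h => proj1 h)) (hov_refl Rw _)) _.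
have hnear : forall n (B B' : T -> Prop), ed w B B' <= 1 * (2 ^ n * ed w B B' + eta n).
  by move=> n B B'; have := eta_pos n; have := pow2_ge1 n; have := ed_ge0 w B B'; nra.
have {}key := key (fun y B _ h => conj h Logic.I) (fun N F ys y bs b _ _ _ _ _ _ h => h)
  (fun n y B B' _ _ _ _ => hnear n B B') (fun _ _ _ _ _ _ _ => Logic.I) (fun _ _ => Rle_0_1)
  (fun N F ys y hF _ _ _ => tends_const F hF 1).
exact: (hov_base _ _ _ _ (fun y : Ybase be => fst y) key).
Qed.
End Prs.

(** * Weighted sums *)

Fixpoint psum (u : nat -> R) (n : nat) : R :=
  match n with O => 0 | S n => psum u n + (/ 2) ^ (S n) * u n end.

(** For nonnegative terms at most 1 this is the sum of a series with weights 2^(-k-1). The weights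
    add up to 1, hence the constant 1 in [wsum_dist]. *)
Definition wsum (u : nat -> R) : R := supr (fun r => exists n, r = psum u n).

Lemma half_pos n : 0 < (/ 2) ^ n. Proof. apply: pow_lt; lra. Qed.

Lemma psum_le u v d n : (forall k, u k <= v k + d) -> psum u n <= psum v n + d * (1 - (/ 2) ^ n).
Proof.
move=> h; elim: n => [|n ih] /=; first lra.
have := h n; have := half_pos n => h1 h2.
have : / 2 * (/ 2) ^ n * u n <= / 2 * (/ 2) ^ n * (v n + d) by apply: Rmult_le_compat_l; lra.
lra.
Qed.

Lemma psum_le1 u n : (forall k, u k <= 1) -> psum u n <= 1.
Proof.
move=> h; have h1 : forall m, psum (fun _ => 0) m = 0 by elim=> [|m ih] //=; rewrite ih; lra.
have := psum_le u (fun _ => 0) 1 n (fun k => ltac:(have := h k; lra)); rewrite h1.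
by have := half_pos n; lra.
Qed.

Lemma wsum_ub u n : (forall k, u k <= 1) -> psum u n <= wsum u.
Proof. by move=> h; apply: (supr_ub _ 1); [move=> _ [m ->]; exact: psum_le1 | exists n]. Qed.

Lemma wsum_le u c : (forall n, psum u n <= c) -> wsum u <= c.
Proof. by move=> h; apply: supr_le; [exists (psum u O), O | move=> _ [m ->]]. Qed.

Lemma wsum_dist u v d : (forall k, u k <= 1) -> (forall k, v k <= 1) -> (forall k, Rabs (u k - v k) <= d) ->
  Rabs (wsum u - wsum v) <= d.
Proof.
have key : forall u v, (forall k, v k <= 1) -> (forall k, Rabs (u k - v k) <= d) -> wsum u <= wsum v + d.
  move=> u' v' hv h; apply: wsum_le => n; have h0 : 0 <= d by apply: Rle_trans (h O); exact: Rabs_pos.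
  have := psum_le u' v' d n (fun k => ltac:(have := Rle_trans _ _ _ (Rle_abs _) (h k); lra)).
  by have := wsum_ub v' n hv; have := half_pos n; nra.
move=> hu hv h; have := key u v hv h; have := key v u hu (fun k => ltac:(rewrite Rabs_minus_sym; exact: h)).
by move=> h1 h2; apply: Rabs_le; lra.
Qed.

Lemma wsum_gain u v k : (forall k, 0 <= u k <= v k) -> (forall k, v k <= 1) ->
  wsum u + (/ 2) ^ (S k) * (v k - u k) <= wsum v.
Proof.
move=> h hv; set g := _ * _; suff : wsum u <= wsum v - g by lra.
have mono : forall n, psum u n <= psum v n by move=> n; have := psum_le u v 0 n (fun k => ltac:(have := h k; lra)); lra.
have inc : forall n p, psum u n <= psum u (n + p).
  move=> n; elim=> [|p ih]; first by rewrite Nat.add_0_r; lra.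
  rewrite Nat.add_succ_r /=; have := half_pos (n + p); have := h (n + p)%nat => h1 h2.
  have : 0 <= / 2 * (/ 2) ^ (n + p) * u (n + p)%nat by apply: Rmult_le_pos; lra.
  lra.
have key : forall n, (k < n)%nat -> psum u n + g <= psum v n.
  elim=> [|n ih] hn; first lia.
  case: (Nat.eq_dec n k) => [->|hne]; first by rewrite /g /=; have := mono k; lra.
  rewrite /=; have := ih ltac:(lia); have := half_pos n; have := h n => h1 h2 h3.
  have : 0 <= / 2 * (/ 2) ^ n * (v n - u n) by apply: Rmult_le_pos; lra.
  lra.
apply: wsum_le => n; have h1 := key (n + S k)%nat ltac:(lia); have h2 := wsum_ub v (n + S k) hv.
by have := inc n (S k); lra.
Qed.

(** * Contraction of a set onto its greatest point *)

Section Trunc.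
Context {I : Type}.
Notation T := (I -> R).

Lemma closed_img (A : T -> Prop) (f : T -> T) : (forall a, A a -> cube a) -> closed A ->
  (forall (N : Type) (F : (N -> Prop) -> Prop) (b : N -> T) a, filt F -> (forall i, tends F (fun m => b m i) (a i)) ->
     forall i, tends F (fun m => f (b m) i) (f a i)) -> closed (fun x => exists a, A a /\ x = f a).
Proof.
move=> hA hc hf x hx; have [U [hU [hUA [h1 [a [h2 h3]]]]]] := cl_ultra A f x hA hx.
have [hfU [hp _]] := hU.
exists a; split; first exact: (closed_lim U A (fun b => b) a hfU hp hc hUA h3).
apply: functional_extensionality => i.
exact: (tends_uniq U (fun b => f b i) _ _ hfU hp (h1 i) (hf _ U (fun b => b) a hfU h3 i)).
Qed.

Definition raise (p : R) (a : T) : T := fun i => Rmax (a i) p.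
(** [raise p a] is the combination of [a] and [one] with weights 1 and [p]. So for the sets at hand
    [tau p] contracts [A] inside itself, from [A] at [p = 0] to the single point [one] at
    [p = 1]. *)
Definition tau (p : R) (A : T -> Prop) (x : T) : Prop := exists a, A a /\ x = raise p a.

Lemma raise_comb p s t (a b : T) : 0 <= p -> 0 <= s <= 1 -> 0 <= t <= 1 -> Rmax s t = 1 ->
  comb s t (raise p a) (raise p b) = raise p (comb s t a b).
Proof.
move=> hp hs ht hst; apply: functional_extensionality => i; rewrite /comb /raise.
rewrite !Rmul_maxk; try lra.
have : Rmax (s * p) (t * p) = p.
  have : s * p <= p by nra.
  have : t * p <= p by nra.
  by move: hst; rewrite {1}/Rmax; case: Rle_dec => _ ->; rewrite Rmult_1_l => *; rmx.
move: (s * a i) (t * b i) (s * p) (t * p) => u v x y; rmx.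
Qed.

Lemma tau_sub p (A : T -> Prop) : 0 <= p <= 1 -> mconv A -> A one -> forall x, tau p A x -> A x.
Proof.
move=> hp hA h1 _ [a [ha ->]]; have -> : raise p a = comb 1 p a one.
  by apply: functional_extensionality => i; rewrite /raise /comb /one Rmult_1_l Rmult_1_r.
by apply: hA => //; [lra | rmx].
Qed.

Lemma tau0 A : nneg A -> tau 0 A = A.
Proof.
move=> hA; apply: set_ext => x; split.
  by move=> [a [ha ->]]; rewrite (_ : raise 0 a = a) //; apply: functional_extensionality => i; rewrite /raise Rmax_left //; exact: Rge_le (Rle_ge _ _ (hA a ha i)).
move=> hx; exists x; split => //; apply: functional_extensionality => i; rewrite /raise Rmax_left //.
exact: hA.
Qed.

Lemma tau_mi p A i : nneg A -> (exists a, A a) -> 0 <= p -> mi (tau p A) i = Rmax (mi A i) p.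
Proof.
move=> hA [a0 ha0] hp; have hn0 : nneg (tau p A) by move=> _ [a [_ ->]] j; apply: Rle_trans hp (Rmax_r _ _).
apply: Rle_antisym; last first.
  apply: mi_ge; first by exists (raise p a0), a0.
  move=> _ [a [ha ->]]; have := mi_le A a i hA ha; rewrite /raise; rmx.
apply: Rle_eps => d hd.
have [r [[a [ha hr]] h]] := infr_approx (fun r => exists a, A a /\ r = a i) 0 (mi A i + d)
   (ex_intro _ (a0 i) (ex_intro _ a0 (conj ha0 eq_refl))) ltac:(by move=> _ [b [hb ->]]; exact: hA) ltac:(rewrite -/(mi A i); lra).
have := mi_le (tau p A) (raise p a) i hn0 (ex_intro _ a (conj ha eq_refl)).
by rewrite /raise; rewrite hr in h; rmx.
Qed.

Lemma tau_ed w p q A : (forall i, 0 <= w i <= 1) -> ed w (tau p A) (tau q A) <= Rabs (p - q).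
Proof.
move=> hw; apply: ed_le; first exact: Rabs_pos.
have key : forall p q, hl w (Rabs (p - q)) (tau p A) (tau q A).
  move=> p' q' _ [a [ha ->]]; exists (raise q' a); split; first by exists a.
  move=> i; have := hw i => hwi; apply: mul_le_of_le => //; first exact: Rabs_pos.
  by rewrite /raise; rmx.
by split; [|rewrite Rabs_minus_sym].
Qed.

Lemma tau_ed2 w p A B : (forall i, 0 <= w i) -> ed w (tau p A) (tau p B) <= ed w A B.
Proof.
move=> hw; apply: Rle_eps => d hd.
have [d1 [h1 [h2|h2]]] := ed_lt w A B (ed w A B + d) ltac:(lra).
  by have := ed_le1 w (tau p A) (tau p B); lra.
apply: (Rle_trans _ d1); last lra.
have key : forall A B, hl w d1 A B -> hl w d1 (tau p A) (tau p B).
  move=> A' B' h _ [a [ha ->]]; have [b [hb h3]] := h a ha; exists (raise p b); split; first by exists b.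
  move=> i; apply: Rle_trans (h3 i); apply: Rmult_le_compat_l => //; rewrite /raise; rmx.
by apply: ed_le; [lra | split; apply: key; apply h2].
Qed.

Section Kappa.
Context (C : I -> Prop) (nu : I -> nat) (w : T) (hw : wt C w)
  (hnu : forall i j, C i -> C j -> nu i = nu j -> i = j)
  (hwn : forall n i, (n <= nu i)%nat -> w i <= eta n).

(** A weighted sum, where a supremum would overlook all but the dominant coordinate: it decreases
    strictly when the infimum rises in any coordinate of [C], it is 1-Lipschitz for [ed w], and it
    vanishes only when [one] is the sole element. *)
Definition kap (A : T -> Prop) : R := wsum (ext C nu (fun i => w i * (1 - mi A i))).

Definition goodA (A : T -> Prop) : Prop := A one /\ nneg A.

Lemma goodA_mi A i : goodA A -> 0 <= mi A i <= 1.
Proof.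
move=> [h1 h2]; split; first by apply: mi_ge; [exists one | move=> a ha; exact: h2].
by have := mi_le A one i h2 h1; rewrite /one.
Qed.

Lemma kt_bd A k : goodA A -> 0 <= ext C nu (fun i => w i * (1 - mi A i)) k <= 1.
Proof.
move=> hA; case: (ext_cases C nu k) => [[i [hi <-]]|h]; last by rewrite ext_out //; lra.
by rewrite ext_in //; have := goodA_mi A i hA; have := proj1 hw i; nra.
Qed.

Lemma mi_ed A B i : goodA A -> goodA B -> w i * Rabs (mi A i - mi B i) <= ed w A B.
Proof.
have hw0 : forall i, 0 <= w i by move=> j; apply (proj1 hw).
have key : forall A B, goodA A -> goodA B -> w i * (mi A i - mi B i) <= ed w A B.
  move=> A' B' hA hB; apply: Rle_eps => d hd.
  have [d1 [h1 [h2|h2]]] := ed_lt w A' B' (ed w A' B' + d) ltac:(lra).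
    by have := goodA_mi A' i hA; have := goodA_mi B' i hB; have := proj1 hw i; nra.
  apply: (Rle_trans _ d1); last lra.
  case: (Req_dec (w i) 0) => [->|hne]; first lra.
  have hwi : 0 < w i by have := hw0 i; lra.
  suff : mi A' i - d1 / w i <= mi B' i.
    move=> h; have := Rmult_le_compat_l _ _ _ (Rlt_le _ _ hwi) h.
    have : w i * (mi A' i - d1 / w i) = w i * mi A' i - d1 by field.
    nra.
  apply: mi_ge; first by exists one; apply hB.
  move=> b hb; have [a [ha h3]] := proj2 h2 b hb.
  have := mi_le A' a i (proj2 hA) ha; have := h3 i => h4 h5.
  have : Rabs (b i - a i) <= d1 / w i.
    by apply: (Rmult_le_reg_l (w i)) => //; have -> : w i * (d1 / w i) = d1 by field.
  move: h5; rmx.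
move=> hA hB; have := key A B hA hB; have := key B A hB hA; rewrite (ed_sym w B A) => h1 h2.
by rewrite -Rabs_mulk //; apply: Rabs_le; lra.
Qed.

Lemma kap_dist A B : goodA A -> goodA B -> Rabs (kap A - kap B) <= ed w A B.
Proof.
move=> hA hB; apply: wsum_dist => [k|k|k]; [by apply kt_bd | by apply kt_bd |].
case: (ext_cases C nu k) => [[i [hi <-]]|h]; last by rewrite !ext_out // Rminus_diag Rabs_R0; exact: ed_ge0.
rewrite !ext_in //; have -> : w i * (1 - mi A i) - w i * (1 - mi B i) = w i * (mi B i - mi A i) by ring.
rewrite Rabs_mulk; last by apply (proj1 hw).
by rewrite ed_sym; apply: mi_ed.
Qed.

Lemma kap_bd A : goodA A -> 0 <= kap A <= 1.
Proof.
move=> hA; split; last by apply: wsum_le => n; apply: psum_le1 => k; apply kt_bd.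
by have := wsum_ub _ 0 (fun k => proj2 (kt_bd A k hA)).
Qed.

Lemma kap_mono A B i : goodA A -> goodA B -> (forall i, mi A i <= mi B i) -> C i ->
  kap B + (/ 2) ^ (S (nu i)) * (w i * (mi B i - mi A i)) <= kap A.
Proof.
move=> hA hB h hi.
have -> : w i * (mi B i - mi A i) = ext C nu (fun i => w i * (1 - mi A i)) (nu i) - ext C nu (fun i => w i * (1 - mi B i)) (nu i).
  by rewrite !ext_in //; ring.
apply: wsum_gain => k; last by apply kt_bd.
split; first by apply kt_bd.
case: (ext_cases C nu k) => [[j [hj <-]]|h']; last by rewrite !ext_out //; lra.
by rewrite !ext_in //; apply: Rmult_le_compat_l; [apply (proj1 hw) | have := h j; lra].
Qed.

Lemma kap_le A B : goodA A -> goodA B -> (forall i, mi A i <= mi B i) -> kap B <= kap A.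
Proof.
move=> hA hB h; have := wsum_gain (ext C nu (fun i => w i * (1 - mi B i))) (ext C nu (fun i => w i * (1 - mi A i))) 0.
have hle : forall k, 0 <= ext C nu (fun i => w i * (1 - mi B i)) k <= ext C nu (fun i => w i * (1 - mi A i)) k.
  move=> k; split; first by apply kt_bd.
  case: (ext_cases C nu k) => [[j [hj <-]]|h']; last by rewrite !ext_out //; lra.
  by rewrite !ext_in //; apply: Rmult_le_compat_l; [apply (proj1 hw) | have := h j; lra].
move=> /(_ hle (fun k => proj2 (kt_bd A k hA))); rewrite -/(kap A) -/(kap B).
have := hle O; rewrite /=; lra.
Qed.

Lemma kap_eq0 A : goodA A -> supp C A -> kap A <= 0 -> forall a, A a -> a = one.
Proof.
move=> hA hs hk a ha; have hg1 : goodA (eq (one : T)) by split => // _ <- i; rewrite /one; lra.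
have m1 : forall i, mi (eq (one : T)) i = 1.
  move=> i; apply: Rle_antisym; first by apply goodA_mi.
  by apply: mi_ge; [exists one | move=> _ <-; rewrite /one; lra].
apply: functional_extensionality => i; case: (classic (C i)) => hi; last by rewrite (proj2 (hs a ha)).
have := kap_mono A (eq one) i hA hg1 (fun i => ltac:(rewrite m1; exact: (proj2 (goodA_mi A i hA)))) hi.
have := kap_bd _ hg1; have := mi_le A a i (proj2 hA) ha; have := proj1 (hs a ha) i.
have := proj1 (proj2 hw) i hi; have := half_pos (S (nu i)); rewrite m1 /one => h1 h2 h3 h4 h5 h6.
have h7 := goodA_mi A i hA.
have hp : 0 < (/ 2) ^ S (nu i) * w i by apply: Rmult_lt_0_compat.
have : (/ 2) ^ S (nu i) * w i * (1 - mi A i) <= 0 by lra.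
nra.
Qed.

Lemma goodA_tau A p : goodA A -> 0 <= p <= 1 -> goodA (tau p A).
Proof.
move=> [h1 h2] hp; split.
  by exists one; split => //; apply: functional_extensionality => i; rewrite /raise /one Rmax_left //; lra.
by move=> _ [a [_ ->]] i; apply: Rle_trans (Rmax_r _ _); lra.
Qed.

(** The weights of [kap] lose a factor [2 ^ n] on the [n] first coordinates, and the others hardly count. *)
Lemma tau_move A p q n : goodA A -> 0 <= p <= q -> q <= 1 -> supp C A ->
  ed w (tau p A) (tau q A) <= 2 ^ n * (kap (tau p A) - kap (tau q A)) + eta n.
Proof.
move=> hA hp hq hs; have hn0 := eta_pos n; have h2n := pow2_pos n.
have gp_ := goodA_tau A p hA ltac:(lra); have gq := goodA_tau A q hA ltac:(lra).
have tm : forall p i, 0 <= p -> mi (tau p A) i = Rmax (mi A i) p.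
  by move=> p' i hp'; apply: tau_mi => //; [apply hA | exists one; apply hA].
have mle : forall i, mi (tau p A) i <= mi (tau q A) i by move=> i; rewrite !tm; [rmx | lra | lra].
have kge := kap_le _ _ gp_ gq mle.
have hk : 0 <= 2 ^ n * (kap (tau p A) - kap (tau q A)) by apply: Rmult_le_pos; lra.
apply: ed_le; first lra.
have key : forall a i, A a -> w i * Rabs (raise p a i - raise q a i) <= 2 ^ n * (kap (tau p A) - kap (tau q A)) + eta n.
  move=> a i ha; have hai := mi_le A a i (proj2 hA) ha.
  have hca := proj1 (hs a ha) i; have hwi := proj1 hw i.
  (* The function [Rmax t q - Rmax t p] of [t] does not increase, so no point of [A] moves further
     in a coordinate than the infimum does. *)
  have d1 : Rabs (raise p a i - raise q a i) <= mi (tau q A) i - mi (tau p A) i by rewrite !tm; [rewrite /raise; rmx | lra | lra].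
  have d2 : Rabs (raise p a i - raise q a i) <= 1 by rewrite /raise; rmx.
  case: (classic (C i)) => hi; last first.
    by rewrite /raise (proj2 (hs a ha)) // !Rmax_left; try lra; rewrite Rminus_diag Rabs_R0; lra.
  case: (le_lt_dec n (nu i)) => hni.
    have : w i * Rabs (raise p a i - raise q a i) <= eta n; last lra.
    by apply: mul_le_of_le1; [exact: hwn | lra | split => //; exact: Rabs_pos].
  have h1 := kap_mono _ _ i gp_ gq mle hi.
  set D := mi (tau q A) i - mi (tau p A) i in d1 h1 *; have hD : 0 <= D by have := mle i; rewrite /D; lra.
  have h3 : 1 <= 2 ^ n * (/ 2) ^ S (nu i).
    rewrite pow_inv; have := pow2_mono (S (nu i)) n ltac:(lia); have := pow2_pos (S (nu i)) => h4 h5.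
    apply: (Rmult_le_reg_r (2 ^ S (nu i))) => //; rewrite Rmult_assoc Rinv_l; lra.
  have h4 : 0 <= w i * D by apply: Rmult_le_pos; lra.
  have h5 : w i * Rabs (raise p a i - raise q a i) <= w i * D by apply: Rmult_le_compat_l; lra.
  have h6 : 2 ^ n * ((/ 2) ^ S (nu i) * (w i * D)) <= 2 ^ n * (kap (tau p A) - kap (tau q A)) by apply: Rmult_le_compat_l; lra.
  have h7 : 1 * (w i * D) <= 2 ^ n * (/ 2) ^ S (nu i) * (w i * D) by apply: Rmult_le_compat_r.
  lra.
split => _ [a [ha ->]].
  by exists (raise q a); split; [exists a | move=> i; exact: key].
by exists (raise p a); split; [exists a | move=> i; rewrite Rabs_minus_sym; exact: key].
Qed.
End Kappa.
End Trunc.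

(** * Neighbourhoods of [x + ln A] inside [M] *)

Lemma ln_lip m a b : 0 < m -> m <= a -> m <= b -> m * Rabs (ln a - ln b) <= Rabs (a - b).
Proof.
move=> hm; have key : forall a b, m <= b -> b <= a -> m * (ln a - ln b) <= a - b.
  move=> a' b' hb hab; have hb0 : 0 < b' by lra.
  have h1 : ln a' - ln b' <= a' / b' - 1.
    have -> : ln a' - ln b' = ln (a' / b') by rewrite /Rdiv ln_mult ?ln_Rinv //; try lra; apply: Rinv_0_lt_compat.
    have := exp_ineq1_le (ln (a' / b')); rewrite exp_ln; first lra.
    by apply: Rdiv_lt_0_compat; lra.
  have h2 : 0 <= ln a' - ln b' by have := ln_le b' a' hb0 hab; lra.
  apply: (Rle_trans _ (b' * (ln a' - ln b'))); first by apply: Rmult_le_compat_r.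
  apply: (Rle_trans _ (b' * (a' / b' - 1))); first by apply: Rmult_le_compat_l; lra.
  by apply: Req_le; field; lra.
move=> ha hb; case: (Rle_dec a b) => hab.
  rewrite Rabs_minus_sym (Rabs_minus_sym a) !Rabs_pos_eq; first exact: key.
    by lra.
  by have := ln_le a b ltac:(lra) hab; lra.
rewrite !Rabs_pos_eq; first by apply: key; lra.
  by lra.
by have := ln_le b a ltac:(lra) ltac:(lra); lra.
Qed.

Lemma ln_le0 a : a <= 1 -> 0 < a -> ln a <= 0.
Proof. by move=> h1 h2; have := ln_le a 1 h2 h1; rewrite ln_1. Qed.

(** The truncation keeps displacements bounded, so that coordinates of small weight can be
    neglected. *)
Definition mn (t : R) : R := Rmin 1 (Rabs t).

Lemma mn_bd t : 0 <= mn t <= 1.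
Proof. by rewrite /mn; have := Rabs_pos t; rmx. Qed.

Lemma mn_tri s t : mn (s + t) <= mn s + mn t.
Proof. rewrite /mn; rmx. Qed.

Lemma mn_le t : mn t <= Rabs t.
Proof. exact: Rmin_r. Qed.

Lemma mn_ge t e : e <= 1 -> mn t < e -> Rabs t < e.
Proof. rewrite /mn; rmx. Qed.

Section Mu.
Context {I : Type} (C : I -> Prop) (w : I -> R) (hw : wt C w) (M : (I -> R) -> Prop)
  (hMo : product_top I M) (hMC : forall x y, (forall i, C i -> x i = y i) -> M x -> M y).
Notation T := (I -> R).

Definition shf (x a : T) : T := fun i => x i + ln (a i).

(** [mu x l A] is the size of a neighbourhood of [x + ln A] contained in [M]; the weights
    [l], lower bounds for [A], make it 1-Lipschitz in [A]. *)
Definition inM (x l : T) (A : T -> Prop) (r : R) : Prop :=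
  forall a z, A a -> (forall i, C i -> w i * (l i * mn (z i - shf x a i)) <= r) -> M z.

Definition mu (x l : T) (A : T -> Prop) : R := supr (fun r => r = 0 \/ 0 <= r <= 1 /\ inM x l A r).

Lemma mu_ge x l A r : 0 <= r <= 1 -> inM x l A r -> r <= mu x l A.
Proof. by move=> h1 h2; apply: (supr_ub _ 1); [move=> y [->|[h _]]; lra | right]. Qed.

Lemma mu_le x l A c : 0 <= c -> (forall r, 0 <= r <= 1 -> inM x l A r -> r <= c) -> mu x l A <= c.
Proof. by move=> h0 h; apply: supr_le; [exists 0; left | move=> r [->|[h1 h2]] //; exact: h]. Qed.

Lemma mu_bd x l A : 0 <= mu x l A <= 1.
Proof.
split; first by apply: (supr_ub _ 1); [move=> y [->|[h _]]; lra | left].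
by apply: mu_le => [|r]; lra.
Qed.

Lemma mu_mono x l A B : (forall a, A a -> B a) -> mu x l B <= mu x l A.
Proof.
move=> h; apply: mu_le; first by apply mu_bd.
by move=> r hr h1; apply: mu_ge => // a z ha; apply: h1; exact: h.
Qed.

Lemma mu_in x l A a : 0 < mu x l A -> A a -> M (shf x a).
Proof.
move=> h ha; have [r [[hr|[h1 h2]] h3]] := supr_approx (fun r => r = 0 \/ 0 <= r <= 1 /\ inM x l A r) 1 0
   (ex_intro _ 0 (or_introl eq_refl)) ltac:(by move=> y [->|[hy _]]; lra) h; first lra.
apply: (h2 a) => // i _; rewrite Rminus_diag /mn Rabs_R0 Rmin_right; lra.
Qed.

(** Otherwise there are [a] in [A] and [z] outside [M] with [z] arbitrarily close to [x + ln a]. An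
    ultrafilter limit of such [a] lies in the compact set [A], and openness of [M] at its image is
    contradicted. *)
Lemma mu_pos x l A : okP C A -> (forall i, 0 < l i) -> (forall a, A a -> M (shf x a)) -> 0 < mu x l A.
Proof.
move=> hA hl hM; apply: NNPP => h0.
have bad : forall n, exists az : T * T, A (fst az) /\ ~ M (snd az) /\
   forall i, C i -> w i * (l i * mn (snd az i - shf x (fst az) i)) <= (/ 2) ^ n.
  move=> n; apply: NNPP => hn; apply: h0; apply: (Rlt_le_trans _ ((/ 2) ^ n)); first exact: half_pos.
  apply: mu_ge.
    split; first exact: Rlt_le (half_pos n).
    by rewrite pow_inv -[1]Rinv_1; apply: Rinv_le_contravar; [lra | exact: pow2_ge1].
  by move=> a z ha hz; apply: NNPP => hMz; apply: hn; exists (a, z).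
have [az haz] := choice_fun _ bad.
pose F (P : nat -> Prop) := exists n0, forall n, (n0 <= n)%nat -> P n.
have hF : filt F.
  split; first by exists O.
  split; last by move=> P Q h [n0 hn0]; exists n0 => n hn; apply: h; exact: hn0.
  by move=> P Q [n1 h1] [n2 h2]; exists (n1 + n2)%nat => n hn; split; [apply: h1 | apply: h2]; lia.
have [U [hU hUF]] : exists U, ultra U /\ forall P, F P -> U P.
  by apply: ultra_ex => // -[n0 hn0]; exact: (hn0 n0 (le_n _)).
have [hUf [hUp _]] := hU.
have [a [ca ha]] := ulim_T U (fun n => fst (az n)) hU (fun n => okP_cube C A hA _ (proj1 (haz n))).
have hAa : A a by apply: (closed_lim U A (fun n => fst (az n))) => //; [apply hA | apply: (filtT _ _ hUf) => n; apply (haz n)].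
have [D [eps [heps hD]]] := hMo _ (hM a hAa).
have [_ [_ [_ [_ [b [hb1 hb2]]]]]] := hA.
pose e := Rmin 1 (eps / 2); have he : 0 < e <= 1 by rewrite /e; rmx.
have ev : U (fun n => forall i, In i D -> C i -> Rabs (snd (az n) i - shf x a i) < eps).
  apply: (filt_list U D (fun i n => C i -> Rabs (snd (az n) i - shf x a i) < eps)) => // i _.
  case: (classic (C i)) => hi; last by apply: (filtT _ _ hUf).
  have tl : tends U (fun n => ln (fst (az n) i)) (ln (a i)).
    by apply: tends_ln => //; apply: Rlt_le_trans (hb1 i) (hb2 a hAa i).
  have hc : 0 < w i * l i * e by apply: Rmult_lt_0_compat; [apply: Rmult_lt_0_compat => //; exact: (proj1 (proj2 hw)) | lra].
  have [n0 hn0] := half_pow_small 1 (w i * l i * e / 2) ltac:(lra).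
  have ev2 : U (fun n => (n0 <= n)%nat) by apply: hUF; exists n0.
  apply: (filt2 _ _ hUf (tl (eps / 2) ltac:(lra)) ev2) => n h1 h2 _.
  have h3 := proj2 (proj2 (haz n)) i hi; have h4 := hn0 n h2.
  have h5 : mn (snd (az n) i - shf x (fst (az n)) i) < e.
    apply: (Rmult_lt_reg_l (w i * l i)); last by lra.
    by apply: Rmult_lt_0_compat => //; exact: (proj1 (proj2 hw)).
  have := mn_ge _ _ (proj2 he) h5; rewrite /shf; have : e <= eps / 2 by exact: Rmin_r.
  move: h1; clear; rmx.
apply: hUp; apply: (filt1 _ hUf ev) => n hn.
have [_ [hnM _]] := haz n; apply: hnM.
(* Nothing is known about [z] in the coordinates outside [C]; there it is replaced by the limit
   point, which membership in [M] does not notice. *)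
apply: (hMC (fun i => if excluded_middle_informative (C i) then snd (az n) i else shf x a i)).
  by move=> i hi; case: excluded_middle_informative.
apply: hD => i hi; case: excluded_middle_informative => hc; first exact: hn.
by rewrite Rminus_diag Rabs_R0.
Qed.

(** The factor [l i], a lower bound for the points of [A], cancels the slope of [ln], so a
    displacement of [A] costs no more than [ed]. For two different bounds the smaller one is used,
    and their difference is charged to [d2]. *)
Lemma mu_pert x x' l l' A A' d1 d2 : (forall i, 0 < l i <= 1) -> (forall i, 0 < l' i <= 1) ->
  (forall a i, A a -> C i -> l i <= a i) -> (forall a i, A' a -> C i -> l' i <= a i) ->
  0 <= d1 -> 0 <= d2 -> (forall i, C i -> w i * mn (x i - x' i) <= d1) -> (forall i, C i -> w i * Rabs (l i - l' i) <= d2) ->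
  mu x l A <= mu x' l' A' + d1 + d2 + ed w A A'.
Proof.
move=> hl hl' hA hA' hd1 hd2 hx hll; apply: Rle_eps => d hd.
have [d3 [h1 [h2|h2]]] := ed_lt w A A' (ed w A A' + d) ltac:(lra).
  by have := mu_bd x l A; have := mu_bd x' l' A'; lra.
have hm := mu_bd x' l' A'.
suff : mu x l A <= mu x' l' A' + d1 + d2 + d3 by lra.
apply: mu_le; first lra.
move=> r hr hi; case: (Rle_dec r (d1 + d2 + d3)) => hrd; first lra.
suff : r - (d1 + d2 + d3) <= mu x' l' A' by lra.
apply: mu_ge; first lra.
move=> a' z ha' hz; have [a [ha h3]] := proj2 h2 a' ha'.
apply: (hi a z ha) => i hCi; have wi := proj1 hw i.
set c := mn (z i - shf x a i); set c' := mn (z i - shf x' a' i).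
have hzi := hz i hCi; rewrite -/c' in hzi.
have cb := mn_bd (z i - shf x a i); rewrite -/c in cb.
have cb' := mn_bd (z i - shf x' a' i); rewrite -/c' in cb'.
set m := Rmin (l i) (l' i); have li := hl i; have li' := hl' i.
have hm0 : 0 < m <= 1 by rewrite /m; rmx.
have e1 : l i * c <= m * c + Rabs (l i - l' i).
  have : (l i - m) * c <= Rabs (l i - l' i) * 1 by apply: Rmult_le_compat; try lra; rewrite /m; rmx.
  lra.
have e2 : c <= c' + mn (x i - x' i) + Rabs (ln (a i) - ln (a' i)).
  have -> : c = mn ((z i - shf x' a' i) + (x' i - x i) + (ln (a' i) - ln (a i))) by rewrite /c /shf; congr mn; ring.
  apply: Rle_trans (mn_tri _ _) _; have := mn_tri (z i - shf x' a' i) (x' i - x i).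
  have := mn_le (ln (a' i) - ln (a i)); rewrite (Rabs_minus_sym (ln (a' i))) -/c'.
  have -> : mn (x' i - x i) = mn (x i - x' i) by rewrite /mn Rabs_minus_sym.
  lra.
have e3 : m * Rabs (ln (a i) - ln (a' i)) <= Rabs (a i - a' i).
  apply: ln_lip; [by apply hm0 | |].
    by have := hA a i ha hCi; have := Rmin_l (l i) (l' i); rewrite -/m; lra.
  by have := hA' a' i ha' hCi; have := Rmin_r (l i) (l' i); rewrite -/m; lra.
have e4 : m * c' <= l' i * c' by apply: Rmult_le_compat_r; [lra | exact: Rmin_r].
have e5 : m * mn (x i - x' i) <= mn (x i - x' i) by have := mn_bd (x i - x' i); nra.
have e6 : m * c <= m * (c' + mn (x i - x' i) + Rabs (ln (a i) - ln (a' i))) by apply: Rmult_le_compat_l; lra.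
have e7 : l i * c <= l' i * c' + mn (x i - x' i) + Rabs (a' i - a i) + Rabs (l i - l' i) by rewrite (Rabs_minus_sym (a' i)); lra.
have := Rmult_le_compat_l _ _ _ (proj1 wi) e7; have := hx i hCi; have := hll i hCi; have := h3 i; lra.
Qed.
End Mu.

(** * The retraction onto sets inside [M], and the factor over [M] *)

Section Retract.
Context {I : Type} (C : I -> Prop) (nu : I -> nat) (w : I -> R) (L : nat -> list I) (hw : wt C w)
  (hnu : forall i j, C i -> C j -> nu i = nu j -> i = j)
  (hL : forall n i, ~ In i (L n) -> w i <= eta n)
  (hwn : forall n i, (n <= nu i)%nat -> w i <= eta n) (M : (I -> R) -> Prop)
  (hMo : product_top I M) (hMC : forall x y, (forall i, C i -> x i = y i) -> M x -> M y).
Notation T := (I -> R).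
Notation none := (fun _ : I => False).
(** The hyperspace base is trivial here: it has no coordinates and the one set containing just
    [one]. The parameters are [x], the lower bounds and the slope. *)
Notation fb l := (fib C none C (eq (one : T)) l).
Notation kap := (kap C nu w).
Notation mu := (mu C w M).

Lemma w01' i : 0 <= w i <= 1. Proof. exact: (proj1 hw). Qed.
Lemma w0' i : 0 <= w i. Proof. by apply w01'. Qed.

Lemma fb_good l A : fb l A -> goodA A.
Proof. by move=> h; split; [exact: fib_one h | move=> a /(fib_supp _ _ _ _ _ _ h) [hc _] i; apply hc]. Qed.

Lemma fb_tau l A p : fb l A -> 0 <= p <= 1 -> fb l (tau p A).
Proof.
move=> h hp; have hs := fib_supp _ _ _ _ _ _ h; have [g1 g2] := fb_good l A h.
split; last first.
  apply: closed_img; [by move=> a /hs [] | by case: h |].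
  by move=> N F b a hF hb i; apply: tends_max => //; exact: tends_const.
split.
  by move=> _ [a [ha ->]] i hi; apply: Rle_trans (Rmax_l _ _); exact: fib_bd h ha hi.
split; first by apply goodA_tau.
split.
  move=> _ _ s t [a [ha ->]] [b [hb ->]] hs' ht hst; exists (comb s t a b); split; first exact: (fib_mconv _ _ _ _ _ _ h).
  by apply: raise_comb => //; lra.
split; first by move=> b _; apply: functional_extensionality => i; rewrite cut_out.
split.
  move=> _ <-; exists one; split; first by apply goodA_tau.
  exact: cut_one.
move=> _ [a [ha ->]]; have [ca oa] := hs a ha; split.
  by move=> i; have := ca i; rewrite /raise; rmx.
by move=> i hi; rewrite /raise oa // Rmax_left //; lra.
Qed.

Definition phi (x l : T) (s : R) (A : T -> Prop) (p : R) : R := kap (tau p A) - s * mu x l (tau p A).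

Definition lam x l s A : R := infr (fun p => 0 <= p <= 1 /\ phi x l s A p <= 0).

Section One.
Context (x l : T) (s : R) (A : T -> Prop) (hl : forall i, 0 < l i <= 1) (hs : 0 <= s) (hA : fb l A).

Lemma mi_tau p i : 0 <= p -> mi (tau p A) i = Rmax (mi A i) p.
Proof. by move=> hp; apply: tau_mi => //; [apply (fb_good l A hA) | exists one; apply (fb_good l A hA)]. Qed.

Lemma mu_tau_le p q : 0 <= p <= q -> q <= 1 -> mu x l (tau p A) <= mu x l (tau q A).
Proof.
move=> hp hq; apply: mu_mono => _ [a [ha ->]].
have ho := fib_one _ _ _ _ _ _ hA; have hm := fib_mconv _ _ _ _ _ _ hA.
exists (raise q a); split; first by apply: (tau_sub q A) => //; [lra | exists a].
by apply: functional_extensionality => i; rewrite /raise; rmx.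
Qed.

Lemma mu_ed A' B' : fb l A' -> fb l B' -> Rabs (mu x l A' - mu x l B') <= ed w A' B'.
Proof.
have key : forall A' B', fb l A' -> fb l B' -> mu x l A' <= mu x l B' + ed w A' B'.
  move=> A1 B1 h1 h2; have := mu_pert C w hw M x x l l A1 B1 0 0 hl hl.
  have e1 : forall i, C i -> w i * mn (x i - x i) <= 0 by move=> i _; rewrite /mn Rminus_diag Rabs_R0 Rmin_right; lra.
  have e2 : forall i, C i -> w i * Rabs (l i - l i) <= 0 by move=> i _; rewrite Rminus_diag Rabs_R0; lra.
  move=> /(_ (fun a i ha hi => fib_bd _ _ _ _ _ _ _ _ h1 ha hi) (fun a i ha hi => fib_bd _ _ _ _ _ _ _ _ h2 ha hi)).
  by move=> /(_ (Rle_refl _) (Rle_refl _) e1 e2); lra.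
move=> h1 h2; have := key _ _ h1 h2; have := key _ _ h2 h1; rewrite (ed_sym w B').
by move=> *; apply: Rabs_le; lra.
Qed.

Lemma phi_cont p q : 0 <= p <= 1 -> 0 <= q <= 1 -> Rabs (phi x l s A p - phi x l s A q) <= (1 + s) * Rabs (p - q).
Proof.
move=> hp hq; have fp := fb_tau l A p hA hp; have fq := fb_tau l A q hA hq.
have he := tau_ed w p q A w01'.
have hk := kap_dist C nu w hw hnu _ _ (fb_good _ _ fp) (fb_good _ _ fq).
have hm := mu_ed _ _ fp fq.
rewrite /phi; set k1 := kap _ in hk *; set k2 := kap _ in hk *; set m1 := mu _ _ _ in hm *; set m2 := mu _ _ _ in hm *.
have -> : k1 - s * m1 - (k2 - s * m2) = (k1 - k2) + s * (m2 - m1) by ring.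
apply: Rle_trans (Rabs_triang _ _) _; rewrite Rabs_mulk // (Rabs_minus_sym m2).
have : s * Rabs (m1 - m2) <= s * Rabs (p - q) by apply: Rmult_le_compat_l => //; lra.
lra.
Qed.

Lemma phi1 : phi x l s A 1 <= 0.
Proof.
have f1 := fb_tau l A 1 hA ltac:(lra).
have h0 : kap (tau 1 A) <= 0.
  have hg : goodA (eq (one : T)) by split => // _ <- i; rewrite /one; lra.
  apply: wsum_le => n; elim: n => [|n ih] /=; first lra.
  have -> : ext C nu (fun i => w i * (1 - mi (tau 1 A) i)) n = 0; last lra.
  case: (ext_cases C nu n) => [[i [hi <-]]|h]; last by rewrite ext_out.
  rewrite ext_in // mi_tau; last lra.
  by have := goodA_mi A i (fb_good _ _ hA) => hm; rewrite Rmax_right; [ring | lra].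
have := mu_bd C w M x l (tau 1 A); rewrite /phi; nra.
Qed.

Lemma lam_spec : 0 <= lam x l s A <= 1 /\ phi x l s A (lam x l s A) <= 0 /\
  (lam x l s A = 0 \/ 0 <= phi x l s A (lam x l s A)).
Proof.
set E := fun p => 0 <= p <= 1 /\ phi x l s A p <= 0.
have E1 : E 1 by split; [lra | exact: phi1].
have lb : forall p, E p -> 0 <= p by move=> p [[]].
have h01 : 0 <= lam x l s A <= 1.
  by split; [apply: infr_ge; [exists 1 | exact: lb] | apply: (infr_lb _ 0)].
split => //; split.
  apply: Rle_eps => d hd.
  have hd' : 0 < d / (1 + s) by apply: Rdiv_lt_0_compat; lra.
  have [p [[hp1 hp2] hp3]] := infr_approx E 0 (lam x l s A + d / (1 + s)) (ex_intro _ 1 E1) lb ltac:(rewrite -/(lam x l s A); lra).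
  have hp4 : lam x l s A <= p by apply: (infr_lb _ 0).
  have := phi_cont (lam x l s A) p h01 hp1.
  have : (1 + s) * Rabs (lam x l s A - p) <= (1 + s) * (d / (1 + s)).
    by apply: Rmult_le_compat_l; [lra | apply: Rabs_le; lra].
  have -> : (1 + s) * (d / (1 + s)) = d by field; lra.
  move=> h1 h2; have := Rle_trans _ _ _ (Rle_abs _) h2; lra.
case: (Req_dec (lam x l s A) 0) => h0; [by left | right].
apply: Rle_eps => d hd.
have hd' : 0 < d / (1 + s) by apply: Rdiv_lt_0_compat; lra.
set q := lam x l s A in h0 h01 *.
pose p := Rmax 0 (q - d / (1 + s)).
have hp : 0 <= p < q /\ q - p <= d / (1 + s) by rewrite /p; rmx.
have hphi : 0 < phi x l s A p.
  apply: Rnot_le_lt => h; have : q <= p; last lra.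
  by apply: (infr_lb _ 0) => //; split => //; lra.
have := phi_cont p q ltac:(lra) h01.
have : (1 + s) * Rabs (p - q) <= (1 + s) * (d / (1 + s)).
  by apply: Rmult_le_compat_l; [lra | apply: Rabs_le; lra].
have -> : (1 + s) * (d / (1 + s)) = d by field; lra.
move=> h1 h2; have := Rle_trans _ _ _ (Rle_abs _) h2; lra.
Qed.
End One.

(** Raising the coordinates of [A] to at least [p] shrinks [A], so it decreases [kap] and
    increases [mu]; [lam] is the first level at which [kap <= s * mu], whence a retraction
    onto the sets with this property.  They satisfy [x + ln A] in [M] for [x] in [M],
    and every such [A] is of this form for [s] large. *)
Definition rho x l s A : T -> Prop := tau (lam x l s A) A.

(** Let [p] and [q] be the two levels, say [p <= q]. Then [phi] is nonpositive for [A] at [p], and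
    at least [- d] at [q] unless [q = 0]. Since [mu] increases with the level, [kap] drops by at
    most [d] between them, and [tau_move] converts this into a distance. *)
Lemma rho_stab x l s A x' l' s' A' d n : (forall i, 0 < l i <= 1) -> (forall i, 0 < l' i <= 1) ->
  0 <= s -> 0 <= s' -> fb l A -> fb l' A' ->
  (forall p, 0 <= p <= 1 -> Rabs (phi x l s A p - phi x' l' s' A' p) <= d) ->
  ed w (rho x l s A) (rho x' l' s' A') <= 2 ^ n * d + eta n + ed w A A'.
Proof.
move=> hl hl' hs hs' hA hA' hd.
have [a1 [a2 a3]] := lam_spec x l s A hl hs hA; have [b1 [b2 b3]] := lam_spec x' l' s' A' hl' hs' hA'.
rewrite /rho; set p := lam x l s A in a1 a2 a3 *; set q := lam x' l' s' A' in b1 b2 b3 *.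
have d0 : 0 <= d by apply: Rle_trans (hd 0 ltac:(lra)); exact: Rabs_pos.
have hh : 0 < 2 ^ n := pow2_pos n; have hn0 := eta_pos n.
have gA := fb_good l A hA; have sA := fib_supp _ _ _ _ _ _ hA.
have t1 := ed_tri w w0' (tau p A) (tau q A) (tau q A'); have t2 := tau_ed2 w q A A' w0'.
suff : ed w (tau p A) (tau q A) <= 2 ^ n * d + eta n by lra.
have fin : forall D, ed w (tau p A) (tau q A) <= 2 ^ n * D + eta n -> D <= d -> ed w (tau p A) (tau q A) <= 2 ^ n * d + eta n.
  move=> D h1 h2; have : 2 ^ n * D <= 2 ^ n * d by apply: Rmult_le_compat_l; lra.
  lra.
case: (Rle_dec p q) => hpq.
  apply: (fin _ (tau_move C nu w hw hnu hwn A p q n gA ltac:(lra) ltac:(lra) sA)).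
  case: b3 => b3.
    have -> : p = q by lra.
    lra.
  have := hd q b1; rewrite Rabs_minus_sym => /(Rle_trans _ _ _ (Rle_abs _)) h1.
  have h2 := mu_tau_le x l A hA p q ltac:(lra) ltac:(lra).
  have : s * mu x l (tau p A) <= s * mu x l (tau q A) by apply: Rmult_le_compat_l.
  by move: a2 b3 h1; rewrite /phi; lra.
rewrite ed_sym in fin *.
apply: (fin _ (tau_move C nu w hw hnu hwn A q p n gA ltac:(lra) ltac:(lra) sA)).
case: a3 => a3; first lra.
have := hd q b1 => /(Rle_trans _ _ _ (Rle_abs _)) h1.
have h2 := mu_tau_le x l A hA q p ltac:(lra) ltac:(lra).
have : s * mu x l (tau q A) <= s * mu x l (tau p A) by apply: Rmult_le_compat_l.
by move: a3 b2 h1; rewrite /phi; lra.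
Qed.

Lemma phi_dist x l s A x' l' s' A' d1 d2 p : (forall i, 0 < l i <= 1) -> (forall i, 0 < l' i <= 1) ->
  0 <= s -> fb l A -> fb l' A' -> 0 <= d1 -> 0 <= d2 ->
  (forall i, C i -> w i * mn (x i - x' i) <= d1) -> (forall i, C i -> w i * Rabs (l i - l' i) <= d2) -> 0 <= p <= 1 ->
  Rabs (phi x l s A p - phi x' l' s' A' p) <= ed w A A' + Rabs (s - s') + s * (d1 + d2 + ed w A A').
Proof.
move=> hl hl' hs hA hA' hd1 hd2 h1 h2 hp.
have fA := fb_tau l A p hA hp; have fA' := fb_tau l' A' p hA' hp.
have hk := kap_dist C nu w hw hnu _ _ (fb_good _ _ fA) (fb_good _ _ fA').
have he := tau_ed2 w p A A' w0'.
have lb : forall a i, tau p A a -> C i -> l i <= a i by move=> a i ha hi; exact: fib_bd fA ha hi.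
have lb' : forall a i, tau p A' a -> C i -> l' i <= a i by move=> a i ha hi; exact: fib_bd fA' ha hi.
have m1 := mu_pert C w hw M x x' l l' _ _ d1 d2 hl hl' lb lb' hd1 hd2 h1 h2.
have m2 := mu_pert C w hw M x' x l' l _ _ d1 d2 hl' hl lb' lb hd1 hd2 _ _.
have {}m2 : mu x' l' (tau p A') <= mu x l (tau p A) + d1 + d2 + ed w (tau p A') (tau p A).
  apply: m2 => i hi; last by rewrite Rabs_minus_sym; exact: h2.
  by rewrite /mn Rabs_minus_sym; exact: h1.
rewrite (ed_sym w (tau p A')) in m2.
have b' := mu_bd C w M x' l' (tau p A').
rewrite /phi; set k1 := kap _ in hk *; set k2 := kap _ in hk *.
set u := mu x l _ in m1 m2 *; set v := mu x' l' _ in m1 m2 b' *.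
have -> : k1 - s * u - (k2 - s' * v) = (k1 - k2) + ((s' - s) * v + s * (v - u)) by ring.
apply: Rle_trans (Rabs_triang _ _) _; have := Rabs_triang ((s' - s) * v) (s * (v - u)).
rewrite Rabs_mult (Rabs_mult s) (Rabs_pos_eq s) // (Rabs_pos_eq v); last lra.
rewrite (Rabs_minus_sym s').
have h3 : Rabs (v - u) <= d1 + d2 + ed w A A' by apply: Rabs_le; lra.
have : s * Rabs (v - u) <= s * (d1 + d2 + ed w A A') by apply: Rmult_le_compat_l.
have : Rabs (s - s') * v <= Rabs (s - s') * 1 by apply: Rmult_le_compat_l; [exact: Rabs_pos | lra].
lra.
Qed.

Lemma unif_ev {N : Type} (F : (N -> Prop) -> Prop) (f_ : N -> T) f d : filt F -> (forall i, tends F (fun m => f_ m i) (f i)) ->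
  0 < d -> F (fun m => forall i, w i * mn (f_ m i - f i) <= d).
Proof.
move=> hF hf hd; have [l hl] := proj2 (proj2 hw) d hd.
apply: (filt1 _ hF (filt_list F l (fun i m => Rabs (f_ m i - f i) <= d) hF (fun i _ => hf i d hd))) => m h i.
have hm := mn_bd (f_ m i - f i); have := w01' i => hwi.
case: (classic (In i l)) => hi.
  by apply: mul_le_of_le => //; [lra | apply: Rle_trans (mn_le _) (h i hi)].
by apply: mul_le_of_le1 => //; [exact: hl | lra].
Qed.

Definition Tsp : space := funS I Rsp.
Definition Msp : space := subS Tsp M.
Definition Yb : space := prodS (prodS Msp Hw) Hw.
Definition yx (y : Yb) : T := fst (fst y).
Definition yl (y : Yb) : T := lo_ nu (snd (fst y)).
(** The slope is stored as entry 0 of a sequence, the form in which [absorb_maj] adjoins data;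
    [thr2] bounds the other entries below by 0. *)
Definition ys_ (y : Yb) : R := snd y O.

Lemma okP_one : okP none (eq (one : T)).
Proof.
split => //; split.
  move=> a b p q <- <- hp hq hpq; apply: functional_extensionality => i; rewrite /comb /one !Rmult_1_r.
  by rewrite hpq.
split.
  move=> x hx; apply: functional_extensionality => i; apply: Rle_antisym; apply: Rle_eps => d hd;
    have [_ [<- h]] := hx (i :: nil) d hd; have := h i (or_introl eq_refl); rmx.
split; first by move=> _ <-; split => // i; rewrite /one; lra.
by exists one; split => [i|_ <- i]; rewrite /one; lra.
Qed.

Lemma yl_good y : ok Yb y -> goodlo (yl y).
Proof. by move=> [[_ h] _]; apply: lo_good => k; apply (h k). Qed.

Lemma ys_ge0 y : ok Yb y -> 0 <= ys_ y.
Proof. by move=> [_ h]; apply (h O). Qed.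

Lemma yl_cv N F (ys : N -> Yb) y : filt F -> cv Yb N F ys y -> forall i, tends F (fun m => yl (ys m) i) (yl y i).
Proof.
move=> hF [[_ h] _] i; apply: tends_exp => //.
apply: (tends_ext _ hF (fun m => 0 - snd (fst (ys m)) (nu i))); first by move=> m; lra.
by rewrite -[- _]Rplus_0_l; apply: tends_minus => //; [exact: tends_const | exact: h].
Qed.

Definition Qc (y : Yb) (B : T -> Prop) : Prop := kap B <= ys_ y * mu (yx y) (yl y) B.

Definition trho (y : Yb) (B : T -> Prop) : T -> Prop := rho (yx y) (yl y) (ys_ y) B.

Lemma phi0 y B : fb (yl y) B -> phi (yx y) (yl y) (ys_ y) B 0 <= 0 <-> Qc y B.
Proof. by move=> hB; rewrite /phi /Qc tau0; [lra | apply (fb_good _ _ hB)]. Qed.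

Lemma trho_id y B : fb (yl y) B -> Qc y B -> trho y B = B.
Proof.
move=> hB /(phi0 y B hB) h; rewrite /trho /rho.
have -> : lam (yx y) (yl y) (ys_ y) B = 0.
  apply: Rle_antisym; first by apply: (infr_lb _ 0) => [p [[]]|] //; split => //; lra.
  by apply: infr_ge; [exists 0; split => //; lra | move=> p [[]]].
by apply: tau0; apply (fb_good _ _ hB).
Qed.

Lemma trho_near n y B B' : ok Yb y -> fb (yl y) B -> fb (yl y) B' ->
  ed w (trho y B) (trho y B') <= (2 + ys_ y) * (2 ^ n * ed w B B' + eta n).
Proof.
move=> hy hB hB'; have hs := ys_ge0 y hy; have hl := yl_good y hy; have hn0 := eta_pos n; have h2n := pow2_ge1 n.
have he := ed_ge0 w B B'.
have := rho_stab (yx y) (yl y) (ys_ y) B (yx y) (yl y) (ys_ y) B' ((1 + ys_ y) * ed w B B') n hl hl hs hs hB hB' _.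
move=> h; apply: Rle_trans (h _) _.
  move=> p hp; have := phi_dist (yx y) (yl y) (ys_ y) B (yx y) (yl y) (ys_ y) B' 0 0 p hl hl hs hB hB' (Rle_refl _) (Rle_refl _) _ _ hp.
  rewrite Rminus_diag Rabs_R0 => h1; apply: Rle_trans (h1 _ _) _; [| |lra] => i _.
    by rewrite /mn Rminus_diag Rabs_R0 Rmin_right; lra.
  by rewrite Rminus_diag Rabs_R0; lra.
have : 1 * ed w B B' <= 2 ^ n * ed w B B' by apply: Rmult_le_compat_r.
have : 0 <= ys_ y * eta n by apply: Rmult_le_pos; lra.
lra.
Qed.

Lemma eta_small_ex d : 0 < d -> exists n, eta n <= d.
Proof.
move=> hd; have [n hn0] := half_pow_small 1 d hd; exists (S n); have := hn0 (S n) ltac:(lia).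
have : eta (S n) <= (/ 2) ^ (S n); last lra.
by rewrite /eta pow_inv; apply: Rinv_le_contravar; [exact: pow2_pos | apply: pow2_mono; nia].
Qed.

Lemma trho_cv N F (ys : N -> Yb) y (bs : N -> T -> Prop) b : filt F -> (forall i, ok Yb (ys i)) -> ok Yb y ->
  (forall i, fb (yl (ys i)) (bs i)) -> fb (yl y) b -> cv Yb N F ys y -> tends F (fun i => ed w (bs i) b) 0 ->
  tends F (fun i => ed w (trho (ys i) (bs i)) (trho y b)) 0.
Proof.
move=> hF h1 h2 h3 h4 hc hb ep hep.
have [n hn] := eta_small_ex (ep / 3) ltac:(lra); have h2n := pow2_ge1 n.
have hs := ys_ge0 y h2; set s := ys_ y in hs.
(* The phases of the estimate: [phi_dist] gives at most [d * (2 + 3 * (s + 1))] because the nearby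
   slopes are at most [s + 1], and one more [d] accounts for the distance of the sets. *)
pose d := ep / (3 * 2 ^ n * (3 + 3 * (s + 1))).
have hden : 0 < 3 * 2 ^ n * (3 + 3 * (s + 1)) by apply: Rmult_lt_0_compat; lra.
have hd : 0 < d by apply: Rdiv_lt_0_compat.
have hdeq : 2 ^ n * (d * (3 + 3 * (s + 1))) = ep / 3 by rewrite /d; field; lra.
have ex := unif_ev F (fun m => yx (ys m)) (yx y) d hF (proj1 (proj1 hc)) hd.
have el := unif_ev F (fun m => yl (ys m)) (yl y) d hF (yl_cv _ _ _ _ hF hc) hd.
have es : tends F (fun m => ys_ (ys m)) s by exact: (proj2 hc O).
have dd : d <= 1 * d by lra.
have dmin : 0 < Rmin d 1 by rmx.
have ev := filt2 (P := fun m => Rabs (ys_ (ys m) - s) <= Rmin d 1 /\ Rabs (ed w (bs m) b - 0) <= d) _ _ hF (es _ dmin) (hb d hd) (fun m p q => conj p q).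
have exl := filt2 (P := fun m => (forall i, w i * mn (yx (ys m) i - yx y i) <= d) /\ (forall i, w i * mn (yl (ys m) i - yl y i) <= d)) _ _ hF ex el (fun m p q => conj p q).
apply: (filt2 _ _ hF ev exl) => m [e1 e2] [e3 e4].
have hlm := yl_good _ (h1 m); have hl := yl_good _ h2.
rewrite Rminus_0_r Rabs_pos_eq; last exact: ed_ge0.
have e2' : ed w (bs m) b <= d by move: e2; rewrite Rminus_0_r; apply: Rle_trans (Rle_abs _).
have e0 := ed_ge0 w (bs m) b.
have e1' : ys_ (ys m) <= s + 1 by move: e1; rmx.
have e1'' : Rabs (ys_ (ys m) - s) <= d by apply: Rle_trans e1 (Rmin_l _ _).
have hsm := ys_ge0 _ (h1 m).
have := rho_stab (yx (ys m)) (yl (ys m)) (ys_ (ys m)) (bs m) (yx y) (yl y) s b (d * (2 + 3 * (s + 1))) n hlm hl hsm hs (h3 m) h4.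
move=> h; apply: Rle_trans (h _) _.
  move=> p hp.
  have := phi_dist (yx (ys m)) (yl (ys m)) (ys_ (ys m)) (bs m) (yx y) (yl y) s b d d p hlm hl hsm (h3 m) h4 ltac:(lra) ltac:(lra) (fun i _ => e3 i).
  have e4' : forall i, C i -> w i * Rabs (yl (ys m) i - yl y i) <= d.
    move=> i _; have := e4 i; rewrite /mn Rmin_right //.
    by have := hlm i; have := hl i; move=> *; apply: Rabs_le; lra.
  move=> /(_ e4' hp) h5; apply: Rle_trans h5 _.
  have : ys_ (ys m) * (d + d + ed w (bs m) b) <= (s + 1) * (3 * d) by apply: Rmult_le_compat; lra.
  lra.
have : 0 <= 2 ^ n * d by apply: Rmult_le_pos; lra.
have : 1 * d <= 2 ^ n * d by apply: Rmult_le_compat_r; lra.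
have : 2 ^ n * (d * (2 + 3 * (s + 1))) = ep / 3 - 2 ^ n * d by rewrite -hdeq; ring.
lra.
Qed.

Definition Usp : space := subS (prodS Msp (Psp C)) (fun z => forall a, snd z a -> M (shf (fst z) a)).

Definition thr1 (z : Usp) : nat -> R := thr C nu (snd z).
(** Entry 0 exceeds this quotient exactly when [Qc] holds; the quotient is continuous because [mu]
    is positive on [Usp]. *)
Definition thr2 (z : majS Usp thr1) (k : nat) : R :=
  match k with
  | O => kap (snd (fst z)) / mu (fst (fst z)) (lo_ nu (snd z)) (snd (fst z))
  | _ => 0
  end.

Lemma htends_const {N : Type} (F : (N -> Prop) -> Prop) (A : T -> Prop) : filt F -> htends F (fun _ => A) A.
Proof. by move=> hF l ep hep; apply: (filtT _ _ hF) => m; apply: hn_refl; lra. Qed.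

Lemma prs_none (A : T -> Prop) : A one -> prs none A = eq one.
Proof.
move=> hA; have hc : forall a, cut none a = one :> T by move=> a; apply: functional_extensionality => i; rewrite cut_out.
by apply: set_ext => x; split; [move=> [a [_ ->]] | move=> <-; exists one].
Qed.

Lemma hal0 i : C i <-> False \/ C i. Proof. by split; [right | case]. Qed.

Lemma maj_fb (z : majS Usp thr1) : ok (majS Usp thr1) z -> fb (lo_ nu (snd z)) (snd (fst z)) /\ (forall k, 0 <= snd z k) /\
  0 < mu (fst (fst z)) (lo_ nu (snd z)) (snd (fst z)).
Proof.
case: z => [[x A] t] [[/= [[hx hA] hU] _] ht].
have ht0 : forall k, 0 <= t k by move=> k; apply: Rle_trans (ht k); exact: (thr_ge0 C C).
split.
  have := okP_fib C none C nu hnu A t hA ht; rewrite prs_none //; exact: (proj1 hA).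
split => //; apply: mu_pos => // i; exact: exp_pos.
Qed.

Lemma mu_cv N F (xs : N -> T) x (ls : N -> T) l (As : N -> T -> Prop) A : filt F ->
  (forall m i, 0 < ls m i <= 1) -> (forall i, 0 < l i <= 1) -> (forall m, fb (ls m) (As m)) -> fb l A ->
  (forall i, tends F (fun m => xs m i) (x i)) -> (forall i, tends F (fun m => ls m i) (l i)) ->
  tends F (fun m => ed w (As m) A) 0 -> tends F (fun m => mu (xs m) (ls m) (As m)) (mu x l A).
Proof.
move=> hF h1 h2 h3 h4 hx hl hA ep hep; have hep3 : 0 < ep / 3 by lra.
apply: (filt2 _ _ hF (hA _ hep3) (filt2 (P := fun m => (forall i, w i * mn (xs m i - x i) <= ep / 3) /\ (forall i, w i * mn (ls m i - l i) <= ep / 3)) _ _ hF (unif_ev F xs x _ hF hx hep3) (unif_ev F ls l _ hF hl hep3) (fun m p q => conj p q))).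
move=> m; rewrite Rminus_0_r Rabs_pos_eq; last exact: ed_ge0.
move=> e1 [e2 e3].
have e3' : forall i, w i * Rabs (ls m i - l i) <= ep / 3.
  move=> i; have := e3 i; rewrite /mn Rmin_right //.
  by have := h1 m i; have := h2 i; move=> *; apply: Rabs_le; lra.
have lb1 : forall a i, As m a -> C i -> ls m i <= a i by move=> a i ha hi; exact: fib_bd (h3 m) ha hi.
have lb2 : forall a i, A a -> C i -> l i <= a i by move=> a i ha hi; exact: fib_bd h4 ha hi.
have := mu_pert C w hw M (xs m) x (ls m) l (As m) A (ep / 3) (ep / 3) (h1 m) h2 lb1 lb2 ltac:(lra) ltac:(lra) (fun i _ => e2 i) (fun i _ => e3' i).
have := mu_pert C w hw M x (xs m) l (ls m) A (As m) (ep / 3) (ep / 3) h2 (h1 m) lb2 lb1 ltac:(lra) ltac:(lra)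
  (fun i _ => ltac:(rewrite /mn Rabs_minus_sym; exact: e2)) (fun i _ => ltac:(rewrite Rabs_minus_sym; exact: e3')).
rewrite (ed_sym w A); move=> *; apply: Rabs_le; lra.
Qed.

Lemma thr2_cv k (N : Type) F (zs : N -> majS Usp thr1) z : filt F -> (forall i, ok (majS Usp thr1) (zs i)) ->
  ok (majS Usp thr1) z -> cv (majS Usp thr1) N F zs z -> tends F (fun i => thr2 (zs i) k) (thr2 z k).
Proof.
move=> hF h1 h2 [[cx cA] ct]; case: k => [|k] /=; last exact: tends_const.
have [f2 [t2 m2]] := maj_fb z h2.
have fm := fun m => maj_fb (zs m) (h1 m).
have ce : tends F (fun m => ed w (snd (fst (zs m))) (snd (fst z))) 0.
  apply: (htends_ed F C) => // [m|]; first exact: fib_supp (proj1 (fm m)).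
  exact: fib_supp f2.
apply: tends_div => //; first exact: (Rgt_not_eq _ _ m2).
  move=> ep hep; apply: (filt1 _ hF (ce ep hep)) => m; rewrite Rminus_0_r Rabs_pos_eq; last exact: ed_ge0.
  apply: Rle_trans; apply: kap_dist => //; apply: fb_good; [exact: (proj1 (fm m)) | exact: f2].
apply: mu_cv => //.
- by move=> m; apply: lo_good; apply (fm m).
- exact: lo_good.
- by move=> m; apply (fm m).
- move=> i; apply: tends_exp => //.
  apply: (tends_ext _ hF (fun m => 0 - snd (zs m) (nu i))); first by move=> m; exact: Rminus_0_l.
  by rewrite -[- _]Rplus_0_l; apply: tends_minus => //; [exact: tends_const | exact: ct].
Qed.

Lemma hov_U_tot : hov (majS (majS Usp thr1) thr2)
  (totS Yb (T -> Prop) (fun y B => fb (yl y) B /\ Qc y B) (ed w)) (fun z => fst (fst (fst z))) (fun z => yx (fst z)).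
Proof.
exists (fun z => (((fst (fst (fst z)), snd (fst z)), snd z), snd (fst (fst z)))),
  (fun z => (((yx (fst z), snd z), snd (fst (fst z))), snd (fst z))).
split.
  split.
    move=> [[[x A] t] s] [[/= hz _] hs]; have [f2 [t2 m2]] := maj_fb ((x, A), t) hz; rewrite /= in f2 t2 m2.
    have hs0 : forall k, 0 <= s k.
      move=> k; apply: Rle_trans (hs k); case: k => [|k] /=; last lra.
      by apply: Rmult_le_pos; [apply (kap_bd C nu w hw hnu _ (fb_good _ _ f2)) | apply: Rlt_le; apply: Rinv_0_lt_compat].
    have [[[[hx _] _] _] _] := hz.
    split; first by split; [split => //= k; split | move=> k; split].
    split => //; have := hs O; rewrite /Qc /= /yx /yl /ys_ /= => h.
    have := Rmult_le_compat_r _ _ _ (Rlt_le _ _ m2) h.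
    by rewrite /Rdiv Rmult_assoc Rinv_l ?Rmult_1_r; lra.
  move=> N F zs z hF h1 h2 [[[cx cA] ct] cs]; split => //=.
  have [f2 _] := maj_fb _ (proj1 (proj1 h2)).
  apply: (htends_ed F C) => // [m|]; last exact: fib_supp f2.
  have [f1 _] := maj_fb _ (proj1 (proj1 (h1 m))); exact: fib_supp f1.
split.
  split.
    move=> [[[x t] s] A] [[/= [hx ht] hs] [hf hq]]; rewrite /yl /= in hf.
    have ht0 : forall k, 0 <= t k by move=> k; apply (ht k).
    have [h1 [h2 _]] := fib_okP C none C nu hal0 hnu (eq one) t A okP_one ht0 hf.
    have hl : forall i, 0 < lo_ nu t i by move=> i; exact: exp_pos.
    have gA := fb_good _ _ hf.
    have hU : forall a, A a -> M (shf x a).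
      move=> a ha; have hm := mu_bd C w M x (lo_ nu t) A.
      case: (Rlt_dec 0 (mu x (lo_ nu t) A)) => hpos; first exact: mu_in hpos ha.
      (* If [mu] vanishes, [Qc] forces [kap A <= 0]; then [one] is the only element of [A], and [x]
         in [M] suffices. *)
      have hm0 : mu x (lo_ nu t) A = 0 by lra.
      rewrite /Qc /yx /yl /= hm0 Rmult_0_r in hq.
      rewrite (kap_eq0 C nu w hw hnu A gA (fib_supp _ _ _ _ _ _ hf) hq a ha).
      by apply: (hMC x) => [i _|]; [rewrite /shf /one ln_1 Rplus_0_r | apply hx].
    have hm := mu_pos C w hw M hMo hMC x (lo_ nu t) A h1 hl hU.
    split; last first.
      case=> [|k] /=; last by apply (hs (S k)).
      rewrite /Qc /yx /yl /ys_ /= in hq; apply: (Rmult_le_reg_r (mu x (lo_ nu t) A)) => //.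
      by rewrite /Rdiv Rmult_assoc Rinv_l ?Rmult_1_r //; exact: (Rgt_not_eq _ _ hm).
    by split => //; split => //; split => //; split.
  move=> N F zs z hF h1 h2 [[[/= c1 c2] c3] c4]; split => //; split => //; split => //.
  apply: (ed_htends F C w) => // [m|]; first exact: fib_supp (proj1 (proj2 (h1 m))).
  exact: fib_supp (proj1 (proj2 h2)).
split; first by move=> [[[x A] t] s].
split; first by move=> [[[x t] s] A].
by [].
Qed.

(** The lower bounds are adjoined before the slope because [mu], and with it the threshold of the
    slope, depends on them. Both end up in the base [Yb], where they are absorbed. *)
Lemma hov_factor_U : hov (prodS Usp Rw) (prodS Msp Rw) (fun z => fst (fst z)) (fun z => fst z).
Proof.
apply: hov_trans (absorb_maj Usp (fun z => fst z) thr1 _) _.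
  move=> k N F xs x hF h1 h2 [_ c2]; apply: (thr_cv C C) => // [i|]; [by apply (h1 i) | by apply h2].
apply: hov_trans (absorb_maj (majS Usp thr1) (fun z => fst (fst z)) thr2 thr2_cv) _.
apply: hov_trans (hov_prod _ _ Rw Rw _ _ hov_U_tot (hov_refl Rw _)) _.
apply: (hov_trans _ (prodS Yb Rw) _ _ (fun z => yx (fst z))); last first.
  apply: hov_sym; apply: hov_trans (absorb_Hw Msp (fun x => x)) _.
  exact: (absorb_Hw (prodS Msp Hw) (fun z => fst z)).
have key := fib_factor C none C w L hw hal0 (fun i h => False_ind _ h) hL Yb (fun _ => eq one) yl (fun _ _ => okP_one) yl_good
  (fun N F ys y hF _ _ hc => conj (htends_const F (eq one) hF) (yl_cv N F ys y hF hc)) Qc trho (fun y => 2 + ys_ y).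
refine (hov_base _ _ _ _ yx (key _ _ _ _ _ _)).
- move=> y B hy hB; have [h1 [h2 _]] := lam_spec (yx y) (yl y) (ys_ y) B (yl_good y hy) (ys_ge0 y hy) hB.
  by split; [exact: fb_tau | rewrite /phi in h2; rewrite /Qc /trho /rho; lra].
- by move=> N F ys y bs b hF h1 h2 h3 h4; exact: trho_cv.
- by move=> n y B B' hy hB hB' hq; have := trho_near n y B B' hy hB hB'; rewrite (trho_id y B' hB' hq).
- move=> y b B hy hb hB hlim; rewrite /Qc; apply: Rle_eps => d hd; have hs := ys_ge0 y hy.
  have hd' : 0 < d / (1 + ys_ y) by apply: Rdiv_lt_0_compat; lra.
  have [n0 hn0] := hlim _ hd'; have h1 := hn0 n0 (le_n _); have [hf hq] := hb n0; rewrite /Qc in hq.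
  have h2 := Rle_trans _ _ _ (kap_dist C nu w hw hnu _ _ (fb_good _ _ hf) (fb_good _ _ hB)) h1.
  have h3 := Rle_trans _ _ _ (mu_ed (yx y) (yl y) (yl_good y hy) _ _ hf hB) h1.
  have h4 : ys_ y * mu (yx y) (yl y) (b n0) <= ys_ y * (mu (yx y) (yl y) B + d / (1 + ys_ y)).
    by apply: Rmult_le_compat_l => //; have := Rle_trans _ _ _ (Rle_abs _) h3; lra.
  have h5 : d / (1 + ys_ y) + ys_ y * (d / (1 + ys_ y)) = d by field; lra.
  rewrite Rabs_minus_sym in h2; have := Rle_trans _ _ _ (Rle_abs _) h2; lra.
- by move=> y hy; have := ys_ge0 y hy; lra.
- by move=> N F ys y hF _ _ [_ h]; apply: tends_plus => //; [exact: tends_const | exact: (h O)].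
Qed.
End Retract.

(** * Orders of type omega_1 *)

Section Order.
Context {I : Type} (lt : I -> I -> Prop) (HI : is_omega1 I lt).
Notation T := (I -> R).

Definition le (i j : I) : Prop := lt i j \/ i = j.

Lemma o_irr i : ~ lt i i. Proof. by apply HI. Qed.
Lemma o_tr i j k : lt i j -> lt j k -> lt i k. Proof. by apply HI. Qed.
Lemma o_tot i j : lt i j \/ i = j \/ lt j i. Proof. by apply HI. Qed.
Lemma o_wf : well_founded lt. Proof. by apply HI. Qed.
Lemma o_unc : ~ countable I. Proof. by apply HI. Qed.
Lemma o_cnt i : countable {j : I | lt j i}. Proof. by apply HI. Qed.

Lemma nlt i j : ~ lt i j <-> le j i.
Proof.
split; first by case: (o_tot i j) => [|[->|h]] // _; [right | left].
by move=> [h|->] h'; [apply: (o_irr i); exact: o_tr h' h | exact: o_irr h'].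
Qed.

Lemma le_tr i j k : le i j -> le j k -> le i k.
Proof. by move=> [h|->] // [h'|<-]; left => //; exact: o_tr h h'. Qed.
Lemma lt_le_tr i j k : lt i j -> le j k -> lt i k.
Proof. by move=> h [h'|<-] //; exact: o_tr h h'. Qed.
Lemma le_lt_tr i j k : le i j -> lt j k -> lt i k.
Proof. by move=> [h|->] // h'; exact: o_tr h h'. Qed.

Lemma least (P : I -> Prop) : (exists i, P i) -> exists i, P i /\ forall j, P j -> le i j.
Proof.
move=> [i]; elim/(well_founded_ind o_wf): i => i ih hi.
case: (classic (exists j, P j /\ lt j i)) => [[j [h1 h2]]|h]; first exact: (ih j).
by exists i; split => // j hj; apply/nlt => hji; apply: h; exists j.
Qed.

Lemma nu_ex i : exists nu : I -> nat, forall a b, lt a i -> lt b i -> nu a = nu b -> a = b.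
Proof.
have [f hf] := o_cnt i.
exists (fun a => match excluded_middle_informative (lt a i) with left h => f (exist _ a h) | right _ => O end).
move=> a b ha hb; case: excluded_middle_informative => // ha'; case: excluded_middle_informative => // hb' /hf h.
by injection h.
Qed.

Lemma nu_le_ex i : exists nu : I -> nat, forall a b, le a i -> le b i -> nu a = nu b -> a = b.
Proof.
have [nu hnu] := nu_ex i.
exists (fun a => if excluded_middle_informative (a = i) then O else S (nu a)).
move=> a b [ha|->] [hb|->]; do 2 (case: excluded_middle_informative => //); try by move=> ->.
by move=> _ _ [] /hnu; apply.
Qed.

(** An unbounded sequence would make the order a countable union of countable initial segments. *)
Lemma bounded (s : nat -> I) : exists b, forall n, lt (s n) b.
Proof.
apply: NNPP => h; apply: o_unc.
have key : forall b, exists n, le b (s n).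
  move=> b; apply: NNPP => hb; apply: h; exists b => n; apply: NNPP => /nlt h1; apply: hb; by exists n.
have [N hN] := choice_fun _ key.
have [nu hnu] := choice_fun _ (fun n => nu_le_ex (s n)).
exists (fun b => Cantor.to_nat (N b, nu (N b) b)) => a b hab.
have := f_equal Cantor.of_nat hab; rewrite !Cantor.cancel_of_to => -[h1 h2].
by apply: (hnu (N a)); [exact: hN | rewrite h1; exact: hN | rewrite h2 h1].
Qed.

(** Finite sequences of naturals are the codes of the rational points [qpt], of which there are thus
    countably many over a countable set of coordinates. *)
Lemma bounded_seqs (phi : list nat -> I) : exists b, forall l, lt (phi l) b.
Proof.
have key : forall n phi, exists b, forall l : list nat, length l = n -> lt (phi l) b.
  elim=> [|n ih] {}phi.
    by have [b hb] := bounded (fun _ => phi nil); exists b => -[|//] _; exact: (hb O).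
  have [b hb] := choice_fun _ (fun k => ih (fun l => phi (k :: l))).
  have [b' hb'] := bounded b; exists b' => -[|k l] //= [hl]; exact: o_tr (hb k l hl) (hb' k).
have [b hb] := choice_fun _ (fun n => key n phi).
have [b' hb'] := bounded b; exists b' => l; exact: o_tr (hb _ l eq_refl) (hb' _).
Qed.

Lemma bounded_list (l : list I) : exists b, forall i, In i l -> lt i b.
Proof.
elim: l => [|j l [b hb]].
  have : exists i : I, True.
    apply: NNPP => h; apply: o_unc; exists (fun _ => O) => a; case: h; by exists a.
  by move=> [i _]; exists i.
have [b' hb'] := bounded (fun n => match n with O => j | _ => b end); exists b' => i [<-|hi]; first exact: (hb' O).
exact: o_tr (hb i hi) (hb' 1%nat).
Qed.

(** * Continuous functions depend on countably many coordinates *)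

Definition ratio (n : nat) : R := let pq := Cantor.of_nat n in let ab := Cantor.of_nat (fst pq) in
  (INR (fst ab) - INR (snd ab)) / (INR (snd pq) + 1).

Lemma ratio_dense x e : 0 < e -> exists n, Rabs (ratio n - x) < e.
Proof.
move=> he; have [q hq] := INR_unbounded (/ e); have hq0 := pos_INR q.
have [a ha] : exists a b : nat, INR a - INR b <= x * (INR q + 1) < INR a - INR b + 1.
  have [b hb] := INR_unbounded (Rabs (x * (INR q + 1))).
  have hx : 0 <= x * (INR q + 1) + INR b by move: hb; rmx.
  have [n [h1 h2]] : exists n, INR n <= x * (INR q + 1) + INR b < INR n + 1.
    have [m hm] := INR_unbounded (x * (INR q + 1) + INR b).
    elim: m hm => [|m ih] hm; first by rewrite /= in hm; lra.
    case: (Rle_dec (INR m) (x * (INR q + 1) + INR b)) => h.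
      by exists m; move: hm; rewrite S_INR; lra.
    by apply: ih; lra.
  by exists n, b; lra.
have [b [h1 h2]] := ha.
exists (Cantor.to_nat (Cantor.to_nat (a, b), q)).
rewrite /ratio Cantor.cancel_of_to; cbn [fst snd]; rewrite Cantor.cancel_of_to; cbn [fst snd].
have -> : (INR a - INR b) / (INR q + 1) - x = - ((x * (INR q + 1) - (INR a - INR b)) / (INR q + 1)) by field; lra.
rewrite Rabs_Ropp Rabs_pos_eq; last first.
  by apply: Rmult_le_pos; [lra | apply: Rlt_le; apply: Rinv_0_lt_compat; lra].
apply: (Rlt_trans _ (1 / (INR q + 1))).
  by apply: Rmult_lt_compat_r; [apply: Rinv_0_lt_compat; lra | lra].
apply: (Rmult_lt_reg_r (INR q + 1)); first lra.
rewrite /Rdiv Rmult_assoc Rinv_l ?Rmult_1_r; last lra.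
have : / e * e < (INR q + 1) * e by apply: Rmult_lt_compat_r; lra.
rewrite Rinv_l; lra.
Qed.

(** Rational points of finite support, with positions in the countable range of [e]. *)
Fixpoint qpt (e : nat -> I) (l : list nat) : T :=
  match l with
  | nil => fun _ => 0
  | k :: l => fun i => if excluded_middle_informative (i = e (fst (Cantor.of_nat k))) then ratio (snd (Cantor.of_nat k)) else qpt e l i
  end.

Lemma qpt_dense e (l : list I) (x : T) d : 0 < d -> (forall i, In i l -> exists n, i = e n) ->
  exists c, forall i, In i l -> Rabs (qpt e c i - x i) < d.
Proof.
move=> hd; elim: l => [|j l ih] h; first by exists nil.
have [c hc] := ih (fun i hi => h i (or_intror hi)); have [n hn] := h j (or_introl eq_refl).
have [m hm] := ratio_dense (x j) d hd.
exists (Cantor.to_nat (n, m) :: c) => i hi; cbn [qpt]; rewrite Cantor.cancel_of_to; cbn [fst snd].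
case: excluded_middle_informative => hin; first by rewrite hin -hn.
by case: hi => [hj|hi]; [case: hin; rewrite -hj hn | exact: hc].
Qed.

Lemma enum_ex i : exists e : nat -> I, forall j, le j i -> exists n, j = e n.
Proof.
have [nu hnu] := nu_le_ex i.
have key : forall n, exists j, (exists j', le j' i /\ nu j' = n) -> le j i /\ nu j = n.
  move=> n; case: (classic (exists j', le j' i /\ nu j' = n)) => [[j hj]|h]; [by exists j | by exists i => /h].
have [e he] := choice_fun _ key; exists e => j hj; exists (nu j).
have [h1 h2] := he (nu j) (ex_intro _ j (conj hj eq_refl)); by apply: hnu.
Qed.

(** A closing-off argument: [i0] is chosen such that at every rational point over the coordinates up
    to some [s n], the continuity of [f] is witnessed by coordinates below [i0]. If [x] and [y]
    agree below [i0], one rational point approximates both there, and [f x] and [f y] differ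
    arbitrarily little. *)
Lemma depends (f : T -> R) : continuous (product_top I) R_top f ->
  exists i0, forall x y, (forall i, lt i i0 -> x i = y i) -> f x = f y.
Proof.
move=> hf.
have hnb : forall (q : T) n, exists (F : list I) (d : R), 0 < d /\ forall y, (forall i, In i F -> Rabs (y i - q i) < d) -> Rabs (f y - f q) < / (INR n + 1).
  move=> q n; have hn : 0 < / (INR n + 1) by apply: Rinv_0_lt_compat; have := pos_INR n; lra.
  have hq : Rabs (f q - f q) < / (INR n + 1) by rewrite Rminus_diag Rabs_R0.
  have [|F [d [hd h]]] := hf (fun r => Rabs (r - f q) < / (INR n + 1)) _ q hq.
    move=> r hr; exists (/ (INR n + 1) - Rabs (r - f q)); split; first lra.
    move=> s hs; have -> : s - f q = (s - r) + (r - f q) by ring.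
    by apply: Rle_lt_trans (Rabs_triang _ _) _; lra.
  by exists F, d.
have [F hF] := choice_fun _ (fun qn : T * nat => hnb (fst qn) (snd qn)).
have hb : forall q, exists b, forall n i, In i (F (q, n)) -> lt i b.
  move=> q; have [s hs] := choice_fun _ (fun n => bounded_list (F (q, n))).
  by have [b hb] := bounded s; exists b => n i hi; exact: o_tr (hs n i hi) (hb n).
have [B hB] := choice_fun _ hb.
have [e he] := choice_fun _ enum_ex.
(* One step of the closing-off: a bound above [i] for the coordinates that witness continuity at the
   rational points over the coordinates up to [i]. *)
have hh : forall i, exists b, lt i b /\ forall c, lt (B (qpt (e i) c)) b.
  move=> i; have [b1 h1] := bounded_seqs (fun c => B (qpt (e i) c)); have [b2 h2] := bounded_list (i :: b1 :: nil).
  exists b2; split; first by apply: h2; left.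
  by move=> c; apply: o_tr (h1 c) _; apply: h2; right; left.
have [h hh'] := choice_fun _ hh.
have [j0 _] := bounded_list nil.
pose s n := Nat.iter n h j0.
have sS : forall n, s (S n) = h (s n) by [].
(* Taking the least upper bound ensures that finitely many coordinates below [i0] already lie below
   some [s n]. *)
have [i0 [h1 h2]] := least (fun b => forall n, lt (s n) b) (bounded s).
have cov : forall l : list I, exists n, forall i, In i l -> lt i i0 -> le i (s n).
  have smono : forall n p, le (s n) (s (n + p)%nat).
    move=> n; elim=> [|p ih]; first by rewrite Nat.add_0_r; right.
    by rewrite Nat.add_succ_r sS; apply: le_tr ih _; left; apply hh'.
  elim=> [|j l [n hn]]; first by exists O.
  case: (classic (lt j i0)) => hj; last by exists n => i [<-|hi] //; exact: hn.
  have [m hm] : exists m, le j (s m).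
    apply: NNPP => hm; have : le i0 j; last by move/nlt.
    by apply: h2 => m; apply: NNPP => /nlt hjm; apply: hm; exists m.
  exists (m + n)%nat => i [<-|hi] hi0; first exact: le_tr hm (smono m n).
  by apply: le_tr (hn i hi hi0) _; rewrite Nat.add_comm; exact: smono.
exists i0 => x y hxy; apply: NNPP => hne.
have hpos : 0 < Rabs (f x - f y) by apply: Rabs_pos_lt; lra.
have [n hn] := INR_unbounded (4 / Rabs (f x - f y)); have hn0 := pos_INR n.
have hsm : 4 * / (INR n + 1) < Rabs (f x - f y).
  apply: (Rmult_lt_reg_r (INR n + 1)); first lra.
  rewrite Rmult_assoc Rinv_l ?Rmult_1_r; last lra.
  have : 4 / Rabs (f x - f y) * Rabs (f x - f y) < (INR n + 1) * Rabs (f x - f y) by apply: Rmult_lt_compat_r; lra.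
  rewrite /Rdiv Rmult_assoc Rinv_l; lra.
have [dx [hdx hx]] := hF (x, n); have [dy [hdy hy]] := hF (y, n).
rewrite /= in hx hy; set Fx := F (x, n) in hx; set Fy := F (y, n) in hy.
have [m hm] := cov (Fx ++ Fy)%list.
pose l := filter (fun i => if excluded_middle_informative (lt i i0) then true else false) (Fx ++ Fy)%list.
have hl : forall i, In i l <-> In i (Fx ++ Fy)%list /\ lt i i0.
  move=> i; rewrite filter_In; case: excluded_middle_informative => hi; split => // -[] //.
have [c hc] := qpt_dense (e (s m)) l x (Rmin dx dy) ltac:(rmx) (fun i hi => he (s m) i (hm i (proj1 (proj1 (hl i) hi)) (proj2 (proj1 (hl i) hi)))).
set q := qpt (e (s m)) c in hc.
(* [mk z] follows [q] below [i0] and [z] elsewhere: it agrees with [q] on the witnesses at [q], all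
   below [i0], and for [z] equal to [x] or [y] it is close to [z] on the witnesses at [z]. *)
pose mk (z : T) : T := fun i => if excluded_middle_informative (lt i i0) then q i else z i.
have [dq [hdq hq]] := hF (q, n); rewrite /= in hq.
have near : forall z, Rabs (f (mk z) - f q) < / (INR n + 1).
  move=> z; apply: hq => i hi; rewrite /mk; case: excluded_middle_informative => hi0; first by rewrite Rminus_diag Rabs_R0.
  case: hi0; apply: o_tr (hB q n i hi) _; apply: o_tr (h1 (S m)); rewrite sS; apply hh'.
have nx : Rabs (f (mk x) - f x) < / (INR n + 1).
  apply: hx => i hi; rewrite /mk; case: excluded_middle_informative => hi0; last by rewrite Rminus_diag Rabs_R0.
  by apply: Rlt_le_trans (Rmin_l dx dy); apply: hc; apply/hl; split => //; apply/in_app_iff; left.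
have ny : Rabs (f (mk y) - f y) < / (INR n + 1).
  apply: hy => i hi; rewrite /mk; case: excluded_middle_informative => hi0; last by rewrite Rminus_diag Rabs_R0.
  by rewrite -(hxy i hi0); apply: Rlt_le_trans (Rmin_r dx dy); apply: hc; apply/hl; split => //; apply/in_app_iff; right.
have := near x; have := near y; move: nx ny hsm; clear; rmx.
Qed.

(** * Blocks of coordinates *)

Lemma succ_ex i : exists s, lt i s /\ forall j, lt i j -> le s j.
Proof. by apply: least; have [b hb] := bounded_list (i :: nil); exists b; apply: hb; left. Qed.

(** The coordinates from [i0] on split into chains of type omega. Cantor pairing identifies each
    chain with the product of its members and the naturals, which assigns a sequence of its
    coordinates to every member. One further sequence, the block [None], is taken from the chain of
    [i0]. *)
Lemma blocks i0 : exists (bo : I -> option I * nat) (bf : option I * nat -> I),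
  (forall i, ~ lt i i0 -> bf (bo i) = i /\ forall j, fst (bo i) = Some j -> ~ lt j i0) /\
  (forall o n, (forall j, o = Some j -> ~ lt j i0) -> ~ lt (bf (o, n)) i0 /\ bo (bf (o, n)) = (o, n)).
Proof.
have [s hs] := choice_fun _ succ_ex.
have s_inj : forall a b, s a = s b -> a = b.
  move=> a b h; case: (o_tot a b) => [hab|[//|hba]].
    by have := proj2 (hs a) b hab; rewrite h => /nlt []; apply hs.
  by have := proj2 (hs b) a hba; rewrite -h => /nlt []; apply hs.
(* The starting points of the chains; [it n] is the [n]-th successor. *)
pose lam i := ~ lt i i0 /\ forall r, ~ lt r i0 -> i <> s r.
pose it n i := Nat.iter n s i.
have itJ : forall n i, ~ lt i i0 -> ~ lt (it n i) i0.
  move=> n i hi; elim: n => [|n ih] //= h; apply: ih; apply: o_tr h; apply hs.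
have dec : forall i, exists p : I * nat, ~ lt i i0 -> lam (fst p) /\ i = it (snd p) (fst p).
  elim/(well_founded_ind o_wf) => i ih.
  case: (classic (exists r, ~ lt r i0 /\ i = s r)) => [[r [h1 h2]]|h].
    have [[a n] hp] := ih r ltac:(rewrite h2; apply hs); exists (a, S n) => _.
    by have [h3 h4] := hp h1; split => //=; rewrite h2 {1}h4.
  by exists (i, O) => hi; split => //; split => // r hr hir; apply: h; exists r.
have [dd hdd] := choice_fun _ dec.
have uniq : forall a b n m, lam a -> lam b -> it n a = it m b -> (a, n) = (b, m).
  move=> a b n; elim: n => [|n ih] [|m] ha hb //=; first by move=> ->.
    by move=> h; case: (proj2 ha _ (itJ m b (proj1 hb)) h).
    by move=> h; case: (proj2 hb _ (itJ n a (proj1 ha)) (eq_sym h)).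
  by move=> /s_inj /(ih _ ha hb) [-> ->].
have dK : forall a n, lam a -> dd (it n a) = (a, n).
  move=> a n ha; have [h1 h2] := hdd (it n a) (itJ n a (proj1 ha)); case E : (dd (it n a)) h1 h2 => [b m] /= hb h.
  by apply: eq_sym; apply: uniq.
have lam0 : lam i0.
  split; first exact: o_irr.
  by move=> r hr h; apply: hr; rewrite h; apply hs.
(* In the chain of [i0] the members use the odd positions and leave the even ones to [None]. *)
pose enc (a : I) (n : nat) := if excluded_middle_informative (a = i0) then (2 * n + 1)%nat else n.
pose bf (p : option I * nat) := match fst p with
  | None => it (2 * snd p)%nat i0
  | Some j => it (enc (fst (dd j)) (Cantor.to_nat (snd (dd j), snd p))) (fst (dd j)) end.
pose dcd (a : I) (m : nat) : option I * nat := let q := Cantor.of_nat m in (Some (it (fst q) a), snd q).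
pose bo (i : I) : option I * nat := let a := fst (dd i) in let m := snd (dd i) in
  if excluded_middle_informative (a = i0) then (if Nat.even m then (None, Nat.div2 m) else dcd a (Nat.div2 m)) else dcd a m.
exists bo, bf; split.
  move=> i hi; have [h1 h2] := hdd i hi; set a := fst (dd i) in h1 h2; set m := snd (dd i) in h2.
  have dc : forall k, bf (dcd a k) = it (enc a k) a.
    move=> k; rewrite /bf /dcd; cbn [fst snd]; rewrite dK //; cbn [fst snd].
    by rewrite -surjective_pairing Cantor.cancel_to_of.
  rewrite /bo -/a -/m; case: excluded_middle_informative => ha.
    case hev : (Nat.even m).
      split => //; rewrite /bf /= h2 ha; congr it; have := Nat.Even_double m (proj1 (Nat.even_spec m) hev).
      by rewrite /Nat.double; lia.
    split; last by move=> j [<-]; apply: itJ; apply h1.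
    rewrite dc /enc; case: excluded_middle_informative => // _.
    rewrite h2; congr it.
    have hodd : Nat.Odd m by apply/Nat.odd_spec; rewrite -Nat.negb_even hev.
    by have := Nat.Odd_double m hodd; rewrite /Nat.double; lia.
  split; last by move=> j [<-]; apply: itJ; apply h1.
  by rewrite dc /enc; case: excluded_middle_informative.
move=> [j|] n ho; rewrite /bf; cbn [fst snd].
  have hj := ho j eq_refl; have [h1 h2] := hdd j hj; split; first by apply: itJ; apply h1.
  rewrite /bo dK //; cbn [fst snd]; rewrite /enc; case: excluded_middle_informative => ha.
    have -> : Nat.even (2 * Cantor.to_nat (snd (dd j), n) + 1) = false.
      by rewrite Nat.add_1_r Nat.even_succ -Nat.negb_even Nat.even_mul.
    by rewrite Nat.add_1_r Nat.div2_succ_double /dcd Cantor.cancel_of_to; cbn [fst snd]; rewrite -h2.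
  by rewrite /dcd Cantor.cancel_of_to; cbn [fst snd]; rewrite -h2.
split; first by apply: itJ; exact: o_irr.
rewrite /bo dK //; cbn [fst snd]; case: excluded_middle_informative => // _.
by rewrite Nat.even_mul Nat.div2_double.
Qed.
End Order.

(** * Transfinite composition of the factorizations *)

Section Transfinite.
Context {I : Type} (lt : I -> I -> Prop) (HI : is_omega1 I lt) (i0 : I).
Notation T := (I -> R).
Notation S_ := (T -> Prop).
Notation le := (le lt).
Notation D0 := (fun i => lt i i0).
Notation J := (fun i => ~ lt i i0).
Notation dn k := (fun i => le i k).
Notation ds k := (fun i => lt i k).

(** The inverse limit of the sets [Rk k]. Compactness determines a set by its projections to initial
    segments, so this one definition serves initial, successor and limit stages alike. *)
Definition limS (A0 : S_) (Rk : I -> S_) (D : I -> Prop) : S_ := fun a =>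
  (cube a /\ forall i, ~ D i -> a i = 1) /\ A0 (cut D0 a) /\ forall k, J k -> D k -> Rk k (cut (dn k) a).

Lemma limS_ext A0 Rk Rk' (D : I -> Prop) : (forall k, J k -> D k -> Rk k = Rk' k) -> limS A0 Rk D = limS A0 Rk' D.
Proof.
move=> h; apply: set_ext => a; split; move=> [h1 [h2 h3]]; split => //; split => // k hk hD.
  by rewrite -h //; exact: h3.
by rewrite h //; exact: h3.
Qed.

Lemma D0_dn k i : J k -> lt i i0 -> le i k.
Proof. by move=> /(nlt lt HI) hk hi; left; exact: (lt_le_tr lt HI) hi hk. Qed.

Definition coh (A0 : S_) (Rk : I -> S_) (D : I -> Prop) : Prop :=
  forall k, J k -> D k -> okP (dn k) (Rk k) /\ prs D0 (Rk k) = A0 /\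
    forall k', J k' -> lt k' k -> prs (dn k') (Rk k) = Rk k'.

Section Lim.
Context (D : I -> Prop) (hD : forall i j, D j -> le i j -> D i) (hD0 : forall i, lt i i0 -> D i).

(** Closedness and convergence are tested on finite lists of coordinates, and each such list is
    captured by one stage; this is why both pass to the limit. *)
Lemma lim_cap (l : list I) : (forall i, In i l -> D i -> lt i i0) \/
  exists k, J k /\ D k /\ forall i, In i l -> D i -> le i k.
Proof.
elim: l => [|j l ih]; first by left => i [].
case: (classic (D j)) => hj; last first.
  case: ih => [h|[k [h1 [h2 h3]]]]; [left | right; exists k; do 2 split => //]; move=> i [<-|hi] // hDi; [exact: h | exact: h3].
case: (classic (lt j i0)) => hj0.
  case: ih => [h|[k [h1 [h2 h3]]]]; [left | right; exists k; do 2 split => //]; move=> i [<-|hi] // hDi; [exact: h | | exact: h3].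
  exact: D0_dn.
right; case: ih => [h|[k [h1 [h2 h3]]]].
  exists j; do 2 split => //; move=> i [<-|hi] hDi; first by right.
  by apply: D0_dn => //; exact: h.
case: (o_tot lt HI j k) => hjk.
  exists k; do 2 split => //; move=> i [<-|hi] hDi; [by left | exact: h3].
exists j; do 2 split => //; move=> i [<-|hi] hDi; first by right.
by apply: (le_tr lt HI) (h3 i hi hDi) _; case: hjk => [->|h]; [right | left].
Qed.

Context (A0 : S_) (Rk : I -> S_) (hA0 : okP D0 A0) (hR : coh A0 Rk D).

Lemma R_coh k k' a : J k -> D k -> J k' -> le k' k -> Rk k a -> Rk k' (cut (dn k') a).
Proof.
move=> hk hDk hk' [h|->] ha.
  have [_ [_ h3]] := hR k hk hDk; rewrite -(h3 k' hk' h); by exists a.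
have [h1 _] := hR k hk hDk; rewrite cut_supp //; apply (okP_supp _ _ h1 a ha).
Qed.

Lemma R_coh0 k a : J k -> D k -> Rk k a -> A0 (cut D0 a).
Proof. by move=> hk hDk ha; have [_ [<- _]] := hR k hk hDk; exists a. Qed.

(** [c] is lifted to every later stage separately, without coherence between the lifts; an
    ultrafilter limit of the lifts along the stages lies in the inverse limit. *)
Lemma lim_surj k c : J k -> D k -> Rk k c -> exists a, limS A0 Rk D a /\ cut (dn k) a = c.
Proof.
move=> hk hDk hc.
pose ix := {j : I | D j /\ le k j}.
have Jx : forall x : ix, J (proj1_sig x).
  by move=> [j [h1 h2]] /= hj; apply: hk; exact: (le_lt_tr lt HI) h2 hj.
have hb0 : forall x : ix, exists b : T, Rk (proj1_sig x) b /\ cut (dn k) b = c.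
  move=> x; have [h1 h2] := proj2_sig x.
  case: h2 => [h2|h2].
    have [_ [_ h3]] := hR _ (Jx x) h1; have : prs (dn k) (Rk (proj1_sig x)) c by rewrite h3.
    by move=> [a [ha ->]]; exists a.
  exists c; rewrite -h2; split => //; rewrite cut_supp //.
  by have [h3 _] := hR k hk hDk; apply (okP_supp _ _ h3 c hc).
have [b hb] := choice_fun _ hb0.
pose F (P : ix -> Prop) := exists j, D j /\ le k j /\ forall x : ix, le j (proj1_sig x) -> P x.
have hF : filt F.
  split; first by exists k; split => //; split => //; right.
  split.
    move=> P Q [j1 [a1 [a2 a3]]] [j2 [b1 [b2 b3]]].
    case: (classic (le j1 j2)) => h.
      by exists j2; do 2 split => //; move=> x hx; split; [apply: a3; exact: (le_tr lt HI) h hx | exact: b3].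
    have {}h : le j2 j1 by left; apply: NNPP => /(nlt lt HI).
    by exists j1; do 2 split => //; move=> x hx; split; [exact: a3 | apply: b3; exact: (le_tr lt HI) h hx].
  by move=> P Q h [j [a1 [a2 a3]]]; exists j; do 2 split => //; move=> x hx; apply: h; exact: a3.
have [U [hU hUF]] : exists U, ultra U /\ forall P, F P -> U P.
  apply: ultra_ex => // -[j [h1 [h2 h3]]]; exact: (h3 (exist _ j (conj h1 h2)) (or_intror eq_refl)).
have [hUf [hUp _]] := hU.
have okR : forall x : ix, okP (dn (proj1_sig x)) (Rk (proj1_sig x)) by move=> x; have [h _] := hR _ (Jx x) (proj1 (proj2_sig x)).
have cb : forall x, cube (b x) by move=> x; apply: (okP_cube _ _ (okR x)); apply (hb x).
have [a [ca ha]] := ulim_T U b hU cb.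
exists a; split.
  split.
    split => // i hi; apply: (tends_cst_lim U (fun x => b x i)) => //; apply: (filtT _ _ hUf) => x.
    apply (okP_supp _ _ (okR x) _ (proj1 (hb x))) => hix; apply: hi; apply: hD hix; apply (proj2_sig x).
  split.
    apply: (closed_lim U A0 (fun x => cut D0 (b x))) => //; [by apply hA0 | | exact: tends_cut].
    apply: (filtT _ _ hUf) => x; exact: R_coh0 (Jx x) (proj1 (proj2_sig x)) (proj1 (hb x)).
  move=> k2 hk2 hDk2; have [ok2 _] := hR k2 hk2 hDk2.
  apply: (closed_lim U (Rk k2) (fun x => cut (dn k2) (b x))) => //; [by apply ok2 | | exact: tends_cut].
  have [j [j1 [j2 j3]]] : exists j, D j /\ le k j /\ le k2 j.
    case: (o_tot lt HI k k2) => [h|[h|h]].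
        by exists k2; split => //; split; [left | right].
      by exists k2; split => //; split; right.
    by exists k; split => //; split; [right | left].
  apply: hUF; exists j; do 2 split => //; move=> x hx.
  apply: (R_coh (proj1_sig x)) => //; [apply (proj2_sig x) | exact: (le_tr lt HI) j3 hx | apply (hb x)].
apply: functional_extensionality => i.
apply: (tends_uniq U (fun x => cut (dn k) (b x) i)) => //; first exact: tends_cut.
apply: (tends_ext _ hUf (fun _ => c i)); first by move=> x; rewrite (proj2 (hb x)).
exact: tends_const.
Qed.

Lemma lim_surj0 c : A0 c -> exists a, limS A0 Rk D a /\ cut D0 a = c.
Proof.
move=> hc; case: (classic (exists k, J k /\ D k)) => [[k [hk hDk]]|h].
  have [_ [h2 _]] := hR k hk hDk; have : prs D0 (Rk k) c by rewrite h2.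
  move=> [b [hb ->]]; have [a [ha hab]] := lim_surj k b hk hDk hb; exists a; split => //.
  by rewrite -hab cut_cut // => i; exact: D0_dn.
have [cc oc] := okP_supp _ _ hA0 c hc.
exists c; split; last by rewrite cut_supp.
split; first by split => // i hi; apply: oc => h0; apply: hi; exact: hD0.
split; first by rewrite cut_supp.
by move=> k hk hDk; case: h; exists k.
Qed.

Lemma lim_prs k : J k -> D k -> prs (dn k) (limS A0 Rk D) = Rk k.
Proof.
move=> hk hDk; apply: set_ext => c; split; first by move=> [a [[_ [_ h]] ->]]; exact: h.
by move=> /(lim_surj k c hk hDk) [a [h1 h2]]; exists a.
Qed.

Lemma lim_prs0 : prs D0 (limS A0 Rk D) = A0.
Proof.
apply: set_ext => c; split; first by move=> [a [[_ [h _]] ->]].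
by move=> /lim_surj0 [a [h1 h2]]; exists a.
Qed.

Lemma closed_cut (B : S_) (E : I -> Prop) : closed B -> closed (fun a => B (cut E a)).
Proof.
move=> hB a ha; apply: hB => l d hd; have [b [hb h]] := ha l d hd; exists (cut E b); split => // i hi.
case: (classic (E i)) => hE; first by rewrite !cut_in //; exact: h.
by rewrite !cut_out // Rminus_diag Rabs_R0; lra.
Qed.

Lemma lim_ok : okP D (limS A0 Rk D).
Proof.
split.
  split; first by split => // i; rewrite /one; lra.
  by split; [rewrite cut_one; exact: (proj1 hA0) | move=> k hk hDk; rewrite cut_one; have [h _] := hR k hk hDk; exact: (proj1 h)].
split.
  move=> a b p q [[ca oa] [a1 a2]] [[cb ob] [b1 b2]] hp hq hpq; split.
    split.
      move=> i; have := ca i; have := cb i => h1 h2; have : 0 <= p * a i by apply: Rmult_le_pos; lra.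
      have : p * a i <= 1 by apply: mul_le_of_le => //; lra.
      have : q * b i <= 1 by apply: mul_le_of_le => //; lra.
      rewrite /comb; rmx.
    by move=> i hi; rewrite /comb oa // ob // !Rmult_1_r.
  split; first by rewrite cut_comb //; apply (proj1 (proj2 hA0)).
  by move=> k hk hDk; have [h _] := hR k hk hDk; rewrite cut_comb //; apply (proj1 (proj2 h)); auto.
split.
  move=> a ha; split.
    split; first by move=> i; apply: (cl_coord (limS A0 Rk D)) => // b [[hb _] _]; exact: hb.
    move=> i hi; have h1 : 1 <= a i <= 1 by apply: (cl_coord (limS A0 Rk D)) => // b [[_ hb] _]; rewrite hb //; lra.
    lra.
  split; first by apply: (closed_cut A0 D0); [apply hA0 | apply: cl_mono ha => b [_ [h _]]].
  move=> k hk hDk; have [h _] := hR k hk hDk.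
  by apply: (closed_cut (Rk k) (dn k)); [apply h | apply: cl_mono ha => b [_ [_ hb]]; exact: hb].
split; first by move=> a [].
have [_ [_ [_ [_ [l0 [l1 l2]]]]]] := hA0.
have key : forall i, exists c, 0 < c /\ forall a, limS A0 Rk D a -> c <= a i.
  move=> i; case: (classic (D i)) => hi; last by exists 1; split; [lra | move=> a [[_ h] _]; rewrite h //; lra].
  case: (classic (lt i i0)) => h0.
    by exists (l0 i); split => // a [_ [h _]]; have := l2 _ h i; rewrite cut_in.
  have [[_ [_ [_ [_ [l [h1 h2]]]]]] _] := hR i h0 hi.
  by exists (l i); split => // a [_ [_ h]]; have := h2 _ (h i h0 hi) i; rewrite cut_in //; right.
by have [l hl] := choice_fun _ key; exists l; split; [move=> i; apply hl | move=> a ha i; apply hl].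
Qed.

(** A closed set contains whatever it approximates on finite lists of coordinates, and each such
    list lies in one stage, where the projections agree. *)
Lemma lim_unique A : okP D A -> prs D0 A = A0 -> (forall k, J k -> D k -> prs (dn k) A = Rk k) -> limS A0 Rk D = A.
Proof.
move=> hA h0 hk; have [_ [_ [cA [sA _]]]] := hA; apply: set_ext => a; split; last first.
  move=> ha; split; first by apply sA.
  by split; [rewrite -h0; exists a | move=> k h1 h2; rewrite -hk //; exists a].
move=> [[ca oa] [a1 a2]]; apply: cA => l d hd.
have fin : forall (E : I -> Prop) b, A b -> cut E a = cut E b -> (forall i, In i l -> D i -> E i) -> exists b, A b /\ forall i, In i l -> Rabs (a i - b i) <= d.
  move=> E b hb hE hl; exists b; split => // i hi; case: (classic (D i)) => hDi; last first.
    by rewrite oa // (proj2 (sA b hb)) // Rminus_diag Rabs_R0; lra.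
  have := f_equal (fun f => f i) hE; have hEi := hl i hi hDi; rewrite !cut_in // => ->.
  by rewrite Rminus_diag Rabs_R0; lra.
case: (lim_cap l) => [h|[k [h1 [h2 h3]]]].
  by rewrite -h0 in a1; have [b [hb hE]] := a1; exact: (fin D0 b).
by have := a2 k h1 h2; rewrite -hk // => -[b [hb hE]]; exact: (fin (dn k) b).
Qed.
End Lim.

Lemma lim_near (D : I -> Prop) A0 Rk A0' Rk' l ep :
  (forall i j, D j -> le i j -> D i) -> (forall i, lt i i0 -> D i) -> okP D0 A0 -> okP D0 A0' -> coh A0 Rk D -> coh A0' Rk' D -> 0 <= ep ->
  ((forall i, In i l -> D i -> lt i i0) /\ hl (ind l) ep A0 A0') \/
  (exists k, J k /\ D k /\ (forall i, In i l -> D i -> le i k) /\ hl (ind l) ep (Rk k) (Rk' k)) ->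
  hl (ind l) ep (limS A0 Rk D) (limS A0' Rk' D).
Proof.
move=> hD hD0 h1 h2 h3 h4 hep hn.
have fin : forall (E : I -> Prop) (a a' c : T), (forall i, In i l -> D i -> E i) -> (forall i, ind l i * Rabs (cut E a i - c i) <= ep) ->
   cut E a' = c -> (forall i, ~ D i -> a i = 1) -> (forall i, ~ D i -> a' i = 1) -> forall i, ind l i * Rabs (a i - a' i) <= ep.
  move=> E a a' c hE hc hac o o'; apply: ind_le => // i hi.
  case: (classic (D i)) => hDi; last by rewrite o // o' // Rminus_diag Rabs_R0.
  by have := ind_ge _ _ _ _ hc i hi; rewrite -hac !cut_in //; exact: hE.
move=> a [[ca oa] [a1 a2]]; case: hn => [[hl0 hn]|[k [k1 [k2 [hl0 hn]]]]].
  have [c [hc hca]] := hn _ a1; have [a' [ha' hac]] := lim_surj0 D hD hD0 A0' Rk' h2 h4 c hc.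
  by exists a'; split => //; apply: (fin D0 a a' c) => //; apply (proj1 ha').
have [c [hc hca]] := hn _ (a2 k k1 k2); have [a' [ha' hac]] := lim_surj D hD A0' Rk' h2 h4 k c k1 k2 hc.
by exists a'; split => //; apply: (fin (dn k) a a' c) => //; apply (proj1 ha').
Qed.

Lemma lim_htends {N : Type} (F : (N -> Prop) -> Prop) (D : I -> Prop) (A0s : N -> S_) A0 (Rs : N -> I -> S_) Rk : filt F ->
  (forall i j, D j -> le i j -> D i) -> (forall i, lt i i0 -> D i) -> (forall m, okP D0 (A0s m)) -> okP D0 A0 ->
  (forall m, coh (A0s m) (Rs m) D) -> coh A0 Rk D -> htends F A0s A0 ->
  (forall k, J k -> D k -> htends F (fun m => Rs m k) (Rk k)) -> htends F (fun m => limS (A0s m) (Rs m) D) (limS A0 Rk D).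
Proof.
move=> hF hD hD0 h1 h2 h3 h4 h5 h6 l ep hep.
case: (lim_cap D l) => [h|[k [k1 [k2 k3]]]].
  apply: (filt1 _ hF (h5 l ep hep)) => m [n1 n2].
  by split; apply: lim_near => //; try lra; left.
apply: (filt1 _ hF (h6 k k1 k2 l ep hep)) => m [n1 n2].
by split; apply: lim_near => //; try lra; right; exists k.
Qed.

Definition PR := ((T -> Prop) * (nat -> R))%type.

Section Rec.
Context (f g : I -> PR -> PR).
Context (hf : forall j, cont (prodS (Psp (dn j)) Rw) (prodS (Psp (ds j)) Rw) (f j))
  (hg : forall j, cont (prodS (Psp (ds j)) Rw) (prodS (Psp (dn j)) Rw) (g j))
  (gf : forall j z, okP (dn j) (fst z) -> g j (f j z) = z)
  (fg : forall j z, okP (ds j) (fst z) -> f j (g j z) = z)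
  (pf_ : forall j z, okP (dn j) (fst z) -> fst (f j z) = prs (ds j) (fst z)).

(** [A0] is a mere default for indices not below [j]; [limS] reads only the stages below [j]. *)
Definition step (A0 : S_) (t : I -> nat -> R) (j : I) (rec : forall k, lt k j -> PR) : PR :=
  g j (limS A0 (fun k => match excluded_middle_informative (lt k j) with left h => fst (rec k h) | right _ => A0 end) (ds j), t j).

Definition rv (A0 : S_) (t : I -> nat -> R) : I -> PR := Fix (o_wf lt HI) (fun _ => PR) (step A0 t).

Lemma rv_eq A0 t j : rv A0 t j = g j (limS A0 (fun k => fst (rv A0 t k)) (ds j), t j).
Proof.
rewrite {1}/rv Fix_eq; last first.
  move=> x u v huv; congr (step A0 t x); apply: functional_extensionality_dep => y; apply: functional_extensionality_dep => p; exact: huv.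
rewrite /step; congr (g j (_, _)); apply: limS_ext => k _ hk.
by case: excluded_middle_informative.
Qed.

Lemma ds_down j i k : lt k j -> le i k -> lt i j.
Proof. by move=> h1 h2; exact: (le_lt_tr lt HI) h2 h1. Qed.

Lemma D0_ds j i : J j -> lt i i0 -> lt i j.
Proof. by move=> /(nlt lt HI) hj hi; exact: (lt_le_tr lt HI) hi hj. Qed.

(** By [pf_] and [fg] the set produced at stage [j] projects onto the inverse limit of the earlier
    ones, and that limit projects onto each of them. *)
Lemma rv_coh A0 t : okP D0 A0 -> coh A0 (fun k => fst (rv A0 t k)) (fun _ => True).
Proof.
move=> hA0 j; elim/(well_founded_ind (o_wf lt HI)): j => j ih hj _.
have hc : coh A0 (fun k => fst (rv A0 t k)) (ds j) by move=> k hk hkj; apply: ih.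
have hL := lim_ok (ds j) A0 _ hA0 hc.
set Lj := limS _ _ _ in hL.
have e1 : rv A0 t j = g j (Lj, t j) by rewrite rv_eq.
have hok : okP (dn j) (fst (rv A0 t j)) by rewrite e1; apply (proj1 (hg j) (Lj, t j)); split.
have hp : prs (ds j) (fst (rv A0 t j)) = Lj by rewrite -pf_ // e1 fg.
split => //; split.
  rewrite -[RHS](lim_prs0 (ds j) (fun i k => ds_down j i k) (fun i => D0_ds j i hj) A0 _ hA0 hc) -/Lj -hp prs_prs //.
  by move=> i; exact: D0_ds.
move=> k hk hkj; rewrite -[RHS](lim_prs (ds j) (fun i k => ds_down j i k) A0 _ hA0 hc k hk hkj) -/Lj -hp prs_prs //.
by move=> i hi; exact: ds_down hkj hi.
Qed.

Lemma coh_sub A0 Rk (D : I -> Prop) : coh A0 Rk (fun _ => True) -> coh A0 Rk D.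
Proof. by move=> h k hk _; apply: h. Qed.

Lemma rvL_ok A0 t j : okP D0 A0 -> okP (ds j) (limS A0 (fun k => fst (rv A0 t k)) (ds j)).
Proof. by move=> hA0; apply: lim_ok => //; exact: coh_sub (rv_coh A0 t hA0). Qed.

Lemma rv_cv {N : Type} (F : (N -> Prop) -> Prop) A0s A0 ts t : filt F -> (forall m : N, okP D0 (A0s m)) -> okP D0 A0 ->
  htends F A0s A0 -> (forall j n, tends F (fun m => ts m j n) (t j n)) ->
  forall j, J j -> htends F (fun m => fst (rv (A0s m) (ts m) j)) (fst (rv A0 t j)) /\
    forall n, tends F (fun m => snd (rv (A0s m) (ts m) j) n) (snd (rv A0 t j) n).
Proof.
move=> hF h1 h2 h3 h4 j; elim/(well_founded_ind (o_wf lt HI)): j => j ih hj.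
have hL : htends F (fun m => limS (A0s m) (fun k => fst (rv (A0s m) (ts m) k)) (ds j)) (limS A0 (fun k => fst (rv A0 t k)) (ds j)).
  apply: lim_htends => //; try exact: ds_down; try (by move=> i; exact: D0_ds).
  { by move=> m; apply: coh_sub; exact: rv_coh. }
  { by apply: coh_sub; exact: rv_coh. }
  by move=> k hk hkj; apply ih.
have := proj2 (hg j) N F (fun m => (limS (A0s m) (fun k => fst (rv (A0s m) (ts m) k)) (ds j), ts m j)) (limS A0 (fun k => fst (rv A0 t k)) (ds j), t j) hF.
move=> /(_ (fun m => conj (rvL_ok _ _ j (h1 m)) (fun _ => Logic.I)) (conj (rvL_ok _ _ j h2) (fun _ => Logic.I)) (conj hL (h4 j))) [c1 c2].
by split => [l ep hep|n ep hep]; [apply: (filt1 _ hF (c1 l ep hep)) | apply: (filt1 _ hF (c2 n ep hep))] => m; rewrite -!rv_eq.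
Qed.

Lemma rv_fw A v t : okP (fun _ => True) A -> (forall j, J j -> t j = snd (f j (prs (dn j) A, v j))) ->
  forall j, J j -> rv (prs D0 A) t j = (prs (dn j) A, v j).
Proof.
move=> hA ht j; elim/(well_founded_ind (o_wf lt HI)): j => j ih hj.
have hj' := okP_prs _ (dn j) A hA.
rewrite rv_eq ht //; have -> : limS (prs D0 A) (fun k => fst (rv (prs D0 A) t k)) (ds j) = prs (ds j) (prs (dn j) A).
  rewrite prs_prs; last by move=> i hi; left.
  apply: lim_unique.
  { exact: okP_prs hA. }
  { by rewrite prs_prs // => i; exact: D0_ds. }
  by move=> k hk hkj; rewrite ih // prs_prs // => i hi; exact: ds_down hkj hi.
have e : f j (prs (dn j) A, v j) = (prs (ds j) (prs (dn j) A), snd (f j (prs (dn j) A, v j))).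
  by rewrite -(pf_ j (prs (dn j) A, v j)) // -surjective_pairing.
by rewrite -e gf.
Qed.

Definition zr (u : I -> nat -> R) : I -> nat -> R := fun j => if excluded_middle_informative (lt j i0) then fun _ => 0 else u j.

Lemma zr_in u j : J j -> zr u j = u j.
Proof. by move=> hj; rewrite /zr; case: excluded_middle_informative. Qed.

Lemma zr_out u j : lt j i0 -> zr u j = fun _ => 0.
Proof. by move=> hj; rewrite /zr; case: excluded_middle_informative. Qed.

Lemma zr_id u : (forall j, lt j i0 -> u j = fun _ => 0) -> zr u = u.
Proof. by move=> h; apply: functional_extensionality => j; rewrite /zr; case: excluded_middle_informative => // hj; rewrite h. Qed.

Lemma zr_ext u u' : (forall j, J j -> u j = u' j) -> zr u = zr u'.
Proof. by move=> h; apply: functional_extensionality => j; rewrite /zr; case: excluded_middle_informative => // hj; rewrite h. Qed.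

Lemma zr_cv {N : Type} (F : (N -> Prop) -> Prop) us u : filt F -> (forall j, J j -> forall n, tends F (fun m => us m j n) (u j n)) ->
  forall j n, tends F (fun m => zr (us m) j n) (zr u j n).
Proof.
move=> hF h j n; case: (classic (lt j i0)) => hj; last first.
  by rewrite zr_in //; apply: (tends_ext _ hF _ _ _ _ (h j hj n)) => m; rewrite zr_in.
by rewrite zr_out //; apply: (tends_ext _ hF (fun _ => 0)); [move=> m; rewrite zr_out | exact: tends_const].
Qed.

(** A product of copies of R^omega over the indices from [i0] on, coded by families over all of [I]
    that vanish below [i0]. *)
Definition VJ : space := subS (funS I Rw) (fun v => forall i, lt i i0 -> v i = fun _ => 0).
Notation all := (fun _ : I => True).

(** Stage [j] only sees the projection of [A] to the coordinates up to [j], so no recursion occurs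
    in this direction; it is confined to [Tg]. *)
Definition Tf (z : prodS (Psp all) VJ) : prodS (Psp D0) VJ :=
  (prs D0 (fst z), zr (fun j => snd (f j (prs (dn j) (fst z), snd z j)))).
Definition Tg (z : prodS (Psp D0) VJ) : prodS (Psp all) VJ :=
  (limS (fst z) (fun k => fst (rv (fst z) (snd z) k)) all, zr (fun j => snd (rv (fst z) (snd z) j))).

Lemma cont_Tf : cont (prodS (Psp all) VJ) (prodS (Psp D0) VJ) Tf.
Proof.
split.
  move=> [A v] [hA hv]; split; first exact: okP_prs hA.
  by split; [move=> i n | move=> i hi; rewrite /= zr_out].
move=> N F zs z hF h1 h2 [c1 c2]; split => /=; first exact: htends_prs.
apply: zr_cv => // j hj n.
have := proj2 (hf j) N F (fun m => (prs (dn j) (fst (zs m)), snd (zs m) j)) (prs (dn j) (fst z), snd z j) hF.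
move=> /(_ (fun m => conj (okP_prs _ _ _ (proj1 (h1 m))) (fun _ => Logic.I)) (conj (okP_prs _ _ _ (proj1 h2)) (fun _ => Logic.I)) (conj (htends_prs _ _ _ _ hF c1) (c2 j))) [_ c].
exact: (c n).
Qed.

Lemma cont_Tg : cont (prodS (Psp D0) VJ) (prodS (Psp all) VJ) Tg.
Proof.
split.
  move=> [A0 t] [hA ht]; split.
    by apply: lim_ok => //; exact: rv_coh.
  by split; [move=> i n | move=> i hi; rewrite /= zr_out].
move=> N F zs z hF h1 h2 [c1 c2].
have key := rv_cv F (fun m => fst (zs m)) (fst z) (fun m => snd (zs m)) (snd z) hF (fun m => proj1 (h1 m)) (proj1 h2) c1 c2.
split => /=; last by apply: zr_cv => // j hj n; apply (key j hj).
apply: lim_htends => //; [by move=> m; exact: (proj1 (h1 m)) | exact: (proj1 h2) | | |].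
{ by move=> m; apply: rv_coh; exact: (proj1 (h1 m)). }
{ by apply: rv_coh; exact: (proj1 h2). }
by move=> k hk _; apply (key k hk).
Qed.

Lemma hov_transfinite_fg : hov (prodS (Psp all) VJ) (prodS (Psp D0) VJ) (fun z => prs D0 (fst z)) (fun z => fst z).
Proof.
exists Tf, Tg; split; first exact: cont_Tf.
split; first exact: cont_Tg.
split; last split => //.
  move=> [A v] [hA [_ hv]]; rewrite /Tg /Tf; cbn [fst snd].
  set t := zr _; have ht : forall j, J j -> t j = snd (f j (prs (dn j) A, v j)) by move=> j hj; rewrite /t zr_in.
  have key := rv_fw A v t hA ht.
  congr pair.
    apply: lim_unique => //.
    by move=> k hk _; rewrite key.
  rewrite -[RHS]zr_id //; apply: zr_ext => j hj; by rewrite key.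
move=> [A0 t] [hA [_ ht]]; rewrite /Tg /Tf; cbn [fst snd] in hA, ht |- *.
have hc := rv_coh A0 t hA.
congr pair; first by apply: lim_prs0.
rewrite -[RHS](zr_id t) //; apply: zr_ext => j hj.
rewrite zr_in // (lim_prs all (fun _ _ _ _ => Logic.I) A0 _ hA hc j hj Logic.I) -surjective_pairing rv_eq fg //.
exact: rvL_ok.
Qed.
End Rec.

Lemma hov_transfinite : hov (prodS (Psp (fun _ => True)) VJ) (prodS (Psp D0) VJ) (fun z => prs D0 (fst z)) (fun z => fst z).
Proof.
pose good j (fg : (PR -> PR) * (PR -> PR)) : Prop :=
    cont (prodS (Psp (dn j)) Rw) (prodS (Psp (ds j)) Rw) (fst fg) /\ (cont (prodS (Psp (ds j)) Rw) (prodS (Psp (dn j)) Rw) (snd fg) /\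
    ((forall z, ok (prodS (Psp (dn j)) Rw) z -> snd fg (fst fg z) = z) /\ ((forall z, ok (prodS (Psp (ds j)) Rw) z -> fst fg (snd fg z) = z) /\
    (forall z, ok (prodS (Psp (dn j)) Rw) z -> fst (fst fg z) = prs (ds j) (fst z))))).
have hE : forall j, exists fg, good j fg.
  move=> j; have [nu hnu] := nu_le_ex lt HI j.
  have [f [g h]] := hov_factor_P (dn j) (ds j) (fun i => i = j) nu (fun i => conj (fun h => h) (fun h => h))
    (fun i h e => o_irr lt HI j (eq_ind i (fun i => lt i j) h j e)) hnu.
  by exists (f, g).
have [fg hfg] := choice_fun _ hE.
apply: (hov_transfinite_fg (fun j => fst (fg j)) (fun j => snd (fg j))).
- by move=> j; apply (hfg j).
- by move=> j; apply (hfg j).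
- by move=> j z hz; have [_ [_ [h _]]] := hfg j; apply: h.
- by move=> j z hz; have [_ [_ [_ [h _]]]] := hfg j; apply: h.
- by move=> j z hz; have [_ [_ [_ [_ h]]]] := hfg j; apply: h.
Qed.
End Transfinite.

(** * Assembly of the factors *)

Lemma hov_prod_r {B} (S X X' : space) (p : X -> B) (p' : X' -> B) : hov X X' p p' ->
  hov (prodS S X) (prodS S X') (fun z => (fst z, p (snd z))) (fun z => (fst z, p' (snd z))).
Proof.
move=> [f [g [hf [hg [h1 [h2 h3]]]]]].
exists (fun z => (fst z, f (snd z))), (fun z => (fst z, g (snd z))).
split; first by apply: (cont_prod S X S X' (fun s => s) f) => //; exact: cont_id.
split; first by apply: (cont_prod S X' S X (fun s => s) g) => //; exact: cont_id.
split; first by move=> [s x] [/= hs hx]; rewrite h1.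
split; first by move=> [s x] [/= hs hx]; rewrite h2.
by move=> [s x] [/= hs hx]; rewrite h3.
Qed.

(** The reason for keeping homeomorphisms over a base: that [x + ln A] lies in [M] depends on [A]
    only through its projection below [i0], so the condition survives the transfinite
    factorization. *)
Lemma hov_sub {B} (X X' : space) (p : X -> B) (p' : X' -> B) (P : B -> Prop) : hov X X' p p' ->
  hov (subS X (fun x => P (p x))) (subS X' (fun x => P (p' x))) p p'.
Proof.
move=> [f [g [[f1 f2] [[g1 g2] [h1 [h2 h3]]]]]]; exists f, g.
split.
  split; first by move=> x [hx hp]; split; [exact: f1 | rewrite h3].
  by move=> N F xs x hF a1 [a2 _] a3; apply: f2 => // m; apply a1.
split.
  split; first by move=> x [hx hp]; split; [exact: g1 | rewrite -h3 ?h2 //; exact: g1].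
  by move=> N F xs x hF a1 [a2 _] a3; apply: g2 => // m; apply a1.
split; first by move=> x [hx _]; exact: h1.
by split; move=> x [hx _]; [exact: h2 | exact: h3].
Qed.

Section Chain.
Context {I : Type} (lt : I -> I -> Prop) (HI : is_omega1 I lt) (i0 : I) (M : (I -> R) -> Prop)
  (hMo : product_top I M) (hMC : forall x y, (forall i, lt i i0 -> x i = y i) -> M x -> M y)
  (bo : I -> option I * nat) (bf : option I * nat -> I)
  (hb1 : forall i, ~ lt i i0 -> bf (bo i) = i /\ forall j, fst (bo i) = Some j -> ~ lt j i0)
  (hb2 : forall o n, (forall j, o = Some j -> ~ lt j i0) -> ~ lt (bf (o, n)) i0 /\ bo (bf (o, n)) = (o, n)).
Notation T := (I -> R).
Notation D0 := (fun i => lt i i0).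
Notation allI := (fun _ : I => True).
Notation VJ := (VJ lt i0).
Notation zr := (zr lt i0).

Definition c0 (x : T) : T := fun i => if excluded_middle_informative (lt i i0) then x i else 0.
Definition z0 (x : T) : Prop := forall i, ~ lt i i0 -> x i = 0.
Definition bN (x : T) : nat -> R := fun n => x (bf (None, n)).
Definition bJ (x : T) : I -> nat -> R := zr (fun j n => x (bf (Some j, n))).
Definition mrg (x : T) (vN : nat -> R) (vJ : I -> nat -> R) : T := fun i =>
  if excluded_middle_informative (lt i i0) then x i
  else match fst (bo i) with None => vN (snd (bo i)) | Some j => vJ j (snd (bo i)) end.

Lemma mrg_split x : mrg (c0 x) (bN x) (bJ x) = x.
Proof.
apply: functional_extensionality => i; rewrite /mrg /c0; case: excluded_middle_informative => hi //.
have [h1 h2] := hb1 i hi; move: h1 h2; case: (bo i) => [[j|] n] /= h1 h2; last by rewrite /bN h1.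
by rewrite /bJ zr_in ?h1 //; exact: h2.
Qed.

Lemma c0_mrg x vN vJ : z0 x -> c0 (mrg x vN vJ) = x.
Proof.
move=> h; apply: functional_extensionality => i; rewrite /c0 /mrg; case: excluded_middle_informative => hi //.
by rewrite h.
Qed.

Lemma z0_c0 x : z0 (c0 x).
Proof. by move=> i hi; rewrite /c0; case: excluded_middle_informative. Qed.

Lemma bN_mrg x vN vJ : bN (mrg x vN vJ) = vN.
Proof.
apply: functional_extensionality => n; have [h1 h2] := hb2 None n ltac:(by []).
by rewrite /bN /mrg h2; case: excluded_middle_informative.
Qed.

Lemma bJ_mrg x vN vJ : ok VJ vJ -> bJ (mrg x vN vJ) = vJ.
Proof.
move=> [_ hv]; rewrite -[RHS](zr_id lt i0 vJ hv); apply: zr_ext => j hj; apply: functional_extensionality => n.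
have [h1 h2] := hb2 (Some j) n ltac:(by move=> j' [<-]).
by rewrite /mrg h2; case: excluded_middle_informative.
Qed.

Section Cv.
Context {N : Type} (F : (N -> Prop) -> Prop) (hF : filt F).

Lemma cv_if (P : Prop) (d : {P} + {~ P}) (f g : N -> R) a b : (P -> tends F f a) -> (~ P -> tends F g b) ->
  tends F (fun m => if d then f m else g m) (if d then a else b).
Proof. by case: d => h h1 h2; [exact: h1 | exact: h2]. Qed.

Lemma c0_cv (xs : N -> T) x : (forall i, tends F (fun m => xs m i) (x i)) -> forall i, tends F (fun m => c0 (xs m) i) (c0 x i).
Proof. by move=> h i; apply: cv_if => _ //; exact: tends_const. Qed.

Lemma bJ_cv (xs : N -> T) x : (forall i, tends F (fun m => xs m i) (x i)) -> forall j n, tends F (fun m => bJ (xs m) j n) (bJ x j n).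
Proof. by move=> h; apply: zr_cv. Qed.

Lemma mrg_cv (xs : N -> T) x (vNs : N -> nat -> R) vN (vJs : N -> I -> nat -> R) vJ : (forall i, tends F (fun m => xs m i) (x i)) ->
  (forall n, tends F (fun m => vNs m n) (vN n)) -> (forall j n, tends F (fun m => vJs m j n) (vJ j n)) ->
  forall i, tends F (fun m => mrg (xs m) (vNs m) (vJs m) i) (mrg x vN vJ i).
Proof. by move=> h1 h2 h3 i; apply: cv_if => _ //; case: (fst (bo i)). Qed.
End Cv.

Definition cnd (x : T) (A : T -> Prop) : Prop := forall a, A a -> M (shf x a).

Lemma cnd_prs x y A : (forall i, lt i i0 -> x i = y i) -> cnd x A <-> cnd y (prs D0 A).
Proof.
move=> h; split.
  move=> hx _ [a [ha ->]]; apply: hMC (hx a ha) => i hi.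
  by rewrite /shf (h i hi) cut_in.
move=> hy a ha; apply: hMC (hy _ (ex_intro _ a (conj ha eq_refl))) => i hi.
by rewrite /shf (h i hi) cut_in.
Qed.

Definition XA : space := subS (prodS Tsp (Psp allI)) (fun z => cnd (fst z) (snd z)).

(** The coordinates of [x] below [i0] are kept, extended by 0. The block [None] is the R^omega
    consumed by [hov_factor_U], the other blocks are consumed by [hov_transfinite], and [iso_S4_Msp]
    puts all of them back into one point. *)
Definition S1 : space := subS (prodS (prodS Tsp Rw) (prodS (Psp allI) VJ))
  (fun z => z0 (fst (fst z)) /\ cnd (fst (fst z)) (prs D0 (fst (snd z)))).
Definition S2 : space := subS (prodS (prodS Tsp Rw) (prodS (Psp D0) VJ))
  (fun z => z0 (fst (fst z)) /\ cnd (fst (fst z)) (fst (snd z))).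
Definition S3 : space := prodS (subS (prodS (Usp D0 M) Rw) (fun z => z0 (fst (fst z)))) VJ.
Definition S4 : space := prodS (subS (prodS (Msp M) Rw) (fun z => z0 (fst z))) VJ.

Lemma bJ_ok x : ok VJ (bJ x).
Proof. by split => // i hi; exact: zr_out. Qed.

Lemma iso_XA_S1 : iso XA S1.
Proof.
exists (fun z => ((c0 (fst z), bN (fst z)), (snd z, bJ (fst z)))), (fun z => (mrg (fst (fst z)) (snd (fst z)) (snd (snd z)), fst (snd z))).
have c0E : forall (x : T) i, lt i i0 -> x i = c0 x i by move=> x i hi; rewrite /c0; case: excluded_middle_informative.
split.
  split.
    move=> [x A] [[_ hA] hc]; split; first by split; [split | split => //; exact: bJ_ok].
    by split; [exact: z0_c0 | apply/(cnd_prs x) => // i; exact: c0E].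
  move=> N F zs z hF _ _ [h1 h2]; split; split => //; [exact: c0_cv | by move=> n; exact: h1 | exact: bJ_cv].
split.
  split.
    move=> [[x vN] [A vJ]] [[_ [hA hv]] [hz hc]]; split; first by split.
    apply/(cnd_prs _ x A) => //= i hi; rewrite /mrg; by case: excluded_middle_informative.
  by move=> N F zs z hF _ _ [[h1 h2] [h3 h4]]; split => //; exact: mrg_cv.
split; first by move=> [x A] _ /=; rewrite mrg_split.
split => //; move=> [[x vN] [A vJ]] [[_ [hA hv]] [hz hc]] /=; by rewrite c0_mrg // bN_mrg bJ_mrg.
Qed.

Lemma iso_S1_S2 : iso S1 S2.
Proof.
have h := hov_prod_r (prodS (@Tsp I) Rw) _ _ _ _ (hov_transfinite lt HI i0).
have {}h := hov_sub _ _ _ _ (fun z : (T * (nat -> R)) * (T -> Prop) => z0 (fst (fst z)) /\ cnd (fst (fst z)) (snd z)) h.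
exact: (hov_base _ _ _ _ (fun _ => tt) h).
Qed.

Lemma iso_S2_S3 : iso S2 S3.
Proof.
exists (fun z => (((fst (fst z), fst (snd z)), snd (fst z)), snd (snd z))), (fun z => ((fst (fst (fst z)), snd (fst z)), (snd (fst (fst z)), snd z))).
split.
  split; last by move=> N F zs z hF _ _ [[h1 h2] [h3 h4]].
  move=> [[x vN] [A vJ]] [[_ [hA hv]] [hz hc]]; split => //; split => //; split => //.
  split => //; split => //; split => //.
  (* [x] itself lies in [M] because [one] belongs to [A]. *)
  apply: (hMC _ _ _ (hc one (proj1 hA))) => i _; by rewrite /shf /one /= ln_1 Rplus_0_r.
split.
  split; last by move=> N F zs z hF _ _ [[[h1 h2] h3] h4].
  by move=> [[[x A] vN] vJ] [[[[[_ hA] hc] _] hz] hv].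
by split; [move=> [[x vN] [A vJ]] | split => // -[[[x A] vN] vJ]].
Qed.

Lemma iso_S3_S4 : iso S3 S4.
Proof.
have [nu hnu] := nu_ex lt HI i0; have [w [L [hw [hL hwn]]]] := weight_ex D0 nu hnu.
have h := hov_factor_U D0 nu w L hw hnu hL hwn M hMo hMC.
have {}h := hov_sub _ _ _ _ z0 h.
exact: (hov_prod _ _ VJ VJ (fun _ => tt) (fun _ => tt) (hov_base _ _ _ _ (fun _ => tt) h) (hov_refl VJ _)).
Qed.

Lemma iso_S4_Msp : iso S4 (Msp M).
Proof.
exists (fun z => mrg (fst (fst z)) (snd (fst z)) (snd z)), (fun x => ((c0 x, bN x), bJ x)).
split.
  split; last by move=> N F zs z hF _ _ [[h1 h2] h3]; exact: mrg_cv.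
  move=> [[x vN] vJ] [[[[_ hx] _] hz] hv]; split => //; apply: hMC hx => i hi /=; rewrite /mrg; by case: excluded_middle_informative.
split.
  split.
    move=> x [_ hx]; split; last exact: bJ_ok.
    split; last exact: z0_c0.
    by split => //; split => //; apply: hMC hx => i hi /=; rewrite /c0; case: excluded_middle_informative.
  move=> N F xs x hF _ _ h; split; last exact: bJ_cv.
  by split; [exact: c0_cv | move=> n; exact: h].
split; last by split => // x _ /=; rewrite mrg_split.
by move=> [[x vN] vJ] [[_ hz] hv] /=; rewrite c0_mrg // bN_mrg bJ_mrg.
Qed.

Lemma iso_XA_Msp : iso XA (Msp M).
Proof.
apply: hov_trans iso_XA_S1 _; apply: hov_trans iso_S1_S2 _; apply: hov_trans iso_S2_S3 _.
apply: hov_trans iso_S3_S4 _; exact: iso_S4_Msp.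
Qed.
End Chain.

(** * Compact max-plus convex sets in exponential coordinates *)

Section Plumb.
Context {I : Type}.
Notation T := (I -> R).
Notation ptop := (product_top I).
Notation allI := (fun _ : I => True).

Definition box (l : list I) (e : R) (k y : T) : Prop := forall i, In i l -> Rabs (y i - k i) < e.

Lemma min_list {A : Type} (l : list A) (P : A -> R -> Prop) :
  (forall a, In a l -> exists e, 0 < e /\ forall e', 0 < e' <= e -> P a e') -> exists e, 0 < e /\ forall a, In a l -> P a e.
Proof.
move=> h; suff [e [h1 h2]] : exists e, 0 < e /\ forall a, In a l -> forall e', 0 < e' <= e -> P a e'.
  by exists e; split => // a ha; apply: h2 => //; lra.
elim: l h => [|b l ih] h; first by exists 1; split; [lra |].
have [e [h1 h2]] := ih (fun a ha => h a (or_intror ha)); have [e' [h3 h4]] := h b (or_introl eq_refl).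
exists (Rmin e e'); split; first by rmx.
move=> a [<-|ha] d hd; [apply: h4 | apply: h2] => //; split; try lra.
  by apply: Rle_trans (proj2 hd) (Rmin_r _ _).
by apply: Rle_trans (proj2 hd) (Rmin_l _ _).
Qed.

Lemma open_box l e k : ptop (box l e k).
Proof.
move=> x hx.
have [d [hd h]] : exists d, 0 < d /\ forall i, In i l -> d <= e - Rabs (x i - k i).
  apply: min_list => i hi; exists (e - Rabs (x i - k i)); split; [have := hx i hi; lra | move=> d [_ h]; exact: h].
exists l, d; split => // y hy i hi; have := hy i hi; have := h i hi.
have -> : y i - k i = (y i - x i) + (x i - k i) by ring.
by have := Rabs_triang (y i - x i) (x i - k i); lra.
Qed.

Section Compact.
Context (K : T -> Prop) (hK : compact_set ptop K).

Lemma compact_bound i : exists b, forall k, K k -> Rabs (k i) <= b.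
Proof.
have [n|k hk|l hl] := hK nat (fun n k => Rabs (k i) < INR n).
{ move=> x hx; exists (i :: nil), (INR n - Rabs (x i)); split; first lra.
  move=> y /(_ i (or_introl eq_refl)) h; have -> : y i = (y i - x i) + x i by ring.
  by apply: Rle_lt_trans (Rabs_triang _ _) _; lra. }
{ by have [n hn] := INR_unbounded (Rabs (k i)); exists n. }
exists (lmx INR l) => k /hl [n [hn h]]; have := lmx_ub INR l n hn; lra.
Qed.

Lemma compact_closed : closed K.
Proof.
move=> z hz; apply: NNPP => hzK.
have [[i n]|k hk|l hl] := hK (I * nat)%type (fun p k => / (INR (snd p) + 1) < Rabs (k (fst p) - z (fst p))).
{ move=> x /= hx; exists (i :: nil), (Rabs (x i - z i) - / (INR n + 1)); split; first lra.
  move=> y /(_ i (or_introl eq_refl)) h; have := Rabs_triang (x i - y i) (y i - z i).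
  have -> : x i - y i + (y i - z i) = x i - z i by ring.
  by rewrite (Rabs_minus_sym (x i) (y i)); lra. }
{ have [i hi] : exists i, k i <> z i.
    apply: NNPP => h; apply: hzK; have -> // : z = k.
    by apply: functional_extensionality => i; apply: NNPP => hi; apply: h; exists i => h'; apply: hi.
  have hp : 0 < Rabs (k i - z i) by apply: Rabs_pos_lt; lra.
  have [n hn] := INR_unbounded (/ Rabs (k i - z i)); have hn0 := pos_INR n.
  exists (i, n) => /=; rewrite -[X in _ < X]Rinv_inv; apply: Rinv_lt_contravar; last lra.
  by apply: Rmult_lt_0_compat; [apply: Rinv_0_lt_compat | lra]. }
have [e [he h]] : exists e, 0 < e /\ forall p, In p l -> e <= / (INR (snd p) + 1).
  apply: min_list => p hp; exists (/ (INR (snd p) + 1)); split; last by move=> d [].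
  by apply: Rinv_0_lt_compat; have := pos_INR (snd p); lra.
have [k [hk hk2]] := hz (map fst l) e he; have [p [hp1 hp2]] := hl k hk.
have := hk2 (fst p) (in_map fst l p hp1); have := h p hp1; rewrite Rabs_minus_sym; lra.
Qed.

Lemma compact_net l e : 0 < e -> exists ks : list T, (forall k, In k ks -> K k) /\
  forall k, K k -> exists k', In k' ks /\ box l e k' k.
Proof.
move=> he; have [j|k hk|ks hks] := hK {k : T | K k} (fun p => box l e (proj1_sig p)).
{ exact: open_box. }
{ by exists (exist _ k hk) => i _ /=; rewrite Rminus_diag Rabs_R0. }
exists (map (fun p => proj1_sig p) ks); split.
  by move=> k /in_map_iff [p [<- _]]; exact: proj2_sig.
move=> k /hks [p [h1 h2]]; exists (proj1_sig p); split => //; exact: (in_map (fun p => proj1_sig p)).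
Qed.

(** A Lebesgue number: boxes of half size cover [K], and the other half absorbs the displacement of
    [y]. *)
Lemma compact_lebesgue U : ptop U -> (forall k, K k -> U k) ->
  exists l e, 0 < e /\ forall k y, K k -> (forall i, In i l -> Rabs (y i - k i) <= e) -> U y.
Proof.
move=> hU hKU.
have hk : forall p : {k : T | K k}, exists le : list I * R, 0 < snd le /\ forall y, box (fst le) (snd le) (proj1_sig p) y -> U y.
  by move=> [k hk]; have [l [e [he h]]] := hU k (hKU k hk); exists (l, e).
have [g hg] := choice_fun _ hk.
have [j|k hKk|ks hks] := hK {k : T | K k} (fun p => box (fst (g p)) (snd (g p) / 2) (proj1_sig p)).
{ exact: open_box. }
{ by exists (exist _ k hKk) => i _; rewrite Rminus_diag Rabs_R0; apply: Rdiv_lt_0_compat; [exact: (proj1 (hg _)) | lra]. }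
have [e [he h]] : exists e, 0 < e /\ forall p, In p ks -> e < snd (g p) / 2.
  by apply: min_list => p hp; exists (snd (g p) / 4); have h0 := proj1 (hg p); split => [|d [hd1 hd2]]; lra.
exists (flat_map (fun p => fst (g p)) ks), e; split => // k y hKk hy.
have [p [hp1 hp2]] := hks k hKk; apply: (proj2 (hg p)) => i hi.
have := hp2 i hi; have := hy i ltac:(by apply/in_flat_map; exists p); have := h p hp1.
have -> : y i - proj1_sig p i = (y i - k i) + (k i - proj1_sig p i) by ring.
by have := Rabs_triang (y i - k i) (k i - proj1_sig p i); lra.
Qed.

Definition subbasic (W : (T -> Prop) -> Prop) : Prop := exists U : T -> Prop, ptop U /\
  ((forall A, W A <-> (forall x, A x -> U x)) \/ (forall A, W A <-> (exists x, A x /\ U x))).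

(** Together with [subbasic_near], this identifies Vietoris neighbourhoods of a compact set with
    Hausdorff neighbourhoods in finitely many coordinates. *)
Lemma near_subbasic B : subbasic B -> B K -> exists l e, 0 < e /\ forall K', hn (ind l) e K' K -> B K'.
Proof.
move=> [U [hU [hB|hB]]] /hB hBK.
  have [l [e [he h]]] := compact_lebesgue U hU hBK; exists l, e; split => // K' [h1 _]; apply/hB => y hy.
  by have [k [hk hky]] := h1 y hy; apply: (h k) => //; exact: ind_ge hky.
have [k [hk hUk]] := hBK; have [l [e [he h]]] := hU k hUk; exists l, (e / 2); split; first lra.
move=> K' [_ h2]; apply/hB; have [y [hy hky]] := h2 k hk; exists y; split => //; apply: h => i hi.
by have := ind_ge _ _ _ _ hky i hi; rewrite Rabs_minus_sym; lra.
Qed.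

Lemma subbasic_near l e : 0 < e -> exists Bs, (forall B, In B Bs -> subbasic B) /\ (forall B, In B Bs -> B K) /\
  forall K', (forall B, In B Bs -> B K') -> hn (ind l) e K' K.
Proof.
move=> he; have [ks [h1 h2]] := compact_net l (e / 2) ltac:(lra).
(* [up] keeps the set near [K]; the conditions [lo k], over a finite net of half size, force it to
   come near every point of [K]. *)
pose lo k := fun A : T -> Prop => exists x, A x /\ box l (e / 2) k x.
pose up := fun A : T -> Prop => forall x, A x -> exists k, K k /\ box l e k x.
exists (up :: map lo ks); split; last split.
{ move=> B [<-|/in_map_iff [k [<- hk]]].
    exists (fun x => exists k, K k /\ box l e k x); split; last by left.
    move=> x [k [hk hx]]; have [F [d [hd h]]] := open_box l e k x hx; exists F, d; split => // y hy.
    by exists k; split => //; exact: h.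
  by exists (box l (e / 2) k); split; [exact: open_box | right]. }
{ move=> B [<-|/in_map_iff [k [<- hk]]].
    by move=> x hx; exists x; split => // i _; rewrite Rminus_diag Rabs_R0.
  by exists k; split; [exact: h1 | move=> i _; rewrite Rminus_diag Rabs_R0; lra]. }
move=> K' hB; split.
  move=> y hy; have [k [hk hb]] := hB up (or_introl eq_refl) y hy; exists k; split => //.
  by apply: ind_le => [|i hi]; [lra | exact: Rlt_le (hb i hi)].
move=> k hk; have [k' [hk' hkb]] := h2 k hk.
have [y [hy hyb]] := hB (lo k') (or_intror (in_map lo ks k' hk')); exists y; split => //.
apply: ind_le => [|i hi]; first lra.
have := hkb i hi; have := hyb i hi; rewrite (Rabs_minus_sym (y i)) => a b.
have -> : k i - y i = (k i - k' i) + (k' i - y i) by ring.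
by have := Rabs_triang (k i - k' i) (k' i - y i); lra.
Qed.
End Compact.

Definition mx (K : T -> Prop) : T := fun i => supr (fun r => exists k, K k /\ r = k i).
Definition nA (K : T -> Prop) (a : T) : Prop := exists k, K k /\ a = fun i => exp (k i - mx K i).
Definition Kof (z : T * (T -> Prop)) (k : T) : Prop := exists a, snd z a /\ k = shf (fst z) a.

Lemma exp_dist u v : u <= 0 -> v <= 0 -> Rabs (exp u - exp v) <= Rabs (u - v).
Proof.
have key : forall u v, u <= 0 -> v <= u -> exp u - exp v <= u - v.
  move=> a b ha hab; have h1 := exp_ineq1_le (b - a); have -> : exp b = exp a * exp (b - a) by rewrite -exp_plus; congr exp; ring.
  have h2 : exp a <= 1 by rewrite -exp_0; case: ha => [/exp_increasing|->]; lra.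
  have h3 := exp_pos a; have h4 : exp (b - a) <= 1 by rewrite -exp_0; case: (Req_dec a b) => [->|hne]; [rewrite Rminus_diag; lra | apply: Rlt_le; apply: exp_increasing; lra].
  have : exp a * (1 - exp (b - a)) <= 1 * (1 - exp (b - a)) by apply: Rmult_le_compat_r; lra.
  lra.
have mono : forall u v, v <= u -> exp v <= exp u by move=> a b [h|->]; [apply: Rlt_le; exact: exp_increasing | lra].
move=> hu hv; case: (Rle_dec v u) => h.
  by have h0 := mono u v h; rewrite !Rabs_pos_eq; try lra; exact: key.
have h' : u <= v by lra.
by have h0 := mono v u h'; rewrite Rabs_minus_sym (Rabs_minus_sym u) !Rabs_pos_eq; try lra; exact: key.
Qed.

Section Mpcc.
Context (M : T -> Prop) (K : T -> Prop) (hK : mpcc I M K).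

Lemma K_ne : exists k, K k. Proof. by case: hK. Qed.
Lemma K_c : compact_set ptop K. Proof. by case: hK => _ []. Qed.
Lemma K_conv : maxplus_convex K. Proof. by case: hK => _ [_ []]. Qed.

Lemma mx_ub k i : K k -> k i <= mx K i.
Proof.
move=> hk; have [b hb] := compact_bound K K_c i.
apply: (supr_ub _ b); last by exists k.
by move=> _ [k' [hk' ->]]; have := hb k' hk'; have := Rle_abs (k' i); lra.
Qed.

Lemma K_max a b : K a -> K b -> K (fun i => Rmax (a i) (b i)).
Proof.
move=> ha hb; have [|y [hy h]] := K_conv a b ha hb (Some 0) (Some 0); first by rewrite /= Rmax_left //; lra.
have -> // : (fun i => Rmax (a i) (b i)) = y.
by apply: functional_extensionality => i; have := h i; rewrite /mp_comb /= !Rplus_0_l => -[].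
Qed.

(** On finitely many coordinates the suprema are approached by finite maxima of points of [K], and
    [K] is closed. *)
Lemma mx_in : K (mx K).
Proof.
apply: compact_closed => [|l e he]; first exact: K_c.
elim: l => [|j l [a [ha h]]]; first by have [k hk] := K_ne; exists k.
have [b0 hb0] := compact_bound K K_c j.
have ne : exists r, exists k, K k /\ r = k j by have [k hk] := K_ne; exists (k j), k.
have [r [[b [hb hr]] hlt]] := supr_approx (fun r => exists k, K k /\ r = k j) b0 (mx K j - e) ne
   ltac:(by move=> _ [k [hk ->]]; have := hb0 k hk; have := Rle_abs (k j); lra) ltac:(rewrite -/(mx K j); lra).
exists (fun i => Rmax (a i) (b i)); split; first exact: K_max.
move=> i [<-|hi].
  have := mx_ub a j ha; have := mx_ub b j hb; rewrite hr in hlt => h1 h2; apply: Rabs_le; split; last by rmx.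
  by have := Rmax_lub _ _ _ h2 h1; lra.
have := h i hi; have := mx_ub a i ha; have := mx_ub b i hb; rmx.
Qed.

Lemma nA_one : nA K one.
Proof.
exists (mx K); split; first exact: mx_in.
by apply: functional_extensionality => i; rewrite Rminus_diag exp_0.
Qed.

Lemma Kof_nA : Kof (mx K, nA K) = K.
Proof.
have e : forall k, shf (mx K) (fun i => exp (k i - mx K i)) = k.
  by move=> k; apply: functional_extensionality => i; rewrite /shf ln_exp; lra.
apply: set_ext => k; split; first by move=> [_ [[k' [hk' ->]] ->]]; rewrite /= e.
by move=> hk; exists (fun i => exp (k i - mx K i)); split; [exists k | rewrite /= e].
Qed.

Lemma nA_le1 a i : nA K a -> 0 < a i <= 1.
Proof.
move=> [k [hk ->]]; split; first exact: exp_pos.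
have := mx_ub k i hk => h; rewrite -exp_0; case: (Req_dec (k i) (mx K i)) => [->|hne]; first by rewrite Rminus_diag; lra.
by apply: Rlt_le; apply: exp_increasing; lra.
Qed.

Lemma nA_lb : exists l : T, (forall i, 0 < l i) /\ forall a, nA K a -> forall i, l i <= a i.
Proof.
have [b hb] := choice_fun _ (compact_bound K K_c).
exists (fun i => exp (- b i - mx K i)); split; first by move=> i; exact: exp_pos.
move=> _ [k [hk ->]] i; have := hb i k hk; have := Rle_abs (- k i); rewrite Rabs_Ropp => h1 h2.
case: (Req_dec (- b i) (k i)) => [->|hne]; first lra.
by apply: Rlt_le; apply: exp_increasing; lra.
Qed.

Lemma nA_shf a : (forall i, 0 < a i) -> K (shf (mx K) a) -> nA K a.
Proof.
move=> ha hk; exists (shf (mx K) a); split => //; apply: functional_extensionality => i.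
have -> : shf (mx K) a i - mx K i = ln (a i) by rewrite /shf; ring.
by rewrite exp_ln.
Qed.

Lemma nA_closed : closed (nA K).
Proof.
move=> a ha; have [m [m1 m2]] := nA_lb.
have hm : forall i, m i <= a i.
  by move=> i; apply: Rle_eps => d hd; have [b [hb h]] := ha (i :: nil) d hd; have := h i (or_introl eq_refl); have := m2 b hb i; rmx.
apply: nA_shf; first by move=> i; have := m1 i; have := hm i; lra.
apply: compact_closed => [|l d hd]; first exact: K_c.
have [e [he h]] : exists e, 0 < e /\ forall i, In i l -> e <= m i * d.
  by apply: min_list => i hi; exists (m i * d); split; [apply: Rmult_lt_0_compat | move=> e' []].
have [b [hb hab]] := ha l e he; have [k [hk hkb]] := hb; exists k; split => // i hi.
have -> : shf (mx K) a i - k i = ln (a i) - ln (b i) by rewrite /shf hkb ln_exp; ring.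
apply: (Rmult_le_reg_l (m i)); first exact: m1.
by apply: Rle_trans (ln_lip _ _ _ (m1 i) (hm i) (m2 b hb i)) _; apply: Rle_trans (hab i hi) (h i hi).
Qed.

Lemma nA_mconv : mconv (nA K).
Proof.
move=> a b p q ha hb hp hq hpq; have [k [hk hka]] := ha; have [k' [hk' hkb]] := hb.
(* The multiplicative weight 0 corresponds to the scalar minus infinity. *)
pose lg r := if Req_EM_T r 0 then None else Some (ln r).
have lg1 : lg 1 = Some 0 by rewrite /lg; case: Req_EM_T => [h|_]; [lra | rewrite ln_1].
have hln : forall r, 0 < r <= 1 -> ln r <= 0 by move=> r hr; apply: ln_le0; lra.
have hmax : emax (lg p) (lg q) = Some 0.
  have : p = 1 \/ q = 1 by move: hpq; rewrite /Rmax; case: Rle_dec => _ ->; [right | left].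
  case=> h; rewrite h lg1 /lg; case: Req_EM_T => hz //=; congr Some; [rewrite Rmax_left | rewrite Rmax_right] => //; apply: hln; lra.
have [y [hy h]] := K_conv k k' hk hk' (lg p) (lg q) hmax.
exists y; split => //; apply: functional_extensionality => i; have := h i; rewrite /comb hka hkb /mp_comb.
have mul : forall r s, 0 < r -> r * exp (s - mx K i) = exp (ln r + s - mx K i).
  by move=> r s hr; rewrite -{1}(exp_ln r) // -exp_plus; congr exp; ring.
have emx : forall s t, Rmax (exp (s - mx K i)) (exp (t - mx K i)) = exp (Rmax s t - mx K i).
  move=> s t; case: (Rle_dec s t) => hst.
    rewrite !Rmax_right //; case: (Req_dec s t) => [->|hne]; first lra.
    by apply: Rlt_le; apply: exp_increasing; lra.
  by rewrite !Rmax_left //; [lra | apply: Rlt_le; apply: exp_increasing; lra].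
have ep := exp_pos (k i - mx K i); have ep' := exp_pos (k' i - mx K i).
rewrite /lg; case: Req_EM_T => hp0; case: Req_EM_T => hq0 /=.
- by move: hpq; rewrite hp0 hq0 Rmax_left; lra.
- move=> [<-]; rewrite hp0 Rmult_0_l -mul; last lra.
  by rewrite Rmax_right //; apply: Rmult_le_pos; lra.
- move=> [<-]; rewrite hq0 Rmult_0_l -mul; last lra.
  by rewrite Rmax_left //; apply: Rmult_le_pos; lra.
- by move=> [<-]; rewrite !mul ?emx //; lra.
Qed.

Lemma mpcc_XA : ok (XA M) (mx K, nA K).
Proof.
split; last first.
  move=> a ha; apply: (proj2 (proj2 (proj2 hK))).
  have h : Kof (mx K, nA K) (shf (mx K) a) by exists a.
  by rewrite Kof_nA in h.
split => //; split; first exact: nA_one.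
split; first exact: nA_mconv.
split; first exact: nA_closed.
split; last exact: nA_lb.
by move=> a ha; split => // i; have := nA_le1 a i ha; lra.
Qed.
End Mpcc.

(** Without a finite subcover, the points of [A] missed by finitely many [U j] generate a proper
    filter. A refining ultrafilter converges to a point of [A], and the positive lower bounds of [A]
    make [ln] continuous there. *)
Lemma Kof_compact x A : okP allI A -> compact_set ptop (Kof (x, A)).
Proof.
move=> hA V U hU hcov; apply: NNPP => hno.
pose F (P : T -> Prop) := exists l : list V, forall a, A a -> (forall j, In j l -> ~ U j (shf x a)) -> P a.
have hF : filt F.
  split; first by exists nil.
  split; last by move=> P Q h [l hl]; exists l => a ha h1; apply: h; exact: hl.
  move=> P Q [l1 h1] [l2 h2]; exists (l1 ++ l2)%list => a ha h; split; [apply: h1 | apply: h2] => // j hj; apply: h; apply/in_app_iff; [by left | by right].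
have [W [hW hWF]] : exists W, ultra W /\ forall P, F P -> W P.
  apply: ultra_ex => // -[l hl]; apply: hno; exists l => _ [a [ha ->]].
  apply: NNPP => h; apply: (hl a ha) => j hj hUj; apply: h; by exists j.
have [hWf [hWp _]] := hW.
have hWA : W A by apply: hWF; exists nil.
have hb : forall b : T, exists b', cube b' /\ (A b -> b' = b).
  move=> b; case: (classic (A b)) => h; first by exists b; split => //; exact: (okP_cube _ _ hA).
  by exists one; split => // i; rewrite /one; lra.
have [g hg] := choice_fun _ hb; have [a [h1 h2]] := ulim_T W g hW (fun b => proj1 (hg b)).
have ha : forall i, tends W (fun b => b i) (a i).
  by move=> i ep hep; apply: (filt2 _ _ hWf hWA (h2 i ep hep)) => b hAb; rewrite (proj2 (hg b) hAb).
have hAa : A a by apply: (closed_lim W A (fun b => b)) => //; apply hA.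
have [j hj] := hcov (shf x a) (ex_intro _ a (conj hAa eq_refl)).
have [D [e [he hD]]] := hU j _ hj.
have [_ [_ [_ [_ [m [m1 m2]]]]]] := hA.
have ev : W (fun b => forall i, In i D -> Rabs (ln (b i) - ln (a i)) <= e / 2).
  apply: filt_list => // i _; apply: (tends_ln W hWf) => //; last lra.
  exact: Rlt_le_trans (m1 i) (m2 a hAa i).
have ev2 : W (fun b => A b /\ ~ U j (shf x b)).
  by apply: hWF; exists (j :: nil) => b hAb h; split => //; apply: h; left.
apply: hWp; apply: (filt2 _ _ hWf ev ev2) => b h3 [_ h4]; apply: h4; apply: hD => i hi.
have -> : shf x b i - shf x a i = ln (b i) - ln (a i) by rewrite /shf; ring.
by have := h3 i hi; lra.
Qed.

Lemma XA_mpcc M x A : ok (XA M) (x, A) -> mpcc I M (Kof (x, A)).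
Proof.
move=> [[_ hA] hc]; have hA' := hA; have [h1 [h2 [h3 [h4 [m [m1 m2]]]]]] := hA.
split; first by exists (shf x one), one.
split; first exact: Kof_compact.
split; last by move=> _ [a [ha ->]]; exact: hc.
move=> _ _ [a [ha ->]] [b [hb ->]] al be hab.
pose ex (r : Rmaxplus) := match r with None => 0 | Some t => exp t end.
have ex01 : forall r s, emax r s = Some 0 \/ emax s r = Some 0 -> 0 <= ex r <= 1.
  move=> [r|] [s|] /=; try lra.
    move=> h; have hr : r <= 0 by case: h => -[]; rmx.
    split; first exact: Rlt_le (exp_pos r).
    by rewrite -exp_0; case: hr => [/exp_increasing|->]; lra.
  by case=> -[->]; rewrite exp_0; lra.
have exm : Rmax (ex al) (ex be) = 1.
  have b1 := ex01 al be (or_introl hab); have b2 := ex01 be al (or_intror hab).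
  move: hab b1 b2; case: al => [r|]; case: be => [s|] //= -[].
    move=> h; have [->|->] : r = 0 \/ s = 0 by move: h; rewrite /Rmax; case: Rle_dec => _ ->; [right | left].
      by rewrite exp_0 => _ hs; rewrite Rmax_left //; lra.
    by rewrite exp_0 => hs _; rewrite Rmax_right //; lra.
    by move=> ->; rewrite exp_0 => _ _; rewrite Rmax_left //; lra.
  by move=> ->; rewrite exp_0 => _ _; rewrite Rmax_right //; lra.
exists (shf x (comb (ex al) (ex be) a b)); split.
  exists (comb (ex al) (ex be) a b); split => //; apply: h2 => //; [exact: (ex01 al be (or_introl hab)) | exact: (ex01 be al (or_intror hab))].
move=> i; have pa : 0 < a i := Rlt_le_trans _ _ _ (m1 i) (m2 a ha i); have pb : 0 < b i := Rlt_le_trans _ _ _ (m1 i) (m2 b hb i).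
have lm : forall r s t, 0 < t -> 0 < s -> ln (exp r * s) = r + ln s by move=> r s t _ hs; rewrite ln_mult ?ln_exp //; exact: exp_pos.
have lnmax : forall s t, 0 < s -> 0 < t -> ln (Rmax s t) = Rmax (ln s) (ln t).
  move=> s t hs ht; case: (Rle_dec s t) => hst.
    by rewrite !Rmax_right //; exact: ln_le.
  by rewrite !Rmax_left //; [apply: ln_le; lra | lra].
rewrite /mp_comb /shf /comb /ex; clear ex01 exm; move: hab; case: al => [r|]; case: be => [s|] //= _; congr Some.
- have pr : 0 < exp r * a i by apply: Rmult_lt_0_compat => //; exact: exp_pos.
  have ps : 0 < exp s * b i by apply: Rmult_lt_0_compat => //; exact: exp_pos.
  rewrite lnmax // !(lm _ _ 1) //; try lra.
  by move: (ln (a i)) (ln (b i)) => u v; rmx.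
- have pr : 0 < exp r * a i by apply: Rmult_lt_0_compat => //; exact: exp_pos.
  by rewrite Rmult_0_l Rmax_left ?(lm _ _ 1) //; lra.
- have pr : 0 < exp s * b i by apply: Rmult_lt_0_compat => //; exact: exp_pos.
  by rewrite Rmult_0_l Rmax_right ?(lm _ _ 1) //; lra.
Qed.

Lemma mx_Kof M x A : ok (XA M) (x, A) -> mx (Kof (x, A)) = x /\ nA (Kof (x, A)) = A.
Proof.
move=> h; have [[_ hA] _] := h; have hK := XA_mpcc M x A h.
have [h1 [_ [_ [h4 [m [m1 m2]]]]]] := hA.
have pos : forall a i, A a -> 0 < a i by move=> a i ha; exact: Rlt_le_trans (m1 i) (m2 a ha i).
have ex : mx (Kof (x, A)) = x.
  apply: functional_extensionality => i; apply: Rle_antisym.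
    have [a [ha ->]] := mx_in M _ hK; rewrite /shf /=; have := ln_le0 (a i) (proj2 (proj1 (h4 a ha) i)) (pos a i ha); lra.
  have := mx_ub M _ hK (shf x one) i (ex_intro _ one (conj h1 eq_refl)); rewrite /shf /one ln_1; lra.
split => //; rewrite /nA ex; apply: set_ext => a; split.
  move=> [_ [[b [hb ->]] ->]]; have -> // : (fun i => exp (shf (fst (x, A)) b i - x i)) = b.
  apply: functional_extensionality => i; have -> : shf (fst (x, A)) b i - x i = ln (b i) by rewrite /shf /=; ring.
  by rewrite exp_ln //; exact: pos.
move=> ha; exists (shf x a); split; first by exists a.
apply: functional_extensionality => i; have -> : shf x a i - x i = ln (a i) by rewrite /shf; ring.
by rewrite exp_ln //; exact: pos.
Qed.

Lemma near_mx M K K' i e : mpcc I M K -> mpcc I M K' -> hn (ind (i :: nil)) e K' K -> Rabs (mx K' i - mx K i) <= e.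
Proof.
have key : forall K K', mpcc I M K -> mpcc I M K' -> hl (ind (i :: nil)) e K' K -> mx K' i <= mx K i + e.
  move=> A B hA hB h; have [k [hk h1]] := h _ (mx_in M B hB).
  have := ind_ge _ _ _ _ h1 i (or_introl eq_refl); have := mx_ub M A hA k i hk; rmx.
move=> hK hK' [h1 h2]; have := key _ _ hK hK' h1; have := key _ _ hK' hK h2 => a b; apply: Rabs_le; lra.
Qed.

Lemma near_nA M K K' l e : 0 <= e -> mpcc I M K -> mpcc I M K' -> hn (ind l) e K' K -> hn (ind l) (e + e) (nA K') (nA K).
Proof.
move=> he.
have key : forall K K', mpcc I M K -> mpcc I M K' -> hl (ind l) e K' K -> (forall i, In i l -> Rabs (mx K' i - mx K i) <= e) -> hl (ind l) (e + e) (nA K') (nA K).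
  move=> A B hA hB h hm _ [k [hk ->]]; have [k' [hk' h1]] := h k hk.
  exists (fun i => exp (k' i - mx A i)); split; first by exists k'.
  apply: ind_le => [|i hi]; first lra.
  have h2 := ind_ge _ _ _ _ h1 i hi; have h3 := hm i hi.
  have := mx_ub M B hB k i hk; have := mx_ub M A hA k' i hk' => h4 h5.
  apply: Rle_trans (exp_dist _ _ _ _) _; try lra.
  have -> : k i - mx B i - (k' i - mx A i) = (k i - k' i) - (mx B i - mx A i) by ring.
  by move: h2 h3; rmx.
move=> hK hK' hn0; have hm : forall i, In i l -> Rabs (mx K' i - mx K i) <= e.
  move=> i hi; apply: (near_mx M) => //; apply: hn_mono hn0; last lra.
  move=> j; case: (classic (In j (i :: nil))) => hj; last by rewrite ind_out //; apply ind01.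
  by rewrite ind_in // ind_in //; [lra | case: hj => [<-|[]]].
by split; apply: key => //; [apply hn0 | apply hn0 | move=> i hi; rewrite Rabs_minus_sym; exact: hm].
Qed.

Lemma near_Kof {N : Type} (F : (N -> Prop) -> Prop) (xs : N -> T) x (As : N -> T -> Prop) A l e : filt F -> 0 < e ->
  (forall m, okP allI (As m)) -> okP allI A ->
  (forall i, tends F (fun m => xs m i) (x i)) -> htends F As A -> F (fun m => hn (ind l) e (Kof (xs m, As m)) (Kof (x, A))).
Proof.
move=> hF he hAs hA hx hh; have [_ [_ [_ [_ [m [m1 m2]]]]]] := hA.
(* The sets [As n] have no common lower bound; a point within [m i / 2] of [A] is still at least
   [m i / 2], which bounds the slope of [ln]. *)
have [d [hd hdm]] : exists d, 0 < d /\ forall i, In i l -> d <= m i / 2 /\ d <= m i / 2 * (e / 2).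
  apply: min_list => i hi; exists (Rmin (m i / 2) (m i / 2 * (e / 2))); have := m1 i => hm.
  have : 0 < m i / 2 * (e / 2) by apply: Rmult_lt_0_compat; lra.
  split; first by rmx.
  move=> d' [_ hd']; split; [exact: Rle_trans hd' (Rmin_l _ _) | exact: Rle_trans hd' (Rmin_r _ _)].
have e2 : 0 < e / 2 by lra.
apply: (filt2 _ _ hF (hh l d hd) (filt_list F l (fun i m => Rabs (xs m i - x i) <= e / 2) hF (fun i _ => hx i _ e2))) => n [n1 n2] h.
have est : forall a b i, A b -> In i l -> Rabs (a i - b i) <= d -> Rabs (shf (xs n) a i - shf x b i) <= e.
  move=> a b i hb hi hab; have [d1 d2] := hdm i hi; have hm := m1 i; have hbi := m2 b hb i.
  have hai : m i / 2 <= a i by move: hab; rmx.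
  have := ln_lip (m i / 2) (a i) (b i) ltac:(lra) hai ltac:(lra) => hl0.
  have : Rabs (ln (a i) - ln (b i)) <= e / 2.
    by apply: (Rmult_le_reg_l (m i / 2)); lra.
  have := h i hi; rewrite /shf; rmx.
split.
  move=> _ [a [ha ->]]; have [b [hb hab]] := n1 a ha; exists (shf x b); split; first by exists b.
  by apply: ind_le => [|i hi]; [lra | apply: est => //; exact: ind_ge hab i hi].
move=> _ [b [hb ->]]; have [a [ha hab]] := n2 b hb; exists (shf (xs n) a); split; first by exists a.
apply: ind_le => [|i hi]; first lra.
by rewrite Rabs_minus_sym; apply: est => //; rewrite Rabs_minus_sym; exact: ind_ge hab i hi.
Qed.
End Plumb.

(** * From convergence along filters back to topologies *)

Lemma sig_ext {A : Type} (P : A -> Prop) (u v : {x : A | P x}) : proj1_sig u = proj1_sig v -> u = v.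
Proof.
by case: u v => [x hx] [y hy] /= e; subst y; congr exist; exact: proof_irrelevance.
Qed.

(** The neighbourhoods of a point form a filter along which the identity family converges to it;
    applying [cont] to this family gives continuity in terms of open sets. *)
Lemma homeo_of_iso {I : Type} (M : (I -> R) -> Prop) : iso (XA M) (Msp M) ->
  homeomorphic (subspace_top (vietoris_top (product_top I)) (mpcc I M)) (subspace_top (product_top I) M).
Proof.
move=> [f [g [[f1 f2] [[g1 g2] [gf [fg _]]]]]].
have fM : forall K, mpcc I M K -> M (f (mx K, nA K)) by move=> K hK; apply (f1 _ (mpcc_XA M K hK)).
have okx : forall x, M x -> ok (Msp M) x by move=> x hx; split.
have gM : forall x, M x -> mpcc I M (Kof (g x)).
  move=> x hx; have := g1 x (okx x hx); case: (g x) => y A h; exact: XA_mpcc h.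
pose Phi (p : {K | mpcc I M K}) : {x | M x} := exist _ (f (mx (proj1_sig p), nA (proj1_sig p))) (fM _ (proj2_sig p)).
pose Psi (q : {x | M x}) : {K | mpcc I M K} := exist _ (Kof (g (proj1_sig q))) (gM _ (proj2_sig q)).
have cPhi : forall p U, product_top I U -> U (proj1_sig (Phi p)) -> exists Bs,
    (forall B, In B Bs -> subbasic B) /\ (forall B, In B Bs -> B (proj1_sig p)) /\
    forall q, (forall B, In B Bs -> B (proj1_sig q)) -> U (proj1_sig (Phi q)).
  move=> p U hU hp.
  pose F (P : {K | mpcc I M K} -> Prop) := exists Bs, (forall B, In B Bs -> subbasic B) /\
    (forall B, In B Bs -> B (proj1_sig p)) /\ forall q, (forall B, In B Bs -> B (proj1_sig q)) -> P q.
  have hF : filt F.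
    split; first by exists nil.
    split; last by move=> P Q h [Bs [b1 [b2 b3]]]; exists Bs; do 2 split => //; move=> q hq; apply: h; exact: b3.
    move=> P Q [Bs [b1 [b2 b3]]] [Bs' [d1 [d2 d3]]]; exists (Bs ++ Bs')%list.
    split; first by move=> B /in_app_iff [hB|hB]; [exact: b1 | exact: d1].
    split; first by move=> B /in_app_iff [hB|hB]; [exact: b2 | exact: d2].
    by move=> q hq; split; [apply: b3 | apply: d3] => B hB; apply: hq; apply/in_app_iff; [left | right].
  have hn0 : forall l e, 0 < e -> F (fun q => hn (ind l) e (proj1_sig q) (proj1_sig p)).
    move=> l e he; have [Bs [b1 [b2 b3]]] := subbasic_near _ (K_c M _ (proj2_sig p)) l e he.
    by exists Bs; do 2 split => //; move=> q; exact: b3.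
  have c := f2 _ F (fun q => (mx (proj1_sig q), nA (proj1_sig q))) (mx (proj1_sig p), nA (proj1_sig p)) hF
    (fun q => mpcc_XA M _ (proj2_sig q)) (mpcc_XA M _ (proj2_sig p)).
  have {}c : forall i, tends F (fun q => proj1_sig (Phi q) i) (proj1_sig (Phi p) i).
    apply: c; split => /=.
      move=> i e he; apply: (filt1 _ hF (hn0 (i :: nil) e he)) => q; apply: (near_mx M); exact: proj2_sig.
    move=> l e he; have he2 : 0 < e / 2 by lra.
    apply: (filt1 _ hF (hn0 l _ he2)) => q hq.
    have -> : e = e / 2 + e / 2 by lra.
    by apply: (near_nA M) hq; [lra | exact: proj2_sig | exact: proj2_sig].
  have [D [e [he hD]]] := hU _ hp; have he2 : 0 < e / 2 by lra.
  have [Bs [b1 [b2 b3]]] := filt_list F D (fun i q => Rabs (proj1_sig (Phi q) i - proj1_sig (Phi p) i) <= e / 2) hF (fun i _ => c i _ he2).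
  by exists Bs; do 2 split => //; move=> q hq; apply: hD => i hi; have := b3 q hq i hi; lra.
have cPsi : forall q W, vietoris_top (product_top I) W -> W (proj1_sig (Psi q)) -> exists l e, 0 < e /\
    forall q', box l e (proj1_sig q) (proj1_sig q') -> W (proj1_sig (Psi q')).
  move=> q W hW hq.
  pose F (P : {x | M x} -> Prop) := exists l e, 0 < e /\ forall q', box l e (proj1_sig q) (proj1_sig q') -> P q'.
  have hF : filt F.
    split; first by exists nil, 1; split; [lra |].
    split; last by move=> P Q h [l [e [he h1]]]; exists l, e; split => // q' hq'; apply: h; exact: h1.
    move=> P Q [l [e [he h1]]] [l' [e' [he' h1']]]; exists (l ++ l')%list, (Rmin e e'); split; first by rmx.
    move=> q' hq'; split; [apply: h1 | apply: h1'] => i hi.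
      by apply: Rlt_le_trans (Rmin_l e e'); apply: hq'; apply/in_app_iff; left.
    by apply: Rlt_le_trans (Rmin_r e e'); apply: hq'; apply/in_app_iff; right.
  have c := g2 _ F (fun q' => proj1_sig q') (proj1_sig q) hF (fun q' => okx _ (proj2_sig q')) (okx _ (proj2_sig q)).
  have {}c : cv (XA M) _ F (fun q' => g (proj1_sig q')) (g (proj1_sig q)).
    apply: c => i e he; exists (i :: nil), e; split => // q' h; apply: Rlt_le; apply: h; by left.
  have okg := fun q' => g1 _ (okx _ (proj2_sig q')).
  have nearK : forall l e, 0 < e -> F (fun q' => hn (ind l) e (proj1_sig (Psi q')) (proj1_sig (Psi q))).
    move=> l e he; have := near_Kof F (fun q' => fst (g (proj1_sig q'))) (fst (g (proj1_sig q))) (fun q' => snd (g (proj1_sig q'))) (snd (g (proj1_sig q))) l e hF he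
      (fun q' => proj2 (proj1 (okg q'))) (proj2 (proj1 (okg q))) (proj1 c) (proj2 c).
    by move=> h; apply: (filt1 _ hF h) => q'; rewrite -!surjective_pairing.
  have [Bs [b1 [b2 b3]]] := hW _ hq.
  have ev : F (fun q' => forall B, In B Bs -> B (proj1_sig (Psi q'))).
    apply: filt_list => // B hB.
    have [l [e [he h]]] := near_subbasic _ (K_c M _ (proj2_sig (Psi q))) B (b1 B hB) (b2 B hB).
    by apply: (filt1 _ hF (nearK l e he)) => q'; exact: h.
  have [l [e [he h]]] := ev; exists l, e; split => // q' hq'; apply: b3; exact: h.
exists Phi, Psi; split.
  move=> V [U [hU hV]].
  (* An open set of arbitrary subsets is required: it consists of those having a basic neighbourhood
     whose members in [mpcc I M] are sent into [U]. *)
  exists (fun K' => exists Bs, (forall B, In B Bs -> subbasic B) /\ (forall B, In B Bs -> B K') /\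
    forall q, (forall B, In B Bs -> B (proj1_sig q)) -> U (proj1_sig (Phi q))); split.
    move=> K' [Bs [b1 [b2 b3]]]; exists Bs; do 2 split => //; by move=> K'' h; exists Bs.
  move=> p; rewrite hV; split; first exact: cPhi.
  by move=> [Bs [b1 [b2 b3]]]; exact: b3.
split.
  move=> V [W [hW hV]].
  exists (fun y => exists (q : {x | M x}) l e, 0 < e /\ box l e (proj1_sig q) y /\ forall q', box l e (proj1_sig q) (proj1_sig q') -> W (proj1_sig (Psi q'))); split.
    move=> y [q [l [e [he [h1 h2]]]]]; have [D [d [hd hD]]] := open_box l e _ y h1.
    by exists D, d; split => // y' hy'; exists q, l, e; split => //; split => //; exact: hD.
  move=> p; rewrite hV; split.
    move=> h; have [l [e [he h1]]] := cPsi p W hW h; exists p, l, e; split => //; split => //.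
    by move=> i _; rewrite Rminus_diag Rabs_R0.
  by move=> [q [l [e [he [h1 h2]]]]]; exact: h2.
split.
  move=> p; apply: sig_ext => /=; rewrite gf; last exact: mpcc_XA (proj2_sig p).
  exact: Kof_nA.
move=> q; apply: sig_ext => /=; have hq := okx _ (proj2_sig q); have := g1 _ hq; have := fg _ hq.
case: (g (proj1_sig q)) => x A e hxA; have [-> ->] := mx_Kof M x A hxA; exact: e.
Qed.

Theorem theorem4p5 (I : Type) (lt : I -> I -> Prop) (HI : is_omega1 I lt)
  (M : (I -> R) -> Prop) (Hne : exists x, M x) (Hfo : functionally_open I M) :
  homeomorphic (subspace_top (vietoris_top (product_top I)) (mpcc I M))
               (subspace_top (product_top I) M).
Proof.
apply: homeo_of_iso.
have [f [cf [f01 hM]]] := Hfo.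
(* Functional openness enters twice: it makes [M] open, and through [depends] it makes membership in
   [M] a matter of the coordinates below some [i0]. *)
have hMo : product_top I M.
  move=> x /hM [hx _]; have [|D [e [he h]]] := cf (fun r => 0 < r) _ x hx.
    by move=> r hr; exists r; split => // s hs; move: hs; rmx.
  by exists D, e; split => // y hy; apply/hM; split; [exact: h | apply f01].
have [i0 hi0] := depends lt HI f cf.
have hMC : forall x y, (forall i, lt i i0 -> x i = y i) -> M x -> M y.
  by move=> x y hxy /hM hx; apply/hM; rewrite -(hi0 x y hxy).
have [bo [bf [hb1 hb2]]] := blocks lt HI i0.
exact: iso_XA_Msp HI i0 M hMo hMC bo bf hb1 hb2.
Qed.
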